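(* Let $n\ge 2$ and $b\neq 0$ be fixed integers. Then, as $H\to\infty$, \[ \mathcal{E}_{n,b}(G_2;H) \ll H^{n}, \qquad \mathcal{E}_{n,b}^{\mathrm{monic}}(G_2;H)\ll H^{n-1}. \]
   Context: A polynomial $f(x)=\sum_{i=0}^{2n} a_i x^i \in \mathbb{Z}[x]$ of degree $2n$ is $b$-reciprocal if $a_{n+i} = b^i a_{n-i}$ for $i=0,\dots,n$. For such $f$ let $g\in\mathbb{Z}[u]$ be the unique degree-$n$ polynomial with $f(x)=x^n g(x+b/x)$; let $G_g\subseteq S_n$ be the Galois group of $g$ and $G_f$ the Galois group of $f$ on its roots $\alpha_1,b/\alpha_1,\dots,\alpha_n,b/\alpha_n$. $G_f$ lies in $G_0=S_2\wr S_n$, the group of permutations of the roots preserving the pairs $\{\alpha_i,b/\alpha_i\}$; write its elements as $(\mathbf v,\sigma)\in\mathbb{F}_2^n\rtimes S_n$, with $\sigma$ the induced permutation of pairs and $v_i=1$ iff $\alpha_i\mapsto b/\alpha_{\sigma(i)}$. Let $G_2=\{(\mathbf v,\sigma):\sum_i v_i=\operatorname{sgn}\sigma\}$, where $\operatorname{sgn}\sigma\in\mathbb{F}_2$ is $0$ for even and $1$ for odd $\sigma$ (an index-$2$ normal subgroup of $G_0$). For a subgroup $G\subseteq G_0$ and $H\ge2$, $\mathcal{E}_{n,b}(G;H)$ is the number of separable $b$-reciprocal $f$ of degree $2n$ with coefficients in $[-H,H]$ such that $G_g=S_n$ and $G_f\subseteq G$; $\mathcal{E}^{\mathrm{monic}}_{n,b}(G;H)$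 counts the monic ones. Implied constants depend on $n$ and $b$.
   Formalization: The b-reciprocity condition a_{n+i}=b^i a_{n-i} is replaced by a_{n-i}=b^i a_{n+i}, which f(x)=x^n g(x+b/x) forces; with the printed condition no such g exists when |b|≥2, and for b=±1 the two conditions agree. *)

(* Defs.v *)
From HB Require Import structures.
From mathcomp Require Import all_boot all_order all_algebra all_fingroup all_field.
From mathcomp Require Import finmap zify ring.
From mathcomp Require Import boolp classical_sets cardinality reals.

Set Implicit Arguments.
Unset Strict Implicit.
Unset Printing Implicit Defensive.

Import Order.TTheory GRing.Theory Num.Theory.
Local Open Scope ring_scope.

Local Notation "x %:F" := (@tofrac _ x) : ring_scope.

(* f has degree exactly 2n and a_(n-i) = b^i a_(n+i); this is the orientation
   satisfied by x^n g(x + b/x), i.e. the one for which the roots of f pair up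
   as {alpha, b/alpha} (compare x * (x + b/x) = x^2 + b). *)
Definition breciprocal (n : nat) (b : int) (f : {poly int}) : Prop :=
  size f = n.*2.+1 /\
  forall i : nat, (i <= n)%N -> f`_(n - i) = b ^+ i * f`_(n + i).

(* f(x) = x^n g(x + b/x), an identity in the field Frac(Z[x]). *)
Definition trace_poly (n : nat) (b : int) (f g : {poly int}) : Prop :=
  size g = n.+1 /\
  f%:F = 'X%:F ^+ n *
    (map_poly (fun c : int => c%:P%:F) g).['X%:F + b%:P%:F / 'X%:F].

Definition cleared (n : nat) (b : int) (g : {poly int}) : {poly int} :=
  \sum_(i < n.+1) g`_i *: ('X^(n - i) * ('X^2 + b%:P) ^+ i).

Lemma horner_mulXn (K : fieldType) (x c : K) (n : nat) (p : {poly K}) :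
  x != 0 -> (size p <= n.+1)%N ->
  x ^+ n * p.[x + c / x] = \sum_(i < n.+1) p`_i * (x ^+ (n - i) * (x ^+ 2 + c) ^+ i).
Proof.
move=> x0 szp; rewrite (horner_coef_wide _ szp) mulr_sumr.
apply: eq_bigr => i _; rewrite mulrCA; congr (_ * _).
have -> : x ^+ 2 + c = x * (x + c / x) by rewrite mulrDr [_ * (_ / _)]mulrC divfK.
by rewrite exprMn mulrA -exprD subnK // -ltnS.
Qed.

Lemma clearedE (n : nat) (b : int) (g : {poly int}) : (size g <= n.+1)%N ->
  'X%:F ^+ n *
    (map_poly (fun c : int => c%:P%:F) g).['X%:F + b%:P%:F / 'X%:F] =
  (cleared n b g)%:F.
Proof.
move=> szg; have X0 : ('X%:F : {fraction {poly int}}) != 0.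
  by rewrite tofrac_eq0 polyX_eq0.
rewrite horner_mulXn //; last exact: leq_trans (size_poly _ _) szg.
rewrite rmorph_sum; apply: eq_bigr => i _.
rewrite (coef_map_id0 (f := fun c : int => c%:P%:F)) ?rmorph0 //.
by rewrite -mul_polyC !rmorphM !rmorphXn rmorphD rmorphXn.
Qed.

Lemma clearedS (n : nat) (b : int) (g : {poly int}) :
  cleared n.+1 b g = 'X * cleared n b g + g`_n.+1 *: ('X^2 + b%:P) ^+ n.+1.
Proof.
rewrite /cleared big_ord_recr /= subnn mul1r; congr (_ + _).
rewrite mulr_sumr; apply: eq_bigr => i _.
by rewrite (subSn (ltn_ord i : (i <= n)%N)) exprS -scalerAr mulrA.
Qed.

Lemma size_X2Db (b : int) (n : nat) : size (('X^2 + b%:P) ^+ n) = n.*2.+1.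
Proof.
have s2 : size ('X^2 + b%:P : {poly int}) = 3 by rewrite size_XnaddC.
have := size_exp ('X^2 + b%:P) n; rewrite s2 mul2n /= => <-; rewrite prednK //.
by rewrite size_poly_gt0 expf_neq0 // -size_poly_eq0 s2.
Qed.

Lemma coef_X2Db_top (b : int) (n : nat) :
  (('X^2 + b%:P) ^+ n : {poly int})`_n.*2 = 1.
Proof.
have -> : n.*2 = (size (('X^2 + b%:P) ^+ n : {poly int})).-1.
  by rewrite size_X2Db.
by rewrite -lead_coefE lead_coef_exp lead_coefDl ?lead_coefXn ?expr1n //
           size_polyXn (leq_ltn_trans (size_polyC_leq1 _)).
Qed.

Definition bsym (n : nat) (b : int) (p : {poly int}) : Prop :=
  (size p <= n.*2.+1)%N /\
  forall i : nat, (i <= n)%N -> p`_(n - i) = b ^+ i * p`_(n + i).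

Lemma bsym_X2Db (n : nat) (b : int) : bsym n b (('X^2 + b%:P) ^+ n).
Proof.
elim: n => [|n [szp symp]].
  by split=> [|[|//] _]; rewrite ?size_X2Db // mul1r.
split=> [|[_|i lein]]; rewrite ?size_X2Db // ?mul1r ?subn0 ?addn0 //.
rewrite exprSr; move: (_ ^+ n) szp symp => p szp symp; have p0 k : (n.*2 < k)%N -> p`_k = 0.
  by move=> ltk; rewrite nth_default // (leq_trans szp).
rewrite mulrDr !coefD !coefMXn !coefMC subSS addSnnS.
have -> : (n + i.+2 < 2)%N = false by lia.
have -> : (n + i.+2 - 2 = n + i)%N by lia.
rewrite (symp i lein) [b ^+ i.+1]exprSr.
case: ltnP => h.
  rewrite [p`_(n + i.+2)]p0; last by lia.
  by ring.
have h2 : (i.+2 <= n)%N by lia.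
have -> : (n - i - 2 = n - i.+2)%N by lia.
by rewrite (symp _ h2) !exprSr; ring.
Qed.

Lemma bsym_cleared (n : nat) (b : int) (f : {poly int}) : bsym n b f ->
  exists2 g : {poly int}, (size g <= n.+1)%N & f = cleared n b g /\ g`_n = f`_n.*2.
Proof.
elim: n f => [|n IHn] f [szf symf].
  exists f => //; split=> //.
  by rewrite /cleared big_ord1 mul1r expr0 alg_polyC -size1_polyC.
pose a := f`_n.+1.*2; pose h := f - a *: ('X^2 + b%:P) ^+ n.+1.
have [_ sym2] := bsym_X2Db n.+1 b.
have symh i : (i <= n.+1)%N -> h`_(n.+1 - i) = b ^+ i * h`_(n.+1 + i).
  by move=> le_i; rewrite !coefB !coefZ symf // sym2 //; ring.
have htop : h`_n.+1.*2 = 0 by rewrite coefB coefZ coef_X2Db_top mulr1 subrr.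
have h0 : h`_0 = 0.
  by have := symh _ (leqnn n.+1); rewrite subnn addnn htop mulr0.
pose q := drop_poly 1 h.
have hq : h = 'X * q.
  rewrite mulrC -[h in LHS](poly_take_drop 1) expr1.
  suff -> : take_poly 1 h = 0 by rewrite add0r.
  by apply/polyP => -[|i]; rewrite coef_take_poly coef0.
have [|g' szg' [qE g'n]] := IHn q.
  split=> [|i le_in]; last first.
    by rewrite !coef_drop_poly !addn1 -addSn -symh ?subSn // (leq_trans le_in).
  apply/leq_sizeP => j lej; rewrite coef_drop_poly addn1.
  have [->|ne] := eqVneq j n.*2.+1; first exact: htop.
  have ltj : (n.+1.*2 < j.+1)%N by lia.
  rewrite coefB coefZ [f`_ _]nth_default ?(leq_trans szf) // nth_default.
    by rewrite mulr0 subr0.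
  by rewrite size_X2Db.
have cg' : g'`_n.+1 = 0 by rewrite nth_default.
exists (g' + a *: 'X^(n.+1)); last split.
- rewrite (leq_trans (size_polyD _ _)) // geq_max (leq_trans szg') //=.
  by rewrite (leq_trans (size_scale_leq _ _)) // size_polyXn.
- rewrite clearedS coefD coefZ coefXn eqxx mulr1 cg' add0r.
  rewrite -[LHS](subrK (a *: ('X^2 + b%:P) ^+ n.+1)) -/h hq qE.
  congr ('X * _ + _); apply: eq_bigr => i _; congr (_ *: _).
  by rewrite coefD coefZ coefXn ltn_eqF ?mulr0 ?addr0.
- by rewrite coefD coefZ coefXn eqxx mulr1 cg' add0r.
Qed.

Lemma cleared_inj (n : nat) (b : int) (g1 g2 : {poly int}) :
  (size g1 <= n.+1)%N -> (size g2 <= n.+1)%N ->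
  cleared n b g1 = cleared n b g2 -> g1 = g2.
Proof.
suff inj0 (g : {poly int}) : (size g <= n.+1)%N -> cleared n b g = 0 -> g = 0.
  move=> s1 s2 eq12; apply/eqP; rewrite -subr_eq0; apply/eqP/inj0.
    by rewrite (leq_trans (size_polyD _ _)) // size_polyN geq_max s1.
  rewrite /cleared; under eq_bigr do rewrite coefB scalerBl.
  by rewrite sumrB -/(cleared n b g1) eq12 subrr.
elim: n g => [|n IHn] g szg; first by
  rewrite /cleared big_ord1 mul1r expr0 alg_polyC => g0; rewrite (size1_polyC szg).
rewrite clearedS => cg0.
have szc : (size (cleared n b g) <= n.*2.+1)%N.
  apply: (leq_trans (size_sum _ _ _)); apply/bigmax_leqP => i _.
  rewrite (leq_trans (size_scale_leq _ _)) // (leq_trans (size_polyMleq _ _)) //.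
  by rewrite size_polyXn size_X2Db; have := ltn_ord i; lia.
have gn : g`_n.+1 = 0.
  have /(congr1 (fun p : {poly int} => p`_n.+1.*2)) := cg0.
  rewrite coefD coefXM coefZ coef0 /= [(cleared _ _ _)`_ _]nth_default //.
  by rewrite coef_X2Db_top mulr1 add0r.
apply: IHn.
  apply/leq_sizeP => j; rewrite leq_eqVlt => /predU1P[<- //|ltj].
  by rewrite nth_default // (leq_trans szg).
by move/eqP: cg0; rewrite gn scale0r addr0 mulf_eq0 polyX_eq0 => /eqP.
Qed.

Lemma trace_poly_exists_unique (n : nat) (b : int) (f : {poly int}) :
  breciprocal n b f -> exists! g : {poly int}, trace_poly n b f g.
Proof.
move=> [szf symf]; have [|g szg [fE gn]] := @bsym_cleared n b f.
  by split; rewrite ?szf.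
exists g; split=> [|g' [szg' fE']].
  split; last by rewrite clearedE // -fE.
  apply/eqP; rewrite eqn_leq szg ltnNge; apply/negP => /leq_sizeP/(_ n (leqnn n)).
  rewrite gn => /eqP; have -> : n.*2 = (size f).-1 by rewrite szf.
  by rewrite -lead_coefE lead_coef_eq0 -size_poly_eq0 szf.
apply: (@cleared_inj n b) => //; first by rewrite szg'.
by apply/eqP; rewrite -tofrac_eq; apply/eqP; rewrite -fE fE' clearedE // szg'.
Qed.

Definition roots_of (L : splittingFieldType rat) (I : finType)
    (p : {poly int}) (r : I -> L) : Prop :=
  map_poly intr p = (lead_coef p)%:~R *: \prod_i ('X - (r i)%:P).

(* The permutations of the labels I induced by Gal(Q(r)/Q) when it permutes the
   family r. If r lists the roots of a separable polynomial p then Q(r) is its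
   splitting field, and this is its Galois group as a permutation group. *)
Definition galois_perms (L : splittingFieldType rat) (I : finType)
    (r : I -> L) : {set {perm I}} :=
  [set s : {perm I} | [exists tau in 'Gal(<<1 & codom r>> / 1)%g,
                        [forall i, tau (r i) == r (s i)]]].

(* (i, 0) labels the root alpha_i and (i, 1) labels b / alpha_i. *)
Definition pair_label (n : nat) : finType := ('I_n * 'F_2)%type.

Definition pair_roots (L : splittingFieldType rat) (n : nat) (b : int)
    (alpha : 'I_n -> L) (k : pair_label n) : L :=
  if k.2 == 0 then alpha k.1 else b%:~R / alpha k.1.

(* The permutation (v, sigma) of F_2^n x| S_n: it sends alpha_i to
   alpha_(sigma i) if v_i = 0 and to b / alpha_(sigma i) if v_i = 1. *)
Definition wreath_coord (n : nat) (v : {ffun 'I_n -> 'F_2}) (sigma : 'S_n)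
    (s : {perm pair_label n}) : bool :=
  [forall i, forall e, s (i, e) == (sigma i, e + v i)].

Definition G0 (n : nat) : {set {perm pair_label n}} :=
  [set s : {perm pair_label n} | [forall i, (s (i, 0)).1 == (s (i, 1)).1]].

Definition G2 (n : nat) : {set {perm pair_label n}} :=
  [set s : {perm pair_label n} |
    [exists v : {ffun 'I_n -> 'F_2}, exists sigma : 'S_n,
      wreath_coord v sigma s && (\sum_i v i == (odd_perm sigma)%:R)]].

Lemma G2P (n : nat) (s : {perm pair_label n}) :
  reflect (exists (v : {ffun 'I_n -> 'F_2}) (sigma : 'S_n),
             (forall i e, s (i, e) = (sigma i, e + v i)) /\
             \sum_i v i = (odd_perm sigma)%:R)
          (s \in G2 n).
Proof.
rewrite inE; apply: (iffP existsP) => -[v].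
  case/existsP=> sigma /andP[/forallP h /eqP hs]; exists v, sigma; split=> // i e.
  by have /forallP/(_ e)/eqP := h i.
case=> sigma [h hs]; exists v; apply/existsP; exists sigma.
by rewrite hs eqxx andbT; do 2![apply/forallP => ?]; rewrite h.
Qed.

Lemma G2_sub_G0 (n : nat) : G2 n \subset G0 n.
Proof.
apply/fintype.subsetP => s /G2P[v [sigma [h _]]]; rewrite inE; apply/forallP => i.
by rewrite !h.
Qed.

Lemma G2_group_set (n : nat) : group_set (G2 n).
Proof.
apply/group_setP; split=> [|s t /G2P[v [sigma [hs Hs]]] /G2P[w [tau [ht Ht]]]].
  apply/G2P; exists [ffun=> 0], 1%g; split=> [i e|].
    by rewrite !perm1 ffunE addr0.
  by rewrite odd_perm1 big1 // => i _; rewrite ffunE.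
apply/G2P; exists [ffun i => v i + w (sigma i)], (sigma * tau)%g; split=> [i e|].
  by rewrite !permM hs ht ffunE addrA.
under eq_bigr do rewrite ffunE.
have wE : \sum_i w (sigma i) = \sum_i w i by rewrite [RHS](reindex_perm sigma).
rewrite big_split /= Hs wE Ht odd_permM.
by case: odd_perm; case: odd_perm; apply/val_inj.
Qed.

Canonical G2_group (n : nat) : {group {perm pair_label n}} :=
  Group (G2_group_set n).

Definition galois_group_is_Sn (n : nat) (g : {poly int}) : Prop :=
  exists (L : splittingFieldType rat) (beta : 'I_n -> L),
    roots_of g beta /\ galois_perms beta = [set: 'S_n].

(* G_f \subset G for some labelling of the roots of f as alpha_i, b/alpha_i.
   Relabelling conjugates G_f by an element of G0, so the choice of labelling
   is immaterial when G is normal in G0. *)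
Definition galois_group_within (n : nat) (b : int) (f : {poly int})
    (G : {group {perm pair_label n}}) : Prop :=
  exists (L : splittingFieldType rat) (alpha : 'I_n -> L),
    roots_of f (pair_roots b alpha) /\
    galois_perms (pair_roots b alpha) \subset G.

Definition reciprocal_family (R : realType) (n : nat) (b : int)
    (G : {group {perm pair_label n}}) (H : R) : set {poly int} :=
  [set f : {poly int} |
    [/\ breciprocal n b f,
        forall i : nat, - H <= (f`_i)%:~R <= H,
        separable_poly (map_poly intr f : {poly rat}),
        exists2 g : {poly int}, trace_poly n b f g & galois_group_is_Sn n g
      & galois_group_within b f G]]%classic.

Lemma finite_reciprocal_family (R : realType) (n : nat) (b : int)
    (G : {group {perm pair_label n}}) (H : R) :
  finite_set (reciprocal_family b G H).
Proof.
pose K := Num.truncn `|H|.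
pose F (a : {ffun 'I_n.*2.+1 -> 'I_K.*2.+1}) : {poly int} :=
  \poly_(i < n.*2.+1) ((a (inord i) : nat)%:Z - K%:Z).
apply: (@sub_finite_set _ _ (F @` setT)%classic); last first.
  exact/finite_image/finite_finset.
move=> f [[szf _] fH _ _ _] /=.
exists [ffun i : 'I_n.*2.+1 => inord (absz (f`_i + K%:Z))] => //.
apply/polyP => i; rewrite coef_poly; case: ltnP => [lti|]; last first.
  by rewrite -szf => /leq_sizeP/(_ i (leqnn i)) ->.
have hK : `|f`_i| <= K%:Z.
  have fH' : `|(f`_i)%:~R| <= `|H|.
    have /andP[f1 f2] := fH i.
    by rewrite ler_norml (le_trans _ f1) ?lerN2 ?(le_trans f2) // ler_norm.
  by rewrite -ltzD1 -(ltr_int R) intr_norm (le_lt_trans fH') // -PoszD addn1 truncnS_gt.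
by rewrite ffunE !inordK //; lia.
Qed.

(* The underlying set is finite (finite_reciprocal_family), so this is the
   actual number of its elements. *)
Definition E_count (R : realType) (n : nat) (b : int)
    (G : {group {perm pair_label n}}) (H : R) : nat :=
  #|` fset_set (reciprocal_family b G H)|%fset.

Definition E_monic_count (R : realType) (n : nat) (b : int)
    (G : {group {perm pair_label n}}) (H : R) : nat :=
  #|` fset_set (reciprocal_family b G H `&` [set f | f \is monic])%classic|%fset.

(* Main.v *)
(* Write [g = (u^2 - 4b) q + B u + A].  The condition [G_f <= G_2] says that
   [prod_i (beta_i^2 - 4b)] times the discriminant of [g] is a rational square,
   and that product is, up to squares, the norm [N = A^2 - 4 b B^2]
   ([g] reduced modulo [u^2 - 4b] is [A + B u]).

   Fix [A], [B] and all coefficients of [q] but one, called [t].  A prime [p]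
   dividing [N] to an odd power must divide the discriminant, which confines
   [t] to boundedly many classes modulo [p]; and [N] times the discriminant is
   a polynomial in [t], not a square, that takes a square value, so the
   determinant method of Bombieri and Pila saves a power of the height.  When
   the squarefree part of [N] is large the congruences alone give [O(1)] values
   of [t] on average over [A], [B] (Rankin's trick bounds how often
   [N] has a large smooth part); when it is small there are few [(A, B)], by counting solutions of
   Pell equations, and the determinant method suffices.  As [q] has [n - 1]
   coefficients, and one fewer if [g] is monic, summing over the others gives
   the bounds.

   The only case without a free coefficient is that of monic quadratics.  There
   [B^2 - 4A + 16b] and [N] have the same squarefree part [m], which divides
   [B^2 - 16b] and [4(A - 8b)].  If [m] is large, the divisor bound applies; if
   it is small, the solutions lie on few lines, obtained from a Dirichlet
   approximation to [sqrt m], and on each line the determinant method applies to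
   a quartic. *)

Require Import Defs.
From mathcomp Require Import all_boot all_order all_algebra all_fingroup all_field.
From mathcomp Require Import zify ring lra.
From mathcomp Require Import finmap boolp classical_sets cardinality reals.

Set Implicit Arguments.
Unset Strict Implicit.
Unset Printing Implicit Defensive.

Import Order.TTheory GRing.Theory Num.Theory.

(** * Residue classes and divisors *)

Section Counting.

(** The bounds carry no factor [T ^ eps], and this dictates the shape of the argument. A modulus
    made of all the primes of [N] would leave up to [c ^ omega(N)] classes, which is unbounded on
    average; but a modulus of size [T] already leaves O(1) values of [t] per class, so it is built
    from the large primes of [N] alone. Their number is bounded unless [N] has a large smooth part,
    and that is rare enough to pay for the extra classes. Elsewhere a power is saved: heights are
    [T = U ^ E] with [E] fixed, each logarithm or divisor number costs one factor [U], and the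
    saving is a larger power of [U].

    To recognise a nonsquare polynomial in [t] without expanding a discriminant, [t] multiplies a
    direction [h] divisible by [u^2 - 4b], and the discriminant is replaced by the resultant of [g]
    with the Wronskian of [g] and [h]. The Wronskian is constant along [g + t h], so the degree in
    [t] can be read off, and [h] is chosen to make it odd. In degrees two and three there is no room
    for such an [h], and coefficients are compared by hand. *)

Lemma size_fiber (T T' : eqType) (f : T -> T') (s : seq T) (r : seq T') (k : nat) :
  (forall x, x \in s -> f x \in r) ->
  (forall y, y \in r -> count (fun x => f x == y) s <= k) -> size s <= k * size r.
Proof.
elim: r s => [|y r IHr] s sr cnt.
  by case: s sr {cnt} => // x s /(_ x); rewrite mem_head => /(_ isT).
rewrite -(count_predC (fun x => f x == y)) /= mulnS leq_add ?cnt ?mem_head //.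
rewrite -size_filter; apply: IHr => [x|z zr].
  rewrite mem_filter => /andP[/= fxy xs]; have := sr x xs.
  by rewrite inE (negPf fxy).
apply: leq_trans (cnt z _); last by rewrite inE zr orbT.
by rewrite count_filter; apply: sub_count => x /= /andP[].
Qed.

Lemma count_fiber (T T' : eqType) (f : T -> T') (P : pred T) (s : seq T) (r : seq T') (k : nat) :
  (forall x, x \in s -> P x -> f x \in r) ->
  (forall y, y \in r -> count (fun x => P x && (f x == y)) s <= k) -> count P s <= k * size r.
Proof.
move=> sr cnt; rewrite -size_filter; apply: (size_fiber (f := f)) => [x|y yr].
  by rewrite mem_filter => /andP[Px xs]; apply: sr.
rewrite count_filter; apply: leq_trans (cnt y yr).
by apply: sub_count => x /= /andP[-> ->].
Qed.

(** With [f := modz^~ d] this is the number of residue classes modulo [d] met by [s], the quantity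
    that every congruence argument bounds. *)
Definition ncl (T T' : eqType) (f : T -> T') (s : seq T) := size (undup (map f s)).

Lemma undup_map_reps (T T' : eqType) (f : T -> T') (s : seq T) :
  exists2 ts, {subset ts <= s} & map f ts = undup (map f s).
Proof.
elim: s => [|x s [ts tss eqf]]; first by exists [::].
rewrite /=; case: ifP => _.
  by exists ts => // y /tss ys; rewrite inE ys orbT.
exists (x :: ts); last by rewrite /= eqf.
by move=> y; rewrite !inE => /orP[->//|/tss->]; rewrite orbT.
Qed.

(** Reduces to lists with pairwise distinct values. For residues these are pairwise incongruent
    integers, the form in which root counting over ['F_p] applies. *)
Lemma ncl_leq (T T' : eqType) (f : T -> T') (s : seq T) k :
  (forall ts, {subset ts <= s} -> uniq (map f ts) -> size ts <= k) -> ncl f s <= k.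
Proof.
move=> H; have [ts tss eqf] := undup_map_reps f s.
by rewrite /ncl -eqf size_map; apply: H; rewrite // eqf undup_uniq.
Qed.

Lemma uniq_map_inj (T T' : eqType) (f : T -> T') (s : seq T) (x y : T) :
  uniq (map f s) -> x \in s -> y \in s -> f x = f y -> x = y.
Proof.
elim: s => //= z s IHs /andP[fzs us]; rewrite !inE => /predU1P[->|xs] /predU1P[->|ys] // fxy.
- by case/negP: fzs; rewrite fxy map_f.
- by case/negP: fzs; rewrite -fxy map_f.
- exact: IHs.
Qed.

Lemma ncl_pair (T T1 T2 T3 : eqType) (f : T -> T1) (g : T -> T2) (h : T -> T3) (s : seq T) :
  (forall x y, x \in s -> y \in s -> g x = g y -> h x = h y -> f x = f y) ->
  ncl f s <= ncl g s * ncl h s.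
Proof.
move=> inj; apply: ncl_leq => ts tss uf.
rewrite -(size_map (fun x => (g x, h x))) -(size_allpairs pair).
apply: uniq_leq_size.
  rewrite map_inj_in_uniq; first exact: map_uniq uf.
  move=> x y xs ys [gxy hxy]; have fxy := inj _ _ (tss _ xs) (tss _ ys) gxy hxy.
  exact: (uniq_map_inj uf xs ys fxy).
move=> _ /mapP[x xts ->]; apply/allpairsP; exists (g x, h x).
by rewrite /= !mem_undup !map_f // tss.
Qed.

Lemma count_ncl (T T' : eqType) (f : T -> T') (P : pred T) (s : seq T) (k : nat) :
  (forall y, count (fun x => P x && (f x == y)) s <= k) -> count P s <= k * ncl f (filter P s).
Proof.
move=> cnt; apply: (@count_fiber _ _ f) => // x xs Px.
by rewrite mem_undup map_f // mem_filter Px.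
Qed.

Lemma sum_bool_count (T : Type) (P : pred T) (s : seq T) : \sum_(x <- s) (P x : nat) = count P s.
Proof. by rewrite -sum1_count [RHS]big_mkcond; apply: eq_bigr => x _; case: (P x). Qed.

Lemma sum_const_seq (T : Type) (s : seq T) (c : nat) : \sum_(x <- s) c = size s * c.
Proof. by rewrite big_const_seq count_predT iter_addn_0 mulnC. Qed.

End Counting.

Section Intervals.
Local Open Scope ring_scope.

Definition itv (a : int) (L : nat) : seq int := [seq a + i%:Z | i <- iota 0 L].
Definition rng (T : nat) : seq int := itv (- T%:Z) T.*2.+1.

Lemma mem_itv a L x : (x \in itv a L) = (a <= x < a + L%:Z).
Proof.
apply/mapP/idP => [[i]|/andP[ax xa]].
  by rewrite mem_iota => /andP[_ iL] ->; lia.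
by exists `|x - a|%N; rewrite ?mem_iota; lia.
Qed.

Lemma itv_uniq a L : uniq (itv a L).
Proof. by rewrite map_inj_uniq ?iota_uniq // => i j /addrI[]. Qed.

Lemma size_itv a L : size (itv a L) = L.
Proof. by rewrite size_map size_iota. Qed.

Lemma mem_itv0 L x : x \in itv 0 L -> (`|x| < L)%N.
Proof. by rewrite mem_itv; lia. Qed.

Lemma mem_rng T x : (x \in rng T) = (`|x| <= T)%N.
Proof. by rewrite mem_itv; lia. Qed.

Lemma rng_uniq T : uniq (rng T). Proof. exact: itv_uniq. Qed.

Lemma size_rng T : size (rng T) = T.*2.+1. Proof. exact: size_itv. Qed.

Lemma count_resid a L d (y : int) : (0 < d)%N ->
  (count (fun t => (t %% d%:Z)%Z == y) (itv a L) <= L %/ d + 1)%N.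
Proof.
move=> d0; rewrite count_map -size_filter -(size_iota 0 (L %/ d + 1)).
rewrite -(size_map (divn^~ d)); apply: uniq_leq_size.
  rewrite map_inj_in_uniq ?filter_uniq ?iota_uniq // => i j.
  rewrite !mem_filter /= => /andP[/eqP ei _] /andP[/eqP ej _] eq_div.
  have : (a + i%:Z == a + j%:Z %[mod d%:Z])%Z by rewrite ei ej.
  rewrite eqz_modDl => /eqP; rewrite !modz_nat => -[eq_mod].
  by rewrite (divn_eq i d) (divn_eq j d) eq_div eq_mod.
move=> _ /mapP[i + ->]; rewrite mem_filter !mem_iota /= add0n => /andP[_ iL].
by rewrite addn1 ltnS leq_div2r // ltnW.
Qed.

Lemma count_modcl a L d (Q : pred int) : (0 < d)%N ->
  (count Q (itv a L) <= (L %/ d + 1) * ncl (modz^~ d%:Z) (filter Q (itv a L)))%N.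
Proof.
move=> d0; apply: count_ncl => y; apply: leq_trans (count_resid a L y d0).
by apply: sub_count => x /andP[].
Qed.

(** By the Chinese remainder theorem a class modulo the product is a tuple of classes, so the bounds
    multiply. *)
Lemma ncl_crt (s : seq int) (ps : seq nat) (c : nat) : uniq ps -> all prime ps ->
  (forall p, p \in ps -> (ncl (modz^~ p%:Z) s <= c)%N) ->
  (ncl (modz^~ (\prod_(p <- ps) p)%N%:Z) s <= c ^ size ps)%N.
Proof.
elim: ps => [_ _ _|p ps IHps /= /andP[pps ups] /andP[pp pr] H].
  rewrite big_nil expn0; apply: ncl_leq => -[|x [|y ts]] //= _.
  by rewrite !modz1 inE eqxx.
have cop : coprime p (\prod_(p <- ps) p).
  elim: ps pps pr {IHps ups H} => [|q ps IH]; first by rewrite big_nil coprimen1.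
  rewrite inE negb_or => /andP[pq pps] /andP[qq pr].
  by rewrite big_cons coprimeMr IH // prime_coprime // dvdn_prime2 // pq.
rewrite big_cons expnS; apply: (@leq_trans (ncl (modz^~ p%:Z) s *
    ncl (modz^~ (\prod_(p <- ps) p)%N%:Z) s)); last first.
  by rewrite leq_mul ?H ?mem_head ?IHps // => q qps; rewrite H // inE qps orbT.
apply: ncl_pair => x y _ _ /eqP + /eqP; rewrite !eqz_mod_dvd => xy1 xy2.
by apply/eqP; rewrite eqz_mod_dvd PoszM Gauss_dvdz ?xy1.
Qed.

End Intervals.

(** * Numbers of divisors and of prime factors *)

Section DivisorBounds.

Lemma prod_primesE n : 0 < n -> n = \prod_(p <- primes n) p ^ logn p n.
Proof. by move=> n0; rewrite {1}(prod_prime_decomp n0) prime_decompE big_map. Qed.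

Lemma prod_primes_leq n : 0 < n -> \prod_(p <- primes n) p <= n.
Proof.
move=> n0; rewrite {2}(prod_primesE n0) big_seq [X in _ <= X]big_seq.
apply: leq_prod => p; rewrite -logn_gt0; case: (logn p n) => // e _.
by case: p => [|p]; rewrite ?exp0n // expnS leq_pmulr // expn_gt0.
Qed.

Lemma leq_expr (m n e : nat) : m <= n -> m ^ e <= n ^ e.
Proof. by case: e => // e mn; rewrite leq_exp2r. Qed.

Lemma prod_const_seq (T : eqType) (s : seq T) (c : nat) : \prod_(x <- s) c = c ^ size s.
Proof. by elim: s => [|x s IHs]; rewrite ?big_nil // big_cons IHs expnS. Qed.

Lemma leq_prod_seq (T : eqType) (s : seq T) (F G : T -> nat) :
  (forall x, x \in s -> F x <= G x) -> \prod_(x <- s) F x <= \prod_(x <- s) G x.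
Proof. by move=> FG; rewrite big_seq [X in _ <= X]big_seq; apply: leq_prod. Qed.

Lemma prod_small_leq (s : seq nat) (M C : nat) : uniq s -> 0 < C ->
  \prod_(p <- s) (if p < M then C else 1) <= C ^ M.
Proof.
move=> us C0; rewrite -big_mkcond -big_filter prod_const_seq leq_pexp2l //.
rewrite -[X in _ <= X](size_iota 0); apply: uniq_leq_size; first exact: filter_uniq.
by move=> p; rewrite mem_filter mem_iota => /andP[].
Qed.

(** A prime [p >= M] pays for its own factor [M]; the primes below [M] number at most [M] and cost
    [M ^ M] together. *)
Lemma omega_bound (c k : nat) : exists C, 0 < C /\
  forall n, 0 < n -> (c ^ size (primes n)) ^ k <= C * n.
Proof.
pose M := (c ^ k).+1; exists (M ^ M); split=> [|n n0]; first by rewrite expn_gt0.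
rewrite -expnM mulnC expnM.
apply: (@leq_trans (M ^ size (primes n))); first exact: leq_expr.
apply: (@leq_trans (\prod_(p <- primes n) ((if p < M then M else 1) * p))).
  rewrite -prod_const_seq; apply: leq_prod_seq => p.
  rewrite mem_primes => /andP[/prime_gt0 p0 _].
  by case: ltnP; rewrite ?mul1n // => _; rewrite leq_pmulr.
by rewrite big_split leq_mul ?prod_primes_leq ?prod_small_leq ?primes_uniq.
Qed.

(** A divisor is its gcd with [p ^ e] times a cofactor, and the cofactor divides [m] even when [p]
    does. *)
Lemma size_divisors_pfactor p e m : prime p -> 0 < m ->
  size (divisors (p ^ e * m)) <= e.+1 * size (divisors m).
Proof.
move=> pp m0; rewrite -(size_iota 0 e.+1) -(size_allpairs (fun i d => p ^ i * d)).
apply: uniq_leq_size; first exact: divisors_uniq.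
have pe0 : 0 < p ^ e by rewrite expn_gt0 prime_gt0.
move=> d; rewrite -dvdn_divisors ?muln_gt0 ?pe0 // => dd.
have d0 : 0 < d by apply: dvdn_gt0 dd; rewrite muln_gt0 pe0.
have /(dvdn_pfactor _ _ pp)[i ie eqi] := dvdn_gcdr d (p ^ e).
have g0 : 0 < gcdn d (p ^ e) by rewrite gcdn_gt0 d0.
apply/allpairsP; exists (i, d %/ gcdn d (p ^ e)); rewrite mem_iota ltnS ie; split=> //=.
  rewrite -dvdn_divisors //.
  have cop : coprime (d %/ gcdn d (p ^ e)) (p ^ e %/ gcdn d (p ^ e)).
    by rewrite /coprime -(eqn_pmul2r g0) muln_gcdl !divnK ?dvdn_gcdl ?dvdn_gcdr // mul1n.
  rewrite -(Gauss_dvdr _ cop) -(dvdn_pmul2r g0) divnK ?dvdn_gcdl //.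
  by rewrite mulnAC divnK ?dvdn_gcdr.
by rewrite -eqi mulnC divnK ?dvdn_gcdl.
Qed.

Lemma size_divisors_prod (ps : seq nat) (e : nat -> nat) : all prime ps ->
  size (divisors (\prod_(p <- ps) p ^ e p)) <= \prod_(p <- ps) (e p).+1.
Proof.
elim: ps => [|p ps IHps] /=; first by rewrite !big_nil.
case/andP=> pp pr; rewrite !big_cons.
apply: (leq_trans (size_divisors_pfactor _ pp _)); last by rewrite leq_mul ?IHps.
rewrite big_seq; apply: prodn_cond_gt0 => q qps; rewrite expn_gt0 prime_gt0 //.
exact: (allP pr).
Qed.

Lemma size_divisors_sqfree (ps : seq nat) : all prime ps ->
  size (divisors (\prod_(p <- ps) p)) <= 2 ^ size ps.
Proof.
move=> pr; rewrite -prod_const_seq.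
by have := size_divisors_prod (fun=> 1) pr; under eq_bigr do rewrite expn1.
Qed.

(** Compare [(e + 1) ^ K] with [p ^ e] prime by prime. For [p >= 2 ^ K] it is at most
    [(2 ^ e) ^ K <= p ^ e]; a smaller prime loses at most [K ^ K], because [e + 1 <= K 2 ^ (e / K)],
    and there are at most [2 ^ K] of these. *)
Lemma tau_bound (k : nat) : exists C, 0 < C /\
  forall n, 0 < n -> size (divisors n) ^ k <= C * n.
Proof.
case: k => [|k]; first by exists 1; split=> // n; rewrite mul1n.
set K := k.+1; pose M := 2 ^ K; exists ((K ^ K) ^ M); split=> [|n n0].
  by rewrite expn_gt0 expn_gt0.
rewrite {1}(prod_primesE n0).
apply: (leq_trans (leq_expr _ (size_divisors_prod _ (all_prime_primes n)))).
rewrite (big_morph (expn^~ K) (fun x y => expnMn x y K) (exp1n K)).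
apply: (@leq_trans (\prod_(p <- primes n) ((if p < M then K ^ K else 1) * p ^ logn p n))).
  apply: leq_prod_seq => p; rewrite mem_primes => /andP[pp _].
  set e := logn p n; case: ltnP => [_|Mp].
    have e1 : e.+1 <= K * 2 ^ (e %/ K).
      apply: (@leq_trans (K * (e %/ K).+1)); last by rewrite leq_mul // ltn_expl.
      by rewrite mulnC; apply: ltn_ceil.
    apply: (leq_trans (leq_expr _ e1)); rewrite expnMn leq_mul // -expnM.
    apply: (@leq_trans (2 ^ e)); last by rewrite leq_expr ?prime_gt1.
    by rewrite leq_exp2l // leq_trunc_div.
  rewrite mul1n; apply: (@leq_trans ((2 ^ e) ^ K)); first by rewrite leq_expr // ltn_expl.
  by rewrite -expnM mulnC expnM leq_expr.
rewrite big_split -prod_primesE // leq_mul // prod_small_leq ?primes_uniq //.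
by rewrite expn_gt0.
Qed.

(* The slack [U] absorbs every factor of size [T ^ o(1)] once [T] is a power of [U]. *)
Lemma tau_leq (K e : nat) : exists C, 0 < C /\
  forall U n, 0 < U -> n <= K * U ^ e -> size (divisors n) <= C * U.
Proof.
have [C [C0 H]] := tau_bound e.+1; exists (C * K).+1; split=> // U n U0 nK.
case: n nK => [|n] nK; first by rewrite /= muln_gt0.
rewrite -(@leq_exp2r _ _ e.+1) //; apply: (leq_trans (H _ _)) => //.
rewrite expnMn; apply: (@leq_trans (C * (K * U ^ e))); first by rewrite leq_mul.
rewrite mulnA leq_mul //; last by rewrite leq_pexp2l.
by rewrite expnS -[X in X <= _]muln1 leq_mul // expn_gt0.
Qed.

(** Apply [omega_bound] with exponent [e.+1]: the power [e.+1] of the left side is at most a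
    constant times [U ^ e], and a root is extracted. *)
Lemma omega_leq (c K e : nat) : exists C, 0 < C /\
  forall U n, 0 < U -> n <= K * U ^ e -> c ^ size (primes n) <= C * U.
Proof.
have [C [C0 H]] := omega_bound c e.+1; exists (C * K).+1; split=> // U n U0 nK.
case: n nK => [|n] nK; first by rewrite /= muln_gt0.
rewrite -(@leq_exp2r _ _ e.+1) //; apply: (leq_trans (H _ _)) => //.
rewrite expnMn; apply: (@leq_trans (C * (K * U ^ e))); first by rewrite leq_mul.
rewrite mulnA leq_mul //; last by rewrite leq_pexp2l.
by rewrite expnS -[X in X <= _]muln1 leq_mul // expn_gt0.
Qed.

End DivisorBounds.

(** * Square roots modulo an integer *)

Section QuadraticRoots.
Local Open Scope ring_scope.

Lemma dvdz_eq (x : int) (d : nat) : (d%:Z %| x)%Z = (d %| `|x|)%N.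
Proof. by rewrite dvdzE. Qed.

Lemma dvdz_sub (d x y : int) : (d %| x)%Z -> (d %| y)%Z -> (d %| x - y)%Z.
Proof. by move=> dx dy; apply: rpredB. Qed.

Lemma dvdz_add (d x y : int) : (d %| x)%Z -> (d %| y)%Z -> (d %| x + y)%Z.
Proof. by move=> dx dy; apply: rpredD. Qed.

(** Fix one root [y]. For another root [x], [d] divides [(x - y)(x + y)]; put [d1 = gcd(x - y, d)]
    and [d2 = d / d1], so that [d2] divides [x + y]. For each divisor [d1] of [d] this determines
    [x] modulo [lcm(d1, d2) = d / g] with [g = gcd(d1, d2)], leaving at most [g + 1] classes modulo
    [d]. Here [g ^ 2] divides [d], and [g] divides [2 y], so [g ^ 2] divides [4 c] and [g <= G]. *)
Lemma sqrt_mod_count (d G : nat) (c : int) (s : seq int) : (0 < d)%N ->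
  (forall g : nat, (g ^ 2 %| d)%N -> ((g ^ 2)%N%:Z %| 4 * c)%Z -> (g <= G)%N) ->
  (forall x, x \in s -> (d%:Z %| x ^+ 2 - c)%Z) ->
  (ncl (modz^~ d%:Z) s <= G.+1 * size (divisors d))%N.
Proof.
move=> d0 HG Hs; apply: ncl_leq => ts tss uts.
case: ts tss uts => [|y ts'] //; set ts := y :: ts' => tss uts.
have yts : y \in ts by rewrite mem_head.
pose f (x : int) := gcdn `|x - y| d.
apply: (size_fiber (f := f)) => [x _|d1].
  by rewrite -dvdn_divisors // dvdn_gcdr.
rewrite -dvdn_divisors // => d1d.
set u := [seq x <- ts | f x == d1].
rewrite -size_filter -/u; have [|[x0 x0u]] : u = [::] \/ exists x, x \in u.
- by case: (u) => [|x v]; [left|right; exists x; rewrite mem_head].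
- by move->.
pose d2 := (d %/ d1)%N; pose g := gcdn d1 d2; pose e := (d %/ g)%N.
have dE : d = (d1 * d2)%N by rewrite /d2 mulnC divnK.
have d10 : (0 < d1)%N by apply: dvdn_gt0 d1d.
have d20 : (0 < d2)%N by rewrite divn_gt0 // dvdn_leq.
have g0 : (0 < g)%N by rewrite gcdn_gt0 d10.
have gg : (g ^ 2 %| d)%N by rewrite dE -mulnn dvdn_mul ?dvdn_gcdl ?dvdn_gcdr.
have gd : (g %| d)%N by apply: dvdn_trans gg; rewrite -mulnn dvdn_mulr.
have Hx x : x \in u -> (d1%:Z %| x - y)%Z /\ (d2%:Z %| x + y)%Z.
  rewrite mem_filter => /andP[/eqP fx xts].
  have dx1 : (d1 %| `|(x - y)%R|)%N by rewrite -fx dvdn_gcdl.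
  split; first by rewrite dvdz_eq.
  have dd : (d %| `|(x - y)%R| * `|(x + y)%R|)%N.
    rewrite -abszM -dvdz_eq; have -> : (x - y) * (x + y) = (x ^+ 2 - c) - (y ^+ 2 - c) by ring.
    by rewrite rpredB ?Hs ?tss.
  have cop : coprime d2 (`|(x - y)%R| %/ d1)%N.
    rewrite /coprime -(eqn_pmul2r d10) mul1n muln_gcdl /d2 !divnK // -fx.
    by rewrite gcdnC.
  rewrite dvdz_eq -(Gauss_dvdr _ cop) -(dvdn_pmul2l d10) -dE mulnA.
  by rewrite [(d1 * _)%N]mulnC divnK.
have [x01 x02] := Hx _ x0u.
have gG : (g <= G)%N.
  apply: HG => //.
  have g1 : (g%:Z %| x0 - y)%Z by apply: dvdz_trans x01; rewrite dvdz_eq dvdn_gcdl.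
  have g2 : (g%:Z %| x0 + y)%Z by apply: dvdz_trans x02; rewrite dvdz_eq dvdn_gcdr.
  have g3 : (g%:Z %| 2 * y)%Z.
    have -> : 2 * y = (x0 + y) - (x0 - y) by ring.
    exact: dvdz_sub.
  have -> : 4 * c = (2 * y) * (2 * y) - 4 * (y ^+ 2 - c) by ring.
  apply: dvdz_sub; first by rewrite -mulnn PoszM dvdz_mul.
  apply: dvdz_mull; apply: (@dvdz_trans d%:Z); first by rewrite dvdz_eq.
  by rewrite Hs ?tss.
have de : (d %/ e)%N = g by rewrite /e divnA // mulKn.
have e0 : (0 < e)%N by rewrite divn_gt0 // dvdn_leq.
apply: (@leq_trans (d %/ e + 1)%N); last by rewrite de addn1 ltnS.
apply: leq_trans (count_resid 0 d (x0 %% e%:Z)%Z e0).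
rewrite -(size_map (modz^~ d%:Z)) -size_filter; apply: uniq_leq_size.
  by apply: subseq_uniq uts; apply/map_subseq/filter_subseq.
move=> _ /mapP[x xu ->]; rewrite mem_filter mem_itv add0r modz_ge0 ?ltz_pmod //; last by rewrite eqz_nat -lt0n.
have [x1 x2] := Hx _ xu.
have ed : (e%:Z %| d%:Z)%Z by rewrite dvdz_eq; apply: dvdn_div.
rewrite !andbT eqz_mod_dvd.
have -> : (x %% d%:Z)%Z - x0 = (x - x0) - (x %/ d%:Z)%Z * d%:Z.
  by rewrite {2}(divz_eq x d%:Z); ring.
apply: dvdz_sub; last exact: dvdz_mull.
have -> : e = lcmn d1 d2 by rewrite /lcmn -dE.
rewrite dvdz_eq dvdn_lcm -!dvdz_eq; apply/andP; split.
  have -> : x - x0 = (x - y) - (x0 - y) by ring.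
  exact: dvdz_sub.
have -> : x - x0 = (x + y) - (x0 + y) by ring.
exact: dvdz_sub.
Qed.

End QuadraticRoots.

(** * Pell equations *)

Section Pell.
Local Open Scope ring_scope.

(** The quotient [a2 + c2 sqrt m] of the two units is again a unit with positive coordinates, so
    [a2 >= 2], and [a' = a a2 + m c c2 >= 2 a]. *)
Lemma pell_unit_double (m a c a' c' : int) :
  0 < m -> a ^+ 2 - m * c ^+ 2 = 1 -> a' ^+ 2 - m * c' ^+ 2 = 1 ->
  0 < a -> 0 < c -> 0 < a' -> 0 < c' -> a < a' -> 2 * a <= a'.
Proof.
move=> m0 e1 e2 a0 c0 a0' c0' aa'.
have cc' : c < c'.
  rewrite ltNge; apply/negP => c'c; have h1 : m * c' ^+ 2 <= m * c ^+ 2.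
    by rewrite ler_pM2l // ler_sqr // nnegrE ltW.
  have h2 : a ^+ 2 < a' ^+ 2 by rewrite ltr_sqr // nnegrE ltW.
  by lia.
pose c2 := a * c' - a' * c; pose a2 := a * a' - m * c * c'.
have e3 : a2 ^+ 2 - m * c2 ^+ 2 = 1.
  transitivity ((a ^+ 2 - m * c ^+ 2) * (a' ^+ 2 - m * c' ^+ 2)).
    by rewrite /a2 /c2; ring.
  by rewrite e1 e2.
have e4 : a' = a * a2 + m * c * c2.
  by rewrite /a2 /c2 -[LHS]mulr1 -e1; ring.
have c20 : 0 < c2.
  rewrite /c2 subr_gt0 -(ltr_pXn2r (n := 2)) ?nnegrE ?mulr_ge0 ?ltW // !exprMn.
  have -> : a ^+ 2 = 1 + m * c ^+ 2 by rewrite -e1; ring.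
  have -> : a' ^+ 2 = 1 + m * c' ^+ 2 by rewrite -e2; ring.
  rewrite -subr_gt0; have -> : (1 + m * c ^+ 2) * c' ^+ 2 - (1 + m * c' ^+ 2) * c ^+ 2 = c' ^+ 2 - c ^+ 2 by ring.
  rewrite subr_gt0.
  by rewrite ltr_sqr // nnegrE ltW.
have a20 : 0 < a2.
  rewrite /a2 subr_gt0 -(ltr_pXn2r (n := 2)) ?nnegrE ?mulr_ge0 ?ltW // !exprMn.
  have -> : a ^+ 2 = 1 + m * c ^+ 2 by rewrite -e1; ring.
  have -> : a' ^+ 2 = 1 + m * c' ^+ 2 by rewrite -e2; ring.
  rewrite -subr_gt0; have -> : (1 + m * c ^+ 2) * (1 + m * c' ^+ 2) - m ^+ 2 * c ^+ 2 * c' ^+ 2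
     = 1 + m * c ^+ 2 + m * c' ^+ 2 by ring.
  by rewrite !addr_gt0 // mulr_gt0 // exprn_gt0.
have mc : 1 <= m * c2 ^+ 2 by rewrite -[1](mulr1) ler_pM // -?gtz0_ge1 ?exprn_gt0.
have a21 : 2 <= a2.
  rewrite leNgt; apply/negP => lt2; have a2E : a2 = 1 by lia.
  by move: e3 mc; rewrite a2E; lia.
rewrite e4; apply: (@le_trans _ _ (a * a2)); first by rewrite mulrC ler_pM2l.
by rewrite lerDl !mulr_ge0 // ltW.
Qed.

Definition sgcode (x : int) : nat := if x == 0 then 0 else if 0 < x then 1 else 2.

Lemma sgcode_inj_small (x y : int) : x ^+ 2 <= 1 -> y ^+ 2 <= 1 -> sgcode x = sgcode y -> x = y.
Proof.
have h (z : int) : z ^+ 2 <= 1 -> z = 0 \/ z = 1 \/ z = -1 by rewrite expr2 => ?; nia.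
by move=> /h[->|[->|->]] /h[->|[->|->]].
Qed.

Lemma sgcode_inj (x y : int) : `|x| = `|y| -> sgcode x = sgcode y -> x = y.
Proof. by rewrite /sgcode => xy; do ![case: ifP => ?]; lia. Qed.

(** A solution is determined by its two signs (nine possibilities, zero included) and by the dyadic
    size of its first coordinate: for [m > 0] two distinct solutions with equal signs differ by a
    factor two there, and for [m < 0] all coordinates lie in [{-1, 0, 1}]. *)
Lemma pell_units_count (m : int) (W : nat) (s : seq (int * int)) : m != 0 -> uniq s ->
  (forall v, v \in s -> v.1 ^+ 2 - m * v.2 ^+ 2 = 1 /\ (`|v.1| <= W)%N) ->
  (size s <= 9 * (trunc_log 2 W).+1)%N.
Proof.
move=> m0 us Hs; pose f (v : int * int) := (sgcode v.1, sgcode v.2, trunc_log 2 `|v.1|).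
pose r := [seq (ij, l) | ij <- [seq (i, j) | i <- iota 0 3, j <- iota 0 3],
                         l <- iota 0 (trunc_log 2 W).+1].
have sr : size r = (9 * (trunc_log 2 W).+1)%N by rewrite !size_allpairs !size_iota.
rewrite -sr -(size_map f); apply: uniq_leq_size; last first.
  move=> _ /mapP[v vs ->]; have [_ vW] := Hs _ vs.
  apply/allpairsP; exists (sgcode v.1, sgcode v.2, trunc_log 2 `|v.1|); split=> //; first last.
    by rewrite mem_iota ltnS leq_trunc_log.
  apply/allpairsP; exists (sgcode v.1, sgcode v.2).
  by rewrite !mem_iota /sgcode /=; do 2!case: ifP => _; do ?case: ifP.
rewrite map_inj_in_uniq // => -[a c] [a' c'] /Hs[/= e1 _] /Hs[/= e2 _] [/= sa sc la].
have [m_neg|m_pos] : m < 0 \/ 0 < m by lia.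
  have sq0 (x : int) : 0 <= x ^+ 2 by apply: sqr_ge0.
  have mc0 (x : int) : x ^+ 2 <= - m * x ^+ 2 by rewrite -[X in X <= _]mul1r ler_wpM2r //; lia.
  have a1 : a ^+ 2 <= 1 by move: e1 (mc0 c) (sq0 c); lia.
  have a1' : a' ^+ 2 <= 1 by move: e2 (mc0 c') (sq0 c'); lia.
  have c1 : c ^+ 2 <= 1 by move: e1 (mc0 c) (sq0 a); lia.
  have c1' : c' ^+ 2 <= 1 by move: e2 (mc0 c') (sq0 a'); lia.
  by rewrite (sgcode_inj_small a1 a1' sa) (sgcode_inj_small c1 c1' sc).
wlog: a a' c c' e1 e2 sa sc la / (`|a| <= `|a'|)%N => [W2|aa'].
  case: (leqP `|a| `|a'|) => [?|/ltnW ?]; first exact: W2.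
  by symmetry; apply: W2.
have [|lt_aa'] : `|a| = `|a'| :> int \/ `|a| < `|a'| by lia.
  move=> eqa; have eqc : `|c| = `|c'|.
    apply/eqP; rewrite -(eqrXn2 (n := 2)) // !real_normK ?num_real //.
    apply/eqP; apply: (mulfI m0).
    have : `|a| ^+ 2 = `|a'| ^+ 2 by rewrite eqa.
    by rewrite !real_normK ?num_real // => h; move: e1 e2; rewrite h => <- /addrI/oppr_inj.
  by rewrite (sgcode_inj eqa sa) (sgcode_inj eqc sc).
have [c0|c0] := eqVneq c 0.
  have c0' : c' = 0 by move: sc; rewrite c0 /sgcode eqxx; case: eqP => // _; case: ifP.
  move: e1 e2; rewrite c0 c0' !expr2 !mulr0 !subr0 => e1 e2.
  by have : a * a < a' * a' by [nia]; lia.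
have c0' : c' != 0.
  by apply/negP => /eqP c0'; move: sc; rewrite c0' /sgcode eqxx (negPf c0); case: ifP.
have a0 : a != 0 by apply/negP => /eqP a0; move: e1; rewrite a0 expr0n sub0r => e1; have := mulr_ge0 (ltW m_pos) (sqr_ge0 c); lia.
have a0' : a' != 0 by apply/negP => /eqP a0'; move: e2; rewrite a0' expr0n sub0r => e2; have := mulr_ge0 (ltW m_pos) (sqr_ge0 c'); lia.
have dbl : 2 * `|a| <= `|a'|.
  apply: (@pell_unit_double m _ `|c| _ `|c'|); rewrite ?normr_gt0 ?real_normK ?num_real //.
have l1 : (2 ^ (trunc_log 2 `|a|).+1 <= `|a'|)%N.
  rewrite expnS; apply: (@leq_trans (2 * `|a|)); last by lia.
  by rewrite leq_mul2l trunc_logP ?absz_gt0.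
by have := trunc_log_ltn `|a'| (isT : 1 < 2)%N; rewrite -la ltnNge l1.
Qed.

Lemma leq_abszB (x y : int) : (`|x - y| <= `|x| + `|y|)%N.
Proof. by lia. Qed.

(** To a primitive solution corresponds [w = v.1 / v.2] modulo [n1], a square root of [m]. Solutions
    with the same [w] differ by a unit of norm one, whose coordinates are polynomially bounded. So
    the number of classes is controlled by [sqrt_mod_count], with [G = 2], and the size of each
    class by [pell_units_count]. *)
Lemma pell_primitive_count (m n1 : int) (Z : nat) (s : seq (int * int)) :
  m != 0 -> n1 != 0 -> uniq s -> (`|m| <= Z)%N ->
  (forall g : nat, ((g ^ 2)%N%:Z %| 4 * m)%Z -> (g <= 2)%N) ->
  (forall v, v \in s -> [/\ v.1 ^+ 2 - m * v.2 ^+ 2 = n1, (`|v.1| <= Z)%N,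
                            (`|v.2| <= Z)%N & coprimez v.1 v.2]) ->
  (size s <= 9 * (trunc_log 2 (2 * Z ^ 3)).+1 * (3 * size (divisors `|n1|)))%N.
Proof.
move=> m0 n10 us mZ Hm Hs.
pose w (v : int * int) := v.1 * (egcdz v.2 n1).1.
pose d := `|n1|%N; have d0 : (0 < d)%N by rewrite absz_gt0.
have dvdd x : (d%:Z %| x)%Z = (n1 %| x)%Z by rewrite !dvdzE.
have Hw v : v \in s -> (n1 %| v.1 - w v * v.2)%Z /\ (n1 %| w v ^+ 2 - m)%Z.
  move=> /Hs[eqn _ _ cop].
  have cop2 : coprimez v.2 n1.
    have -> : n1 = (- m * v.2) * v.2 + v.1 ^+ 2 by rewrite -eqn; ring.
    by rewrite /coprimez gcdzMDl -/(coprimez _ _) coprimezXr // coprimez_sym.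
  have eq1 : (egcdz v.2 n1).1 * v.2 + (egcdz v.2 n1).2 * n1 = 1.
    by case: egcdzP => u u' /= -> _; apply/eqP.
  have w1 : (n1 %| v.1 - w v * v.2)%Z.
    rewrite /w; set u := (egcdz _ _).1 in eq1 *; set u' := (egcdz _ _).2 in eq1 *.
    have -> : v.1 - v.1 * u * v.2 = v.1 * u' * n1 by rewrite -{1}[v.1]mulr1 -eq1; ring.
    exact: dvdz_mull.
  split=> //; rewrite -(@Gauss_dvdzl n1 _ (v.2 ^+ 2)); last by rewrite coprimezXr // coprimez_sym.
  have -> : (w v ^+ 2 - m) * v.2 ^+ 2 = n1 - (v.1 - w v * v.2) * (v.1 + w v * v.2).
    by rewrite -eqn; ring.
  by apply: dvdz_sub => //; apply: dvdz_mulr.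
apply: (@leq_trans (9 * (trunc_log 2 (2 * Z ^ 3)).+1 * ncl (modz^~ d%:Z) (map w s))).
  apply: (size_fiber (f := fun v => (w v %% d%:Z)%Z)) => [v vs|y _].
    by rewrite mem_undup; apply: map_f; apply: map_f.
  rewrite -size_filter; set u := [seq v <- s | _].
  have [->//|[[A k] v0u]] : u = [::] \/ exists v, v \in u.
    by case: (u) => [|x v]; [left|right; exists x; rewrite mem_head].
  have Hu v : v \in u -> (n1 %| v.1 * A - m * (v.2 * k))%Z /\ (n1 %| A * v.2 - v.1 * k)%Z.
    rewrite mem_filter => /andP[/eqP wv vs].
    move: v0u; rewrite mem_filter => /andP[/eqP wv0 v0s].
    have [h1 _] := Hw _ vs; have [h2 h3] := Hw _ v0s; rewrite /= in h2 h3.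
    have h4 : (n1 %| w v - w (A, k))%Z.
      by rewrite -dvdd -eqz_mod_dvd wv wv0.
    set w0 := w (A, k) in h2 h3 h4; split.
      have -> : v.1 * A - m * (v.2 * k) = (v.1 - w v * v.2) * A + w v * v.2 * (A - w0 * k)
                + (w v - w0) * (w0 * v.2 * k) + (w0 ^+ 2 - m) * (v.2 * k) by ring.
      apply: dvdz_add; last exact: dvdz_mulr.
      apply: dvdz_add; last exact: dvdz_mulr.
      by apply: dvdz_add; [exact: dvdz_mulr|exact: dvdz_mull].
    have -> : A * v.2 - v.1 * k = (A - w0 * k) * v.2 - (v.1 - w v * v.2) * k
               - (w v - w0) * (v.2 * k) by ring.
    by apply: dvdz_sub; [apply: dvdz_sub|]; exact: dvdz_mulr.
  (* The quotient of [v] by the fixed solution [(A, k)]; equality of [w] makes both coordinates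
     integral. *)
  pose h (v : int * int) := (((v.1 * A - m * (v.2 * k)) %/ n1)%Z, ((A * v.2 - v.1 * k) %/ n1)%Z).
  have hE v : v \in u -> v.1 * A - m * (v.2 * k) = (h v).1 * n1 /\ A * v.2 - v.1 * k = (h v).2 * n1.
    by case/Hu => h1 h2; rewrite /h !divzK.
  have us' : {subset u <= s} by move=> v; rewrite mem_filter => /andP[].
  have [en0 A0 k0 _] := Hs _ (us' _ v0u); rewrite /= in en0 A0 k0.
  rewrite -(size_map h); apply: (@pell_units_count m) => //.
    rewrite map_inj_in_uniq ?filter_uniq // => v v' vu v'u eqh.
    have [e1 e2] := hE _ vu; have [e1' e2'] := hE _ v'u.
    rewrite eqh -e1' in e1; rewrite eqh -e2' in e2.
    have f1 : v.1 = v'.1.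
      apply: (mulfI n10); rewrite -en0.
      have -> : (A ^+ 2 - m * k ^+ 2) * v.1 = A * (v.1 * A - m * (v.2 * k)) + m * k * (A * v.2 - v.1 * k) by ring.
      by rewrite e1 e2; ring.
    have f2 : v.2 = v'.2.
      apply: (mulfI n10); rewrite -en0.
      have -> : (A ^+ 2 - m * k ^+ 2) * v.2 = k * (v.1 * A - m * (v.2 * k)) + A * (A * v.2 - v.1 * k) by ring.
      by rewrite e1 e2; ring.
    by rewrite [v]surjective_pairing f1 f2 -surjective_pairing.
  move=> _ /mapP[v vu ->]; have [e1 e2] := hE _ vu; have [en v1Z v2Z _] := Hs _ (us' _ vu).
  split.
    apply: (mulfI (expf_neq0 2 n10)); rewrite mulr1.
    have -> : n1 ^+ 2 * ((h v).1 ^+ 2 - m * (h v).2 ^+ 2) =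
              ((h v).1 * n1) ^+ 2 - m * ((h v).2 * n1) ^+ 2 by ring.
    rewrite -e1 -e2; transitivity ((A ^+ 2 - m * k ^+ 2) * (v.1 ^+ 2 - m * v.2 ^+ 2)); first by ring.
    by rewrite en0 en expr2.
  have bnd : (`|(v.1 * A - m * (v.2 * k))%R| <= 2 * Z ^ 3)%N.
    apply: leq_trans (leq_abszB _ _) _; rewrite !abszM.
    have p1 : (`|v.1| * `|A| <= Z * Z)%N by rewrite leq_mul.
    have p2 : (`|m| * (`|v.2| * `|k|) <= Z * (Z * Z))%N by rewrite !leq_mul.
    have : (Z * Z <= Z * (Z * Z))%N by case: (Z) => // z; rewrite leq_pmull.
    rewrite !expnS expn0 muln1 mul2n -addnn => p3.
    by rewrite leq_add // (leq_trans p1).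
  apply: leq_trans bnd; rewrite e1 abszM leq_pmulr // absz_gt0.
rewrite leq_mul2l; apply/orP; right; apply: sqrt_mod_count => // [g _|x /mapP[v vs ->]].
  exact: Hm.
by rewrite dvdd; have [] := Hw _ vs.
Qed.

(** Sort by the gcd [g] of the coordinates: [g ^ 2] divides [n0], and dividing by [g] leaves a
    primitive solution for [n0 / g ^ 2]. *)
Lemma pell_count (m n0 : int) (Z : nat) (s : seq (int * int)) :
  m != 0 -> n0 != 0 -> uniq s -> (`|m| <= Z)%N ->
  (forall g : nat, ((g ^ 2)%N%:Z %| 4 * m)%Z -> (g <= 2)%N) ->
  (forall v, v \in s -> [/\ v.1 ^+ 2 - m * v.2 ^+ 2 = n0, (`|v.1| <= Z)%N & (`|v.2| <= Z)%N]) ->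
  (size s <= 9 * (trunc_log 2 (2 * Z ^ 3)).+1 * (3 * size (divisors `|n0|)) * size (divisors `|n0|))%N.
Proof.
move=> m0 n00 us mZ Hm Hs; pose f (v : int * int) := gcdn `|v.1| `|v.2|.
have d0 : (0 < `|n0|)%N by rewrite absz_gt0.
have fdvd v : v \in s -> (f v ^ 2 %| `|n0|)%N.
  move=> /Hs[<- _ _]; rewrite -dvdz_eq.
  have h1 : ((f v)%:Z %| v.1)%Z by rewrite dvdz_eq dvdn_gcdl.
  have h2 : ((f v)%:Z %| v.2)%Z by rewrite dvdz_eq dvdn_gcdr.
  rewrite -mulnn PoszM; apply: dvdz_sub; first by rewrite expr2 dvdz_mul.
  by apply: dvdz_mull; rewrite expr2 dvdz_mul.
apply: (size_fiber (f := f)) => [v vs|g].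
  by rewrite -dvdn_divisors //; apply: dvdn_trans (fdvd _ vs); rewrite -mulnn dvdn_mulr.
rewrite -dvdn_divisors // -size_filter => gn0.
have g0 : (0 < g)%N by apply: dvdn_gt0 gn0.
set u := [seq v <- s | _].
have [->//|[v0 v0u]] : u = [::] \/ exists v, v \in u.
  by case: (u) => [|x v]; [left|right; exists x; rewrite mem_head].
have us' : {subset u <= s} by move=> v; rewrite mem_filter => /andP[].
have gu v : v \in u -> f v = g by rewrite mem_filter => /andP[/eqP].
have g2 : (g ^ 2 %| `|n0|)%N by rewrite -(gu _ v0u) fdvd ?us'.
pose n1 := (n0 %/ (g ^ 2)%N%:Z)%Z.
have n0E : n0 = n1 * (g ^ 2)%N%:Z by rewrite divzK.
have n10 : n1 != 0 by apply: contraNneq n00 => n10; rewrite n0E n10 mul0r.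
pose h (v : int * int) := ((v.1 %/ g%:Z)%Z, (v.2 %/ g%:Z)%Z).
have hE v : v \in u -> v.1 = (h v).1 * g%:Z /\ v.2 = (h v).2 * g%:Z.
  by move=> /gu fg; rewrite /h /= !divzK // -fg dvdz_eq ?dvdn_gcdl ?dvdn_gcdr.
apply: (@leq_trans (9 * (trunc_log 2 (2 * Z ^ 3)).+1 * (3 * size (divisors `|n1|)))); last first.
  rewrite !leq_mul2l; apply/orP; right; apply/orP; right.
  apply: uniq_leq_size; first exact: divisors_uniq.
  move=> x; rewrite -!dvdn_divisors ?absz_gt0 // => xn1.
  by rewrite n0E abszM dvdn_mulr.
rewrite -(size_map h); apply: (@pell_primitive_count m n1 Z) => //.
  rewrite map_inj_in_uniq ?filter_uniq // => v v' /hE[e1 e2] /hE[e1' e2'] eqh.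
  by rewrite [v]surjective_pairing e1 e2 eqh -e1' -e2' -surjective_pairing.
move=> _ /mapP[v vu ->]; have [e1 e2] := hE _ vu; have [en z1 z2] := Hs _ (us' _ vu).
have leg x : (`|x| <= `|(x * g%:Z)%R|)%N by rewrite abszM leq_pmulr.
split; last 1 first.
- have : f v = g by apply: gu.
  rewrite /f {1}e1 {1}e2 !abszM -muln_gcdl absz_nat coprimezE /coprime.
  by move/eqP; rewrite -[X in _ == X](mul1n g) eqn_pmul2r.
- have gz : ((g ^ 2)%N%:Z : int) != 0 by rewrite eqz_nat -lt0n expn_gt0 g0.
  apply: (mulIf gz); rewrite -n0E -en e1 e2 -mulnn PoszM; ring.
- by apply: leq_trans (leg _) _; rewrite -e1.
- by apply: leq_trans (leg _) _; rewrite -e2.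
Qed.

End Pell.

(** * The determinant method *)

Section PrimeSums.

Definition primes_lt (n : nat) : seq nat := [seq p <- iota 0 n | prime p].

Lemma mem_primes_lt n p : (p \in primes_lt n) = prime p && (p < n).
Proof. by rewrite mem_filter mem_iota. Qed.

Lemma primes_lt_uniq n : uniq (primes_lt n).
Proof. by rewrite filter_uniq ?iota_uniq. Qed.

Lemma coprime_prod_pfactor p (ps : seq nat) (e : nat -> nat) k : prime p -> all prime ps ->
  p \notin ps -> coprime (p ^ k) (\prod_(q <- ps) q ^ e q).
Proof.
move=> pp; elim: ps => [|q ps IH] /=; first by rewrite big_nil coprimen1.
case/andP=> qq pr; rewrite inE negb_or => /andP[pq pps].
rewrite big_cons coprimeMr IH // andbT coprimeXl // coprimeXr //.
by rewrite prime_coprime // dvdn_prime2.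
Qed.

Lemma prod_pfactor_dvd (ps : seq nat) m : uniq ps -> all prime ps -> 0 < m ->
  \prod_(p <- ps) p ^ logn p m %| m.
Proof.
elim: ps => [|p ps IH] /=; first by rewrite big_nil dvd1n.
move=> /andP[pps ups] /andP[pp pr] m0; rewrite big_cons Gauss_dvd ?IH ?pfactor_dvdnn //.
exact: coprime_prod_pfactor.
Qed.

Lemma leq_fact_exp n : n`! <= n ^ n.
Proof.
elim: n => // n IH; rewrite factS expnS leq_mul2l /=.
by apply: leq_trans IH _; apply: leq_expr.
Qed.

Lemma leq_exp_fact m k : m ^ k <= (m + k)`!.
Proof.
elim: k => [|k IH]; first by rewrite fact_gt0.
by rewrite addnS factS expnS leq_mul // -addnS leq_addr.
Qed.

Lemma logn_fact_geq p n : prime p -> n %/ p <= logn p n`!.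
Proof.
move=> pp; rewrite logn_fact //; case: n => [|n]; first by rewrite div0n.
by rewrite big_ltn // expn1 leq_addr.
Qed.

Lemma sum_div_expn2 N m : \sum_(k < N) m %/ 2 ^ k <= 2 * m.
Proof.
elim: N m => [|N IH] m; first by rewrite big_ord0.
rewrite big_ord_recl expn0 divn1 mul2n -addnn leq_add2l.
apply: (@leq_trans (2 * (m %/ 2))); last by rewrite mulnC leq_trunc_div.
apply: leq_trans (IH _); apply: leq_sum => i _.
by rewrite lift0 expnS divnMA.
Qed.

Lemma logn_fact_leq p n : prime p -> logn p n`! <= 2 * (n %/ p).
Proof.
move=> pp; rewrite logn_fact //; apply: leq_trans (sum_div_expn2 n _).
rewrite big_add1 big_mkord; apply: leq_sum => i _.
by rewrite expnS divnMA leq_div2l ?expn_gt0 // leq_expr // prime_gt1.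
Qed.

(** The upper half of Mertens' theorem: with [n = 2 ^ a], the product of the [p ^ (n / p)] divides
    [n!], which is at most [n ^ n]; take logarithms to base two. *)
Lemma sum_log_primes a :
  \sum_(p <- primes_lt (2 ^ a)) trunc_log 2 p * (2 ^ a %/ p) <= a * 2 ^ a.
Proof.
set n := 2 ^ a; have n0 : 0 < n by rewrite expn_gt0.
rewrite -(@leq_exp2l 2) //.
have -> : 2 ^ (a * n) = n ^ n by rewrite expnM.
apply: leq_trans (leq_fact_exp n); rewrite expn_sum.
apply: (@leq_trans (\prod_(p <- primes_lt n) p ^ logn p n`!)); last first.
  apply: dvdn_leq; rewrite ?fact_gt0 // prod_pfactor_dvd ?fact_gt0 ?primes_lt_uniq //.
  exact: filter_all.
apply: leq_prod_seq => p; rewrite mem_primes_lt => /andP[pp _].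
apply: (@leq_trans (p ^ (n %/ p))); last by rewrite leq_pexp2l ?prime_gt0 ?logn_fact_geq.
by rewrite expnM leq_expr // trunc_logP // prime_gt0.
Qed.

Lemma trunc_log2_gt0 p : prime p -> 0 < trunc_log 2 p.
Proof. by move=> /prime_gt1 p1; apply: trunc_log_max. Qed.

(** If [n = 2 ^ (16 a + 2)] and no prime lies in the range, all primes of [n!] are below [2 ^ a],
    and Legendre's formula with [sum_log_primes] gives [n! <= 2 ^ (8 a n)]. But [n!] is at least
    [(n / 2) ^ (n / 2)], whose logarithm is [(16 a + 1) n / 2]. *)
Lemma prime_between a : 0 < a -> exists2 p, prime p & 2 ^ a <= p <= 2 ^ (16 * a + 2).
Proof.
move=> a0; set c := 16 * a + 2; set n := 2 ^ c.
have [/hasP[p]|/hasPn none] := boolP (has (fun p => 2 ^ a <= p) (primes_lt n.+1)).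
  by rewrite mem_primes_lt ltnS => /andP[pp pn] ap; exists p; rewrite ?ap.
exfalso; have n0 : 0 < n by rewrite expn_gt0.
have ac : a <= c by rewrite /c; lia.
have small p : p \in primes n`! -> prime p /\ p < 2 ^ a.
  rewrite mem_primes => /and3P[pp _ pd]; split=> //.
  have pn : p <= n.
    rewrite leqNgt; apply/negP => np; have : logn p n`! <= 2 * (n %/ p) by apply: logn_fact_leq.
    by rewrite divn_small // muln0 leqNgt logn_gt0 mem_primes pp fact_gt0 pd.
  by rewrite ltnNge; apply: none; rewrite mem_primes_lt pp ltnS.
have up : n`! <= 2 ^ (8 * a * n).
  rewrite {1}(prod_primesE (fact_gt0 n)).
  have e8 p : prime p -> p < 2 ^ a ->
      p ^ logn p n`! <= 2 ^ (8 * 2 ^ (c - a) * (trunc_log 2 p * (2 ^ a %/ p))).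
    move=> pp pa; have x1 : 0 < 2 ^ a %/ p by rewrite divn_gt0 ?prime_gt0 // ltnW.
    have t1 := trunc_log2_gt0 pp.
    apply: (@leq_trans ((2 ^ (trunc_log 2 p).+1) ^ logn p n`!)).
      by rewrite leq_expr // ltnW // trunc_log_ltn.
    rewrite -expnM leq_exp2l //.
    have np : n %/ p <= 2 ^ (c - a) * (2 ^ a %/ p + 1).
      rewrite -[X in _ <= X](mulnK _ (prime_gt0 pp)) leq_div2r // -mulnA.
      have {1}-> : n = 2 ^ (c - a) * 2 ^ a by rewrite -expnD subnK.
      by rewrite leq_mul2l addn1 ltnW ?orbT // ltn_ceil ?prime_gt0.
    apply: (@leq_trans ((2 * trunc_log 2 p) * (2 * (2 ^ (c - a) * (2 * (2 ^ a %/ p)))))).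
      rewrite leq_mul //; first by lia.
      apply: leq_trans (logn_fact_leq _ pp) _; rewrite leq_mul2l /=.
      by apply: leq_trans np _; rewrite leq_mul2l; apply/orP; right; lia.
    by apply/eq_leq; ring.
  apply: (@leq_trans (\prod_(p <- primes n`!)
      2 ^ (8 * 2 ^ (c - a) * (trunc_log 2 p * (2 ^ a %/ p))))).
    by apply: leq_prod_seq => p /small[pp pa]; apply: e8.
  rewrite -expn_sum leq_exp2l // -big_distrr /=.
  apply: (@leq_trans (8 * 2 ^ (c - a) * (a * 2 ^ a))); last first.
    by rewrite /n -{2}(subnK ac) expnD; apply/eq_leq; ring.
  rewrite leq_mul2l; apply/orP; right; apply: leq_trans (sum_log_primes a).
  have -> : \sum_(p <- primes n`!) trunc_log 2 p * (2 ^ a %/ p) =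
     \sum_(p <- primes_lt (2 ^ a) | p \in primes n`!) trunc_log 2 p * (2 ^ a %/ p).
    rewrite -[RHS]big_filter; apply: perm_big; apply: uniq_perm.
    - exact: primes_uniq.
    - by rewrite filter_uniq ?primes_lt_uniq.
    move=> p; rewrite mem_filter mem_primes_lt; case pin: (p \in primes n`!) => //=.
    by have [-> ->] := small _ pin.
  by rewrite big_mkcond /=; apply: leq_sum => p _; case: ifP.
have low : 2 ^ (c.-1 * 2 ^ c.-1) <= n`!.
  have -> : n = 2 ^ c.-1 + 2 ^ c.-1 by rewrite addnn -mul2n -expnS prednK // /c addnS.
  by rewrite expnM leq_exp_fact.
have := leq_trans low up; rewrite leq_exp2l // leqNgt => /negP; apply.
have -> : n = 2 * 2 ^ c.-1 by rewrite -expnS prednK // /c addnS.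
rewrite mulnA ltn_pmul2r ?expn_gt0 // /c; lia.
Qed.

(** The determinant method tolerates a prime known up to a bounded power. The 34 is [2 * 16 + 2], as
    the power of two above [V] is at most [V ^ 2]. *)
Lemma prime_in_power_range V : 1 < V -> exists2 p, prime p & V <= p <= V ^ 34.
Proof.
move=> V1; have a0 : 0 < up_log 2 V by rewrite up_log_gt0.
have [p pp /andP[p1 p2]] := prime_between a0; exists p => //.
rewrite (leq_trans (up_logP V _) p1) //=; apply: leq_trans p2 _.
have aV : 2 ^ up_log 2 V <= V ^ 2.
  have /andP[h _] := @up_log_bounds 2 V isT V1.
  rewrite -(prednK a0) expnS; apply: (@leq_trans (2 * V)); first by rewrite leq_mul2l ltnW.
  by rewrite -mulnn leq_mul2r V1 orbT.
have -> : V ^ 34 = (V ^ 2) ^ 16 * V ^ 2 by rewrite -expnM -expnD.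
by rewrite expnD mulnC expnM expnAC mulnC leq_mul ?leq_expr.
Qed.

End PrimeSums.

Section PolynomialsModPrimes.
Local Open Scope ring_scope.

Lemma intr_Fp_eq0 (p : nat) (x : int) : prime p -> (x%:~R == 0 :> 'F_p) = (p%:Z %| x)%Z.
Proof. by move=> pp; rewrite (dvdz_pcharf (pchar_Fp pp)). Qed.

Lemma intr_Fp_uniq (p : nat) (ts : seq int) : prime p ->
  uniq (map (modz^~ p%:Z) ts) -> uniq [seq t%:~R : 'F_p | t <- ts].
Proof.
move=> pp uts; rewrite map_inj_in_uniq; first exact: map_uniq uts.
move=> x y xs ys /eqP; rewrite -subr_eq0 -rmorphB /= intr_Fp_eq0 // -eqz_mod_dvd => /eqP.
exact: (uniq_map_inj uts xs ys).
Qed.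

Lemma poly_roots_modp (P : {poly int}) (p : nat) (ts : seq int) : prime p ->
  (exists i, ~~ (p%:Z %| P`_i)%Z) -> uniq (map (modz^~ p%:Z) ts) ->
  (forall t, t \in ts -> (p%:Z %| P.[t])%Z) -> (size ts <= (size P).-1)%N.
Proof.
move=> pp [i Pi] uts Pts; pose Q : {poly 'F_p} := map_poly intr P.
have Q0 : Q != 0.
  apply: contra Pi => /eqP/(congr1 (fun R : {poly 'F_p} => R`_i)).
  by rewrite coef_map coef0 /= => /eqP; rewrite intr_Fp_eq0.
have szQ : (size Q <= size P)%N by apply: size_poly.
have : (size [seq t%:~R : 'F_p | t <- ts] < size Q)%N.
  apply: max_poly_roots => //; last exact: intr_Fp_uniq.
  apply/allP => _ /mapP[t tts ->]; rewrite /root /Q.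
  by rewrite (horner_map (intr : int -> 'F_p)) /= intr_Fp_eq0 // Pts.
rewrite size_map => h; have := leq_trans h szQ; case: (size P) => //.
Qed.

Lemma poly_content_split (P : {poly int}) (p : nat) : prime p -> P != 0 ->
  exists k (P1 : {poly int}), [/\ P = (p ^ k)%N%:Z *: P1, size P1 = size P &
                                  exists i, ~~ (p%:Z %| P1`_i)%Z].
Proof.
move=> pp; have [n] := ubnP `|lead_coef P|; elim: n P => // n IH P ltn P0.
have p1 := prime_gt1 pp; have pz : (p%:Z : int) != 0 by rewrite eqz_nat -lt0n ltnW.
have [/'forall_idP all_div|] := boolP [forall i : 'I_(size P), (p%:Z %| P`_i)%Z]; last first.
  by case/forallPn=> i Pi; exists 0%N, P; rewrite scale1r; split=> //; exists i.
pose P' := \poly_(i < size P) (P`_i %/ p%:Z)%Z.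
have PE : P = p%:Z *: P'.
  apply/polyP => i; rewrite coefZ coef_poly; case: ltnP => [ltiP|leP].
    by rewrite mulrC divzK // (all_div (Ordinal ltiP)).
  by rewrite mulr0 nth_default.
have P'0 : P' != 0 by apply: contraNneq P0 => P'0; rewrite PE P'0 scaler0.
have szP : size P' = size P by rewrite PE size_scale.
have ltP' : (`|lead_coef P'| < `|lead_coef P|)%N.
  by rewrite PE lead_coefZ abszM ltn_Pmull // absz_gt0 lead_coef_eq0.
have [k [P1 [P'E sz1 ex]]] := IH P' (leq_trans ltP' ltn) P'0.
by exists k.+1, P1; split=> //; rewrite ?sz1 // PE {1}P'E scalerA -PoszM -expnS.
Qed.

End PolynomialsModPrimes.

(** * Integral points on [y^2 = P(t)] *)

Section BombieriPila.
Local Open Scope ring_scope.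

(** Near a point with [y0] invertible modulo [q], the curve [y^2 = Q] is modulo [q ^ r.+1] the graph
    of a polynomial [Y]. Each step corrects [Y] by [q ^ r.+1 u Z], where [2 u y0 = 1] modulo [q]; it
    gains one factor [q] and doubles the size bound, whence [2 ^ r]. *)
Lemma hensel_sqrt (q y0 u : int) (Q : {poly int}) (d r : nat) :
  q != 0 -> (q %| 1 - 2 * u * y0)%Z -> (size Q <= d.+1)%N ->
  (exists Q', Q = (y0 ^+ 2)%:P + q *: Q') ->
  exists Y Z Y' : {poly int}, [/\ (size Y <= d.+1 * 2 ^ r)%N,
     Q - Y ^+ 2 = q ^+ r.+1 *: Z & Y = y0%:P + q *: Y'].
Proof.
move=> q0 /dvdzP[v uv] szQ [Q' QE]; elim: r => [|r [Y [Z [Y' [szY ZE YE]]]]].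
  exists y0%:P, Q', 0; rewrite scaler0 addr0; split=> //.
    by rewrite muln1 (leq_trans (size_polyC_leq1 _)).
  by rewrite QE -rmorphXn /= addrC addKr expr1.
have szZ : (size Z <= d.+1 * 2 ^ r.+1)%N.
  rewrite -(size_scale Z (expf_neq0 r.+1 q0)) -ZE (leq_trans (size_polyD _ _)) //.
  rewrite size_polyN geq_max; apply/andP; split.
    by apply: leq_trans szQ _; rewrite leq_pmulr // expn_gt0.
  rewrite expr2 (leq_trans (size_polyMleq _ _)) // expnS mulnCA mul2n -addnn.
  by rewrite (leq_trans (leq_pred _)) // leq_add.
exists (Y + (q ^+ r.+1 * u) *: Z), (v *: Z - (2 * u) *: (Y' * Z) - (q ^+ r * u ^+ 2) *: Z ^+ 2),
       (Y' + (q ^+ r * u) *: Z); split.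
- rewrite (leq_trans (size_polyD _ _)) // geq_max (leq_trans (size_scale_leq _ _)) // andbT.
  by apply: leq_trans szY _; rewrite leq_mul2l leq_exp2l // leqnSn orbT.
- have -> : Q - (Y + (q ^+ r.+1 * u) *: Z) ^+ 2 = (Q - Y ^+ 2) -
      ((2 * q ^+ r.+1 * u) *: (Y * Z) + (q ^+ r.+1 * u) ^+ 2 *: Z ^+ 2).
    by rewrite -!mul_polyC !rmorphM !rmorphXn /=; ring.
  rewrite ZE {1}YE [q ^+ r.+2]exprS [q ^+ r.+1]exprS.
  have vE : v%:P * q%:P = 1 - 2 * u%:P * y0%:P.
    by rewrite -polyCM -uv polyCB !polyCM (rmorph_nat polyC 2).
  rewrite -!mul_polyC !(polyCM, polyC_exp).
  rewrite ?(rmorph_nat polyC 2).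
  set qp := q%:P; set up := u%:P; set yp := y0%:P; set vp := v%:P in vE *.
  have -> : qp * qp ^+ r * Z - (2 * (qp * qp ^+ r) * up * ((yp + qp * Y') * Z) +
      (qp * qp ^+ r * up) ^+ 2 * Z ^+ 2) = qp * qp ^+ r * ((1 - 2 * up * yp) * Z -
      qp * (2 * up * (Y' * Z)) - qp * (qp ^+ r * up ^+ 2 * Z ^+ 2)) by ring.
  by rewrite -vE; ring.
- by rewrite YE exprS scalerDr scalerA -addrA mulrA.
Qed.

Lemma det_col_bound (n : nat) (B : 'M[int]_n) (c : 'I_n -> nat) :
  (forall i j, (`|B i j| <= c j)%N) -> (`|\det B| <= n`! * \prod_j c j)%N.
Proof.
move=> Bc; have : `|\det B| <= \sum_(s : 'S_n) (\prod_j c j)%N%:Z.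
  apply: le_trans (ler_norm_sum _ _ _) _; apply: ler_sum => s _.
  rewrite normrM normrX normrN1 expr1n mul1r normr_prod.
  have -> : (\prod_j c j)%N%:Z = \prod_i (c (s i))%:Z.
    by rewrite -natz natr_prod (reindex_perm s) /=; apply: eq_bigr => i _; rewrite natz.
  by apply: ler_prod => i _; rewrite normr_ge0 /=; have := Bc i (s i); lia.
rewrite sumr_const card_Sn.
have -> : (\prod_j c j)%N%:Z *+ n`! = (n`! * \prod_j c j)%N%:Z by rewrite -mulr_natl natz -PoszM.
by rewrite -abszE lez_nat.
Qed.

(** Subtracting from the column of the [y i] the combination of the columns of powers given by [Y]
    makes it divisible by [M], so [M] divides the determinant. The determinant is smaller than [M]
    in absolute value, hence zero. *)
Lemma minor_eq0 (D : nat) (s y : 'I_D.+1 -> nat) (S Zb : nat) (Y : {poly int}) (M : nat) :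
  (forall i, (s i < S)%N) -> (forall i, (y i <= Zb)%N) -> (size Y <= D)%N ->
  (forall i, (M%:Z %| (y i)%:Z - Y.[(s i)%:Z])%Z) ->
  (D.+1`! * (Zb * S ^ (D * D)) < M)%N ->
  \det (\matrix_(i < 1 + D, j < 1 + D)
      (match split j with inl _ => (y i)%:Z | inr k => (s i)%:Z ^+ k end)) = 0.
Proof.
move=> sS yZ szY Mdvd small; set B := \matrix_(i, j) _.
pose wc : 'M[int]_(1 + D, 1) := \matrix_(i, j) (((y i)%:Z - Y.[(s i)%:Z]) %/ M%:Z)%Z.
pose Vd : 'M[int]_(1 + D, D) := \matrix_(i, k) (s i)%:Z ^+ k.
pose Yc : 'M[int]_(D, 1) := \matrix_(k, j) Y`_k.
have wcE i j : wc i j = (((y i)%:Z - Y.[(s i)%:Z]) %/ M%:Z)%Z by rewrite mxE.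
have VdE i k : Vd i k = (s i)%:Z ^+ k by rewrite mxE.
have YcE k j : Yc k j = Y`_k by rewrite mxE.
have BE : B = row_mx wc Vd *m block_mx (M%:Z)%:M 0 Yc 1%:M.
  rewrite mul_row_block mulmx0 add0r mulmx1; apply/matrixP => i j; rewrite !mxE.
  case: (split j) => k; rewrite !mxE //.
  rewrite big_ord1 wcE mxE [k]ord1 eqxx mulr1n divzK //.
  rewrite (horner_coef_wide _ szY) [X in _ - X](eq_bigr (fun k : 'I_D => Vd i k * Yc k 0)).
    by rewrite subrK.
  by move=> l _; rewrite VdE YcE mulrC.
have Mdet : (M%:Z %| \det B)%Z.
  by rewrite BE det_mulmx det_lblock det1 mulr1 det_scalar expr1 dvdz_mull.
have Bbnd : (`|\det B| < M)%N.
  apply: leq_ltn_trans small.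
  pose c (j : 'I_(1 + D)) := match split j with inl _ => Zb | inr k => (S ^ D)%N end.
  have := @det_col_bound _ B c; rewrite big_split_ord /= big_ord1.
  have -> : c (lshift D ord0) = Zb by rewrite /c (unsplitK (inl _)).
  have -> : (\prod_(i < D) c (rshift 1 i) = S ^ (D * D))%N.
    rewrite (eq_bigr (fun=> (S ^ D)%N)); last by move=> i _; rewrite /c (unsplitK (inr _)).
    by rewrite prod_nat_const card_ord expnM.
  apply=> i j; rewrite mxE /c; case: (split j) => k; first by rewrite absz_nat yZ.
  rewrite abszX absz_nat; apply: (@leq_trans (S ^ k)); first by rewrite leq_expr // ltnW.
  by rewrite leq_pexp2l ?(leq_trans _ (sS i)) // ltnW.
apply/eqP; rewrite -absz_eq0 -leqn0 leqNgt; apply/negP => det0.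
by have := dvdn_leq det0 Mdet; rewrite leqNgt Bbnd.
Qed.

(** All maximal minors vanish, so there is a nontrivial relation [v y + C(s) = 0] with constant [v].
    If [v = 0] the [s i] are roots of [C] and there are few of them; otherwise [y] is a rational
    polynomial in [s] of bounded degree. *)
Lemma common_curve (D n : nat) (s y : 'I_n -> nat) (S Zb : nat) (Y : {poly int}) (M : nat) :
  injective s ->
  (forall i, (s i < S)%N) -> (forall i, (y i <= Zb)%N) -> (size Y <= D)%N ->
  (forall i, (M%:Z %| (y i)%:Z - Y.[(s i)%:Z])%Z) ->
  (D.+1`! * (Zb * S ^ (D * D)) < M)%N ->
  (n <= D)%N \/ exists2 L : {poly rat}, (size L <= D)%N & forall i, (y i)%:R = L.[(s i)%:R].
Proof.
move=> injs sS yZ szY Mdvd small.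
pose A : 'M[rat]_(n, 1 + D) :=
  \matrix_(i, j) match split j with inl _ => (y i)%:R | inr k => (s i)%:R ^+ k end.
have [full|nfull] := boolP (row_full A).
  have := fullrowsub_unit full; set f := fullrankfun full.
  rewrite unitmxE unitfE => /negP[].
  have := @minor_eq0 D (s \o f) (y \o f) S Zb Y M (fun i => sS _) (fun i => yZ _) szY
            (fun i => Mdvd _) small.
  set B := \matrix_(i, j) _ => detB.
  have -> : rowsub f A = map_mx intr B.
    apply/matrixP => i j; rewrite !mxE; case: (split j) => k //=.
    by rewrite rmorphXn.
  by rewrite det_map_mx detB.
have : kermx A^T != 0.
  by rewrite kermx_eq0 /row_free mxrank_tr.
case/rowV0Pn=> v /sub_kermxP vA v0.
pose C : {poly rat} := \poly_(k < D) (if insub k is Some k' then v 0 (rshift 1 k') else 0).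
have Ck (k : 'I_D) : C`_k = v 0 (rshift 1 k).
  by rewrite coef_poly ltn_ord valK.
have szC : (size C <= D)%N by apply: size_poly.
have eqv i : v 0 (lshift D ord0) * (y i)%:R + C.[(s i)%:R] = 0.
  have := congr1 (fun B : 'rV[rat]_n => B 0 i) vA; rewrite !mxE big_split_ord /= big_ord1.
  rewrite !mxE (unsplitK (inl _)) => <-; congr (_ + _).
  rewrite (horner_coef_wide _ szC); apply: eq_bigr => k _.
  by rewrite !mxE (unsplitK (inr _)) Ck.
have [vy0|vy0] := eqVneq (v 0 (lshift D ord0)) 0.
  left; have C0 : C != 0.
    apply: contraNneq v0 => C0; apply/eqP/rowP => j; rewrite mxE -(splitK j).
    case: (split j) => k /=; first by rewrite ord1.
    by rewrite -Ck C0 coef0.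
  have : (size [seq (s i)%:R : rat | i <- enum 'I_n] < size C)%N.
    apply: max_poly_roots => //.
      apply/allP => _ /mapP[i _ ->]; apply/eqP.
      by have := eqv i; rewrite vy0 mul0r add0r.
    rewrite map_inj_uniq ?enum_uniq // => i j /eqP; rewrite eqr_nat => /eqP.
    exact: injs.
  by rewrite size_map size_enum_ord => h; rewrite ltnW // (leq_trans h).
right; exists (- (v 0 (lshift D ord0))^-1 *: C).
  exact: leq_trans (size_scale_leq _ _) szC.
move=> i; rewrite hornerZ; apply: (mulfI vy0); rewrite mulrA mulrN divff // mulN1r.
by apply/eqP; rewrite -subr_eq0 opprK eqv.
Qed.

(** Points in one class modulo [q] for both coordinates. With [t = x0 + q s] they satisfy [y = L(s)]
    unless they are few; then the [s] are roots of [P(x0 + q s) - L(s)^2], nonzero because [P] is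
    not a square over the rationals. *)
Lemma bombieri_pila_class (P : {poly int}) (d r p e S Zb : nat) (x0 y0 : int) (ss : seq nat)
    (y : nat -> nat) (q := (p ^ e)%N) (D := (d.+1 * 2 ^ r)%N) :
  (size P <= d.+1)%N -> (forall Y : {poly rat}, map_poly intr P != Y ^+ 2) ->
  prime p -> (2 < p)%N -> (0 < e)%N -> ~~ (p%:Z %| y0)%Z -> uniq ss ->
  (forall s, s \in ss -> [/\ (s < S)%N, (y s <= Zb)%N, P.[x0 + q%:Z * s%:Z] = (y s)%:Z ^+ 2 &
                             (q%:Z %| (y s)%:Z - y0)%Z]) ->
  (D.+1`! * (Zb * S ^ (D * D)) < q ^ r.+1)%N -> (size ss <= D + D + d.+1)%N.
Proof.
move=> szP nsq pp p2 e0 py0 uss Hss small.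
case: ss uss Hss => [|s0 ss'] //; set ss := s0 :: ss' => uss Hss.
have q0 : (q%:Z : int) != 0 by rewrite eqz_nat -lt0n expn_gt0 prime_gt0.
have pq : (p%:Z %| q%:Z)%Z by rewrite dvdz_eq absz_nat /q -(prednK e0) expnS dvdn_mulr.
have copp x : ~~ (p%:Z %| x)%Z -> coprimez q%:Z x.
  by move=> px; rewrite coprimezE absz_nat /q coprimeXl // prime_coprime // -dvdz_eq.
have p2y (x : int) : ~~ (p%:Z %| x)%Z -> ~~ (p%:Z %| 2 * x)%Z.
  apply: contra; rewrite Gauss_dvdzr // coprimezE prime_coprime //.
  by rewrite gtnNdvd.
have /coprimezP[[u1 u2] /= u12] := copp _ (p2y _ py0).
have qu : (q%:Z %| 1 - 2 * u2 * y0)%Z.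
  have -> : 1 - 2 * u2 * y0 = u1 * q%:Z by rewrite -{1}u12; ring.
  exact: dvdz_mull.
pose Lp : {poly int} := x0%:P + q%:Z *: 'X; pose Q := P \Po Lp.
have szL : size Lp = 2.
  by rewrite /Lp addrC size_polyDl ?size_scale ?size_polyX // (leq_ltn_trans (size_polyC_leq1 _)).
have szQ : size Q = size P by rewrite size_comp_poly2.
have Lps (s : nat) : Lp.[s%:Z] = x0 + q%:Z * s%:Z by rewrite hornerD hornerC hornerZ hornerX.
have Qs (s : nat) : Q.[s%:Z] = P.[x0 + q%:Z * s%:Z] by rewrite horner_comp Lps.
(* A single point of the class suffices: modulo [q], [P(x0) = P(x0 + q s0) = y(s0)^2 = y0^2]. *)
have exQ : exists Q', Q = (y0 ^+ 2)%:P + q%:Z *: Q'.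
  have [P1 P1E] : exists P1, P - P.[x0]%:P = P1 * ('X - x0%:P).
    by apply/factor_theorem; rewrite /root hornerD hornerN hornerC subrr.
  have PE : P = P.[x0]%:P + P1 * ('X - x0%:P) by rewrite -P1E addrC subrK.
  have QE : Q = P.[x0]%:P + q%:Z *: ((P1 \Po Lp) * 'X).
    rewrite /Q {1}PE comp_polyD comp_polyC comp_polyM comp_polyB comp_polyX comp_polyC.
    by rewrite /Lp [_ + _ - _]addrC addKr scalerAr.
  have [_ _ Ps0 /dvdzP[k0 k0E]] := Hss s0 (mem_head _ _).
  have ys0 : (y s0)%:Z = y0 + k0 * q%:Z by rewrite -k0E addrC subrK.
  exists (((P1 \Po Lp) * 'X) + (2 * y0 * k0 + k0 ^+ 2 * q%:Z - s0%:Z * P1.[x0 + q%:Z * s0%:Z])%:P).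
  have Px0 : P.[x0] = y0 ^+ 2 + q%:Z * (2 * y0 * k0 + k0 ^+ 2 * q%:Z - s0%:Z * P1.[x0 + q%:Z * s0%:Z]).
    have := congr1 (fun R => R.[x0 + q%:Z * s0%:Z]) PE.
    rewrite Ps0 hornerD hornerC hornerM hornerD hornerN hornerX hornerC ys0 => h.
    have -> : P.[x0] = (y0 + k0 * q%:Z) ^+ 2 - P1.[x0 + q%:Z * s0%:Z] * (x0 + q%:Z * s0%:Z - x0).
      by rewrite h addrK.
    by ring.
  by rewrite QE Px0 polyCD scalerDr -addrA; congr (_ + _);
    rewrite addrC; congr (_ + _); rewrite polyCM mul_polyC.
have [Y [Z [Y' [szY ZE YE]]]] := @hensel_sqrt _ _ _ Q d r q0 qu (leq_trans (eq_leq szQ) szP) exQ.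
have yY s : s \in ss -> ((q ^ r.+1)%N%:Z %| (y s)%:Z - Y.[s%:Z])%Z.
  move=> sss; have [_ _ Ps qy] := Hss s sss.
  have eqq : ((q ^ r.+1)%N%:Z : int) = q%:Z ^+ r.+1 by rewrite -!natz natrX.
  have dv : (q%:Z ^+ r.+1 %| ((y s)%:Z - Y.[s%:Z]) * ((y s)%:Z + Y.[s%:Z]))%Z.
    have := congr1 (fun R => R.[s%:Z]) ZE.
    rewrite hornerZ hornerD hornerN horner_exp Qs Ps => h.
    have -> : ((y s)%:Z - Y.[s%:Z]) * ((y s)%:Z + Y.[s%:Z]) = (y s)%:Z ^+ 2 - Y.[s%:Z] ^+ 2 by ring.
    by rewrite h dvdz_mulr.
  rewrite eqq; move: dv; rewrite Gauss_dvdzl // coprimezXl // copp //.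
  have -> : (y s)%:Z + Y.[s%:Z] = 2 * y0 + (((y s)%:Z - y0) + q%:Z * Y'.[s%:Z]).
    by rewrite YE hornerD hornerC hornerZ; ring.
  apply: contra (p2y _ py0) => h; rewrite -[2 * y0](addrK (((y s)%:Z - y0) + q%:Z * Y'.[s%:Z])).
  apply: dvdz_sub => //; apply: dvdz_add; first exact: dvdz_trans qy.
  exact: dvdz_mulr.
pose n := size ss; have nthss (i : 'I_n) : nth 0%N ss i \in ss by rewrite mem_nth.
have [nD|[L szL' yL]] : (n <= D)%N \/ exists2 L : {poly rat}, (size L <= D)%N &
    forall i : 'I_n, (y (nth 0%N ss i))%:R = L.[(nth 0%N ss i)%:R].
  apply: (@common_curve D n _ _ S Zb Y (q ^ r.+1)) => //.
  - by move=> i j /eqP; rewrite nth_uniq // => /eqP/val_inj.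
  - by move=> i; have [] := Hss _ (nthss i).
  - by move=> i; have [] := Hss _ (nthss i).
  - by move=> i; apply: yY.
- by rewrite -addnA (leq_trans nD) // leq_addr.
pose R : {poly rat} := map_poly intr Q - L ^+ 2.
have R0 : R != 0.
  apply/eqP => /eqP; rewrite subr_eq0 => /eqP QL.
  pose M : {poly rat} := (q%:R^-1) *: ('X - x0%:~R%:P).
  have qr0 : (q%:R : rat) != 0 by rewrite pnatr_eq0 -lt0n expn_gt0 prime_gt0.
  have : map_poly intr P = (L \Po M) ^+ 2 :> {poly rat}.
    rewrite -rmorphXn /= -QL /Q map_comp_poly -comp_polyA.
    have -> : map_poly intr Lp \Po M = 'X.
      rewrite rmorphD /= map_polyC /= map_polyZ map_polyX comp_polyD comp_polyC comp_polyZ comp_polyX.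
      rewrite /M scalerA (_ : _ * _ = 1) ?scale1r; last by rewrite -[X in X * _ = _]/((q%:Z)%:~R) -pmulrn divff.
      by rewrite addrC subrK.
    by rewrite comp_polyXr.
  by move/eqP; apply/negP/nsq.
have szR : (size R <= D + D + d.+1)%N.
  rewrite (leq_trans (size_polyD _ _)) // size_polyN geq_max; apply/andP; split.
    by rewrite (leq_trans (size_poly _ _)) // szQ (leq_trans szP) // leq_addl.
  rewrite expr2 (leq_trans (size_polyMleq _ _)) // (leq_trans (leq_pred _)) //.
  by rewrite (leq_trans (leq_add szL' szL')) // leq_addr.
have : (size [seq s%:R : rat | s <- ss] < size R)%N.
  apply: max_poly_roots => //.
    apply/allP => _ /mapP[s sss ->]; rewrite /root hornerD hornerN horner_exp.
    have := yL (Ordinal (etrans (index_mem s ss) sss : (index s ss < n)%N)); rewrite /= nth_index // => <-.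
    rewrite pmulrn (horner_map (intr : int -> rat)) /= Qs; have [_ _ -> _] := Hss s sss.
    by rewrite rmorphXn /= -pmulrn subrr.
  by rewrite map_inj_uniq // => i j /eqP; rewrite eqr_nat => /eqP.
by rewrite size_map => h; rewrite (leq_trans (ltnW h)).
Qed.

(** Write [P = p ^ k P1] with [P1] nonzero modulo [p]. Roots of [P1] modulo [p] account for the
    first term. At the other [t] the square root [y1] of the value, once the content is removed, is
    prime to [p], and for each [t] modulo [q] it takes at most the two values [y0] and [- y0] modulo
    [q]. *)
Lemma bombieri_pila_prime (P : {poly int}) (d r p e L S Zb : nat) (Q : pred int) (y : int -> nat)
    (q := (p ^ e)%N) (D := (d.+1 * 2 ^ r)%N) :
  (size P <= d.+1)%N -> (forall Y : {poly rat}, map_poly intr P != Y ^+ 2) ->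
  prime p -> (2 < p)%N -> (0 < e)%N -> (L <= q * S)%N ->
  (forall t, t \in itv 0 L -> Q t -> P.[t] = (y t)%:Z ^+ 2 /\ (y t <= Zb)%N) ->
  (D.+1`! * (Zb * S ^ (D * D)) < q ^ r.+1)%N ->
  (count Q (itv 0 L) <= (L %/ p + 1) * d + (2 * (D + D + d.+1)) * q)%N.
Proof.
move=> szP nsq pp p2 e0 LqS HQ small.
have P0 : P != 0.
  apply: contraTneq (nsq 0) => ->; by rewrite rmorph0 expr0n eqxx.
have [k [P1 [PE szP1 P1p]]] := poly_content_split pp P0.
pose QA t := Q t && (p%:Z %| P1.[t])%Z; pose QB t := Q t && ~~ (p%:Z %| P1.[t])%Z.
have -> : (count Q (itv 0 L) = count QA (itv 0 L) + count QB (itv 0 L))%N.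
  rewrite -(count_predUI QA QB) [X in (_ + X)%N](@eq_count _ _ pred0) ?count_pred0 ?addn0.
    by apply: eq_count => t /=; rewrite /QA /QB /=; case: (Q t) => //=; case: (_ %| _)%Z.
  by move=> t /=; rewrite /QA /QB /=; case: (Q t) => //=; case: (_ %| _)%Z.
have p1 := prime_gt1 pp; have p0 := prime_gt0 pp; have q0 : (0 < q)%N by rewrite expn_gt0 p0.
pose k' := k./2; pose y1 t := (y t %/ p ^ k')%N.
have Hy1 t : t \in itv 0 L -> Q t ->
    (y1 t)%:Z ^+ 2 = (p ^ odd k)%N%:Z * P1.[t] /\ (y1 t <= Zb)%N.
  move=> tL Qt; have [Pt yZ] := HQ t tL Qt; split; last by rewrite (leq_trans (leq_div _ _)).
  have kE : (p ^ k = p ^ odd k * (p ^ k') ^ 2)%N.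
    by rewrite -expnM -expnD muln2 odd_double_half.
  have ysq : (y t)%:Z ^+ 2 = (p ^ k)%N%:Z * P1.[t] by rewrite -Pt PE hornerZ.
  have dv : (p ^ k' %| y t)%N.
    rewrite -(@dvdn_pexp2r _ _ 2) // -[X in (_ %| X)%N]absz_nat -dvdz_eq.
    have -> : ((y t ^ 2)%N%:Z = (p ^ k)%N%:Z * P1.[t]) by rewrite -ysq expr2 -PoszM mulnn.
    by apply: dvdz_mulr; rewrite dvdz_eq absz_nat kE dvdn_mull.
  have yE : (y t)%:Z = (y1 t)%:Z * (p ^ k')%N%:Z by rewrite -PoszM divnK.
  have pk0 : ((p ^ k')%N%:Z : int) ^+ 2 != 0.
    by rewrite expf_neq0 // eqz_nat -lt0n expn_gt0 p0.
  apply: (mulIf pk0); by rewrite -exprMn -yE ysq kE -mulnn !PoszM; ring.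
apply: leq_add.
  apply: leq_trans (count_modcl _ _ _ p0) _; rewrite leq_mul2l; apply/orP; right.
  apply: ncl_leq => ts tss uts; apply: (@leq_trans (size P1).-1).
    apply: (@poly_roots_modp P1 p) => // t /tss; rewrite mem_filter => /andP[/andP[_ ->]] //.
  by rewrite szP1; move: szP; case: (size P).
have -> : (2 * (D + D + d.+1) * q = 2 * (D + D + d.+1) * size (itv 0 q))%N by rewrite size_itv.
apply: (count_fiber (f := modz^~ q%:Z)) => [t tL _|x0 x0q].
  by rewrite mem_itv add0r modz_ge0 ?ltz_pmod // eqz_nat -lt0n.
rewrite -size_filter; set u := [seq t <- _ | _].
have Hu t : t \in u -> [/\ t \in itv 0 L, Q t, ~~ (p%:Z %| P1.[t])%Z & (t %% q%:Z)%Z = x0].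
  by rewrite mem_filter => /andP[/andP[/andP[-> ->] /eqP->] ->].
have uu : uniq u by rewrite filter_uniq ?itv_uniq.
have [->//|[t0 t0u]] : u = [::] \/ exists t, t \in u.
  by case: (u) => [|x v]; [left|right; exists x; rewrite mem_head].
have [t0L Qt0 pt0 t0x] := Hu _ t0u.
(* For odd [k], [y1 ^ 2 = p P1(t0)] would force [p] to divide [P1(t0)]. *)
have evk : odd k = false.
  apply/negP => ok; have [+ _] := Hy1 _ t0L Qt0; rewrite ok expn1 => ysq.
  have py : (p %| y1 t0)%N.
    have : (p%:Z %| (y1 t0)%:Z ^+ 2)%Z by rewrite ysq dvdz_mulr.
    by rewrite dvdz_eq abszX absz_nat Euclid_dvdX // => /andP[].
  case/negP: pt0; have /dvdnP[z zE] := py.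
  have pz : (p%:Z : int) != 0 by rewrite eqz_nat -lt0n.
  have -> : P1.[t0] = p%:Z * z%:Z ^+ 2.
    by apply: (mulfI pz); rewrite -ysq zE PoszM; ring.
  exact: dvdz_mulr.
have Hyu t : t \in u -> (y1 t)%:Z ^+ 2 = P1.[t].
  by move=> /Hu[tL Qt _ _]; have [-> _] := Hy1 _ tL Qt; rewrite evk expn0 mul1r.
have nsq1 (Y : {poly rat}) : map_poly intr P1 != Y ^+ 2.
  apply/eqP => P1Y; have /negP[] := nsq ((p ^ k')%:R *: Y); apply/eqP.
  rewrite PE map_polyZ P1Y exprZn; congr (_ *: _).
  by rewrite -[k in LHS]odd_double_half evk add0n -muln2 expnM -natrX pmulrn.
have pyu t : t \in u -> ~~ (p%:Z %| (y1 t)%:Z)%Z.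
  move=> tu; have [_ _ + _] := Hu _ tu; apply: contra => h.
  by rewrite -(Hyu _ tu) expr2 dvdz_mulr.
(* [p] is odd and prime to [y1 t], so it cannot divide both factors of the difference of squares;
   all of [q] goes into one of them. *)
have ysame t : t \in u -> (q%:Z %| (y1 t)%:Z - (y1 t0)%:Z)%Z || (q%:Z %| (y1 t)%:Z - - (y1 t0)%:Z)%Z.
  move=> tu; have dv : (q%:Z %| ((y1 t)%:Z - (y1 t0)%:Z) * ((y1 t)%:Z - - (y1 t0)%:Z))%Z.
    have -> : ((y1 t)%:Z - (y1 t0)%:Z) * ((y1 t)%:Z - - (y1 t0)%:Z) = P1.[t] - P1.[t0].
      by rewrite -!Hyu //; ring.
    have [_ _ _ tx] := Hu _ tu.
    have tt0 : (q%:Z %| t - t0)%Z by rewrite -eqz_mod_dvd tx t0x.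
    have [R RE] : exists R, P1 - P1.[t0]%:P = R * ('X - t0%:P).
      by apply/factor_theorem; rewrite /root hornerD hornerN hornerC subrr.
    have := congr1 (fun W => W.[t]) RE; rewrite hornerD hornerN hornerC hornerM hornerD hornerN hornerX hornerC => ->.
    exact: dvdz_mull.
  have copq x : ~~ (p%:Z %| x)%Z -> coprimez q%:Z x.
    by move=> px; rewrite coprimezE absz_nat /q coprimeXl // prime_coprime // -dvdz_eq.
  have [pd|/copq cop] := boolP (p%:Z %| (y1 t)%:Z - (y1 t0)%:Z)%Z; last first.
    by move: dv; rewrite (Gauss_dvdzr _ cop) => ->; rewrite orbT.
  move: dv; rewrite Gauss_dvdzl => [-> //|]; apply: copq.
  apply: contra (pyu _ tu) => pd'.
  have : (p%:Z %| 2 * (y1 t)%:Z)%Z.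
    have -> : 2 * (y1 t)%:Z = ((y1 t)%:Z - (y1 t0)%:Z) + ((y1 t)%:Z - - (y1 t0)%:Z) by ring.
    exact: dvdz_add.
  by rewrite Gauss_dvdzr // coprimezE prime_coprime // gtnNdvd.
pose same (y0 t : int) := (q%:Z %| (y1 t)%:Z - y0)%Z.
have half (y0 : int) : ~~ (p%:Z %| y0)%Z -> (size (filter (same y0) u) <= D + D + d.+1)%N.
  move=> py0; set v := filter _ u.
  have vu : {subset v <= u} by move=> t; rewrite mem_filter => /andP[].
  have tE t : t \in u -> t = x0 + q%:Z * (`|t| %/ q)%N%:Z.
    move=> tu; have [+ _ _ tx] := Hu _ tu; rewrite mem_itv => /andP[t_ge0 _].
    rewrite {1}(divz_eq t q%:Z) tx addrC mulrC; congr (_ + _ * _).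
    by rewrite -{1}(gez0_abs t_ge0) divz_nat.
  rewrite -(size_map (fun t => (`|t| %/ q)%N)).
  apply: (@bombieri_pila_class P1 d r p e S Zb x0 y0 _ (fun s => y1 (x0 + q%:Z * s%:Z))) => //.
  - by rewrite szP1.
  - rewrite map_inj_in_uniq ?filter_uniq ?itv_uniq // => t t' /vu tu /vu t'u tt'.
    by rewrite (tE _ tu) (tE _ t'u) tt'.
  move=> _ /mapP[t tv ->]; have tu := vu _ tv; have [tL Qt _ _] := Hu _ tu.
  rewrite -/q -(tE _ tu); split.
  - by rewrite ltn_divLR // mulnC (leq_trans _ LqS) // mem_itv0.
  - by have [] := Hy1 _ tL Qt.
  - by rewrite Hyu.
  - by move: tv; rewrite mem_filter => /andP[].
apply: (@leq_trans (size (filter (same (y1 t0)%:Z) u) + size (filter (same (- (y1 t0)%:Z)) u))).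
  rewrite !(size_filter (same _)) -count_predUI; apply: leq_trans (leq_addr _ _).
  by rewrite -[X in (X <= _)%N](count_predT u); apply/eq_leq/eq_in_count => t tu /=; rewrite /same ysame.
rewrite mul2n -addnn leq_add // half ?pyu //.
by rewrite dvdz_eq abszN -dvdz_eq pyu.
Qed.

(** On an interval of length [V ^ E] a factor [V] is saved. Only the existence of some fixed [E]
    matters, so no attempt is made at a good exponent. *)
Theorem bombieri_pila (d kappa K : nat) : exists C E : nat, (0 < C)%N /\ (1 < E)%N /\
  forall (V : nat) (P : {poly int}) (a : int) (Q : pred int) (y : int -> nat),
  (0 < V)%N -> (size P <= d.+1)%N -> (forall Y : {poly rat}, map_poly intr P != Y ^+ 2) ->
  (forall t, t \in itv a (V ^ E) -> Q t ->
      P.[t] = (y t)%:Z ^+ 2 /\ (y t <= K * (V ^ E) ^ kappa)%N) ->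
  (count Q (itv a (V ^ E)) <= C * V ^ E.-1)%N.
Proof.
pose r := kappa.+1; pose D := (d.+1 * 2 ^ r)%N.
(* The largest power [q] of [p] below [V ^ E.-1] exceeds [V ^ (E - 35)], since [p <= V ^ 34]; so
   [s < V ^ 35], and the determinant is small enough if [(D+1)! + E r + 35 D^2 <= (E - 35)(r + 1)].
   The exponent [r = kappa + 1], rather than [kappa], absorbs the constant [K]. *)
pose E := (35 * r.+1 + D.+1`! + 35 * (D * D) + 1)%N.
exists (2 * d + 2 * (D + D + d.+1) + K + 2)%N, E; split; first by rewrite addnS.
have E36 : (36 <= E)%N by rewrite /E /r mulnS; lia.
split=> [|V P a Q y V0 szP nsq HQ]; first by lia.
have E1 : E = E.-1.+1 by lia.
have [Vsmall|] := leqP V (K + 2).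
  apply: leq_trans (count_size _ _) _; rewrite size_itv {1}E1 expnS leq_mul2r; apply/orP; right.
  by lia.
move=> Vbig; have V2 : (2 < V)%N by lia.
pose P' := P \Po ('X + a%:P).
have szXa : size ('X + a%:P : {poly int}) = 2 by rewrite size_XaddC.
have hP' t : P'.[t] = P.[a + t] by rewrite horner_comp hornerD hornerX hornerC addrC.
have nsq' (Y : {poly rat}) : map_poly intr P' != Y ^+ 2.
  apply/eqP => PY; have /negP[] := nsq (Y \Po ('X - a%:~R%:P)); apply/eqP.
  rewrite -rmorphXn /= -PY /P' map_comp_poly -comp_polyA rmorphD /= map_polyX map_polyC /=.
  by rewrite comp_polyD comp_polyX comp_polyC subrK comp_polyXr.
have -> : count Q (itv a (V ^ E)) = count (fun t => Q (a + t)) (itv 0 (V ^ E)).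
  by rewrite /itv !count_map; apply: eq_count => i /=; rewrite add0r.
have [p pp /andP[Vp pV]] := prime_in_power_range (ltnW V2).
have p2 : (2 < p)%N by apply: leq_trans Vp.
have p1 := prime_gt1 pp.
pose e := trunc_log p (V ^ E.-1); pose q := (p ^ e)%N.
have VE0 : (0 < V ^ E.-1)%N by rewrite expn_gt0 V0.
have e0 : (0 < e)%N.
  by apply: trunc_log_max => //; rewrite expn1 (leq_trans pV) // leq_pexp2l //; lia.
have qV : (q <= V ^ E.-1)%N by apply: trunc_logP.
have Vq : (V ^ (E - 35) <= q)%N.
  have := trunc_log_ltn (V ^ E.-1) p1; rewrite -/e expnS -/q => h.
  have V34 : (0 < V ^ 34)%N by rewrite expn_gt0 V0.
  rewrite -(leq_pmul2r V34) -expnD ltnW // mulnC.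
  have -> : (E - 35 + 34)%N = E.-1 by lia.
  by apply: leq_trans h _; rewrite leq_mul2r pV orbT.
have LqS : (V ^ E <= q * V ^ 35)%N.
  by rewrite -{1}(@subnK 35 E) ?expnD ?leq_mul2r ?Vq ?orbT //; lia.
have szP' : (size P' <= d.+1)%N by rewrite size_comp_poly2.
have HQ' t : t \in itv 0 (V ^ E) -> Q (a + t) -> P'.[t] = (y (a + t))%:Z ^+ 2 /\ (y (a + t)%R <= V ^ (E * r))%N.
  move=> tL Qt; have [|Pt yK] := HQ (a + t) _ Qt.
    by move: tL; rewrite !mem_itv; lia.
  rewrite hP' Pt; split=> //; apply: leq_trans yK _; rewrite /r mulnS expnD expnM leq_mul2r.
  apply/orP; right; apply: (@leq_trans V); first by lia.
  by rewrite -{1}(expn1 V) leq_pexp2l //; lia.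
have small : (D.+1`! * (V ^ (E * r) * (V ^ 35) ^ (D * D)) < q ^ r.+1)%N.
  apply: (@leq_trans ((V ^ (E - 35)) ^ r.+1)); last exact: leq_expr.
  apply: (@leq_trans (V ^ (D.+1`! + E * r + 35 * (D * D)))).
    rewrite -expnM -addnA expnD expnD ltn_pmul2r ?muln_gt0 ?expn_gt0 ?V0 //.
    by apply: ltn_expl; lia.
  rewrite -expnM leq_pexp2l // mulnBl [(_ * r.+1)%N]mulnS.
  have := E36; rewrite /E; move: (D.+1`!) (D * D)%N => x z.
  by nia.
apply: leq_trans (bombieri_pila_prime szP' nsq' pp p2 e0 LqS HQ' small) _; rewrite -/D -/q.
have Lp : (V ^ E %/ p + 1 <= 2 * V ^ E.-1)%N.
  rewrite mul2n -addnn leq_add // {1}E1 expnS.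
  by apply: leq_trans (leq_div2l _ V0 Vp) _; rewrite mulKn.
apply: (@leq_trans (2 * V ^ E.-1 * d + 2 * (D + D + d.+1) * V ^ E.-1)).
  by rewrite leq_add // leq_mul.
by rewrite mulnAC -mulnDl leq_mul2r; apply/orP; right; lia.
Qed.

End BombieriPila.

(** * Squarefree parts of values of the norm form *)

Section Sublists.

Fixpoint subs (s : seq nat) : seq (seq nat) :=
  if s is p :: s' then map (cons p) (subs s') ++ subs s' else [:: [::]].

Lemma prodD1_subs (R : comPzRingType) (w : nat -> R) (s : seq nat) :
  (\prod_(p <- s) (1 + w p) = \sum_(l <- subs s) \prod_(p <- l) w p)%R.
Proof.
elim: s => [|p s IH] /=; first by rewrite big_nil big_seq1 big_nil.
rewrite big_cons IH big_cat big_map /= mulrDl mul1r addrC mulr_sumr; congr (_ + _)%R.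
by apply: eq_bigr => l _; rewrite big_cons.
Qed.

Lemma subs_dvd s l : l \in subs s -> \prod_(p <- l) p %| \prod_(p <- s) p.
Proof.
elim: s l => [|p s IH] l /=; first by rewrite inE => /eqP->; rewrite !big_nil.
rewrite mem_cat big_cons => /orP[/mapP[l' /IH h ->]|/IH h].
  by rewrite big_cons dvdn_mul.
exact: dvdn_mull.
Qed.

Lemma subs_subseq s l : l \in subs s -> subseq l s.
Proof.
elim: s l => [|p s IH] l /=; first by rewrite inE => /eqP->.
rewrite mem_cat => /orP[/mapP[l' /IH h ->]|/IH h]; first by rewrite /= eqxx.
by apply: subseq_trans h (subseq_cons _ _).
Qed.

Lemma sum_subs_subseq (R : realDomainType) (F : seq nat -> R) s s' :
  (forall l, 0 <= F l)%R -> subseq s s' ->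
  (\sum_(l <- subs s) F l <= \sum_(l <- subs s') F l)%R.
Proof.
elim: s' s F => [|p s' IH] s F F0 /=; first by move/eqP->.
rewrite big_cat big_map /=; case: s => [|q s] /=.
  move=> _; rewrite -[X in (X <= _)%R]add0r lerD ?sumr_ge0 //.
  exact: (IH [::] F F0 (sub0seq _)).
case: eqP => [->|_] ss'.
  by rewrite big_cat big_map /= lerD // IH.
rewrite -[X in (X <= _)%R]add0r lerD ?sumr_ge0 //.
exact: (IH (q :: s)).
Qed.

End Sublists.

(** * Rankin's bound for the smooth part of the norm *)

Section Rankin.
Local Open Scope ring_scope.

Definition Nf (b A B : int) : int := A ^+ 2 - 4 * b * B ^+ 2.

Lemma count_sqrt_modp (c : int) (p : nat) (ts : seq int) : prime p ->
  uniq (map (modz^~ p%:Z) ts) -> (forall t, t \in ts -> (p%:Z %| t ^+ 2 - c)%Z) ->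
  (size ts <= 2)%N.
Proof.
move=> pp uts H; have := @poly_roots_modp ('X^2 - c%:P) p ts pp.
rewrite size_XnsubC //; apply => //.
  exists 2; rewrite coefB coefXn coefC /= subr0 dvdz_eq.
  by rewrite dvdn1 gtn_eqF ?prime_gt1.
by move=> t /H; rewrite hornerD hornerN hornerC hornerXn.
Qed.

Lemma count_dvd_Nf (b : int) (T : nat) (l : seq nat) (B : int) : uniq l -> all prime l ->
  (count (fun A => ((\prod_(p <- l) p)%N%:Z %| Nf b A B)%Z) (rng T) <=
    (T.*2.+1 %/ (\prod_(p <- l) p) + 1) * 2 ^ size l)%N.
Proof.
move=> ul pl; have d0 : (0 < \prod_(p <- l) p)%N.
  by rewrite big_seq; apply: prodn_cond_gt0 => p /(allP pl)/prime_gt0.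
apply: leq_trans (count_modcl _ _ _ d0) _; rewrite leq_mul2l; apply/orP; right.
apply: ncl_crt => // p pl'; apply: ncl_leq => ts tss uts.
apply: (@count_sqrt_modp (4 * b * B ^+ 2) p) => //; first exact: (allP pl).
move=> t /tss; rewrite mem_filter => /andP[h _]; apply: dvdz_trans h.
rewrite dvdz_eq absz_nat; rewrite (big_rem p) //=; exact: dvdn_mulr.
Qed.

(** A rescaling of [sum_log_primes]. Of the 8, one factor 2 pays for replacing [log p + 1] by
    [log p] and one for the integer part of [n / p]; the last leaves the sum at one half, the
    threshold of [prod1D_leq]. *)
Lemma sum_log_over_p (a : nat) : (0 < a)%N ->
  \sum_(p <- primes_lt (2 ^ a)) ((trunc_log 2 p).+1%:R / (8 * a%:R * p%:R)) <= 2^-1 :> rat.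
Proof.
move=> a0; set n := (2 ^ a)%N; have n0 : (0 < n)%N by rewrite expn_gt0.
have nR : 0 < (n%:R : rat) by rewrite ltr0n.
have aR : 0 < (a%:R : rat) by rewrite ltr0n.
apply: (@le_trans _ _ (\sum_(p <- primes_lt n) ((trunc_log 2 p * (n %/ p))%N%:R / (2 * a%:R * n%:R)))).
  rewrite big_seq [X in _ <= X]big_seq; apply: ler_sum => p.
  rewrite mem_primes_lt => /andP[pp pn].
  have pR : 0 < (p%:R : rat) by rewrite ltr0n prime_gt0.
  rewrite ler_pdivrMr ?mulr_gt0 // mulrAC ler_pdivlMr ?mulr_gt0 //.
  have t1 := trunc_log2_gt0 pp.
  have q1 : (0 < n %/ p)%N by rewrite divn_gt0 ?prime_gt0 // ltnW.
  rewrite -!natrM ler_nat.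
  have np : (n <= 2 * (n %/ p) * p)%N.
    by apply: leq_trans (ltnW (ltn_ceil _ (prime_gt0 pp))) _; rewrite leq_mul2r; apply/orP; right; lia.
  apply: (@leq_trans ((2 * trunc_log 2 p) * (2 * a * (2 * (n %/ p) * p)))%N).
    by rewrite leq_mul //; [lia|rewrite leq_mul2l np orbT].
  by apply/eq_leq; ring.
rewrite -mulr_suml ler_pdivrMr ?mulr_gt0 // -natr_sum.
have -> : 2^-1 * (2 * a%:R * n%:R) = (a * n)%N%:R :> rat by rewrite natrM; field.
by rewrite ler_nat sum_log_primes.
Qed.

(** By induction, the product times [1 - sum] is at most one. *)
Lemma prod1D_leq (s : seq nat) (z : nat -> rat) : (forall p, p \in s -> 0 <= z p) ->
  \sum_(p <- s) z p <= 2^-1 -> \prod_(p <- s) (1 + z p) <= 2.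
Proof.
move=> z0 zs.
suff H : \prod_(p <- s) (1 + z p) * (1 - \sum_(p <- s) z p) <= 1 /\ 1 <= \prod_(p <- s) (1 + z p).
  by case: H; move: zs; set X := \sum_(_ <- _) _; set Y := \prod_(_ <- _) _ => h1 h2 h3; nra.
have : \sum_(p <- s) z p <= 1 by apply: le_trans zs _; lra.
elim: s z0 {zs} => [|p s IH] z0; first by rewrite !big_nil; split; lra.
rewrite !big_cons => h; have zp := z0 p (mem_head _ _).
have z0' q : q \in s -> 0 <= z q by move=> qs; apply: z0; rewrite inE qs orbT.
have S0 : 0 <= \sum_(q <- s) z q by rewrite big_seq; apply: sumr_ge0.
have [] := IH z0'; first by lra.
move: S0 h zp; set X := \sum_(_ <- _) _; set Y := \prod_(_ <- _) _ => S0 h zp h1 h2.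
by split; nra.
Qed.

Lemma bernoulli (z : rat) (k : nat) : 0 <= z -> 1 + k%:R * z <= (1 + z) ^+ k.
Proof.
move=> z0; elim: k => [|k IH]; first by rewrite mul0r addr0.
rewrite exprS -natr1; have k0 : 0 <= (k%:R : rat) by [].
by set K := k%:R in IH k0 *; set X := _ ^+ k in IH *; nra.
Qed.

(** The arithmetic-geometric inequality for [i] copies of [1 + G] and [a - i] copies of 1. It stands
    for [(1 + G) ^ (i / a) <= 1 + G i / a] without fractional powers. *)
Lemma agm_pow (G i a : nat) : (0 < a)%N -> (i <= a)%N ->
  ((1 + G)%:R ^+ i : rat) <= (1 + G%:R * (i%:R / a%:R)) ^+ a.
Proof.
move=> a0 ia; pose E (j : 'I_a) : rat := if (j < i)%N then (1 + G)%:R else 1.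
have cardi : #|[pred j : 'I_a | (j < i)%N]| = i.
  by rewrite -sum1_card -(big_ord_widen _ (fun=> 1%N) ia) sum1_card card_ord.
have E0 : {in [pred j : 'I_a | true], forall j, 0 <= E j}.
  by move=> j _; rewrite /E; case: ifP => _ //; exact: ler0n.
have [+ _] := leif_AGM E0.
rewrite card_ord; have -> : \prod_(j in [pred j | true]) E j = (1 + G)%:R ^+ i.
  by rewrite (eq_bigl xpredT) // /E -big_mkcond /= prodr_const cardi.
have -> : (\sum_(j in [pred j | true]) E j) / a%:R = 1 + G%:R * (i%:R / a%:R).
  have aR : (a%:R : rat) != 0 by rewrite pnatr_eq0 -lt0n.
  have -> : \sum_(j in [pred j | true]) E j = \sum_(j < a) (1 + if (j < i)%N then G%:R else 0).
    by apply: eq_bigr => j _; rewrite /E; case: ifP => _; rewrite ?addr0 // natrD.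
  rewrite big_split /= sumr_const card_ord -big_mkcond /= sumr_const cardi.
  by rewrite -mulr_natr; field.
by [].
Qed.

(** The shortest prefix reaching [2 ^ J] overshoots by less than one prime. This truncation keeps
    the moduli at most [T], where multiples are evenly spread in [rng T]. *)
Lemma prefix_prod (ps : seq nat) (a J : nat) : (forall p, p \in ps -> (p < 2 ^ a)%N) ->
  (2 ^ J <= \prod_(p <- ps) p)%N ->
  exists i, (2 ^ J <= \prod_(p <- take i ps) p <= 2 ^ J * 2 ^ a)%N.
Proof.
move=> psa big; pose Q i := (2 ^ J <= \prod_(p <- take i ps) p)%N.
have exQ : exists i, Q i by exists (size ps); rewrite /Q take_size.
case: (ex_minnP exQ) => i Qi min_i; exists i; rewrite -/(Q i) Qi /=.
case: i Qi min_i => [|i] Qi min_i; first by rewrite take0 big_nil muln_gt0 !expn_gt0.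
have ips : (i < size ps)%N.
  rewrite ltnNge; apply/negP => h; have := min_i i; rewrite /Q take_oversize // => /(_ big).
  by rewrite ltnn.
rewrite (take_nth 0%N) // -cats1 big_cat big_seq1 /= leq_mul //.
  by rewrite ltnW // ltnNge; apply/negP => /min_i; rewrite ltnn.
by rewrite ltnW // psa // mem_nth.
Qed.

(** Raise to the power [a] and use [agm_pow] at each prime: the exponents [log p + 1] add up to at
    least [J]. *)
Lemma weight_lower (G a J : nat) (ps : seq nat) : (0 < a)%N ->
  (forall p, p \in ps -> prime p && (p < 2 ^ a)%N) -> (2 ^ J <= \prod_(p <- ps) p)%N ->
  ((1 + G)%:R ^+ (J %/ a) : rat) <= \prod_(p <- ps) (1 + G%:R * ((trunc_log 2 p).+1%:R / a%:R)).
Proof.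
move=> a0 psa big.
have W0 : 0 <= \prod_(p <- ps) (1 + G%:R * ((trunc_log 2 p).+1%:R / a%:R)) :> rat.
  by apply: prodr_ge0 => p _; rewrite addr_ge0 // mulr_ge0 // divr_ge0.
rewrite -(ler_pXn2r a0) ?nnegrE ?exprn_ge0 // -exprM -prodrXl.
have sumJ : (J <= \sum_(p <- ps) (trunc_log 2 p).+1)%N.
  rewrite -(@leq_exp2l 2) //; apply: leq_trans big _; rewrite expn_sum.
  by apply: leq_prod_seq => p _; rewrite ltnW // trunc_log_ltn.
apply: (@le_trans _ _ ((1 + G)%:R ^+ (\sum_(p <- ps) (trunc_log 2 p).+1))).
  apply: ler_weXn2l; first by rewrite natrD lerDl.
  by apply: leq_trans (leq_trunc_div _ _) sumJ.
rewrite -prodrXr big_seq [X in _ <= X]big_seq; apply: ler_prod => p /psa/andP[pp pa].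
rewrite exprn_ge0 //= agm_pow //.
rewrite -(ltn_exp2l _ _ (isT : 1 < 2)%N) (leq_ltn_trans _ pa) // trunc_logP // prime_gt0 //.
Qed.

Definition smooth_bad (b : int) (a J : nat) (A B : int) : bool :=
  (2 ^ J <= \prod_(p <- primes_lt (2 ^ a) | (p%:Z %| Nf b A B)%Z) p)%N.

(* Rankin: each prime [p < 2 ^ a] is weighted by [1 + G log p / a]. *)
Lemma rankin (b : int) (G : nat) : exists C : nat, (0 < C)%N /\
  forall a J T, (0 < a)%N -> (2 ^ J * 2 ^ a <= T)%N ->
  ((\sum_(A <- rng T) \sum_(B <- rng T) smooth_bad b a J A B) * (1 + G) ^ (J %/ a) <= C * T ^ 2)%N.
Proof.
exists (12 * 2 ^ (16 * G))%N; split=> [|a J T a0 JT]; first by rewrite muln_gt0 expn_gt0.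
have T0 : (0 < T)%N by apply: leq_trans JT; rewrite muln_gt0 !expn_gt0.
set L := primes_lt (2 ^ a).
pose w (p : nat) : rat := G%:R * ((trunc_log 2 p).+1%:R / a%:R).
have w0 p : 0 <= w p by rewrite mulr_ge0 // divr_ge0.
pose pr (l : seq nat) := (\prod_(p <- l) p)%N.
pose F A B l : rat := (\prod_(p <- l) w p) *
   (((pr l <= T)%N && ((pr l)%:Z %| Nf b A B)%Z) : nat)%:R.
have F0 A B l : 0 <= F A B l by rewrite mulr_ge0 // prodr_ge0.
have Lprime : all prime L by apply: filter_all.
have key A B : (smooth_bad b a J A B)%:R * (1 + G)%:R ^+ (J %/ a) <= \sum_(l <- subs L) F A B l.
  case: (boolP (smooth_bad _ _ _ _ _)) => [|_]; last by rewrite mul0r sumr_ge0.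
  rewrite /smooth_bad -/L -big_filter mul1r; set ps := [seq p <- L | _] => big.
  have psL p : p \in ps -> [/\ prime p, (p < 2 ^ a)%N & (p%:Z %| Nf b A B)%Z].
    by rewrite mem_filter mem_primes_lt => /andP[-> /andP[-> ->]].
  have [|i /andP[i1 i2]] := @prefix_prod ps a J _ big.
    by move=> p /psL[].
  set ps' := take i ps in i1 i2.
  have sub' : subseq ps' ps by apply: take_subseq.
  have subL : subseq ps' L by apply: subseq_trans sub' (filter_subseq _ _).
  have psL' p : p \in ps' -> prime p && (p < 2 ^ a)%N by move=> /(mem_subseq sub')/psL[-> ->].
  apply: le_trans (weight_lower G a0 psL' i1) _.
  rewrite (prodD1_subs w); apply: le_trans (sum_subs_subseq (F0 A B) subL).
  rewrite big_seq [X in _ <= X]big_seq; apply: ler_sum => l lps.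
  rewrite /F (_ : _ && _ = true) ?mulr1 //.
  have dl : (pr l %| pr ps')%N by apply: subs_dvd.
  have ps'0 : (0 < pr ps')%N by apply: leq_trans i1; rewrite expn_gt0.
  rewrite (leq_trans (dvdn_leq ps'0 dl) (leq_trans i2 JT)) /=.
  apply: (@dvdz_trans (pr ps')%:Z); first by rewrite dvdz_eq.
  have : uniq ps' by apply: subseq_uniq sub' _; rewrite filter_uniq ?primes_lt_uniq.
  have : forall p, p \in ps' -> prime p /\ (p%:Z %| Nf b A B)%Z.
    by move=> p /(mem_subseq sub')/psL[].
  rewrite /pr; elim: (ps') => [|p s IH] H /=; first by rewrite big_nil dvd1z.
  case/andP=> pns us; have [pp pN] := H p (mem_head _ _).
  have H' q : q \in s -> prime q /\ (q%:Z %| Nf b A B)%Z by move=> qs; apply: H; rewrite inE qs orbT.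
  rewrite big_cons PoszM Gauss_dvdz ?pN ?IH // coprimezE /=.
  have := @coprime_prod_pfactor p s (fun=> 1%N) 1 pp; rewrite expn1.
  under eq_bigr do rewrite expn1.
  by apply => //; apply/allP => q /H'[].
(* For squarefree [l <= T] at most [12 T^2 2 ^ omega(l) / l] pairs have [l] dividing [N]. The sum
   over [l] is then an Euler product with factors [1 + 2 w p / p = 1 + 16 G z p <= (1 + z p) ^ (16
   G)], and the product of the [1 + z p] is at most 2. *)
have swap : \sum_(A <- rng T) \sum_(B <- rng T) \sum_(l <- subs L) F A B l <=
            (12 * 2 ^ (16 * G) * T ^ 2)%N%:R.
  under eq_bigr do rewrite exchange_big /=.
  rewrite exchange_big /=.
  apply: (@le_trans _ _ (\sum_(l <- subs L) (12 * T ^ 2)%N%:R * \prod_(p <- l) (2 * w p / p%:R))).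
    rewrite big_seq [X in _ <= X]big_seq; apply: ler_sum => l lL.
    have sl := subs_subseq lL.
    have ul : uniq l by apply: subseq_uniq sl (primes_lt_uniq _).
    have pl : all prime l by apply/allP => p /(mem_subseq sl); apply: (allP Lprime).
    have d0 : (0 < pr l)%N.
      by rewrite /pr big_seq; apply: prodn_cond_gt0 => p /(allP pl)/prime_gt0.
    have prR : (pr l)%:R != 0 :> rat by rewrite pnatr_eq0 -lt0n.
    have -> : \prod_(p <- l) (2 * w p / p%:R) = (\prod_(p <- l) w p) * ((2 ^ size l)%N%:R / (pr l)%:R).
      rewrite /pr natr_prod -prodfV -prod_const_seq natr_prod -!big_split /=.
      by apply: eq_bigr => p _; ring.
    rewrite mulrCA; under eq_bigr do rewrite -mulr_sumr.
    rewrite -mulr_sumr ler_wpM2l ?prodr_ge0 //.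
    have [dT|dT] := leqP (pr l) T; last first.
      rewrite big1 => [|A _]; last by rewrite big1.
      by rewrite mulr_ge0 ?ler0n // divr_ge0 ?ler0n.
    rewrite /= exchange_big /=.
    apply: (@le_trans _ _ (\sum_(B <- rng T) (((T.*2.+1 %/ pr l + 1) * 2 ^ size l)%N%:R : rat))).
      apply: ler_sum => B _; rewrite -natr_sum ler_nat.
      by rewrite sum_bool_count count_dvd_Nf.
    rewrite -natr_sum sum_const_seq size_rng mulrA ler_pdivlMr ?ltr0n // -!natrM ler_nat.
    have h1 : (T.*2.+1 <= 3 * T)%N by lia.
    have h2 : ((T.*2.+1 %/ pr l + 1) * pr l <= 4 * T)%N.
      rewrite mulnDl mul1n (_ : 4 * T = 3 * T + T)%N; last by lia.
      by rewrite leq_add // (leq_trans _ h1) // leq_trunc_div.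
    have -> : (T.*2.+1 * ((T.*2.+1 %/ pr l + 1) * 2 ^ size l) * pr l =
               T.*2.+1 * ((T.*2.+1 %/ pr l + 1) * pr l) * 2 ^ size l)%N.
      by move: (T.*2.+1 %/ pr l + 1)%N (2 ^ size l)%N => x y; ring.
    have -> : (12 * T ^ 2 = 3 * T * (4 * T))%N by ring.
    by rewrite leq_mul2r leq_mul ?orbT.
  rewrite -mulr_sumr -(prodD1_subs (fun p => 2 * w p / p%:R)).
  have -> : (12 * 2 ^ (16 * G) * T ^ 2)%N%:R = (12 * T ^ 2)%N%:R * (2 ^ (16 * G))%N%:R :> rat.
    by rewrite !natrM; ring.
  rewrite ler_wpM2l ?ler0n //.
  pose z (p : nat) : rat := (trunc_log 2 p).+1%:R / (8 * a%:R * p%:R).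
  have z0 p : 0 <= z p by rewrite divr_ge0 ?ler0n // !mulr_ge0 ?ler0n.
  apply: (@le_trans _ _ (\prod_(p <- L) (1 + z p) ^+ (16 * G))).
    rewrite big_seq [X in _ <= X]big_seq; apply: ler_prod => p pL.
    have pR : (p%:R : rat) != 0 by rewrite pnatr_eq0 -lt0n prime_gt0 // (allP Lprime).
    have aR : (a%:R : rat) != 0 by rewrite pnatr_eq0 -lt0n.
    have -> : 2 * w p / p%:R = (16 * G)%N%:R * z p.
      rewrite /w /z natrM; move: (trunc_log 2 p).+1%:R => x; by field; rewrite aR pR.
    apply/andP; split; last exact: bernoulli.
    by apply: addr_ge0 => //; apply: mulr_ge0; rewrite ?ler0n.
  rewrite prodrXl natrX; apply: lerXn2r; rewrite ?nnegrE //.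
    by apply: prodr_ge0 => p _; rewrite addr_ge0.
  by apply: prod1D_leq => [p _|] //; apply: sum_log_over_p.
rewrite -(ler_nat rat) natrM natrX; apply: le_trans swap.
rewrite natr_sum mulr_suml; apply: ler_sum => A _.
by rewrite natr_sum mulr_suml; apply: ler_sum => B _; apply: key.
Qed.

End Rankin.

Section SquarefreePart.

Definition oddp (n : nat) : seq nat := [seq p <- primes n | odd (logn p n)].
Definition sf (n : nat) : nat := \prod_(p <- oddp n) p.
Definition sqpart (n : nat) : nat := \prod_(p <- primes n) p ^ (logn p n)./2.

Lemma oddp_uniq n : uniq (oddp n).
Proof. by rewrite filter_uniq ?primes_uniq. Qed.

Lemma mem_oddp p n : (p \in oddp n) = odd (logn p n).
Proof. by rewrite mem_filter -logn_gt0; case: (logn p n) => // k; rewrite andbT. Qed.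

Lemma oddp_prime n : all prime (oddp n).
Proof. by apply/allP => p; rewrite mem_filter mem_primes => /andP[_ /andP[]]. Qed.

Lemma prod_primes_gt0 (ps : seq nat) : all prime ps -> 0 < \prod_(p <- ps) p.
Proof. by move=> pr; rewrite big_seq; apply: prodn_cond_gt0 => p /(allP pr)/prime_gt0. Qed.

Lemma sf_gt0 n : 0 < sf n. Proof. exact/prod_primes_gt0/oddp_prime. Qed.

Lemma sfE n : 0 < n -> n = sf n * sqpart n ^ 2.
Proof.
move=> n0; rewrite {1}(prod_primesE n0) /sf /sqpart /oddp big_filter [X in _ = X * _]big_mkcond.
rewrite (big_morph (expn^~ 2) (fun x y => expnMn x y 2) (exp1n 2)) -big_split /=.
apply: eq_bigr => p _; rewrite -expnM muln2 -{1}(odd_double_half (logn p n)) expnD.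
by case: odd.
Qed.

Lemma sf_leq n : 0 < n -> sf n <= n.
Proof.
move=> n0; rewrite {2}(sfE n0) leq_pmulr // expn_gt0.
by have := n0; rewrite {1}(sfE n0) muln_gt0 expn_gt0 => /andP[_ ->].
Qed.

Lemma sqpart_gt0 n : 0 < n -> 0 < sqpart n.
Proof. by move=> n0; have := n0; rewrite {1}(sfE n0) muln_gt0 expn_gt0 orbF => /andP[]. Qed.

Lemma logn_prod_primes (ps : seq nat) p : uniq ps -> all prime ps ->
  logn p (\prod_(q <- ps) q) = (p \in ps).
Proof.
elim: ps => [|q ps IH] /=; first by rewrite big_nil logn1.
case/andP=> qps ups /andP[qq pr]; rewrite big_cons lognM; [|exact: prime_gt0|exact: prod_primes_gt0].
rewrite IH // logn_prime // inE; case: eqP => [->|_] //=; by rewrite (negPf qps).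
Qed.

(** Supplies the hypothesis on [m] in the Pell counts: [sf n] is squarefree, so the only room for a
    square is the factor 4. *)
Lemma sf_square_dvd n g : g ^ 2 %| 4 * sf n -> g <= 2.
Proof.
move=> gd; have n0 : 0 < 4 * sf n by rewrite muln_gt0 sf_gt0.
have g0 : 0 < g.
  by case: g gd => //; rewrite dvd0n => /eqP h; rewrite h in n0.
have lg p : prime p -> 2 * logn p g <= logn p 4 + 1.
  move=> pp; have := dvdn_leq_log p n0 gd; rewrite lognX lognM ?sf_gt0 // => h.
  apply: leq_trans h _; rewrite leq_add2l logn_prod_primes ?oddp_uniq ?oddp_prime //.
  by case: (_ \in _).
have l4 p : prime p -> logn p 4 = if p == 2 then 2 else 0.
  move=> pp; rewrite (_ : 4 = 2 ^ 2) // lognX logn_prime //; by case: eqP => // ->.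
have p2 : 2.-nat g.
  apply/pnatP => // p pp pg; rewrite inE /=; apply: contraT => pn2.
  have := lg p pp; rewrite l4 // (negPf pn2).
  have : 0 < logn p g by rewrite logn_gt0 mem_primes pp g0.
  by case: (logn p g) => // k _; rewrite mulnS.
rewrite -(part_pnat_id p2) p_part; have := lg 2 isT; rewrite l4 //=.
by case: (logn 2 g) => [|[|k]] //; rewrite !mulnS.
Qed.

End SquarefreePart.

Section HarmonicSums.

Lemma count_sum_fiber (T T' : eqType) (f : T -> T') (P : pred T) (s : seq T) (r : seq T') :
  (forall x, x \in s -> P x -> f x \in r) ->
  count P s <= \sum_(y <- r) count (fun x => P x && (f x == y)) s.
Proof.
elim: r s => [|y r IHr] s sr.
  rewrite big_nil leqn0 -leqn0 leqNgt -has_count; apply/negP => /hasP[x xs Px].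
  by have := sr x xs Px.
rewrite big_cons -size_filter -(count_predC (fun x => f x == y)) !count_filter.
apply: leq_add; first by apply/eq_leq/eq_count => x /=; rewrite andbC.
apply: (@leq_trans (\sum_(z <- r) count (fun x => P x && (f x == z)) [seq x <- s | f x != y])).
  apply: leq_trans (IHr _ _); first by rewrite count_filter; apply/eq_leq/eq_count => x /=; rewrite andbC.
  move=> x; rewrite mem_filter => /andP[/= fxy xs] Px; have := sr x xs Px.
  by rewrite inE (negPf fxy).
apply: leq_sum => z _; rewrite count_filter; apply: sub_count => x /=.
by case/andP.
Qed.

(** Each dyadic block of [m] contributes at most [W]. *)
Lemma sum_div_harmonic (W h : nat) : \sum_(1 <= m < 2 ^ h) W %/ m <= W * h.
Proof.
elim: h => [|h IH]; first by rewrite big_geq.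
have le1 : 1 <= 2 ^ h by rewrite expn_gt0.
have le2 : 2 ^ h <= 2 ^ h.+1 by rewrite leq_exp2l.
rewrite (big_cat_nat le1 le2) /= mulnS addnC leq_add //.
apply: (@leq_trans (\sum_(2 ^ h <= m < 2 ^ h.+1) W %/ 2 ^ h)).
  rewrite big_nat_cond [X in _ <= X]big_nat_cond; apply: leq_sum => m /andP[/andP[hm _] _].
  by rewrite leq_div2l // expn_gt0.
rewrite sum_nat_const_nat expnS mul2n -addnn addnK mulnC leq_trunc_div //.
Qed.

Lemma sum_div_harmonic_leq (W M : nat) : \sum_(1 <= m < M.+1) W %/ m <= W * (trunc_log 2 M).+1.
Proof.
apply: leq_trans (sum_div_harmonic _ _).
have le1 : 0 < M.+1 by [].
have le2 : M.+1 <= 2 ^ (trunc_log 2 M).+1 by rewrite trunc_log_ltn.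
by rewrite (big_cat_nat le1 le2) /= leq_addr.
Qed.

Lemma trunc_log_leqU (K e U x : nat) : 0 < U -> x <= K * U ^ e -> (trunc_log 2 x).+1 <= (K + e).+1 * U.
Proof.
move=> U0 xK; case: x xK => [|x] xK; first by rewrite trunc_log0 muln_gt0.
rewrite mulSn addnC -addn1 leq_add // -(@leq_exp2l 2) //.
apply: leq_trans (trunc_logP _ _) _ => //; apply: leq_trans xK _.
rewrite mulnDl expnD leq_mul //.
  by apply: (@leq_trans (2 ^ K)); [exact/ltnW/ltn_expl|rewrite leq_exp2l // leq_pmulr].
rewrite mulnC expnM; apply: leq_expr; exact/ltnW/ltn_expl.
Qed.

End HarmonicSums.

Section NormForm.
Local Open Scope ring_scope.

Lemma Nf_bound (b : int) (T : nat) (A B : int) : A \in rng T -> B \in rng T ->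
  (`|Nf b A B| <= (1 + 4 * `|b|) * T ^ 2)%N.
Proof.
rewrite !mem_rng /Nf => AT BT; apply: leq_trans (leq_abszB _ _) _.
rewrite abszM !abszX abszM mulnDl mul1n leq_add ?leq_expr //.
by rewrite leq_mul ?leq_expr.
Qed.

(** The signed squarefree part, which represents the class of a nonzero [n] modulo rational
    squares. *)
Definition smsf (n : int) : int := sgz n * (sf `|n|)%:Z.

Lemma smsfE (n : int) : n != 0 -> n = smsf n * (sqpart `|n|)%:Z ^+ 2.
Proof.
move=> n0; have n0' : (0 < `|n|)%N by rewrite absz_gt0.
rewrite /smsf -mulrA expr2 -!PoszM mulnn -sfE // abszE.
by case: sgzP n0 => [->|h|h] _; rewrite ?mul1r ?mulN1r; lia.
Qed.

Lemma absz_smsf (n : int) : n != 0 -> `|smsf n|%N = sf `|n|.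
Proof. by move=> n0; rewrite /smsf abszM absz_nat; case: sgzP n0 => // _ _; rewrite mul1n. Qed.

(** For fixed [B] and [m], [N = m k^2] reads [A^2 - m k^2 = 4 b B^2], a Pell equation with nonzero
    right side. One [U] covers the logarithm, two cover the divisor numbers. *)
Lemma pell_fiber (b : int) (E : nat) : b != 0 -> exists C : nat, (0 < C)%N /\
  forall (U : nat) (B m : int), (0 < U)%N -> B \in rng (U ^ E) -> B != 0 ->
  (count (fun A => (Nf b A B != 0) && (smsf (Nf b A B) == m)) (rng (U ^ E)) <= C * U ^ 3)%N.
Proof.
move=> b0; pose K0 := (1 + 4 * `|b|)%N.
have [C1 [C10 H1]] := tau_leq (4 * `|b|) (2 * E).
pose K3 := (2 * K0 ^ 3)%N.
exists (9 * (K3 + 6 * E).+1 * (3 * C1) * C1)%N; split=> [|U B m U0 BT B0].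
  by rewrite !muln_gt0 C10.
set T := (U ^ E)%N in BT *; have T0 : (0 < T)%N by rewrite expn_gt0 U0.
rewrite -size_filter; set u := filter _ _.
have Hu A : A \in u -> [/\ A \in rng T, Nf b A B != 0 & smsf (Nf b A B) = m].
  by rewrite mem_filter => /andP[/andP[-> /eqP->] ->].
have [->//|[A0 A0u]] : u = [::] \/ exists t, t \in u.
  by case: (u) => [|x v]; [left|right; exists x; rewrite mem_head].
pose Z := (K0 * T ^ 2)%N.
have m0 : m != 0.
  have [_ N0 <-] := Hu _ A0u; rewrite -absz_eq0 absz_smsf // -lt0n sf_gt0 //.
have n00 : 4 * b * B ^+ 2 != 0 by rewrite !mulf_neq0 ?expf_neq0.
have absn0 : (`|(4 * b * B ^+ 2)%R| <= 4 * `|b| * U ^ (2 * E))%N.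
  rewrite abszM abszX abszM leq_mul2l; apply/orP; right; rewrite mulnC expnM leq_expr //.
  by move: BT; rewrite mem_rng.
have tau1 := H1 U _ U0 absn0.
pose h (A : int) := (A, (sqpart `|Nf b A B|)%:Z).
have Hle A : A \in u -> (`|A| <= Z)%N /\ (sqpart `|Nf b A B| <= Z)%N.
  move=> /Hu[AT N0 _]; have N0' : (0 < `|Nf b A B|)%N by rewrite absz_gt0.
  have TZ : (T <= Z)%N.
    by rewrite /Z /K0 -mulnn mulnA -{1}[T]mul1n leq_mul // muln_gt0 T0.
  split; first by move: AT; rewrite mem_rng => /leq_trans; apply.
  apply: leq_trans (Nf_bound b AT BT); rewrite {2}(sfE N0') -mulnn.
  by rewrite mulnA leq_pmull // muln_gt0 sf_gt0 sqpart_gt0.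
have mZ : (`|m| <= Z)%N.
  have [AT N0 <-] := Hu _ A0u; rewrite absz_smsf //.
  apply: leq_trans (sf_leq _) (Nf_bound b AT BT); by rewrite absz_gt0.
have szu : (size u <= 9 * (trunc_log 2 (2 * Z ^ 3)).+1 * (3 * size (divisors `|(4 * b * B ^+ 2)%R|)) *
                      size (divisors `|(4 * b * B ^+ 2)%R|))%N.
  rewrite -(size_map h); apply: (@pell_count m) => //.
  - by rewrite map_inj_uniq ?filter_uniq ?rng_uniq // => x y [].
  - move=> g; have [_ N0 <-] := Hu _ A0u => gd; apply: (@sf_square_dvd `|Nf b A0 B|).
    by move: gd; rewrite dvdz_eq abszM absz_smsf.
  move=> _ /mapP[A Au ->] /=; have [AT N0 <-] := Hu _ Au; have [h1 h2] := Hle _ Au.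
  by split=> //; rewrite -smsfE // /Nf; ring.
apply: leq_trans szu _.
have logU : ((trunc_log 2 (2 * Z ^ 3)).+1 <= (K3 + 6 * E).+1 * U)%N.
  apply: trunc_log_leqU => //; rewrite /Z expnMn mulnA leq_mul2l /T -!expnM.
  by apply/orP; right; rewrite leq_pexp2l //; lia.
have -> : (9 * (K3 + 6 * E).+1 * (3 * C1) * C1 * U ^ 3 =
           9 * ((K3 + 6 * E).+1 * U) * (3 * (C1 * U)) * (C1 * U))%N by ring.
by rewrite !leq_mul.
Qed.

Lemma sum_rng_abs (g : nat -> nat) (M : nat) :
  (\sum_(m <- rng M) (if m == 0 then 0 else g `|m|) <= 2 * \sum_(1 <= k < M.+1) g k)%N.
Proof.
elim: M => [|M IH]; first by rewrite /rng /itv /= big_seq1 big_geq.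
have -> : (\sum_(m <- rng M.+1) (if m == 0 then 0 else g `|m|) =
   \sum_(m <- [:: M.+1%:Z, - M.+1%:Z & rng M]) (if m == 0 then 0 else g `|m|))%N.
  apply: perm_big; apply: uniq_perm; first exact: rng_uniq.
    apply/and3P; split; [|by rewrite mem_rng; lia|exact: rng_uniq].
    by rewrite inE mem_rng; lia.
  by move=> x; rewrite mem_rng in_cons in_cons mem_rng; lia.
rewrite big_cons big_cons (big_nat_recr M.+1) //= mulnDr addnA addnC leq_add //.
by rewrite mul2n -addnn.
Qed.

(** Sort the [A] for each [B] by the signed squarefree part [m]: each [m] occurs [O(U^3)] times by
    [pell_fiber], and the harmonic sum of [W / m] costs a further [U]. The weight [1 / sf N] is what
    working in residue classes modulo the squarefree part will save. *)
Lemma sum_small_sf (b : int) (E : nat) : b != 0 -> exists C : nat, (0 < C)%N /\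
  forall (U M W : nat), (0 < U)%N -> (M <= U ^ E)%N ->
  (\sum_(A <- rng (U ^ E)) \sum_(B <- rng (U ^ E))
     (if [&& B != 0, Nf b A B != 0 & (sf `|Nf b A B| <= M)%N] then W %/ sf `|Nf b A B| else 0)
   <= C * U ^ 4 * U ^ E * W)%N.
Proof.
move=> b0; have [C [C0 HC]] := pell_fiber E b0.
exists (6 * C * E.+2)%N; split=> [|U M W U0 MT]; first by rewrite !muln_gt0 C0.
set T := (U ^ E)%N in MT *; have T0 : (0 < T)%N by rewrite expn_gt0 U0.
rewrite exchange_big /=.
apply: (@leq_trans (\sum_(B <- rng T) (2 * C * U ^ 3 * (W * (E.+2 * U))))); last first.
  rewrite sum_const_seq size_rng.
  apply: (@leq_trans (3 * T * (2 * C * U ^ 3 * (W * (E.+2 * U))))); first by rewrite leq_mul2r; apply/orP; right; lia.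
  by apply/eq_leq; ring.
rewrite big_seq [X in (_ <= X)%N]big_seq; apply: leq_sum => B BT.
have [B0|B0] := eqVneq B 0; first by rewrite big1.
apply: (@leq_trans (\sum_(m <- rng M) (if m == 0 then 0 else (W %/ `|m|) * (C * U ^ 3)))%N).
  apply: (@leq_trans (\sum_(A <- rng T) \sum_(m <- rng M)
     (if [&& m != 0, Nf b A B != 0 & smsf (Nf b A B) == m] then W %/ `|m| else 0))%N).
    apply: leq_sum => A _; case: ifP => // /and3P[_ N0 sM].
    rewrite (big_rem (smsf (Nf b A B))) /=; last by rewrite mem_rng absz_smsf.
    have s0 : smsf (Nf b A B) != 0 by rewrite -absz_eq0 absz_smsf // -lt0n sf_gt0.
    by rewrite s0 N0 eqxx absz_smsf // leq_addr.
  rewrite exchange_big /=; apply: leq_sum => m _; case: eqVneq => [_|m0] /=.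
    by rewrite big1.
  rewrite -big_mkcond big_const_seq iter_addn_0 leq_mul2l; apply/orP; right.
  exact: HC.
apply: leq_trans (sum_rng_abs (fun k => (W %/ k * (C * U ^ 3))%N) M) _.
rewrite -big_distrl /=.
have h := sum_div_harmonic_leq W M.
have h2 : ((trunc_log 2 M).+1 <= E.+2 * U)%N.
  by have := @trunc_log_leqU 1 E U M U0; rewrite mul1n add1n; apply.
apply: (@leq_trans (2 * ((W * (E.+2 * U)) * (C * U ^ 3)))%N).
  rewrite leq_mul2l leq_mul2r; apply/orP; right; apply/orP; right.
  by apply: leq_trans h _; rewrite leq_mul2l h2 orbT.
by apply/eq_leq; ring.
Qed.

Lemma prod_sub_leq (l1 l2 : seq nat) : uniq l1 -> uniq l2 -> {subset l1 <= l2} ->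
  (forall p, p \in l2 -> (0 < p)%N) -> (\prod_(p <- l1) p <= \prod_(p <- l2) p)%N.
Proof.
move=> u1 u2 s12 pos; rewrite [X in (_ <= X)%N](bigID (mem l1)) /=.
have -> : (\prod_(p <- l2 | p \in l1) p = \prod_(p <- l1) p)%N.
  rewrite -big_filter; apply: perm_big; apply: uniq_perm; rewrite ?filter_uniq // => p.
  by rewrite mem_filter; case p1: (p \in l1) => //=; rewrite s12.
by rewrite leq_pmulr // big_seq_cond; apply: prodn_cond_gt0 => p /andP[/pos].
Qed.

Lemma prod_primes_dvd (ps : seq nat) n : uniq ps -> all prime ps ->
  (forall p, p \in ps -> (p %| n)%N) -> (\prod_(p <- ps) p %| n)%N.
Proof.
elim: ps => [|p ps IH] /=; first by rewrite big_nil dvd1n.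
move=> /andP[pps ups] /andP[pp pr] H; rewrite big_cons Gauss_dvd.
  by rewrite H ?mem_head // IH // => q qps; rewrite H // inE qps orbT.
have := @coprime_prod_pfactor p ps (fun=> 1%N) 1 pp pr pps; rewrite expn1.
by under eq_bigr do rewrite expn1.
Qed.

(** Primes dividing [C0] are those at which the bound on residue classes may fail; dropping them
    costs only the factor [C0]. *)
Definition oddp_off (C0 n : nat) : seq nat := [seq p <- oddp n | ~~ (p %| C0)%N].

Lemma sf_leq_off C0 n : (0 < C0)%N -> (sf n <= C0 * \prod_(p <- oddp_off C0 n) p)%N.
Proof.
move=> C00; rewrite /sf (bigID (fun p => (p %| C0)%N)) /= /oddp_off big_filter leq_mul2r.
apply/orP; right; rewrite -big_filter; apply: dvdn_leq => //; apply: prod_primes_dvd.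
- by rewrite filter_uniq ?oddp_uniq.
- by apply/allP => p; rewrite mem_filter => /andP[_]; apply: (allP (oddp_prime n)).
- by move=> p; rewrite mem_filter => /andP[].
Qed.

Lemma exp_size_leq_prod (ps : seq nat) (x : nat) : (forall p, p \in ps -> (x <= p)%N) ->
  (x ^ size ps <= \prod_(p <- ps) p)%N.
Proof. by move=> H; rewrite -prod_const_seq; apply: leq_prod_seq. Qed.

(** Counted down from the last scale with [2 ^ i <= v], the exponents are at least 0, 1, 2, ..., so
    the sum is at most [2 W]; at most four further scales contribute [W] each. *)
Lemma sum_geometric_scales (W v I : nat) : (0 < v)%N -> (I <= trunc_log 2 v + 5)%N ->
  (\sum_(i < I) W %/ 2 ^ (v %/ 2 ^ i) <= 6 * W)%N.
Proof.
move=> v0; set i0 := trunc_log 2 v => Ii.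
apply: (@leq_trans (\sum_(i < i0.+1 + 4) W %/ 2 ^ (v %/ 2 ^ i))).
  rewrite addSnnS -(subnKC Ii) big_split_ord /= -[X in (X <= _)%N]addn0 leq_add //.
rewrite big_split_ord /= (_ : 6 * W = 2 * W + 4 * W)%N; last by rewrite -mulnDl.
apply: leq_add; last first.
  apply: (@leq_trans (\sum_(i < 4) W)%N); last by rewrite sum_nat_const card_ord.
  by apply: leq_sum => i _; rewrite leq_div.
apply: leq_trans (sum_div_expn2 i0.+1 W).
rewrite (reindex_inj rev_ord_inj) /=; apply: leq_sum => i _.
rewrite leq_div2l ?expn_gt0 // leq_exp2l // subSS.
apply: (@leq_trans (2 ^ i)); first exact/ltnW/ltn_expl.
rewrite leq_divRL ?expn_gt0 // -expnD.
have ii0 : (i <= i0)%N by rewrite -ltnS.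
by rewrite subnKC // trunc_logP.
Qed.

(** Chooses the moduli. On scale [i] only the primes above [2 ^ (2 ^ i)] are kept, roughly
    [log N / 2 ^ i] at most; [ps] belongs to the largest scale at which their product still reaches
    [T / C0]. If that is the last scale the number of primes is bounded. Otherwise scale [i + 1]
    fails, so the primes of [N] below [2 ^ (2 ^ i.+1)] have product at least [Y ^ 2]; [rankin] makes
    such pairs so rare that the weight [Gam ^ size ps] is bounded on average. *)
Lemma sum_weights_large_sf (b : int) (C0 Gam : nat) : (0 < C0)%N -> (0 < Gam)%N ->
  exists C : nat, (0 < C)%N /\
  forall Y, (1 < Y)%N -> let T := (Y ^ 20)%N in exists wt : int -> int -> nat,
   (forall A B, A \in rng T -> B \in rng T -> Nf b A B != 0 -> (Y ^ 22 <= sf `|Nf b A B|)%N ->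
      exists ps, [/\ uniq ps, {subset ps <= oddp `|Nf b A B|}, forall p, p \in ps -> ~~ (p %| C0)%N,
                     (T <= C0 * \prod_(p <- ps) p)%N & (Gam ^ size ps <= wt A B)%N]) /\
   (\sum_(A <- rng T) \sum_(B <- rng T) wt A B <= C * T ^ 2)%N.
Proof.
(* The 40 is the exponent in [|N| <= K0 Y ^ 40]: scale [i] carries about [40 v / 2 ^ i] primes, so
   Rankin's factor [1 + G = 2 Gam ^ 40] outweighs [Gam ^ size ps] and leaves [2 ^ (v / 2 ^ i)] for
   summing over the scales. *)
move=> C00 G0; pose K0 := (1 + 4 * `|b|)%N; pose G := (2 * Gam ^ 40).-1.
have GE : (1 + G = 2 * Gam ^ 40)%N by rewrite add1n prednK // muln_gt0 expn_gt0 G0.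
have [CG [CG0 rk]] := rankin b G.
exists (9 * Gam ^ (K0 + 12) + 6 * (Gam ^ (K0 + 80) * CG))%N.
split=> [|Y Y1 T]; first by rewrite addn_gt0 muln_gt0 expn_gt0 G0.
have Y0 : (0 < Y)%N by apply: ltnW.
have T0 : (0 < T)%N by rewrite expn_gt0 Y0.
pose v := trunc_log 2 Y; have v0 : (0 < v)%N by apply: trunc_log_max.
have Yv : (Y < 2 ^ v.+1)%N by apply: trunc_log_ltn.
(* Scales stop at [Y ^ 18] because [rankin] requires [2 ^ J * 2 ^ a <= T = Y ^ 20], with [2 ^ J] up
   to [Y ^ 2]. *)
pose PI i := (2 ^ (2 * 2 ^ i) <= Y ^ 18)%N.
have exPI : exists i, PI i.
  by exists 0; rewrite /PI; apply: (@leq_trans (2 ^ 18)%N) => //; rewrite leq_expr.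
have bndPI i : PI i -> (i <= Y ^ 18)%N.
  move=> h; apply: leq_trans h; apply: ltnW; apply: leq_ltn_trans (ltn_expl _ _); last by [].
  by apply: leq_trans (ltnW (ltn_expl i (isT : 1 < 2)%N)) _; rewrite leq_pmull.
case: (ex_maxnP exPI bndPI) => I PII maxI.
have PIlt i : (i <= I)%N -> PI i.
  by move=> iI; apply: leq_trans PII; rewrite leq_exp2l // leq_mul2l leq_exp2l.
have notPI : (Y ^ 18 < 2 ^ (2 * 2 ^ I.+1))%N by rewrite ltnNge; apply/negP => /maxI; rewrite ltnn.
pose J := trunc_log 2 (Y ^ 2).
(* Bound for the number of primes kept on scale [i]. On the last scale it is [K0 + 12], since [Y ^
   40 <= (Y ^ 18) ^ 3 < 2 ^ (12 * 2 ^ I)]. *)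
pose ex i := (K0 + 80 + 40 * (v %/ 2 ^ i))%N.
pose wt A B := (Gam ^ (K0 + 12) + \sum_(i < I) Gam ^ ex i * smooth_bad b (2 * 2 ^ i) J A B)%N.
exists wt; split.
  move=> A B AT BT N0 sfY; set n := `|Nf b A B|%N in sfY *.
  have n0 : (0 < n)%N by rewrite absz_gt0.
  have nK : (n <= K0 * Y ^ 40)%N.
    by apply: leq_trans (Nf_bound b AT BT) _; rewrite leq_mul2l /T -expnM leqnn orbT.
  pose ps i := [seq p <- oddp_off C0 n | (2 ^ (2 ^ i) <= p)%N].
  have off_prime : all prime (oddp_off C0 n).
    by apply/allP => p; rewrite mem_filter => /andP[_]; apply: (allP (oddp_prime n)).
  have ups i : uniq (ps i) by do 2!apply: filter_uniq; apply: oddp_uniq.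
  have sub i : {subset ps i <= oddp n}.
    by move=> p; rewrite mem_filter => /andP[_]; rewrite mem_filter => /andP[].
  have offC i p : p \in ps i -> ~~ (p %| C0)%N.
    by rewrite mem_filter => /andP[_]; rewrite mem_filter => /andP[].
  have prn i : (\prod_(p <- ps i) p <= n)%N.
    apply: leq_trans (sf_leq n0); apply: prod_sub_leq; rewrite ?oddp_uniq //.
    by move=> p /(allP (oddp_prime n))/prime_gt0.
  pose good i := (T <= C0 * \prod_(p <- ps i) p)%N.
  pose QI i := good i && (i <= I)%N.
  have exQ : exists i, QI i.
    exists 0; rewrite /QI andbT /good.
    have -> : ps 0 = oddp_off C0 n.
      by apply/all_filterP/allP => p /(allP off_prime)/prime_gt1.
    apply: leq_trans (sf_leq_off n C00); apply: leq_trans sfY.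
    by rewrite leq_pexp2l.
  have bndQ i : QI i -> (i <= I)%N by case/andP.
  case: (ex_maxnP exQ bndQ) => i /andP[gi iI] maxi; exists (ps i); split=> //.
    exact: offC.
  have sz : (2 ^ (2 ^ i * size (ps i)) <= n)%N.
    apply: leq_trans (prn i); rewrite expnM; apply: exp_size_leq_prod => p.
    by rewrite mem_filter => /andP[].
  have K02 : (K0 <= 2 ^ K0)%N by apply/ltnW/ltn_expl.
  have [eqI|ltI] : i = I \/ (i < I)%N by lia.
    apply: leq_trans (leq_addr _ _); rewrite leq_pexp2l //.
    have i20 : (0 < 2 ^ i)%N by rewrite expn_gt0.
    rewrite -(leq_pmul2l i20) -(@leq_exp2l 2) //; apply: leq_trans sz _; apply: leq_trans nK _.
    rewrite mulnDr expnD leq_mul //.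
      by apply: leq_trans K02 _; rewrite leq_exp2l // leq_pmull.
    apply: (@leq_trans ((Y ^ 18) ^ 3)%N); first by rewrite -expnM leq_pexp2l.
    apply: (@leq_trans ((2 ^ (2 * 2 ^ I.+1)) ^ 3)%N); first by rewrite leq_expr // ltnW.
    by rewrite -expnM leq_exp2l // eqI expnS; lia.
  have ngood : ~~ good i.+1.
    by apply/negP => g1; have := maxi i.+1; rewrite /QI g1 ltI ltnn => /(_ isT).
  have bad : smooth_bad b (2 * 2 ^ i) J A B.
    rewrite /smooth_bad -expnS -big_filter; set L := filter _ _.
    pose sm := [seq p <- oddp_off C0 n | ~~ (2 ^ (2 ^ i.+1) <= p)%N].
    have m0E : (\prod_(p <- oddp_off C0 n) p = \prod_(p <- ps i.+1) p * \prod_(p <- sm) p)%N.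
      by rewrite (bigID (fun p => (2 ^ (2 ^ i.+1) <= p)%N)) /= !big_filter.
    apply: (@leq_trans (\prod_(p <- sm) p)%N); last first.
      apply: prod_sub_leq.
      - by do 2!apply: filter_uniq; apply: oddp_uniq.
      - by rewrite filter_uniq ?primes_lt_uniq.
      - move=> p; rewrite /sm mem_filter -ltnNge => /andP[pl poff].
        rewrite mem_filter mem_primes_lt pl (allP off_prime _ poff) !andbT dvdz_eq.
        by move: poff; rewrite !mem_filter mem_primes => /andP[_ /andP[_ /and3P[]]].
      - by move=> p; rewrite mem_filter mem_primes_lt => /andP[_ /andP[/prime_gt0]].
    apply: (@leq_trans (Y ^ 2)%N); first by apply: trunc_logP; rewrite ?expn_gt0 ?Y0.
    rewrite -(leq_pmul2l T0) -expnD; apply: leq_trans sfY _; apply: leq_trans (sf_leq_off n C00) _.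
    rewrite m0E mulnA leq_mul2r; apply/orP; right; rewrite ltnW // ltnNge; exact: ngood.
  apply: leq_trans (leq_addl _ _); rewrite (bigD1 (Ordinal ltI)) //= bad muln1.
  apply: leq_trans (leq_addr _ _); rewrite leq_pexp2l //.
  have a0 : (0 < 2 ^ i)%N by rewrite expn_gt0.
  have ar : (2 ^ i * size (ps i) <= K0 + 40 * v.+1)%N.
    rewrite -(@leq_exp2l 2) //; apply: leq_trans sz _; apply: leq_trans nK _.
    by rewrite expnD leq_mul // mulnC expnM leq_expr // ltnW.
  rewrite -(leq_pmul2l a0); apply: leq_trans ar _; rewrite /ex.
  have va : (v <= 2 ^ i * (v %/ 2 ^ i).+1)%N by rewrite ltnW // mulnC ltn_ceil.
  move: (v %/ 2 ^ i)%N va a0 => q; move: (2 ^ i)%N => a va a0.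
  have aK : (K0 <= a * K0)%N by rewrite leq_pmull.
  have -> : (a * (K0 + 80 + 40 * q) = a * K0 + 80 * a + 40 * (a * q))%N by ring.
  rewrite mulnS in va; move: aK va a0; move: (a * K0)%N (a * q)%N => z w; clear; lia.
pose W := (Gam ^ (K0 + 80) * CG * T ^ 2)%N.
pose cnt i := (\sum_(A <- rng T) \sum_(B <- rng T) smooth_bad b (2 * 2 ^ i) J A B)%N.
have cntW i : (i < I)%N -> (Gam ^ ex i * cnt i <= W %/ 2 ^ (v %/ 2 ^ i))%N.
  move=> iI; rewrite leq_divRL ?expn_gt0 //.
  have JY : (2 ^ J <= Y ^ 2)%N by apply: trunc_logP; rewrite ?expn_gt0 ?Y0.
  have := rk (2 * 2 ^ i)%N J T; rewrite muln_gt0 expn_gt0 => /(_ isT).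
  have JT : (2 ^ J * 2 ^ (2 * 2 ^ i) <= T)%N.
    by rewrite /T (_ : 20 = 2 + 18)%N // expnD leq_mul //; apply: PIlt; apply: ltnW.
  move=> /(_ JT); rewrite -/(cnt i) GE => h.
  have Jv : (v %/ 2 ^ i <= J %/ (2 * 2 ^ i))%N.
    rewrite divnMA leq_div2r // leq_divRL // mulnC; apply: trunc_log_max => //.
    by rewrite mulnC expnM leq_expr // trunc_logP.
  apply: (@leq_trans (Gam ^ (K0 + 80) * (cnt i * (2 * Gam ^ 40) ^ (v %/ 2 ^ i)))%N).
    rewrite /ex expnD expnMn (expnM Gam 40); move: (cnt i) (Gam ^ (K0 + 80))%N => x y.
    move: (v %/ 2 ^ i)%N => q.
    by move: ((Gam ^ 40) ^ q)%N (2 ^ q)%N => z w; apply/eq_leq; ring.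
  rewrite /W -mulnA leq_mul2l; apply/orP; right; apply: leq_trans h.
  by rewrite leq_mul2l leq_pexp2l ?orbT // muln_gt0 expn_gt0 G0.
have -> : (\sum_(A <- rng T) \sum_(B <- rng T) wt A B =
     \sum_(A <- rng T) \sum_(B <- rng T) Gam ^ (K0 + 12) + \sum_(i < I) Gam ^ ex i * cnt i)%N.
  rewrite /wt; under eq_bigr do rewrite big_split /=.
  rewrite big_split /=; congr (_ + _)%N.
  under eq_bigr do rewrite exchange_big /=.
  rewrite exchange_big /=; apply: eq_bigr => i _; rewrite /cnt big_distrr /=.
  by apply: eq_bigr => A _; rewrite big_distrr.
rewrite mulnDl leq_add //.
  rewrite !sum_const_seq size_rng mulnA [X in (_ <= X)%N]mulnAC leq_mul2r.
  apply/orP; right; have h : (T.*2.+1 <= 3 * T)%N by lia.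
  by apply: leq_trans (leq_mul h h) _; apply/eq_leq; ring.
apply: (@leq_trans (\sum_(i < I) W %/ 2 ^ (v %/ 2 ^ i))%N).
  by apply: leq_sum => i _; apply: cntW.
apply: leq_trans (sum_geometric_scales W v0 _) _; last by rewrite /W mulnA.
case: I PII {maxI PIlt notPI wt cnt cntW} => [|i] PII; first by [].
have v2 : (v < 2 ^ (trunc_log 2 v).+1)%N by apply: trunc_log_ltn.
have h1 : (2 * 2 ^ i.+1 < 18 * v.+1)%N.
  rewrite -(@ltn_exp2l 2) //; apply: leq_ltn_trans PII _; rewrite [(18 * _)%N]mulnC expnM.
  by rewrite ltn_exp2r.
have h2 : (2 ^ i < 2 ^ (trunc_log 2 v + 5))%N.
  move: h1 v2; rewrite expnS expnD expnS (_ : 2 ^ 5 = 32)%N //.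
  by move: (2 ^ i)%N (2 ^ trunc_log 2 v)%N => x y; lia.
by move: h2; rewrite ltn_exp2l.
Qed.

Lemma count_close (L T : nat) (P : pred int) :
  (forall x y, x \in rng T -> y \in rng T -> P x -> P y -> (`|x - y| < L)%N) ->
  (count P (rng T) <= 2 * L)%N.
Proof.
move=> H; rewrite -size_filter; case e: (filter P (rng T)) => [|x s] //.
have xin : x \in filter P (rng T) by rewrite e mem_head.
rewrite -e -(size_itv (x - L%:Z) (2 * L)); apply: uniq_leq_size.
  by rewrite filter_uniq ?rng_uniq.
move=> y; move: xin; rewrite !mem_filter mem_itv => /andP[Px xT] /andP[Py yT].
by have := H x y xT yT Px Py; lia.
Qed.

Lemma count_dvd_rng (d T : nat) : (0 < d)%N ->
  (count (fun x : int => (d %| `|x|)%N) (rng T) <= T.*2.+1 %/ d + 1)%N.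
Proof.
move=> d0; apply: leq_trans (count_resid (- T%:Z) T.*2.+1 0 d0).
by apply: sub_count => x /=; rewrite -dvdz_eq => /dvdz_mod0P->.
Qed.

Lemma gcdn_leq_sum (k m : nat) : (0 < k)%N ->
  (gcdn k m <= \sum_(d <- divisors k) (if (d %| m)%N then d else 0))%N.
Proof.
move=> k0; rewrite (bigD1_seq (gcdn k m)) ?divisors_uniq //=; last by rewrite -dvdn_divisors ?dvdn_gcdl.
by rewrite dvdn_gcdr leq_addr.
Qed.

Lemma sum_gcd_rng (k T : nat) : (0 < k)%N ->
  (\sum_(B <- rng T) gcdn k `|B| <= size (divisors k) * (T.*2.+1 + k))%N.
Proof.
move=> k0.
apply: (@leq_trans (\sum_(B <- rng T) \sum_(d <- divisors k) (if (d %| `|B|)%N then d else 0))%N).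
  by apply: leq_sum => B _; apply: gcdn_leq_sum.
rewrite exchange_big -sum_const_seq /= big_seq [X in (_ <= X)%N]big_seq.
apply: leq_sum => d; rewrite -dvdn_divisors // => dk.
have d0 : (0 < d)%N by apply: dvdn_gt0 dk.
rewrite -big_mkcond big_const_seq iter_addn_0.
apply: leq_trans (leq_mul (leqnn d) (count_dvd_rng T d0)) _.
by rewrite mulnDr muln1 leq_add ?(dvdn_leq k0 dk) // mulnC leq_trunc_div.
Qed.

(** Gives the multiplicity [G] in [sqrt_mod_count] for the modulus [k ^ 2] and [c = 4 b B^2]; the
    gcd is small on average over [B]. *)
Lemma sqr_dvd_mul4 (b B : int) (g k : nat) : b != 0 -> (0 < k)%N -> (g ^ 2 %| k ^ 2)%N ->
  ((g ^ 2)%N%:Z %| 4 * (4 * b * B ^+ 2))%Z -> (g <= 4 * `|b| * gcdn k `|B|)%N.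
Proof.
move=> b0 k0; rewrite dvdn_pexp2r // => gk; rewrite dvdz_eq => h.
have h2 : (g ^ 2 %| (4 * `|b| * `|B|) ^ 2)%N.
  have -> : ((4 * `|b| * `|B|) ^ 2 = `|b| * `|(4 * (4 * b * B ^+ 2))%R|)%N.
    rewrite abszM abszM abszM abszX (_ : `|4|%N = 4) //.
    by move: (`|b|)%N (`|B|)%N => x y; ring.
  by rewrite dvdn_mull.
rewrite dvdn_pexp2r // in h2; have b40 : (0 < 4 * `|b|)%N by rewrite muln_gt0 absz_gt0.
apply: dvdn_leq; first by rewrite muln_gt0 b40 gcdn_gt0 k0.
by rewrite muln_gcdr dvdn_gcd h2 dvdn_mull.
Qed.

(** For equal signs [|x + y| >= |x - y|], so [|x - y| >= 2 M] would give [|x^2 - y^2| >= 4 M^2],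
    whereas it is less than [2 M^2]. *)
Lemma close_small_Nf (b B x y : int) (M : nat) : (`|Nf b x B| < M ^ 2)%N -> (`|Nf b y B| < M ^ 2)%N ->
  (0 <= x) = (0 <= y) -> (`|x - y| < 2 * M)%N.
Proof.
move=> h1 h2 sg; rewrite ltnNge; apply/negP => h.
have hx : (`|x ^+ 2 - y ^+ 2| < 2 * M ^ 2)%N.
  have -> : x ^+ 2 - y ^+ 2 = Nf b x B - Nf b y B by rewrite /Nf; ring.
  by apply: leq_ltn_trans (leq_abszB _ _) _; rewrite mul2n -addnn -addnS leq_add // ltnW.
have hy : ((2 * M) ^ 2 <= `|x ^+ 2 - y ^+ 2|)%N.
  rewrite subr_sqr abszM -mulnn leq_mul //; apply: leq_trans h _.
  case: (ltrP x 0) sg => h0; case: (ltrP y 0) => h3; lia.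
by move: hy hx; rewrite expnMn; move: (M ^ 2)%N (`|_|%N) => u v; lia.
Qed.

(** Either [|N| < Y ^ 32], which leaves [O(Y ^ 16)] values of [A] for each [B], or [N] is divisible
    by a large square [k ^ 2]; then [A] is a square root of [4 b B^2] modulo [k ^ 2], and the counts
    are summed over [B] and [k]. The result is smaller than [T ^ 2 = Y ^ 40] by a power of [Y]. *)
Lemma count_medium_sf (b : int) (f : nat) : b != 0 -> exists C : nat, (0 < C)%N /\
  forall U Y T : nat, (0 < U)%N -> Y = (U ^ f)%N -> T = (Y ^ 20)%N ->
  (\sum_(A <- rng T) \sum_(B <- rng T)
     [&& Nf b A B != 0, (Y ^ 18 <= sf `|Nf b A B|)%N & (sf `|Nf b A B| < Y ^ 22)%N]
   <= C * U ^ 3 * Y ^ 36)%N.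
Proof.
move=> b0; pose K0 := (1 + 4 * `|b|)%N.
have K00 : (0 < K0)%N by [].
have [C1 [C10 H1]] := tau_leq (K0 ^ 2) (22 * f).
have [C2 [C20 H2]] := tau_leq K0 (11 * f).
pose C3 := (5 * `|b| * C2 * (3 + K0) * C1)%N.
exists (24 + C3 * (3 * (K0 + 11 * f).+1 + K0))%N; split; first by [].
move=> U Y T U0 YE TE.
have Y0 : (0 < Y)%N by rewrite YE expn_gt0 U0.
have T0 : (0 < T)%N by rewrite TE expn_gt0 Y0.
(* The range of the square part [k]: [|N| >= Y ^ 32] and [sf N < Y ^ 22] force [k > Y ^ 5], while
   [|N| <= K0 Y ^ 40] and [sf N >= Y ^ 18] force [k ^ 2 <= K0 Y ^ 22]. *)
pose J := index_iota (Y ^ 5).+1 (K0 * Y ^ 11).+1.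
apply: (@leq_trans (\sum_(A <- rng T) \sum_(B <- rng T)
   ((`|Nf b A B| < (Y ^ 16) ^ 2)%N + \sum_(k <- J) ((k ^ 2)%N%:Z %| Nf b A B)%Z))%N).
  rewrite big_seq [X in (_ <= X)%N]big_seq; apply: leq_sum => A AT.
  rewrite big_seq [X in (_ <= X)%N]big_seq; apply: leq_sum => B BT.
  case: and3P => // -[N0 s1 s2]; case: ltnP => //= Nb; rewrite add0n.
  set n := `|Nf b A B|%N in s1 s2 Nb; have n0 : (0 < n)%N by rewrite absz_gt0.
  have nK := Nf_bound b AT BT; rewrite -/n -/K0 in nK.
  have nE := sfE n0; set k := sqpart n in nE.
  have k1 : (Y ^ 5 < k)%N.
    rewrite -(@ltn_exp2r _ _ 2) // -expnM; rewrite nE in Nb.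
    have s0 : (0 < Y ^ 22)%N by rewrite expn_gt0 Y0.
    rewrite -(ltn_pmul2l s0) -expnD; rewrite -expnM in Nb.
    apply: leq_ltn_trans Nb _; rewrite ltn_pmul2r // expn_gt0.
    by have := sqpart_gt0 n0; rewrite -/k => ->.
  have k2 : (k <= K0 * Y ^ 11)%N.
    rewrite -(@leq_exp2r _ _ 2) // expnMn -expnM.
    have s0 : (0 < Y ^ 18)%N by rewrite expn_gt0 Y0.
    rewrite -(leq_pmul2l s0); apply: (@leq_trans n); first by rewrite nE leq_mul2r s1 orbT.
    apply: leq_trans nK _; rewrite TE -expnM mulnCA -expnD leq_mul2r.
    by apply/orP; right; rewrite -mulnn leq_pmulr.
  rewrite (bigD1_seq k) /=; [|by rewrite mem_index_iota k1 ltnS|exact: iota_uniq].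
  by rewrite dvdz_eq -/n nE dvdn_mull.
rewrite exchange_big /=; under eq_bigr do rewrite big_split /=.
rewrite big_split /= mulnDl mulnDl leq_add //.
  apply: (@leq_trans (\sum_(B <- rng T) (8 * Y ^ 16))%N); last first.
    rewrite sum_const_seq size_rng; apply: (@leq_trans (3 * T * (8 * Y ^ 16))%N).
      by rewrite leq_mul2r; apply/orP; right; lia.
    by rewrite TE (_ : 36 = 20 + 16)%N // expnD mulnACA leq_mul // leq_pmulr // expn_gt0 U0.
  apply: leq_sum => B _; rewrite sum_bool_count -size_filter -(count_predC (fun A : int => 0 <= A)) !count_filter.
  rewrite (_ : 8 * Y ^ 16 = 2 * (2 * Y ^ 16) + 2 * (2 * Y ^ 16))%N; last by lia.
  apply: leq_add; apply: count_close => x y _ _ /andP[x1 x2] /andP[y1 y2]; apply: close_small_Nf x2 y2 _.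
    by rewrite x1 y1.
  by move: x1 y1 => /= /negPf-> /negPf->.
under eq_bigr do rewrite exchange_big /=.
rewrite exchange_big /=.
pose Q := (C3 * U ^ 2 * T)%N.
apply: (@leq_trans (\sum_(k <- J) (3 * Y ^ 15 %/ k * Q + Q))%N).
  rewrite big_seq [X in (_ <= X)%N]big_seq; apply: leq_sum => k.
  rewrite mem_index_iota ltnS => /andP[k1 k2]; have k0 : (0 < k)%N by apply: leq_trans k1.
  have kU : (k <= K0 * U ^ (11 * f))%N by rewrite (mulnC 11) expnM -YE.
  have kU2 : (k ^ 2 <= K0 ^ 2 * U ^ (22 * f))%N.
    apply: leq_trans (leq_expr 2 kU) _; rewrite expnMn -expnM; apply/eq_leq; congr (_ * _ ^ _)%N; lia.
  have t1 := H1 U _ U0 kU2; have t2 := H2 U _ U0 kU.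
  rewrite -[X in (_ * Q + X)%N]mul1n -mulnDl.
  apply: (@leq_trans (\sum_(B <- rng T) (3 * Y ^ 15 %/ k + 1) * (5 * `|b| * (C1 * U)) * gcdn k `|B|)%N).
    apply: leq_sum => B _; rewrite sum_bool_count.
    have k20 : (0 < k ^ 2)%N by rewrite expn_gt0 k0.
    apply: leq_trans (count_modcl _ _ _ k20) _; rewrite -mulnA leq_mul //.
      rewrite leq_add2r -mulnn divnMA leq_div2r //.
      apply: (@leq_trans (3 * T %/ Y ^ 5)%N).
        apply: leq_trans (leq_div2l _ _ (ltnW k1)) _; rewrite ?expn_gt0 ?Y0 // leq_div2r //.
        by move: T0; clear; lia.
      by rewrite TE (_ : 20 = 15 + 5)%N // expnD mulnA mulnK // expn_gt0 Y0.
    apply: leq_trans (@sqrt_mod_count (k ^ 2) (4 * `|b| * gcdn k `|B|) (4 * b * B ^+ 2) _ k20 _ _) _.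
    - by move=> g g1 g2; apply: sqr_dvd_mul4 g2.
    - by move=> A; rewrite mem_filter => /andP[].
    rewrite [X in (_ <= X)%N](_ : _ = (5 * `|b| * gcdn k `|B|) * (C1 * U))%N; last by ring.
    rewrite leq_mul //.
    have : (0 < `|b| * gcdn k `|B|)%N by rewrite muln_gt0 absz_gt0 b0 gcdn_gt0 k0.
    by rewrite -!mulnA; move: (_ * _)%N => u; lia.
  rewrite -big_distrr /= -mulnA leq_mul //.
  apply: leq_trans (leq_mul (leqnn _) (sum_gcd_rng T k0)) _.
  apply: (@leq_trans (5 * `|b| * (C1 * U) * (C2 * U * ((3 + K0) * T)))%N); last by rewrite /Q /C3; apply/eq_leq; ring.
  rewrite leq_mul // leq_mul // mulnDl leq_add //; first by lia.
  by apply: leq_trans k2 _; rewrite leq_mul // TE leq_pexp2l.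
rewrite big_split /= -big_distrl /= sum_const_seq size_iota -mulnDl.
have sJ : (\sum_(k <- J) 3 * Y ^ 15 %/ k <= 3 * Y ^ 15 * ((K0 + 11 * f).+1 * U))%N.
  apply: leq_trans (leq_trans (sum_div_harmonic_leq (3 * Y ^ 15) (K0 * Y ^ 11)) _).
    have [h|h] := leqP (K0 * Y ^ 11).+1 (Y ^ 5).+1; first by rewrite /J big_geq.
    have h1 : (1 <= (Y ^ 5).+1)%N by [].
    by rewrite (big_cat_nat h1 (ltnW h)) /= leq_addl.
  by rewrite leq_mul // trunc_log_leqU // YE -expnM [(f * 11)%N]mulnC.
apply: (@leq_trans ((3 * (K0 + 11 * f).+1 + K0) * (U * Y ^ 15) * Q)%N); last first.
  rewrite /Q (_ : 36 = 20 + 15 + 1)%N // !expnD -TE expn1.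
  apply: (@leq_trans (C3 * (3 * (K0 + 11 * f).+1 + K0) * U ^ 3 * (T * Y ^ 15) * 1)%N); first by apply/eq_leq; ring.
  by rewrite -!mulnA !leq_mul.
rewrite leq_mul // mulnDl leq_add //.
  by apply: leq_trans sJ _; apply/eq_leq; ring.
rewrite subSS; apply: leq_trans (leq_subr _ _) _; rewrite leq_mul //.
by rewrite (leq_trans (leq_pexp2l Y0 (isT : 11 <= 15)%N)) // leq_pmull.
Qed.

End NormForm.

(** * Families of square values *)

Section SquareFibers.
Local Open Scope ring_scope.

Lemma count_class_pieces (D L T M : nat) (Q : pred int) (rho : int) : (0 < D)%N -> (0 < L)%N -> (D <= T)%N ->
  (forall a, (count (fun x : int => Q (x * D%:Z + rho)%R) (itv a L) <= M)%N) ->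
  (count (fun t => Q t && ((t %% D%:Z)%Z == rho)) (rng T) <= M * (3 * T %/ (D * L) + 1))%N.
Proof.
move=> D0 L0 DT HM; pose a0 := ((- T%:Z) %/ D%:Z)%Z.
have D0' : D%:Z != 0 :> int by rewrite eqz_nat -lt0n.
have Dp : 0 < D%:Z :> int by rewrite ltz_nat.
pose f (t : int) := (`|(t %/ D%:Z)%Z - a0| %/ L)%N.
have rngE t : t \in rng T -> a0 <= (t %/ D%:Z)%Z /\ (`|(t %/ D%:Z)%Z - a0| <= 3 * T %/ D)%N.
  rewrite mem_rng => tT.
  have h1 : a0 <= (t %/ D%:Z)%Z by rewrite /a0 lez_pdiv2r ?ler0n //; lia.
  split=> //; rewrite leq_divRL //.
  have := divz_eq t D%:Z; have := divz_eq (- T%:Z) D%:Z; rewrite -/a0.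
  have := modz_ge0 t D0'; have := modz_ge0 (- T%:Z) D0'.
  have := ltz_pmod t Dp; have := ltz_pmod (- T%:Z) Dp.
  move: (_ %% _)%Z (_ %% _)%Z (t %/ _)%Z h1 => r1 r2 q h1 l1 l2 l3 l4 e1 e2.
  have h : (q - a0) * D%:Z <= 3 * T%:Z by rewrite mulrBl; lia.
  have h2 : 0 <= (q - a0) * D%:Z by rewrite mulr_ge0 // subr_ge0.
  have -> : (`|(q - a0)%R| * D = `|((q - a0) * D%:Z)%R|)%N by rewrite abszM absz_nat.
  by move: ((q - a0) * D%:Z) h h2 => z; clear; lia.
rewrite -(size_iota 0 (3 * T %/ (D * L) + 1)).
apply: (@count_fiber _ _ f) => [t tT _|j _].
  rewrite mem_iota add0n addn1 ltnS divnMA leq_div2r //.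
  by case: (rngE t tT).
apply: leq_trans (HM (a0 + (j * L)%N%:Z)); rewrite -!size_filter.
rewrite -[X in (X <= _)%N](size_map (fun t => (t %/ D%:Z)%Z)); apply: uniq_leq_size.
  rewrite map_inj_in_uniq ?filter_uniq ?rng_uniq // => t t'.
  rewrite !mem_filter => /andP[/andP[/andP[_ /eqP h1] _] _] /andP[/andP[/andP[_ /eqP h2] _] _] h.
  by rewrite (divz_eq t D%:Z) (divz_eq t' D%:Z) h1 h2 h.
move=> _ /mapP[t + ->]; rewrite !mem_filter -andbA => /andP[/andP[Qt /eqP tr] /andP[/eqP ft tT]].
rewrite -{1}tr -divz_eq Qt /= mem_itv.
have [h1 _] := rngE t tT.
have := divn_eq `|(t %/ D%:Z)%Z - a0| L; have := ltn_pmod `|(t %/ D%:Z)%Z - a0| L0.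
rewrite -/(f t) ft; move: (_ %% _)%N => r; move: (t %/ _)%Z h1 => q h1; move: (j * L)%N => jl.
lia.
Qed.

Lemma nonsquare_comp (P : {poly int}) (D rho : int) : D != 0 ->
  (forall Y : {poly rat}, map_poly intr P != Y ^+ 2) ->
  forall Y : {poly rat}, map_poly intr (P \Po (D *: 'X + rho%:P)) != Y ^+ 2.
Proof.
move=> D0 H Y; apply/negP => /eqP e.
have D0' : (D%:~R : rat) != 0 by rewrite intr_eq0.
case/negP: (H (Y \Po (D%:~R^-1 *: ('X - (rho%:~R)%:P)))); apply/eqP.
rewrite -rmorphXn /= -e map_comp_poly -comp_polyA.
suff -> : map_poly intr (D *: 'X + rho%:P) \Po (D%:~R^-1 *: ('X - (rho%:~R)%:P)) = 'X :> {poly rat}.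
  by rewrite comp_polyXr.
rewrite rmorphD /= map_polyZ map_polyX map_polyC /= comp_polyD comp_polyZ comp_polyX comp_polyC.
by rewrite scalerA divff // scale1r subrK.
Qed.

Lemma size_comp_linear (P : {poly int}) (D rho : int) :
  (size (P \Po (D *: 'X + rho%:P)) <= size P)%N.
Proof.
have [->|P0] := eqVneq P 0; first by rewrite comp_poly0.
have s2 : (size (D *: 'X + rho%:P)%R <= 2)%N.
  rewrite (leq_trans (size_polyD _ _)) // geq_max (leq_trans (size_scale_leq _ _)) ?size_polyX //.
  by rewrite (leq_trans (size_polyC_leq1 _)).
have sP : (0 < size P)%N by rewrite size_poly_gt0.
rewrite (leq_trans (size_comp_poly_leq _ _)) // -[X in (_ <= X)%N](prednK sP) ltnS.
rewrite -[X in (_ <= X)%N]muln1 leq_mul //.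
by move: (size _) s2 => s; lia.
Qed.

Lemma prod_split_dvd (ps : seq nat) (m : nat) : uniq ps -> all prime ps ->
  (\prod_(p <- ps) p <= \prod_(p <- [seq p <- ps | ~~ (p %| m)%N]) p * gcdn (\prod_(p <- ps) p) m)%N.
Proof.
move=> ups pr; rewrite {1}(bigID (fun p => (p %| m)%N)) /= mulnC big_filter leq_mul //.
apply: dvdn_leq; first by rewrite gcdn_gt0 prod_primes_gt0.
rewrite -big_filter; apply: prod_primes_dvd; first by rewrite filter_uniq.
  by apply/allP => p; rewrite mem_filter => /andP[_ /(allP pr)].
move=> p; rewrite mem_filter dvdn_gcd => /andP[-> pps]; rewrite andbT.
by rewrite (big_rem p) //= dvdn_mulr.
Qed.

(** * Square values for one pair [(A, B)]: congruences and determinant method combined *)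

Section Local.
Variables (I : eqType) (S : seq I) (lc : I -> nat) (c T G : nat) (X : I -> pred int).
Hypothesis lc0 : forall s, s \in S -> (0 < lc s)%N.
Hypothesis Hg : forall g, (0 < g)%N -> (\sum_(s <- S) gcdn g (lc s) <= G * size (divisors g))%N.
Hypothesis T0 : (0 < T)%N.
Hypothesis c0 : (0 < c)%N.
Variable ps : seq nat.
Hypothesis ups : uniq ps.
Hypothesis prps : all prime ps.
Hypothesis H1 : forall s p ts, s \in S -> p \in ps -> ~~ (p %| lc s)%N ->
  (forall t, t \in ts -> t \in rng T /\ X s t) -> uniq (map (modz^~ p%:Z) ts) -> (size ts <= c)%N.

(** A prime dividing the leading coefficient [lc s] need not restrict [t], so it is dropped from the
    modulus. The loss is [gcdn M (lc s)], which [Hg] controls on average over [s]. *)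
Let pss s := [seq p <- ps | ~~ (p %| lc s)%N].
Let Ds s := (\prod_(p <- pss s) p)%N.
Let M := (\prod_(p <- ps) p)%N.

Let M0 : (0 < M)%N. Proof. exact: prod_primes_gt0. Qed.
Let pss_prime s : all prime (pss s).
Proof. by apply/allP => p; rewrite mem_filter => /andP[_ /(allP prps)]. Qed.
Let Ds0 s : (0 < Ds s)%N. Proof. exact: prod_primes_gt0. Qed.

Lemma ncl_fiber s : s \in S ->
  (ncl (modz^~ (Ds s)%:Z) (filter (X s) (rng T)) <= c ^ size ps)%N.
Proof.
move=> sS; apply: (@leq_trans (c ^ size (pss s))%N); last first.
  by rewrite leq_pexp2l // size_filter count_size.
apply: ncl_crt; [by rewrite filter_uniq|exact: pss_prime|] => p; rewrite mem_filter => /andP[pl pps].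
apply: ncl_leq => ts tss uts; apply: (H1 sS pps pl _ uts) => t /tss.
by rewrite mem_filter => /andP[].
Qed.

Lemma size_S_leq : (size S <= G)%N.
Proof.
have := @Hg 1 isT; rewrite muln1.
by under eq_bigr do rewrite gcd1n; rewrite sum_const_seq muln1.
Qed.

Lemma gcd_sum_2c : (c ^ size ps * \sum_(s <- S) gcdn M (lc s) <= (2 * c) ^ size ps * G)%N.
Proof.
apply: leq_trans (leq_mul (leqnn _) (Hg M0)) _.
apply: leq_trans (leq_mul (leqnn _) (leq_mul (leqnn _) (size_divisors_sqfree prps))) _.
by rewrite expnMn; apply/eq_leq; ring.
Qed.

(** For each [s] there are at most [c ^ size ps] classes, each with at most [3 T / Ds s + 1]
    elements. Multiplying by [M <= Ds s * gcdn M (lc s)] and averaging the gcd brings in the number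
    of divisors of [M], at most [2 ^ size ps]; hence the base [2 * c]. *)
Lemma fiber_sum_bound :
  ((\sum_(s <- S) count (X s) (rng T)) * M <= (2 * c) ^ size ps * G * (3 * T + M))%N.
Proof.
rewrite big_distrl.
apply: (@leq_trans (\sum_(s <- S) c ^ size ps * (3 * T * gcdn M (lc s) + M))%N).
  rewrite big_seq [X in (_ <= X)%N]big_seq; apply: leq_sum => s sS.
  apply: (@leq_trans ((T.*2.+1 %/ Ds s + 1) * (c ^ size ps) * M)%N).
    rewrite leq_mul2r; apply/orP; right.
    apply: leq_trans (count_modcl _ _ _ (Ds0 s)) _; rewrite leq_mul2l.
    by rewrite [X in _ || X]ncl_fiber // orbT.
  rewrite mulnAC mulnC leq_mul2l; apply/orP; right; rewrite mulnDl mul1n leq_add2r.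
  apply: leq_trans (leq_mul (leqnn _) (prod_split_dvd (lc s) ups prps)) _.
  rewrite mulnA leq_mul2r; apply/orP; right; apply: leq_trans (leq_trunc_div _ _) _.
  by move: T0; clear; lia.
rewrite -big_distrr /= big_split /= -big_distrr /= sum_const_seq mulnDr mulnDr leq_add //.
  by rewrite mulnCA [X in (_ <= X)%N]mulnC leq_mul2l gcd_sum_2c orbT.
rewrite mulnA leq_mul2r; apply/orP; right; rewrite leq_mul ?size_S_leq //.
by rewrite leq_expr // leq_pmull.
Qed.

Variables (Exc : pred I) (d kap K CB EB V : nat).
Hypothesis BP : forall (P : {poly int}) (a : int) (Q : pred int) (y : int -> nat),
  (size P <= d.+1)%N -> (forall Y : {poly rat}, map_poly intr P != Y ^+ 2) ->
  (forall t, t \in itv a (V ^ EB) -> Q t ->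
      P.[t] = (y t)%:Z ^+ 2 /\ (y t <= K * (V ^ EB) ^ kap)%N) ->
  (count Q (itv a (V ^ EB)) <= CB * V ^ EB.-1)%N.
Hypothesis V0 : (0 < V)%N.
Hypothesis EB0 : (0 < EB)%N.
Hypothesis TM : (M * V ^ EB <= T)%N.
Hypothesis H2 : forall s, s \in S -> ~~ Exc s -> (exists2 t, t \in rng T & X s t) ->
  exists (P : {poly int}) (y : int -> nat), [/\ (size P <= d.+1)%N, forall Y : {poly rat}, map_poly intr P != Y ^+ 2 &
     forall t, t \in rng T -> X s t -> P.[t] = (y t)%:Z ^+ 2 /\ (y t <= K * (V ^ EB) ^ kap)%N].

(** Both savings at once: inside a class modulo [Ds s] put [t = Ds s * x + rho] and apply the
    determinant method in [x], on intervals of length [V ^ EB]. The gain is [M * V], up to the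
    gcd. *)
Lemma fiber_count_BP s : s \in S -> ~~ Exc s ->
  (count (X s) (rng T) * M * V <= c ^ size ps * (4 * CB * T) * gcdn M (lc s))%N.
Proof.
move=> sS ex; case: (boolP (has (X s) (rng T))) => [/hasP hX|]; last first.
  by rewrite has_count -leqNgt leqn0 => /eqP->.
have [P [y [szP nsq HP]]] := H2 sS ex hX.
have DM : (Ds s <= M)%N.
  apply: prod_sub_leq; rewrite ?filter_uniq // => p; first by rewrite mem_filter => /andP[].
  by move/(allP prps)/prime_gt0.
have L0 : (0 < V ^ EB)%N by rewrite expn_gt0 V0.
have DLT : (Ds s * V ^ EB <= T)%N by apply: leq_trans TM; rewrite leq_mul2r DM orbT.
have DT : (Ds s <= T)%N by apply: leq_trans DLT; rewrite leq_pmulr.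
have VE : (V * V ^ EB.-1 = V ^ EB)%N by rewrite -expnS prednK.
have cls : (count (X s) (rng T) <= CB * V ^ EB.-1 * (3 * T %/ (Ds s * V ^ EB) + 1) * c ^ size ps)%N.
  apply: leq_trans (leq_mul (leqnn _) (ncl_fiber sS)); apply: count_ncl => rho.
  pose X' t := X s t && (t \in rng T).
  have -> : count (fun x => X s x && ((x %% Ds s)%Z == rho)) (rng T) =
            count (fun x => X' x && ((x %% Ds s)%Z == rho)) (rng T).
    by apply: eq_in_count => t tT; rewrite /X' tT andbT.
  apply: count_class_pieces => // a.
  apply: (BP (P := P \Po ((Ds s)%:Z *: 'X + rho%:P)) (y := fun x => y (x * (Ds s)%:Z + rho))).
  - by apply: leq_trans (size_comp_linear _ _ _) szP.
  - by apply: nonsquare_comp => //; rewrite eqz_nat -lt0n.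
  move=> x _ /andP[Xx xT]; rewrite horner_comp !hornerE mulrC; exact: HP.
apply: (@leq_trans (CB * V ^ EB.-1 * (3 * T %/ (Ds s * V ^ EB) + 1) * c ^ size ps *
                    (Ds s * gcdn M (lc s)) * V)%N).
  by rewrite leq_mul2r !leq_mul ?orbT //; apply: prod_split_dvd.
apply: (@leq_trans (CB * c ^ size ps * gcdn M (lc s) * ((3 * T %/ (Ds s * V ^ EB) + 1) * (Ds s * V ^ EB)))%N).
  by rewrite -VE; apply/eq_leq; ring.
rewrite [X in (_ <= X)%N](_ : _ = CB * c ^ size ps * gcdn M (lc s) * (4 * T))%N; last by ring.
rewrite leq_mul2l mulnDl mul1n; apply/orP; right.
by rewrite (_ : 4 * T = 3 * T + T)%N ?leq_add ?leq_trunc_div //; lia.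
Qed.

Lemma fiber_sum_BP :
  ((\sum_(s <- S | ~~ Exc s) count (X s) (rng T)) * M * V <= (2 * c) ^ size ps * (4 * CB * T) * G)%N.
Proof.
rewrite !big_distrl.
apply: (@leq_trans (\sum_(s <- S) c ^ size ps * (4 * CB * T) * gcdn M (lc s))%N).
  rewrite big_mkcond big_seq [X in (_ <= X)%N]big_seq; apply: leq_sum => s sS.
  by case: ifP => // ex; apply: fiber_count_BP.
rewrite -big_distrr /= mulnAC [X in (_ <= X)%N]mulnAC leq_mul2r.
by rewrite gcd_sum_2c orbT.
Qed.

End Local.

Lemma leq_sum2_seq (J1 J2 : eqType) (r1 : seq J1) (r2 : seq J2) (F1 F2 : J1 -> J2 -> nat) :
  (forall x y, x \in r1 -> y \in r2 -> (F1 x y <= F2 x y)%N) ->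
  (\sum_(x <- r1) \sum_(y <- r2) F1 x y <= \sum_(x <- r1) \sum_(y <- r2) F2 x y)%N.
Proof.
move=> H; rewrite big_seq [X in (_ <= X)%N]big_seq; apply: leq_sum => x xr.
by rewrite big_seq [X in (_ <= X)%N]big_seq; apply: leq_sum => y yr; apply: H.
Qed.

Lemma sum2D (J1 J2 : Type) (r1 : seq J1) (r2 : seq J2) (F1 F2 : J1 -> J2 -> nat) :
  (\sum_(x <- r1) \sum_(y <- r2) (F1 x y + F2 x y) =
   \sum_(x <- r1) \sum_(y <- r2) F1 x y + \sum_(x <- r1) \sum_(y <- r2) F2 x y)%N.
Proof. by rewrite -big_split; apply: eq_bigr => x _; rewrite big_split. Qed.

Lemma sum2M (J1 J2 : Type) (r1 : seq J1) (r2 : seq J2) (F : J1 -> J2 -> nat) (a : nat) :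
  (\sum_(x <- r1) \sum_(y <- r2) (a * F x y) = a * \sum_(x <- r1) \sum_(y <- r2) F x y)%N.
Proof. by rewrite big_distrr; apply: eq_bigr => x _; rewrite big_distrr. Qed.

(* The three ranges of the squarefree part of [Nf b A B] are: at least [T ^ (11/10)], where the
   congruences suffice; at most [T ^ (9/10)], where [X] is treated by the determinant method inside
   the residue classes; and a middle range containing few pairs [(A, B)]. *)
Lemma sum_square_fibers (b : int) (c d kap C0 sg K : nat) : b != 0 -> (0 < c)%N -> (0 < C0)%N ->
  exists C E : nat, (0 < E)%N /\
  forall (U T : nat) (I : eqType) (S : seq I) (lc : I -> nat) (X : int -> int -> I -> pred int)
         (Exc : int -> int -> pred I),
  (0 < U)%N -> T = (U ^ E)%N ->
  (forall g, (0 < g)%N -> (\sum_(s <- S) gcdn g (lc s) <= K * T ^ sg * size (divisors g))%N) ->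
  (forall A B s t, X A B s t -> Nf b A B != 0) ->
  (forall A B s p ts, A \in rng T -> B \in rng T -> s \in S -> prime p -> odd (logn p `|Nf b A B|) ->
     ~~ (p %| C0)%N -> ~~ (p %| lc s)%N -> (forall t, t \in ts -> t \in rng T /\ X A B s t) ->
     uniq (map (modz^~ p%:Z) ts) -> (size ts <= c)%N) ->
  (forall A B s, A \in rng T -> B \in rng T -> s \in S -> ~~ Exc A B s ->
     (exists2 t, t \in rng T & X A B s t) ->
     exists (P : {poly int}) (y : int -> nat),
       [/\ (size P <= d.+1)%N, forall Y : {poly rat}, map_poly intr P != Y ^+ 2 &
           forall t, t \in rng T -> X A B s t -> P.[t] = (y t)%:Z ^+ 2 /\ (y t <= K * T ^ kap)%N]) ->
  (\sum_(A <- rng T) \sum_(B <- rng T) count (Exc A B) S <= K * T ^ sg.+1)%N ->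
  (\sum_(A <- rng T) \sum_(B <- rng T) \sum_(s <- S) count (X A B s) (rng T) <= C * T ^ sg.+2)%N.
Proof.
move=> b0 c0 C00; pose K0 := (1 + 4 * `|b|)%N.
have [CB [EB [CB0 [EB1 BP]]]] := bombieri_pila d (10 * kap) K.
(* With [Y = U ^ f], [T = Y ^ 20] and [V = U ^ 6] one has [V ^ EB = Y ^ 2], so classes modulo at
   most [Y ^ 18] still contain full intervals for the determinant method. The gain [U ^ 6] beats the
   loss [U ^ 5]: [U ^ 4] from [sum_small_sf] and [U] from the number of classes. *)
pose f := (3 * EB)%N; pose E := (20 * f)%N.
have [Cw [Cw0 Hw]] := omega_leq (2 * c) K0 (2 * E).
have [C1 [C10 H1]] := @sum_weights_large_sf b C0 (2 * c) C00 ltac:(by rewrite muln_gt0).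
have [C2 [C20 H2]] := count_medium_sf f b0.
have [C3 [C30 H3]] := sum_small_sf E b0.
pose D1 := (K * (3 * C0 + 1))%N; pose D2 := (4 * C0 * Cw * K)%N.
pose D3 := (4 * C0 * CB * Cw * K)%N.
exists (27 * K + (D1 * C1 + D2 * C2 + (9 * K + 3 * K + C3 * D3)))%N, E; split; first by rewrite /E /f; lia.
move=> U T I S lc X Exc U0 TE Hg HN HI HII HE.
have T0 : (0 < T)%N by rewrite TE expn_gt0 U0.
have szS : (size S <= K * T ^ sg)%N by apply: size_S_leq Hg.
have rngT : (size (rng T) <= 3 * T)%N by rewrite size_rng; move: T0; clear; lia.
have cntT A B : (\sum_(s <- S) count (X A B s) (rng T) <= 3 * K * T ^ sg.+1)%N.
  apply: (@leq_trans (\sum_(s <- S) 3 * T)%N).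
    by apply: leq_sum => s _; apply: leq_trans (count_size _ _) rngT.
  rewrite sum_const_seq; apply: leq_trans (leq_mul szS (leqnn _)) _.
  by rewrite expnS; apply/eq_leq; ring.
(* The choice of moduli requires [Y > 1]. For [U = 1] each range has three elements, and the trivial
   bound accounts for [27 * K]. *)
have [U1|U1] : U = 1%N \/ (1 < U)%N by lia.
  apply: (@leq_trans (\sum_(A <- rng T) \sum_(B <- rng T) 3 * K * T ^ sg.+1)%N).
    by apply: leq_sum2_seq => A B _ _; apply: cntT.
  rewrite !sum_const_seq size_rng TE U1 !exp1n !muln1; set Z := (D1 * C1 + _)%N.
  by move: Z; clear; lia.
pose Y := (U ^ f)%N; pose V := (U ^ 6)%N.
have Y1 : (1 < Y)%N by rewrite -(exp1n f) ltn_exp2r // /f; lia.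
have Y0 : (0 < Y)%N by apply: ltnW.
have V0 : (0 < V)%N by rewrite expn_gt0 U0.
have TY : T = (Y ^ 20)%N by rewrite TE /E mulnC expnM.
have VY : (V ^ EB = Y ^ 2)%N by rewrite /V /Y -!expnM /f; congr (_ ^ _)%N; lia.
have TV : (T ^ kap = (V ^ EB) ^ (10 * kap))%N by rewrite VY TY -!expnM; congr (_ ^ _)%N; lia.
have UY : (U ^ 4 <= Y ^ 2)%N by rewrite /Y -expnM leq_pexp2l //; rewrite /f; lia.
have [wt [wt1 wt2]] := H1 Y Y1.
rewrite /= -TY in wt1 wt2.
pose F A B := (\sum_(s <- S) count (X A B s) (rng T))%N.
pose F' A B := (\sum_(s <- S | ~~ Exc A B s) count (X A B s) (rng T))%N.
pose W := (D3 * U * T ^ sg.+1)%N.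
have oddp_prime' A B p : p \in oddp `|Nf b A B| -> prime p.
  exact: (allP (oddp_prime _)).
have HIp A B ps : A \in rng T -> B \in rng T -> {subset ps <= oddp `|Nf b A B|} ->
   (forall p, p \in ps -> ~~ (p %| C0)%N) ->
   forall s p ts, s \in S -> p \in ps -> ~~ (p %| lc s)%N ->
   (forall t, t \in ts -> t \in rng T /\ X A B s t) -> uniq (map (modz^~ p%:Z) ts) -> (size ts <= c)%N.
  move=> AT BT sub off s p ts sS pps pl Hts uts.
  have po := sub _ pps; apply: (HI A B s p) => //.
  - exact: oddp_prime' po.
  - by rewrite -mem_oddp.
  - exact: off.
have fib A B ps : A \in rng T -> B \in rng T -> uniq ps -> {subset ps <= oddp `|Nf b A B|} ->
   (forall p, p \in ps -> ~~ (p %| C0)%N) ->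
   (F A B * \prod_(p <- ps) p <= (2 * c) ^ size ps * (K * T ^ sg) * (3 * T + \prod_(p <- ps) p))%N.
  move=> AT BT ups sub off; apply: (@fiber_sum_bound _ _ lc c) => //.
    by apply/allP => p /sub/oddp_prime'.
  exact: HIp.
have om A B : A \in rng T -> B \in rng T -> Nf b A B != 0 ->
    ((2 * c) ^ size (oddp_off C0 `|Nf b A B|) <= Cw * U)%N.
  move=> AT BT N0; apply: leq_trans (Hw U `|Nf b A B|%N U0 _).
    rewrite leq_pexp2l ?muln_gt0 // /oddp_off size_filter (leq_trans (count_size _ _)) //.
    by rewrite /oddp size_filter count_size.
  by apply: leq_trans (Nf_bound b AT BT) _; rewrite TE -expnM [(E * 2)%N]mulnC.
(* The ranges are encoded as indicators so that the terms can be summed over pairs separately.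
   [B = 0] stands apart because the Pell equation behind [sum_small_sf] then has right side zero;
   there and for exceptional [s] the trivial bound is used. *)
have ptw A B : A \in rng T -> B \in rng T ->
  (F A B <= D1 * T ^ sg * wt A B +
     (D2 * U * T ^ sg * Y ^ 2 * [&& Nf b A B != 0, (Y ^ 18 <= sf `|Nf b A B|)%N & (sf `|Nf b A B| < Y ^ 22)%N] +
      ((if B == 0 then 3 * K * T ^ sg.+1 else 0) +
       (3 * T * count (Exc A B) S +
       (if [&& B != 0, Nf b A B != 0 & (sf `|Nf b A B| <= Y ^ 18)%N] then F' A B else 0)))))%N.
  move=> AT BT; have [N0|N0] := eqVneq (Nf b A B) 0.
    rewrite {1}/F big1 // => s _; apply/eqP; rewrite -leqn0 leqNgt -has_count; apply/negP.
    by case/hasP => t _ /HN; rewrite N0.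
  set m := sf _; have [m1|m1] := leqP (Y ^ 22) m.
    apply: leq_trans (leq_addr _ _).
    have [ps [ups sub off TM sz]] := wt1 A B AT BT N0 m1.
    have := fib A B ps AT BT ups sub off; set M := (\prod_(p <- ps) p)%N in TM * => h.
    have M0 : (0 < M)%N by move: TM T0; case: (M) => //; rewrite muln0; case: (T).
    rewrite -(leq_pmul2r M0); apply: leq_trans h _.
    apply: (@leq_trans (wt A B * (K * T ^ sg) * (3 * (C0 * M) + M))%N).
      by rewrite leq_mul // ?leq_mul // leq_add2r leq_mul2l TM orbT.
    by rewrite /D1; apply/eq_leq; ring.
  apply: leq_trans (leq_addl _ _).
  pose ps := oddp_off C0 `|Nf b A B|.
  have ups : uniq ps by rewrite /ps /oddp_off filter_uniq // oddp_uniq.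
  have sub : {subset ps <= oddp `|Nf b A B|} by move=> p; rewrite mem_filter => /andP[].
  have off p : p \in ps -> ~~ (p %| C0)%N by rewrite mem_filter => /andP[].
  have sz := om A B AT BT N0; rewrite -/ps in sz.
  have mM := sf_leq_off `|Nf b A B| C00; rewrite -/m -/ps in mM.
  have [m2|m2] := leqP (Y ^ 18) m.
    apply: leq_trans (leq_addr _ _); rewrite /= muln1.
    have := fib A B ps AT BT ups sub off; set M := (\prod_(p <- ps) p)%N in mM * => h.
    have M0 : (0 < M)%N by apply: prod_primes_gt0; apply/allP => p /sub/oddp_prime'.
    have MY : (Y ^ 18 <= C0 * M)%N by apply: leq_trans mM.
    have Z0 : (0 < M * Y ^ 18)%N by rewrite muln_gt0 M0 expn_gt0 Y0.
    rewrite -(leq_pmul2r Z0) mulnA; apply: leq_trans (leq_mul h (leqnn _)) _.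
    apply: (@leq_trans ((Cw * U) * (K * T ^ sg) * ((3 * T + M) * Y ^ 18))%N).
      by rewrite -mulnA leq_mul // leq_mul.
    apply: (@leq_trans ((Cw * U) * (K * T ^ sg) * (4 * C0 * M * Y ^ 20))%N).
      rewrite leq_mul2l; apply/orP; right; rewrite mulnDl.
      rewrite (_ : 4 * C0 * M * Y ^ 20 = 3 * Y ^ 20 * (C0 * M) + C0 * M * Y ^ 20)%N; last by ring.
      have Y18 : (Y ^ 18 <= Y ^ 20)%N by rewrite leq_pexp2l.
      have CM : (M <= C0 * M)%N by rewrite leq_pmull.
      by rewrite TY; apply: leq_add; apply: leq_mul.
    by rewrite /D2 (_ : 20 = 2 + 18)%N // expnD; apply/eq_leq; ring.
  apply: leq_trans (leq_addl _ _).
  have [B0|B0] := eqVneq B 0; first by apply: leq_trans (leq_addr _ _); apply: cntT.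
  rewrite (ltnW m2) add0n.
  have -> : F A B = (\sum_(s <- S | Exc A B s) count (X A B s) (rng T) + F' A B)%N.
    by rewrite /F (bigID (Exc A B)).
  apply: leq_add => //.
  rewrite big_mkcond -sum_bool_count big_distrr; apply: leq_sum => s _.
  case: (Exc A B s) => //; rewrite -[X in (_ <= X)%N]/(3 * T * 1)%N muln1.
  exact: leq_trans (count_size _ _) rngT.
have FpW A B : A \in rng T -> B \in rng T -> Nf b A B != 0 -> (sf `|Nf b A B| <= Y ^ 18)%N ->
    (V * F' A B <= W %/ sf `|Nf b A B|)%N.
  move=> AT BT N0 m2; pose ps := oddp_off C0 `|Nf b A B|.
  have ups : uniq ps by rewrite /ps /oddp_off filter_uniq // oddp_uniq.
  have sub : {subset ps <= oddp `|Nf b A B|} by move=> p; rewrite mem_filter => /andP[].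
  have off p : p \in ps -> ~~ (p %| C0)%N by rewrite mem_filter => /andP[].
  have sz := om A B AT BT N0; rewrite -/ps in sz.
  have mM := sf_leq_off `|Nf b A B| C00; rewrite -/ps in mM.
  have prps : all prime ps by apply/allP => p /sub/oddp_prime'.
  have Msf : (\prod_(p <- ps) p <= Y ^ 18)%N.
    apply: leq_trans m2; apply: prod_sub_leq => //; first exact: oddp_uniq.
    by move=> p /oddp_prime'/prime_gt0.
  have := @fiber_sum_BP _ S lc c T (K * T ^ sg) (X A B) Hg T0 c0 ps ups prps _ (Exc A B) d (10 * kap) K CB EB V.
  rewrite -/(F' A B); set M := (\prod_(p <- ps) p)%N in mM Msf * => h.
  have {h} : (F' A B * M * V <= (2 * c) ^ size ps * (4 * CB * T) * (K * T ^ sg))%N.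
    apply: h => //; first exact: HIp.
    - by move=> P a Q y; apply: BP.
    - exact: ltnW.
    - by rewrite VY TY (_ : 20 = 18 + 2)%N // expnD leq_mul2r Msf orbT.
    by move=> s sS ex hx; rewrite -TV; apply: HII.
  move=> h; rewrite leq_divRL ?sf_gt0 //.
  apply: (@leq_trans (V * F' A B * (C0 * M))%N); first by rewrite leq_mul2l mM orbT.
  apply: (@leq_trans (C0 * (F' A B * M * V))%N); first by apply/eq_leq; ring.
  apply: (@leq_trans (C0 * (Cw * U * (4 * CB * T) * (K * T ^ sg)))%N).
    by rewrite leq_mul2l; apply/orP; right; apply: leq_trans h _; rewrite !leq_mul.
  by rewrite /W /D3 expnS; apply/eq_leq; ring.
apply: leq_trans (leq_sum2_seq ptw) _; rewrite !sum2D mulnDl; apply: leq_trans (leq_addl _ _).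
have TsE : (T ^ sg.+2 = T ^ sg * T ^ 2)%N by rewrite -expnD addn2.
rewrite [X in (_ <= X)%N](_ : _ = D1 * C1 * T ^ sg.+2 + (D2 * C2 * T ^ sg.+2 +
  (9 * K * T ^ sg.+2 + (3 * K * T ^ sg.+2 + C3 * D3 * T ^ sg.+2))))%N; last by ring.
apply: leq_add.
  rewrite sum2M; apply: leq_trans (leq_mul (leqnn _) wt2) _.
  by rewrite TsE; apply/eq_leq; ring.
apply: leq_add.
  rewrite sum2M; apply: leq_trans (leq_mul (leqnn _) (H2 U Y T U0 (erefl _) TY)) _.
  apply: (@leq_trans (D2 * C2 * T ^ sg * (U ^ 4 * (Y ^ 2 * Y ^ 36)))%N); first by apply/eq_leq; ring.
  apply: (@leq_trans (D2 * C2 * T ^ sg * (Y ^ 2 * (Y ^ 2 * Y ^ 36)))%N).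
    by rewrite leq_mul2l leq_mul2r UY !orbT.
  have -> : (Y ^ 2 * (Y ^ 2 * Y ^ 36) = T ^ 2)%N by rewrite TY; move: (Y) => y; rewrite -expnM -!expnD.
  by rewrite TsE mulnA.
apply: leq_add.
  rewrite exchange_big /=.
  apply: (@leq_trans (\sum_(B <- rng T) (if B == 0 then 3 * T * (3 * K * T ^ sg.+1) else 0))%N).
    apply: leq_sum => B _; case: ifP => _; last by rewrite big1.
    by rewrite sum_const_seq leq_mul.
  rewrite -big_mkcond big_const_seq iter_addn_0 count_uniq_mem ?rng_uniq // mem_rng /= muln1.
  by rewrite [in X in (_ <= X)%N]expnS; apply/eq_leq; ring.
apply: leq_add.
  rewrite sum2M; apply: leq_trans (leq_mul (leqnn _) HE) _.
  by rewrite [in X in (_ <= X)%N]expnS; apply/eq_leq; ring.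
have V0' : (0 < U ^ 5)%N by rewrite expn_gt0 U0.
rewrite -(leq_pmul2l V0) -sum2M.
apply: (@leq_trans (C3 * U ^ 4 * T * W)%N).
  have MT : (Y ^ 18 <= U ^ E)%N by rewrite -TE TY leq_pexp2l.
  have := H3 U (Y ^ 18)%N W U0 MT; rewrite -TE; apply: leq_trans.
  apply: leq_sum2_seq => A B AT BT; case: ifP => [/and3P[_ N0 m2]|_]; last by rewrite muln0.
  exact: FpW.
apply: (@leq_trans (C3 * D3 * T ^ sg.+2 * U ^ 5)%N).
  by rewrite /W [(T ^ sg.+2)%N]expnS; apply/eq_leq; ring.
rewrite mulnC leq_mul2r; apply/orP; right.
by rewrite /V leq_pexp2l.
Qed.

End SquareFibers.

(** * The Galois condition *)

Section GaloisCore.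
Local Open Scope ring_scope.

Lemma trace_polyE (n : nat) (b : int) (f g : {poly int}) :
  trace_poly n b f g -> f = cleared n b g.
Proof.
move=> [szg fE]; apply/eqP; rewrite -tofrac_eq; apply/eqP.
by rewrite fE clearedE // szg.
Qed.

Lemma horner_cleared (K : fieldType) (n : nat) (b : int) (g : {poly int}) (x : K) :
  (size g <= n.+1)%N -> x != 0 ->
  (map_poly intr (cleared n b g)).[x] = x ^+ n * (map_poly intr g).[x + b%:~R / x].
Proof.
move=> szg x0; rewrite horner_mulXn //; last exact: leq_trans (size_poly _ _) szg.
rewrite rmorph_sum horner_sum; apply: eq_bigr => i _.
rewrite /= map_polyZ hornerZ coef_map /= !rmorphM /= !rmorphXn /= !rmorphD /= !map_polyXn ?map_polyX map_polyC /=.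
by rewrite !hornerE.
Qed.

Lemma in_alg_intr (L : splittingFieldType rat) (z : int) : in_alg L z%:~R = z%:~R.
Proof. by rewrite rmorph_int. Qed.

Lemma intr_ext_eq0 (L : splittingFieldType rat) (z : int) : (z%:~R == 0 :> L) = (z == 0).
Proof. by rewrite -in_alg_intr fmorph_eq0 intr_eq0. Qed.

Lemma map_poly_in_alg_intr (L : splittingFieldType rat) (f : {poly int}) :
  map_poly intr f = map_poly (in_alg L) (map_poly intr f : {poly rat}).
Proof.
by apply/polyP => i; rewrite !coef_map; symmetry; apply: in_alg_intr.
Qed.

Lemma big_codom_XsubC (K : fieldType) (I : finType) (r : I -> K) :
  \prod_(z <- codom r) ('X - z%:P) = \prod_i ('X - (r i)%:P).
Proof. by rewrite big_image. Qed.

Lemma separable_roots_inj (L : splittingFieldType rat) (I : finType) (f : {poly int}) (r : I -> L) :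
  separable_poly (map_poly intr f : {poly rat}) -> roots_of f r -> injective r.
Proof.
move=> sep rE; apply/injectiveP.
have c0 : (lead_coef f)%:~R != 0 :> L.
  rewrite intr_ext_eq0 lead_coef_eq0; have := separable_poly_neq0 sep.
  by apply: contra_neq => ->; rewrite rmorph0.
have : separable_poly (map_poly intr f : {poly L}) by rewrite map_poly_in_alg_intr separable_map.
by rewrite rE -big_codom_XsubC (eqp_separable (eqp_scale _ c0)) separable_prod_XsubC.
Qed.

Lemma galois_perms_exist (L : splittingFieldType rat) (I : finType) (f : {poly int}) (r : I -> L)
    (tau : gal_of (<<1 & codom r>>%AS)) : injective r -> f != 0 -> roots_of f r ->
  exists s : {perm I}, forall i, tau (r i) = r (s i).
Proof.
move=> rI f0 rE.
have c0 : (lead_coef f)%:~R != 0 :> L by rewrite intr_ext_eq0 lead_coef_eq0.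
have rootP (x : L) : (map_poly intr f).[x] = 0 -> exists i, x = r i.
  move=> h; have : root (\prod_(z <- codom r) ('X - z%:P)) x.
    rewrite big_codom_XsubC; move: h; rewrite rE hornerZ => /eqP.
    by rewrite mulf_eq0 (negPf c0).
  by rewrite root_prod_XsubC => /codomP.
have ex i : exists j, tau (r i) == r j.
  have [j ->] : exists j, tau (r i) = r j; last by exists j.
  apply: rootP; have -> : map_poly intr f = map_poly tau (map_poly intr f : {poly L}).
    by rewrite -map_poly_comp; apply: eq_map_poly => x /=; rewrite rmorph_int.
  rewrite horner_map /= rE -big_codom_XsubC hornerZ.
  have /eqP-> : (\prod_(z <- codom r) ('X - z%:P)).[r i] == 0.
    by rewrite -/(root _ _) root_prod_XsubC codom_f.
  by rewrite mulr0 rmorph0.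
pose s0 i := xchoose (ex i).
have s0E i : tau (r i) = r (s0 i) by apply/eqP/(xchooseP (ex i)).
have s0I : injective s0.
  move=> i j eqs; have : tau (r i) = tau (r j) by rewrite !s0E eqs.
  by move/fmorph_inj/rI.
by exists (perm s0I) => i; rewrite permE.
Qed.

Lemma det_Vandermonde_perm (K : fieldType) (n : nat) (beta : 'I_n -> K) (s : 'S_n) :
  \det (Vandermonde n (\row_i beta (s i))) = (-1) ^+ s * \det (Vandermonde n (\row_i beta i)).
Proof.
have -> : Vandermonde n (\row_i beta (s i)) = col_perm s (Vandermonde n (\row_i beta i)).
  by apply/matrixP => i j; rewrite !mxE.
by rewrite col_permE det_mulmx det_perm mulrC odd_permV.
Qed.

Lemma F2_cases (x : 'F_2) : x = 0 \/ x = 1.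
Proof. by case: x => -[|[|//]] h; [left|right]; apply: val_inj. Qed.

Lemma sign_F2_sum (n : nat) (v : 'I_n -> 'F_2) (e : bool) (K : fieldType) :
  \sum_i v i = e%:R -> \prod_i (-1) ^+ (v i != 0) = (-1) ^+ e :> K.
Proof.
move=> h; pose w i : nat := (v i != 0); have -> : e = odd (\sum_i w i)%N.
  have hv i : v i = (w i)%:R by rewrite /w; case: (F2_cases (v i)) => ->.
  have : e%:R = (\sum_i w i)%N%:R :> 'F_2.
    by rewrite -h natr_sum; apply: eq_bigr => i _; apply: hv.
  move/(congr1 (fun x : 'F_2 => odd x)); by rewrite !val_Fp_nat //= !modn2 !oddb.
by rewrite signr_odd expr_sum.
Qed.

(** Let [del] be the product of the [alpha_i - b / alpha_i] times the Vandermonde determinant of the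
    [beta_i]. Under [(v, sigma)] each [v_i = 1] flips one difference and [sigma] permutes the
    columns, so [del] is multiplied by the sign of [sum v_i] times that of [sigma]. On [G2] these
    cancel: [del] is rational, and its square is the stated product since
    [(alpha - b / alpha)^2 = beta^2 - 4 b]. *)
Lemma galois_core (n : nat) (b : int) (f g : {poly int}) : b != 0 -> breciprocal n b f ->
  separable_poly (map_poly intr f : {poly rat}) -> trace_poly n b f g ->
  galois_group_within b f (G2_group n) ->
  exists (L : splittingFieldType rat) (beta : 'I_n -> L) (k : rat),
    [/\ map_poly intr g = (g`_n)%:~R *: \prod_i ('X - (beta i)%:P), injective beta,
        forall i, beta i ^+ 2 - (4 * b)%:~R != 0 &
        k%:A ^+ 2 = \prod_i (beta i ^+ 2 - (4 * b)%:~R) * (\det (Vandermonde n (\row_i beta i))) ^+ 2].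
Proof.
move=> b0 [szf _] sep tr [L [alpha [rE sub]]].
pose r := pair_roots b alpha; have rI : injective r by apply: separable_roots_inj sep rE.
have bL : b%:~R != 0 :> L by rewrite intr_ext_eq0.
have f0 : f != 0 by rewrite -size_poly_eq0 szf.
have szg : size g = n.+1 by case: tr.
have r0E i : r (i, 0) = alpha i by [].
have r1E i : r (i, 1) = b%:~R / alpha i by [].
have a0 i : alpha i != 0.
  apply/eqP => h; have /rI/(congr1 snd)/eqP : r (i, 0) = r (i, 1) by rewrite r0E r1E h invr0 mulr0.
  by [].
pose beta i := alpha i + b%:~R / alpha i.
have froot k : (map_poly intr f).[r k] = 0.
  rewrite rE -big_codom_XsubC hornerZ.
  have /eqP-> : (\prod_(z <- codom r) ('X - z%:P)).[r k] == 0.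
    by rewrite -/(root _ _) root_prod_XsubC codom_f.
  by rewrite mulr0.
have groot i : root (map_poly intr g) (beta i).
  have := froot (i, 0); rewrite r0E (trace_polyE tr) horner_cleared ?szg // => /eqP.
  by rewrite mulf_eq0 expf_eq0 (negPf (a0 i)) andbF.
have diffE i : (alpha i - b%:~R / alpha i) ^+ 2 = beta i ^+ 2 - (4 * b)%:~R.
  by rewrite /beta rmorphM /=; field; rewrite a0.
have diff0 i : alpha i - b%:~R / alpha i != 0.
  rewrite subr_eq0; apply/eqP => h; have /rI/(congr1 snd)/eqP : r (i, 0) = r (i, 1) by [].
  by [].
have betaI : injective beta.
  move=> i j h; have : (alpha i - alpha j) * (alpha i - b%:~R / alpha j) = 0.
    have -> : (alpha i - alpha j) * (alpha i - b%:~R / alpha j) = alpha i * (beta i - beta j).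
      by rewrite /beta; field; rewrite !a0.
    by rewrite h subrr mulr0.
  move/eqP; rewrite mulf_eq0 !subr_eq0 => /orP[] /eqP h'.
    by have /rI/(congr1 fst) : r (i, 0) = r (j, 0) by [].
  by have /rI/(congr1 snd)/eqP : r (i, 0) = r (j, 1) by [].
exists L, beta.
pose V := \det (Vandermonde n (\row_i beta i)).
pose del := \prod_i (alpha i - b%:~R / alpha i) * V.
pose E := <<1 & codom r>>%AS.
have gal : galois 1 E.
  apply/splitting_galoisField; exists (map_poly intr f); split.
  - apply/polyOverP => i; rewrite coef_map /=; exact: rpred_int.
  - by rewrite map_poly_in_alg_intr separable_map.
  exists (codom r) => //; rewrite rE -big_codom_XsubC eqp_scale //.
  by rewrite intr_ext_eq0 lead_coef_eq0.
have rEin k : r k \in E by apply: seqv_sub_adjoin; apply: codom_f.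
have delE : del \in E.
  rewrite rpredM ?rpred_prod // => [i _|].
    by rewrite rpredB // -?r0E -?r1E.
  rewrite /V det_Vandermonde rpred_prod // => i _; rewrite rpred_prod // => j _.
  by rewrite !mxE /beta rpredB // rpredD // -?r0E -?r1E.
have del1 : del \in 1%VS.
  rewrite -(galois_fixedField gal); apply/(fixedFieldP delE) => tau tauG.
  have [s sE] := galois_perms_exist tau rI f0 rE.
  have /(fintype.subsetP sub)/G2P[v [sg [svE vs]]] : s \in galois_perms (pair_roots b alpha).
    by rewrite inE; apply/existsP; exists tau; rewrite tauG; apply/forallP => i; rewrite sE.
  have ta i : tau (alpha i) = r (sg i, v i) by rewrite -r0E sE svE add0r.
  have tb i : tau (b%:~R / alpha i) = r (sg i, 1 + v i) by rewrite -r1E sE svE.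
  have tbeta i : tau (beta i) = beta (sg i).
    rewrite rmorphD /= ta tb; case: (F2_cases (v i)) => ->; rewrite ?addr0 ?r0E ?r1E //.
    by rewrite (_ : 1 + 1 = 0 :> 'F_2) ?r0E 1?addrC //; apply: val_inj.
  have tdiff i : tau (alpha i - b%:~R / alpha i) = (-1) ^+ (v i != 0) * (alpha (sg i) - b%:~R / alpha (sg i)).
    rewrite rmorphB /= ta tb; case: (F2_cases (v i)) => -> /=.
      by rewrite addr0 r0E r1E expr0 mul1r.
    by rewrite (_ : 1 + 1 = 0 :> 'F_2) ?r0E ?r1E ?expr1 ?mulN1r ?opprB //; apply: val_inj.
  rewrite rmorphM rmorph_prod /= (eq_bigr _ (fun i _ => tdiff i)) big_split /=.
  have -> : \prod_i (alpha (sg i) - b%:~R / alpha (sg i)) = \prod_i (alpha i - b%:~R / alpha i).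
    by rewrite [RHS](reindex_perm sg).
  have -> : tau V = (-1) ^+ sg * V.
    rewrite -det_Vandermonde_perm -det_map_mx; congr (\det _); apply/matrixP => i j.
    by rewrite !mxE rmorphXn /= tbeta.
  by rewrite (sign_F2_sum _ vs) mulrACA -expr2 sqrr_sign mul1r.
have [k kE] := vlineP _ _ del1.
exists k; split=> //.
- have -> : (g`_n)%:~R = lead_coef (map_poly intr g : {poly L}).
    by rewrite lead_coef_map_inj ?rmorph0 // ?lead_coefE ?szg // => x y /eqP; rewrite -subr_eq0 -rmorphB intr_ext_eq0 subr_eq0 => /eqP.
  rewrite -big_codom_XsubC; apply: all_roots_prod_XsubC.
  + rewrite size_map_inj_poly ?rmorph0 // ?szg ?size_codom ?card_ord //.
    by move=> x y /eqP; rewrite -subr_eq0 -rmorphB intr_ext_eq0 subr_eq0 => /eqP.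
  + by apply/allP => _ /codomP[i ->]; apply: groot.
  by rewrite uniq_rootsE; apply/injectiveP.
- by move=> i; rewrite -diffE; apply: expf_neq0; apply: diff0.
by rewrite -kE /del exprMn -prodrXl; congr (_ * _); apply: eq_bigr => i _; rewrite diffE.
Qed.

End GaloisCore.

(** * Resultants in a pencil *)

Section Sylvester.
Local Open Scope ring_scope.

Definition Sylrow (R : comNzRingType) (n m : nat) (W : {poly R}) : 'M[R]_(n, m) :=
  \matrix_(i < n, k < m) ('X^i * W)`_k.

(** Sylvester matrix with formal degrees [d] for [W] and [n] for [g]. They are parameters because
    the true degrees may drop, modulo a prime or when the direction [h] takes the place of [g]. *)
Definition Syl (R : comNzRingType) (n d : nat) (W g : {poly R}) : 'M[R]_(n + d) :=
  col_mx (Sylrow n (n + d) W) (Sylrow d (n + d) g).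

Lemma map_Sylrow (R R' : comNzRingType) (phi : {rmorphism R -> R'}) n m W :
  map_mx phi (Sylrow n m W) = Sylrow n m (map_poly phi W).
Proof.
by apply/matrixP => i k; rewrite !mxE -(map_polyXn phi) -rmorphM coef_map.
Qed.

Lemma map_Syl (R R' : comNzRingType) (phi : {rmorphism R -> R'}) n d W g :
  map_mx phi (Syl n d W g) = Syl n d (map_poly phi W) (map_poly phi g).
Proof. by rewrite map_col_mx !map_Sylrow. Qed.

Lemma SylrowD (R : comNzRingType) n m (W W' : {poly R}) (c : R) :
  Sylrow n m (W + c *: W') = Sylrow n m W + c *: Sylrow n m W'.
Proof. by apply/matrixP => i k; rewrite !mxE mulrDr coefD -scalerAr coefZ. Qed.

Lemma size_mulXn_leq (R : comNzRingType) (W : {poly R}) (i n d : nat) :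
  (i < n)%N -> (size W <= d.+1)%N -> (size ('X^i * W)%R <= n + d)%N.
Proof.
move=> lti szW; rewrite (leq_trans (size_polyMleq _ _)) // size_polyXn /=.
by rewrite (leq_trans (leq_add (leqnn i) szW)) // addnS -addSn leq_add2r.
Qed.

Lemma Sylrow_eval (R : comNzRingType) (n d N : nat) (W : {poly R}) (x : 'I_N -> R) :
  (size W <= d.+1)%N ->
  Sylrow n (n + d) W *m (\matrix_(k < n + d, i < N) x i ^+ k) = \matrix_(r < n, i < N) (x i ^+ r * W.[x i]).
Proof.
move=> szW; apply/matrixP => r i; rewrite !mxE.
have := horner_coef_wide (x i) (size_mulXn_leq (ltn_ord r) szW); rewrite hornerM hornerXn => ->.
by apply: eq_bigr => k _; rewrite !mxE.
Qed.

(** Multiply on the right by the matrix whose first [n] columns evaluate at the [beta i] and whose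
    last [d] columns pick the top coefficients. Its determinant is the Vandermonde determinant. The
    product is block triangular: one diagonal block is the Vandermonde matrix scaled by the
    [W.[beta i]], the other is triangular with [c] on the diagonal. *)
Lemma det_Syl (K : fieldType) (n d : nat) (W g : {poly K}) (c : K) (beta : 'I_n -> K) :
  (size W <= d.+1)%N -> g = c *: \prod_i ('X - (beta i)%:P) -> injective beta ->
  \det (Syl n d W g) = c ^+ d * \prod_i W.[beta i].
Proof.
move=> szW gE bI.
have szg : (size g <= n.+1)%N.
  rewrite gE (leq_trans (size_scale_leq _ _)) //.
  by rewrite size_prod_XsubC -sum1_size sum1_card card_ord.
pose Em := \matrix_(k < n + d, i < n) beta i ^+ k.
pose Fm : 'M[K]_(n + d, d) := col_mx 0 1%:M.
pose V := Vandermonde n (\row_i beta i).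
have V0 : \det V != 0.
  rewrite det_Vandermonde; apply/prodf_neq0 => i _; apply/prodf_neq0 => j ij.
  by rewrite !mxE subr_eq0; apply: contraTneq ij => /bI->; rewrite ltnn.
have detM : \det (row_mx Em Fm) = \det V.
  have -> : Em = col_mx V (dsubmx Em).
    rewrite -[LHS]vsubmxK; congr col_mx; apply/matrixP => i j; by rewrite !mxE.
  by rewrite -block_mxEh det_lblock det1 mulr1.
have g0 i : g.[beta i] = 0.
  by rewrite gE hornerZ horner_prod (bigD1 i) //= hornerXsubC subrr mul0r mulr0.
have SgE : Sylrow d (n + d) g *m Em = 0.
  have := @Sylrow_eval K d n n g beta szg; rewrite addnC => ->.
  by apply/matrixP => r i; rewrite !mxE g0 mulr0.
have SWE : Sylrow n (n + d) W *m Em = V *m diag_mx (\row_i W.[beta i]).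
  rewrite Sylrow_eval //; apply/matrixP => r i; rewrite mul_mx_diag !mxE //.
have gc : g`_n = c.
  rewrite gE coefZ; have quad_cond := monic_prod_XsubC (index_enum 'I_n) xpredT beta.
  have := monicP quad_cond; rewrite lead_coefE size_prod_XsubC -sum1_size sum1_card card_ord /= => ->.
  by rewrite mulr1.
have SgF : \det (Sylrow d (n + d) g *m Fm) = c ^+ d.
  have FE (j j' : 'I_d) : (Sylrow d (n + d) g *m Fm) j j' = ('X^j * g)`_(n + j').
    rewrite -[Sylrow _ _ _]hsubmxK mul_row_col mulmx0 add0r mulmx1 !mxE //.
  rewrite det_trig; last first.
    apply/is_trig_mxP => i j ij; rewrite FE coefXnM ltnNge (leq_trans (ltnW ij) (leq_addl _ _)) /=.
    by rewrite nth_default // (leq_trans szg) //; lia.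
  rewrite (eq_bigr (fun=> c)) ?prodr_const ?card_ord // => i _.
  by rewrite FE coefXnM ltnNge leq_addl /= addnK.
have := det_mulmx (Syl n d W g) (row_mx Em Fm).
rewrite detM /Syl mul_col_row SgE det_ublock SWE det_mulmx det_diag SgF => h.
apply: (mulIf V0); rewrite -h (eq_bigr (fun i => W.[beta i])); last by move=> i _; rewrite mxE.
by rewrite -mulrA mulrC [X in X * _]mulrC.
Qed.

Lemma Syl_ker (K : fieldType) (n d : nat) (W g : {poly K}) :
  (size W <= d.+1)%N -> (size g <= n.+1)%N -> \det (Syl n d W g) = 0 ->
  exists a c : {poly K}, [/\ (size a <= n)%N, (size c <= d)%N, a * W + c * g = 0 & (a != 0) || (c != 0)].
Proof.
move=> szW szg /eqP/det0P[v v0 vS].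
exists (rVpoly (lsubmx v)), (rVpoly (rsubmx v)); split; rewrite ?size_poly //.
  have rowE m (u : 'rV[K]_m) (Q : {poly K}) (k : 'I_(n + d)) :
     (rVpoly u * Q)`_k = (u *m Sylrow m (n + d) Q) 0 k.
    rewrite mxE /rVpoly poly_def mulr_suml coef_sum; apply: eq_bigr => i _.
    by rewrite !mxE -scalerAl coefZ; case: insubP => [j _ /val_inj->|]; rewrite ?ltn_ord.
  apply/polyP => k; rewrite coef0; have [ltk|lek] := ltnP k (n + d).
    have e : (lsubmx v *m Sylrow n (n + d) W + rsubmx v *m Sylrow d (n + d) g) 0 (Ordinal ltk) = 0.
      by rewrite -mul_row_col hsubmxK -/(Syl n d W g) vS mxE.
    by rewrite mxE -!rowE in e; rewrite coefD.
  rewrite coefD !nth_default ?addr0 // (leq_trans _ lek) // (leq_trans (size_polyMleq _ _)) //.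
    have := size_poly d (fun k => if insub k is Some i then rsubmx v 0 i else 0).
    by rewrite -/(rVpoly (rsubmx v)); move: (size _) (size g) szg => s1 s2; lia.
  have := size_poly n (fun k => if insub k is Some i then lsubmx v 0 i else 0).
  by rewrite -/(rVpoly (lsubmx v)); move: (size _) (size W) szW => s1 s2; lia.
apply: contraNT v0; rewrite negb_or !negbK => /andP[/eqP l0 /eqP r0].
by rewrite -[v]hsubmxK -[lsubmx v]rVpolyK -[rsubmx v]rVpolyK l0 r0 !linear0 row_mx0.
Qed.

(** Only one of the formal degrees has to be attained: here that of [g], in [Syl_neq0_l] that of
    [W]. The first form serves modulo [p], where a derivative may lose degree; the second serves for
    [h] of degree below [n]. *)
Lemma Syl_neq0_r (K : fieldType) (n d : nat) (W g : {poly K}) :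
  coprimep W g -> (size W <= d.+1)%N -> size g = n.+1 -> \det (Syl n d W g) != 0.
Proof.
move=> cop szW szg; apply/eqP => /Syl_ker[//||a [c [sza szc ac nz]]]; first by rewrite szg.
have g0 : g != 0 by rewrite -size_poly_eq0 szg.
have a0 : a = 0.
  apply/eqP; apply: contraTT sza => a0; rewrite -ltnNge -szg; apply: dvdp_leq => //.
  rewrite -(Gauss_dvdpl _ (q := W)); last by rewrite coprimep_sym.
  move/eqP: ac; rewrite addr_eq0 => /eqP->; by rewrite dvdpNr dvdp_mull.
move: ac nz; rewrite a0 mul0r add0r eqxx /= => /eqP.
by rewrite mulf_eq0 (negPf g0) orbF => ->.
Qed.

Lemma Syl_neq0_l (K : fieldType) (n d : nat) (W g : {poly K}) :
  coprimep W g -> size W = d.+1 -> (size g <= n.+1)%N -> \det (Syl n d W g) != 0.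
Proof.
move=> cop szW szg; apply/eqP => /Syl_ker[//||a [c [sza szc ac nz]]]; first by rewrite szW.
  by [].
have W0 : W != 0 by rewrite -size_poly_eq0 szW.
have c0 : c = 0.
  apply/eqP; apply: contraTT szc => c0; rewrite -ltnNge -szW; apply: dvdp_leq => //.
  rewrite -(Gauss_dvdpl _ (q := g)) //.
  move/eqP: ac; rewrite addrC addr_eq0 => /eqP->; by rewrite dvdpNr dvdp_mull.
move: ac nz; rewrite c0 mul0r addr0 eqxx orbF => /eqP.
by rewrite mulf_eq0 (negPf W0) orbF => ->.
Qed.

Definition Sylt (R : comNzRingType) n d (W g h : {poly R}) : {poly R} :=
  \det (Syl n d (map_poly polyC W) (map_poly polyC g + 'X *: map_poly polyC h)).

Lemma horner_Sylt (R : comNzRingType) n d (W g h : {poly R}) (t : R) :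
  (Sylt n d W g h).[t] = \det (Syl n d W (g + t *: h)).
Proof.
have cE (p : {poly R}) : map_poly (horner_eval t) (map_poly polyC p) = p.
  by rewrite -map_poly_comp map_poly_id // => x _ /=; rewrite /horner_eval hornerC.
rewrite /Sylt -[LHS]/(horner_eval t _) -det_map_mx map_Syl rmorphD /= map_polyZ !cE.
congr (\det (Syl _ _ _ (_ + _ *: _))); exact: hornerX.
Qed.

Lemma map_Sylt (R R' : comNzRingType) (phi : {rmorphism R -> R'}) n d W g h :
  map_poly phi (Sylt n d W g h) = Sylt n d (map_poly phi W) (map_poly phi g) (map_poly phi h).
Proof.
have cE (p : {poly R}) : map_poly (map_poly phi) (map_poly polyC p) = map_poly polyC (map_poly phi p).
  by rewrite -!map_poly_comp; apply: eq_map_poly => x /=; rewrite map_polyC.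
by rewrite /Sylt -det_map_mx map_Syl rmorphD /= map_polyZ !cE /= map_polyX.
Qed.

(** Multiplying by the inverse of [Syl n d W h] makes the matrix of the pencil block triangular,
    with a nontrivial block equal to [X] times the identity plus a constant matrix: a characteristic
    polynomial, of degree exactly [d]. *)
Lemma size_Sylt (K : fieldType) n d (W g h : {poly K}) :
  \det (Syl n d W h) != 0 -> size (Sylt n d W g h) = d.+1.
Proof.
move=> D0; have Mu : Syl n d W h \in unitmx by rewrite unitmxE unitfE.
pose Q := invmx (Syl n d W h); pose QP := map_mx polyC Q.
have := mulmxV Mu; rewrite -/Q {1}/Syl mul_col_mx (scalar_mx_block n d 1) block_mxEv => /eq_col_mx[SW Sh].
pose G := Sylrow d (n + d) g *m Q.
have detE : Sylt n d W g h * \det QP = char_poly (- rsubmx G).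
  rewrite /Sylt -det_mulmx /Syl SylrowD mul_col_mx mulmxDl -scalemxAl -!map_Sylrow -!map_mxM /=.
  rewrite SW Sh -/G -[G]hsubmxK !map_row_mx !map_scalar_mx /= !raddf0 scale_row_mx add_row_mx scaler0 addr0.
  rewrite -block_mxEv det_lblock det1 mul1r /char_poly; congr (\det _).
  rewrite hsubmxK /char_poly_mx map_mxN opprK addrC; congr (_ + _).
  by rewrite scale_scalar_mx mulr1.
have := size_char_poly (- rsubmx G); rewrite -detE det_map_mx mulrC mul_polyC size_scale //.
by rewrite -unitfE -unitmxE unitmx_inv.
Qed.

Lemma odd_size_nonsquare (P : {poly int}) : ~~ odd (size P) -> P != 0 ->
  forall Y : {poly rat}, map_poly intr P != Y ^+ 2.
Proof.
move=> od P0 Y; apply: contraNneq od => h.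
have inj : injective (intr : int -> rat) by apply: intr_inj.
have szP := size_map_inj_poly inj (rmorph0 _) P.
rewrite -szP h; have Y0 : Y != 0.
  by apply: contra_neq P0 => Y0; apply/eqP; rewrite -size_poly_eq0 -szP h Y0 expr0n size_poly0.
have := size_exp Y 2; rewrite -(prednK (n := size (Y ^+ 2))) ?size_poly_gt0 ?expf_neq0 //= => ->.
by rewrite oddM andbF.
Qed.

Lemma det_norm_bound (m : nat) (M : 'M[int]_m) (B : nat) :
  (forall i j, (`|M i j| <= B)%N) -> (`|\det M| <= m`! * B ^ m)%N.
Proof.
move=> HB; rewrite -(card_Sn m) /determinant.
have lesum (I : finType) (F : I -> int) : (`|(\sum_i F i)%R| <= \sum_i `|F i|)%N.
  apply: (big_ind2 (fun (x : int) (y : nat) => (`|x| <= y)%N)) => // x1 x2 y1 y2 h1 h2.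
  by lia.
apply: leq_trans (lesum _ _) _; rewrite -sum_nat_const; apply: leq_sum => s _.
rewrite abszM abszX /= exp1n mul1n.
have -> : (`|(\prod_i M i (s i))%R| = \prod_i `|M i (s i)|)%N.
  by apply: (big_morph absz) => // x y; rewrite abszM.
rewrite -[m in (B ^ m)%N]card_ord -prod_nat_const; apply: leq_prod => i _; exact: HB.
Qed.

End Sylvester.

(** * Discriminants along a direction *)

Section Directions.
Local Open Scope ring_scope.

Lemma rat_sqr_int (k : rat) (z : int) : k ^+ 2 = z%:~R -> exists y : nat, z = y%:Z ^+ 2.
Proof.
move=> h; exists `|numq k|%N.
have e : numq k ^+ 2 = z * denq k ^+ 2.
  apply: (@intr_inj rat); rewrite !expr2 !intrM -h.
  have -> : k ^+ 2 = ((numq k)%:~R / (denq k)%:~R) ^+ 2 by rewrite divq_num_den.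
  by field; rewrite intr_eq0 denq_neq0.
have d1 : denq k = 1.
  have dd : (`|denq k| %| `|numq k| * `|numq k|)%N.
    by rewrite mulnn -abszX e abszM abszX -mulnn dvdn_mull // dvdn_mulr.
  have cop := coprime_num_den k; rewrite coprime_sym in cop.
  move: dd; rewrite Gauss_dvdr // => dd.
  move/eqP: cop; rewrite (gcdn_idPl dd); have := denq_gt0 k.
  by clear; lia.
by rewrite abszE real_normK ?num_real // e d1 expr1n mulr1.
Qed.

(** The valuation of the square is even, so that of [x] at [p] is odd, hence positive. *)
Lemma odd_logn_dvd (p : nat) (x N : int) (y : nat) : prime p -> odd (logn p `|N|) ->
  x * N = y%:Z ^+ 2 -> (p%:Z %| x)%Z.
Proof.
move=> pp od e; rewrite dvdz_eq; have [->|x0] := eqVneq x 0; first by rewrite dvdn0.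
have N0 : (0 < `|N|)%N by case: (`|N|%N) od => //; rewrite logn0.
have x0' : (0 < `|x|)%N by rewrite absz_gt0.
have := congr1 (fun z : int => odd (logn p `|z|)) e.
rewrite abszM lognM // oddD od abszX lognX oddM /= addbT => /negbFE.
by move/odd_gt0; rewrite logn_gt0 mem_primes => /and3P[].
Qed.

Lemma size_uniq_coprime (T : eqType) (K : fieldType) (ts : seq T) (r : T -> {poly K}) (W : {poly K}) :
  W != 0 -> uniq ts -> (forall t, t \in ts -> (1 < size (r t))%N && (r t %| W)) ->
  (forall t t', t \in ts -> t' \in ts -> t != t' -> coprimep (r t) (r t')) ->
  (size ts <= (size W).-1)%N.
Proof.
move=> W0 uts Hr cop.
have [] : (\prod_(t <- ts) r t %| W) /\ (size ts < size (\prod_(t <- ts) r t)%R)%N.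
  elim: ts uts Hr cop => [|t ts IH] /=; first by rewrite big_nil dvd1p size_poly1.
  case/andP=> tts uts Hr cop; rewrite big_cons.
  have [||h1 h2] := IH uts.
  - by move=> t' h; apply: Hr; rewrite inE h orbT.
  - by move=> t1 t2 h1 h2; apply: cop; rewrite inE ?h1 ?h2 orbT.
  have /andP[s1 s2] := Hr t (mem_head _ _).
  have P0 : \prod_(t <- ts) r t != 0 by rewrite -size_poly_gt0 (leq_ltn_trans _ h2).
  have r0 : r t != 0 by rewrite -size_poly_gt0 (ltn_trans _ s1).
  split; last by rewrite size_mul //; move: (size ts) (size (r t)) (size (\prod_(j <- ts) r j)) s1 h2 => a a' c; clear; lia.
  rewrite Gauss_dvdp ?s2 //.
  rewrite big_seq; apply: (big_ind (fun q => coprimep (r t) q)); first exact: coprimep1.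
    by move=> x y hx hy; rewrite coprimepMr hx.
  move=> t' h; apply: cop; rewrite ?mem_head ?inE ?h ?orbT //.
  by apply: contraNneq tts => ->.
move=> dv sz; have := dvdp_leq W0 dv; move: (size ts) (size W) (size (\prod_(t <- ts) r t)) sz => a a' c; clear; lia.
Qed.

Lemma nonzero_const_coprime (K : fieldType) (p q u v : {poly K}) (k : K) : k != 0 ->
  u * p + v * q = k%:P -> coprimep p q.
Proof.
move=> k0 e; apply/Bezout_coprimepP; exists (u, v) => /=; rewrite e.
by rewrite -size_poly_eq1 size_polyC k0.
Qed.

Lemma monic_shift_coef (R : nzRingType) (g h : {poly R}) (t : R) (n e : nat) :
  size h = e.+1 -> (e < n)%N -> (g + t *: h)`_n = g`_n.
Proof. by move=> sh en; rewrite coefD coefZ [h`_n]nth_default ?mulr0 ?addr0 // sh. Qed.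

(* [Wr (g + t *: h) h] does not depend on [t], so in its Sylvester determinant with [g + t *: h]
   only the rows of the latter involve [t]. *)
Definition Wr (R : nzRingType) (g h : {poly R}) : {poly R} := g^`() * h - h^`() * g.

Lemma Wr_shift (R : comNzRingType) (g h : {poly R}) (t : R) : Wr (g + t *: h) h = Wr g h.
Proof. by rewrite /Wr derivD derivZ mulrDl mulrDr -!scalerAl -!scalerAr opprD; ring. Qed.

Lemma coefM_top (R : comNzRingType) (p q : {poly R}) (i j : nat) :
  (size p <= i.+1)%N -> (size q <= j.+1)%N -> (p * q)`_(i + j) = p`_i * q`_j.
Proof.
move=> sp sq; have li : (i < (i + j).+1)%N by rewrite ltnS leq_addr.
rewrite coefM (bigD1 (Ordinal li)) //= addKn big1 ?addr0 // => k ki.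
have [h|h] := ltnP i k; first by rewrite nth_default ?mul0r // (leq_trans sp).
rewrite [q`_ _]nth_default ?mulr0 // (leq_trans sq) //.
have : k != i :> nat by apply: contraNneq ki => e; apply/eqP/val_inj.
by move: (k : nat) h => m; clear; lia.
Qed.

Lemma size_Wr (R : comNzRingType) (g h : {poly R}) (n e : nat) : (0 < n)%N -> (0 < e)%N ->
  (size g <= n.+1)%N -> (size h <= e.+1)%N -> (size (Wr g h) <= n + e)%N.
Proof.
move=> n0 e0 sg sh; have d1 (p : {poly R}) m : (size p <= m.+1)%N -> (size p^`() <= m)%N.
  by move=> sp; apply: (leq_trans (size_poly _ _)); case: (size p) sp.
rewrite (leq_trans (size_polyD _ _)) // size_polyN geq_max.
have := size_polyMleq g^`() h; have := size_polyMleq h^`() g.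
have := d1 _ _ sg; have := d1 _ _ sh; move: sg sh n0 e0.
move: (size g) (size h) (size g^`()) (size h^`()) (size (h^`() * g)) (size (g^`() * h)).
by clear; lia.
Qed.

Lemma Wr_top (R : comNzRingType) (g h : {poly R}) (n e : nat) : (0 < n)%N -> (0 < e)%N ->
  (size g <= n.+1)%N -> (size h <= e.+1)%N -> h`_e = 1 ->
  (Wr g h)`_(n + e).-1 = (g`_n) *+ n - (g`_n) *+ e.
Proof.
move=> n0 e0 sg sh he; have d1 (p : {poly R}) m : (0 < m)%N -> (size p <= m.+1)%N -> (size p^`() <= m.-1.+1)%N.
  by case: m => // m _ sp; apply: (leq_trans (size_poly _ _)); case: (size p) sp.
rewrite coefB.
have -> : ((n + e).-1 = n.-1 + e)%N by lia.
rewrite (coefM_top (d1 _ _ n0 sg) sh).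
have -> : (n.-1 + e = e.-1 + n)%N by lia.
rewrite (coefM_top (d1 _ _ e0 sh) sg) !coef_deriv !prednK // he mulr1.
by rewrite mulrnAl mul1r.
Qed.

(** If [p] divides the discriminant of [g_t = g0 + t h], then [g_t] and its derivative have a
    nonconstant gcd modulo [p]. It divides the Wronskian of [g0] and [h], which does not depend on
    [t], has degree at most [n + e - 1], and is nonzero modulo [p] because its top coefficient is
    [(n - e)] times that of [g0]. For [t] and [t'] incongruent modulo [p], a common factor of the
    two gcds would divide [h] and its derivative, which are coprime by the Bezout relation. So there
    are at most [n + e - 1] such gcds. *)
Lemma residues_bound (n e p : nat) (h g0 u v : {poly int}) (k : int) (ts : seq int) :
  prime p -> (0 < e < n)%N -> size h = e.+1 -> h`_e = 1 -> u * h + v * h^`() = k%:P ->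
  ~~ (p%:Z %| k)%Z -> ~~ (p %| n - e)%N -> (size g0 <= n.+1)%N -> ~~ (p%:Z %| g0`_n)%Z ->
  (forall t, t \in ts -> (p%:Z %| \det (Syl n n.-1 (g0 + t *: h)^`() (g0 + t *: h)))%Z) ->
  uniq (map (modz^~ p%:Z) ts) -> (size ts <= (n + e).-1)%N.
Proof.
move=> pp /andP[e0 en] sh he bez pk pne sg pc Hts uts.
have n0 : (0 < n)%N by apply: leq_ltn_trans en.
have intr0 (z : int) : (z%:~R == 0 :> 'F_p) = (p%:Z %| z)%Z by apply: intr_Fp_eq0.
pose phi := map_poly (intr : int -> 'F_p).
pose gt t := phi (g0 + t *: h).
have gtE t : gt t = phi g0 + t%:~R *: phi h by rewrite /gt /phi rmorphD /= map_polyZ.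
have szgt t : size (gt t) = n.+1.
  apply/eqP; rewrite eqn_leq; apply/andP; split.
    rewrite (leq_trans (size_poly _ _)) // (leq_trans (size_polyD _ _)) // geq_max sg.
    by rewrite (leq_trans (size_scale_leq _ _)) // sh ltnS ltnW.
  rewrite ltnNge; apply/negP => /leq_sizeP/(_ n (leqnn n)).
  by rewrite /gt /phi coef_map (monic_shift_coef _ _ sh en) /= => /eqP; rewrite intr0 (negPf pc).
have W0 : phi (Wr g0 h) != 0.
  apply/eqP => /(congr1 (fun q : {poly 'F_p} => q`_(n + e).-1)).
  rewrite coef0 coef_map /= (Wr_top n0 e0 sg) ?sh // -mulrnBr ?(ltnW en) //.
  rewrite -mulr_natr rmorphM /= => /eqP; rewrite mulf_eq0 intr0 (negPf pc) /=.
  by rewrite natz intr0 dvdz_eq absz_nat (negPf pne).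
have WE t : phi (Wr g0 h) = (gt t)^`() * phi h - (phi h)^`() * gt t.
  by rewrite -(Wr_shift g0 h t) /Wr /gt /phi rmorphB !rmorphM /= !deriv_map.
pose r t := gcdp (gt t)^`() (gt t).
have ut : uniq ts by apply: map_uniq uts.
have szW : (size (phi (Wr g0 h)) <= n + e)%N.
  by rewrite (leq_trans (size_poly _ _)) // size_Wr // sh.
apply: (@leq_trans (size (phi (Wr g0 h))).-1); last by move: (size _) szW; clear; lia.
apply: (@size_uniq_coprime _ _ ts r) => // [t tts|t t' tts tts' ne].
  have nc : ~~ coprimep (gt t)^`() (gt t).
    apply/negP => cop; have szd : (size (gt t)^`() <= n.-1.+1)%N.
      by rewrite prednK // (leq_trans (size_poly _ _)) // szgt.
    have := Syl_neq0_r cop szd (szgt t).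
    rewrite /gt /phi deriv_map -map_Syl det_map_mx intr0.
    by rewrite Hts.
  have g00 : gt t != 0 by rewrite -size_poly_gt0 szgt.
  have r0 : r t != 0 by rewrite gcdp_eq0 negb_and g00 orbT.
  apply/andP; split.
    rewrite ltn_neqAle size_poly_gt0 r0 andbT eq_sym; apply: contra nc; by rewrite coprimep_def.
  rewrite (WE t); apply: dvdp_sub; [apply: dvdp_mulr|apply: dvdp_mull].
    exact: dvdp_gcdl.
  exact: dvdp_gcdr.
have tt' : (t - t')%:~R != 0 :> 'F_p.
  rewrite intr0; apply: contra ne => d; apply/eqP.
  by apply: (uniq_map_inj uts) => //; apply/eqP; rewrite eqz_mod_dvd.
apply/coprimepP => d; rewrite !dvdp_gcd => /andP[d1 d2] /andP[d3 d4].
have dh : d %| phi h.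
  have : d %| gt t - gt t' by apply: dvdp_sub.
  have -> : gt t - gt t' = (t - t')%:~R *: phi h by rewrite !gtE opprD addrACA subrr add0r -scalerBl rmorphB.
  by rewrite dvdpZr.
have dh' : d %| (phi h)^`().
  have : d %| (gt t)^`() - (gt t')^`() by apply: dvdp_sub.
  have -> : (gt t)^`() - (gt t')^`() = (t - t')%:~R *: (phi h)^`().
    by rewrite -derivB -derivZ !gtE opprD addrACA subrr add0r -scalerBl rmorphB.
  by rewrite dvdpZr.
have cop : coprimep (phi h) (phi h)^`().
  apply: (@nonzero_const_coprime _ _ _ (phi u) (phi v) k%:~R); first by rewrite intr0.
  by rewrite /phi deriv_map -!rmorphM -rmorphD /= bez map_polyC.
by move/coprimepP: cop; apply.
Qed.

Definition gpoly (b A B : int) (q : {poly int}) : {poly int} :=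
  ('X^2 - (4 * b)%:P) * q + B *: 'X + A%:P.

(** The conclusion of [galois_core] as a predicate on [g]. The field and the roots are hidden; from
    here on the condition on [G_f] is used only through the integer squares derived from it. *)
Definition core_cond (n : nat) (b : int) (g : {poly int}) : Prop :=
  exists (L : splittingFieldType rat) (beta : 'I_n -> L) (k : rat),
    [/\ map_poly intr g = (g`_n)%:~R *: \prod_i ('X - (beta i)%:P), injective beta,
        forall i, beta i ^+ 2 - (4 * b)%:~R != 0 &
        k%:A ^+ 2 = \prod_i (beta i ^+ 2 - (4 * b)%:~R) * (\det (Vandermonde n (\row_i beta i))) ^+ 2].

Lemma dvdp_prod_sub (K : fieldType) (n : nat) (d : {poly K}) (F G : 'I_n -> {poly K}) :
  (forall i, d %| F i - G i) -> d %| \prod_i F i - \prod_i G i.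
Proof.
move=> H; apply: (big_rec2 (fun p q => d %| p - q)) => [|i p q _ h].
  by rewrite subrr dvdp0.
have -> : F i * p - G i * q = F i * (p - q) + (F i - G i) * q by ring.
by apply: dvdp_add; [apply: dvdp_mull|apply: dvdp_mulr].
Qed.

(** Reduce [g(u) g(-u)] modulo [u^2 - 4b] in two ways: from [g = A + B u] it is [A^2 - 4 b B^2], and
    from the factorisation it is [c^2] times the product of the [beta_i^2 - 4b]. *)
Lemma norm_Nf (K : fieldType) (n : nat) (b A B : int) (q : {poly int}) (c : K) (beta : 'I_n -> K) :
  map_poly intr (gpoly b A B q) = c *: \prod_i ('X - (beta i)%:P) ->
  (Nf b A B)%:~R = c ^+ 2 * \prod_i (beta i ^+ 2 - (4 * b)%:~R).
Proof.
move=> gE; pose d : {poly K} := 'X^2 - ((4 * b)%:~R)%:P.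
have gE' : map_poly intr (gpoly b A B q) = d * map_poly intr q + B%:~R *: 'X + (A%:~R)%:P :> {poly K}.
  by rewrite /gpoly !rmorphD /= rmorphM rmorphB /= map_polyXn map_polyZ map_polyX !map_polyC.
have h1 : d %| ((Nf b A B)%:~R)%:P - c ^+ 2 *: \prod_i ((beta i ^+ 2)%:P - 'X^2).
  have -> : c ^+ 2 *: \prod_i ((beta i ^+ 2)%:P - 'X^2) =
     map_poly intr (gpoly b A B q) * (map_poly intr (gpoly b A B q) \Po - 'X).
    rewrite gE comp_polyZ rmorph_prod -scalerAl -scalerAr scalerA -expr2 -big_split /=.
    congr (_ *: _); apply: eq_bigr => i _.
    by rewrite comp_polyB comp_polyX comp_polyC polyC_exp; ring.
  rewrite gE' comp_polyD comp_polyD comp_polyC comp_polyZ comp_polyX comp_polyM.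
  have -> : d \Po - 'X = d by rewrite /d comp_polyB comp_Xn_poly comp_polyC sqrrN.
  move: (map_poly intr q) (_ \Po _) => Q1 Q2.
  have -> : ((Nf b A B)%:~R)%:P = (A%:~R)%:P ^+ 2 - ((4 * b)%:~R)%:P * (B%:~R)%:P ^+ 2 :> {poly K}.
    by rewrite -!polyC_exp -polyCM -polyCB /Nf !expr2 rmorphB !rmorphM.
  rewrite -!mul_polyC.
  have -> : (A%:~R)%:P ^+ 2 - ((4 * b)%:~R)%:P * (B%:~R)%:P ^+ 2 -
     (d * Q1 + (B%:~R)%:P * 'X + (A%:~R)%:P) * (d * Q2 + (B%:~R)%:P * - 'X + (A%:~R)%:P) =
     d * ((B%:~R)%:P ^+ 2 - Q1 * (d * Q2 + (B%:~R)%:P * - 'X + (A%:~R)%:P) - Q2 * ((B%:~R)%:P * 'X + (A%:~R)%:P)).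
    by rewrite /d; ring.
  exact: dvdp_mulr.
have h2 : d %| c ^+ 2 *: \prod_i ((beta i ^+ 2)%:P - 'X^2) - c ^+ 2 *: (\prod_i (beta i ^+ 2 - (4 * b)%:~R))%:P.
  rewrite -scalerBr -mul_polyC dvdp_mull // rmorph_prod; apply: dvdp_prod_sub => i.
  have -> : (beta i ^+ 2)%:P - 'X^2 - polyC (beta i ^+ 2 - (4 * b)%:~R) = - d.
    by rewrite polyCB /d; ring.
  by rewrite dvdpNr.
have := dvdp_add h1 h2; rewrite addrA subrK -mul_polyC -polyCM -polyCB => h.
apply/eqP; rewrite -subr_eq0; apply: contraLR h => nz; apply/negP => /dvdp_leq.
rewrite polyC_eq0 => /(_ nz); rewrite size_polyC nz /d size_XnsubC //.
Qed.

(** The sign [(-1) ^ (n (n - 1) / 2)] between the product of the [g'(beta_i)] and the discriminant,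
    written over the pairs [i < j] to match the Vandermonde product. *)
Definition epsn (n : nat) : int := \prod_(i < n) \prod_(j < n | (i < j)%N) (-1).

Lemma epsn_sqr n : epsn n ^+ 2 = 1.
Proof.
rewrite /epsn -prodrXl big1 // => i _; by rewrite -prodrXl big1.
Qed.

Lemma prod_deriv_roots (K : fieldType) (n : nat) (g : {poly K}) (c : K) (beta : 'I_n -> K) :
  g = c *: \prod_i ('X - (beta i)%:P) ->
  \prod_i g^`().[beta i] = c ^+ n * ((epsn n)%:~R * (\det (Vandermonde n (\row_i beta i))) ^+ 2).
Proof.
move=> gE.
have dE i : g^`().[beta i] = c * \prod_(j | j != i) (beta i - beta j).
  rewrite gE derivZ hornerZ (bigD1 i) //= derivM derivXsubC mul1r hornerD hornerM.
  rewrite hornerXsubC subrr mul0r addr0 horner_prod; congr (_ * _).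
  by apply: eq_bigr => j _; rewrite hornerXsubC.
rewrite (eq_bigr _ (fun i _ => dE i)) big_split /= prodr_const card_ord; congr (_ * _).
have VE : \det (Vandermonde n (\row_i beta i)) = \prod_(i < n) \prod_(j < n | (i < j)%N) (beta j - beta i).
  by rewrite det_Vandermonde; apply: eq_bigr => i _; apply: eq_bigr => j _; rewrite !mxE.
have -> : \prod_i \prod_(j | j != i) (beta i - beta j) =
   (\prod_(i < n) \prod_(j < n | (j < i)%N) (beta i - beta j)) *
   (\prod_(i < n) \prod_(j < n | (i < j)%N) (beta i - beta j)).
  rewrite -big_split /=; apply: eq_bigr => i _; rewrite (bigID (fun j : 'I_n => (j < i)%N)) /=.
  congr (_ * _); apply: eq_bigl => j; rewrite -val_eqE /= neq_ltn -?leqNgt; case: ltngtP => //.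
have -> : \prod_(i < n) \prod_(j < n | (j < i)%N) (beta i - beta j) = \det (Vandermonde n (\row_i beta i)).
  by rewrite VE (exchange_big_dep xpredT).
have -> : \prod_(i < n) \prod_(j < n | (i < j)%N) (beta i - beta j) =
    (epsn n)%:~R * \det (Vandermonde n (\row_i beta i)).
  rewrite VE /epsn rmorph_prod -big_split /=; apply: eq_bigr => i _.
  rewrite rmorph_prod -big_split /=; apply: eq_bigr => j _.
  by rewrite rmorphN1 mulN1r opprB.
by rewrite mulrCA -expr2.
Qed.

(** At a root of [g] the Wronskian is [g' h], so this resultant is the discriminant times the
    product of the [h(beta_i)], up to powers of [c]. *)
Lemma det_Syl_deriv_dir (K : fieldType) (n d : nat) (g h : {poly K}) (c : K) (beta : 'I_n -> K) :
  (size (Wr g h) <= d.+1)%N -> g = c *: \prod_i ('X - (beta i)%:P) -> injective beta ->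
  \det (Syl n d (Wr g h) g) =
    c ^+ d * (c ^+ n * ((epsn n)%:~R * (\det (Vandermonde n (\row_i beta i))) ^+ 2) * \prod_i h.[beta i]).
Proof.
move=> szW gE bI; rewrite (det_Syl szW gE bI); congr (_ * _).
rewrite -(prod_deriv_roots gE) -big_split /=; apply: eq_bigr => i _.
have g0 : g.[beta i] = 0 by rewrite gE hornerZ horner_prod (bigD1 i) //= hornerXsubC subrr mul0r mulr0.
by rewrite /Wr hornerD hornerN !hornerM g0 mulr0 subr0.
Qed.

Lemma core_rat_square (L : splittingFieldType rat) (k : rat) (a z : int) :
  (a%:~R * k%:A) ^+ 2 = z%:~R :> L -> exists y : nat, z = y%:Z ^+ 2.
Proof.
move=> e; apply: (@rat_sqr_int (a%:~R * k)); apply: (fmorph_inj (in_alg L)).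
by rewrite rmorphXn rmorphM !rmorph_int.
Qed.

Lemma map_Wr (R R' : comNzRingType) (phi : {rmorphism R -> R'}) (g h : {poly R}) :
  map_poly phi (Wr g h) = Wr (map_poly phi g) (map_poly phi h).
Proof. by rewrite /Wr rmorphB !rmorphM /= !deriv_map. Qed.

Lemma disc_square_id (K : comNzRingType) (y e P V : K) (n : nat) : (0 < n)%N -> e ^+ 2 = 1 ->
  y ^+ n.+1 ^+ 2 * (P * V ^+ 2) = e * y * (y ^+ n.-1 * (y ^+ n * (e * V ^+ 2))) * (y ^+ 2 * P).
Proof.
case: n => // n _ e1; rewrite !exprS /=; move: (y ^+ n) => x.
by transitivity ((y * (y * x)) ^+ 2 * (P * V ^+ 2) * e ^+ 2); [rewrite e1 mulr1 !expr0; ring|ring].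
Qed.

Lemma dir2_square_id (K : comNzRingType) (y e P V : K) (n : nat) : e ^+ 2 = 1 ->
  y ^+ n.+1 ^+ 2 * (P * V ^+ 2) = e * y * (y ^+ n.+1 * (y ^+ n * (e * V ^+ 2) * P)).
Proof.
move=> e1; rewrite [y ^+ n.+1]exprS; move: (y ^+ n) => x.
by transitivity ((y * x) ^+ 2 * (P * V ^+ 2) * e ^+ 2); [rewrite e1 mulr1; ring|ring].
Qed.

Lemma dir3_square_id (K : comNzRingType) (y e P V s Q c0 : K) (n : nat) : e ^+ 2 = 1 ->
  c0 = y * (s * Q) ->
  y ^+ n.+1 ^+ 2 * c0 ^+ 2 * (P * V ^+ 2) =
  e * s * y * c0 * (y ^+ n.+2 * (y ^+ n * (e * V ^+ 2) * (P * Q))).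
Proof.
move=> e1 cE; rewrite [y ^+ n.+2]exprS [y ^+ n.+1]exprS; move: (y ^+ n) => x.
transitivity ((y * x) ^+ 2 * (y * (s * Q) * c0) * (P * V ^+ 2) * e ^+ 2).
  by rewrite -cE e1 mulr1; ring.
by ring.
Qed.

Section CoreFacts.
Variables (n : nat) (b A B : int) (q : {poly int}).
Let g := gpoly b A B q.
Hypothesis n0 : (0 < n)%N.
Hypothesis szg : size g = n.+1.
Hypothesis core : core_cond n b g.

Lemma core_Nf_neq0 : Nf b A B != 0.
Proof.
have [L [beta [k [gE bI nz kE]]]] := core; rewrite -(intr_ext_eq0 L) (norm_Nf gE).
rewrite mulf_neq0 ?expf_neq0 ?intr_ext_eq0 //; last by apply/prodf_neq0 => i _; apply: nz.
by have := lead_coef_eq0 g; rewrite lead_coefE szg /= => ->; rewrite -size_poly_eq0 szg.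
Qed.

Lemma core_disc_square :
  exists y : nat, (epsn n * g`_n * \det (Syl n n.-1 g^`() g)) * Nf b A B = y%:Z ^+ 2.
Proof.
have [L [beta [k [gE bI nz kE]]]] := core; set c := g`_n in gE *.
apply: (@core_rat_square L k (c ^+ n.+1)); rewrite rmorphXn /=.
have dS : (\det (Syl n n.-1 g^`() g))%:~R =
    c%:~R ^+ n.-1 * (c%:~R ^+ n * ((epsn n)%:~R * (\det (Vandermonde n (\row_i beta i))) ^+ 2)) :> L.
  rewrite -(prod_deriv_roots gE) -(@det_Syl _ n n.-1 (map_poly intr g)^`() _ _ _ _ gE bI).
    by rewrite -det_map_mx map_Syl deriv_map.
  rewrite prednK // deriv_map (leq_trans (size_poly _ _)) // (leq_trans (size_poly _ _)) // szg //.
rewrite !rmorphM /= dS (norm_Nf gE) exprMn kE.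
have e1 : ((epsn n)%:~R : L) ^+ 2 = 1 by rewrite -rmorphXn /= epsn_sqr.
exact: disc_square_id.
Qed.

(** For [h = u^2 - 4b] the product of the [h(beta_i)] is the norm factor, so the single resultant
    carries both the norm and the discriminant. *)
Lemma core_dir2_square (h := 'X^2 - (4 * b)%:P) :
  exists y : nat, epsn n * g`_n * \det (Syl n n.+1 (Wr g h) g) = y%:Z ^+ 2.
Proof.
have [L [beta [k [gE bI nz kE]]]] := core; set c := g`_n in gE *.
apply: (@core_rat_square L k (c ^+ n.+1)); rewrite rmorphXn /=.
have mW : map_poly intr (Wr g h) = Wr (map_poly intr g) (map_poly intr h) :> {poly L}.
  exact: map_Wr.
have szW : (size (Wr (map_poly intr g) (map_poly intr h : {poly L})) <= n.+2)%N.
  rewrite -mW (leq_trans (size_poly _ _)) // -addn2 size_Wr ?szg //.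
  by rewrite size_XnsubC.
have := det_Syl_deriv_dir szW gE bI; rewrite -mW -map_Syl det_map_mx /= => dS.
rewrite !rmorphM /= dS exprMn kE.
have -> : \prod_i (map_poly intr h).[beta i] = \prod_i (beta i ^+ 2 - (4 * b)%:~R).
  by apply: eq_bigr => i _; rewrite rmorphB /= map_polyXn map_polyC !hornerE.
have e1 : ((epsn n)%:~R : L) ^+ 2 = 1 by rewrite -rmorphXn /= epsn_sqr.
exact: dir2_square_id.
Qed.

(** The additional factor [u] of [h] contributes the product of the roots, [(-1)^n g_0 / g_n], which
    the multiplier turns into a square. As [h(0) = 0], [g_0] is constant along the pencil. *)
Lemma core_dir3_square (h := ('X^2 - (4 * b)%:P) * 'X) :
  exists y : nat, (epsn n * (-1) ^+ n * g`_n * g`_0) * \det (Syl n n.+2 (Wr g h) g) = y%:Z ^+ 2.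
Proof.
have [L [beta [k [gE bI nz kE]]]] := core; set c := g`_n in gE *; set c0 := g`_0.
apply: (@core_rat_square L k (c ^+ n.+1 * c0)); rewrite rmorphM rmorphXn /=.
have mW : map_poly intr (Wr g h) = Wr (map_poly intr g) (map_poly intr h) :> {poly L}.
  exact: map_Wr.
have szW : (size (Wr (map_poly intr g) (map_poly intr h : {poly L})) <= n.+3)%N.
  rewrite -mW (leq_trans (size_poly _ _)) // -addn3 size_Wr ?szg //.
  by rewrite (leq_trans (size_polyMleq _ _)) // size_XnsubC // size_polyX.
have := det_Syl_deriv_dir szW gE bI; rewrite -mW -map_Syl det_map_mx /= => dS.
have c0E : c0%:~R = c%:~R * ((-1) ^+ n * \prod_i beta i) :> L.
  have := congr1 (fun p : {poly L} => p.[0]) gE.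
  rewrite hornerZ horner_coef0 coef_map /= -/c0 => ->; congr (_ * _).
  have -> : (-1) ^+ n = \prod_(i < n) (-1) :> L by rewrite prodr_const card_ord.
  rewrite horner_prod -big_split /=.
  by apply: eq_bigr => i _; rewrite hornerXsubC sub0r mulN1r.
rewrite !rmorphM rmorphXn /= rmorphN1 dS !exprMn kE.
have -> : \prod_i (map_poly intr h).[beta i] = \prod_i (beta i ^+ 2 - (4 * b)%:~R) * \prod_i beta i.
  rewrite -big_split /=; apply: eq_bigr => i _.
  by rewrite rmorphM rmorphB /= map_polyXn map_polyX map_polyC !hornerE.
have e1 : ((epsn n)%:~R : L) ^+ 2 = 1 by rewrite -rmorphXn /= epsn_sqr.
exact: dir3_square_id.
Qed.

End CoreFacts.

End Directions.

(** * Degree at least four *)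

Section PolyBounds.
Local Open Scope ring_scope.

Definition bnd (p : {poly int}) (M : nat) := forall i : nat, (`|(p`_i)%R| <= M)%N.

Lemma leq_abszD (x y : int) : (`|(x + y)%R| <= `|x| + `|y|)%N.
Proof. lia. Qed.

Lemma bndD p q M M' : bnd p M -> bnd q M' -> bnd (p + q) (M + M').
Proof. by move=> hp hq i; rewrite coefD (leq_trans (leq_abszD _ _)) // leq_add. Qed.

Lemma bndN p M : bnd p M -> bnd (- p) M.
Proof. by move=> hp i; rewrite coefN abszN. Qed.

Lemma bndW p M M' : bnd p M -> (M <= M')%N -> bnd p M'.
Proof. by move=> hp le i; apply: leq_trans (hp i) le. Qed.

Lemma bndC (c : int) : bnd c%:P `|c|.
Proof. by move=> i; rewrite coefC; case: eqP. Qed.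

Lemma bndZX (c : int) k : bnd (c *: 'X^k) `|c|.
Proof. by move=> i; rewrite coefZ coefXn; case: eqP => _; rewrite ?mulr1 ?mulr0. Qed.

Lemma bnd_deriv (p : {poly int}) n M : (size p <= n.+1)%N -> bnd p M -> bnd p^`() (n * M).
Proof.
move=> sp hp i; rewrite coef_deriv; have [le|lt] := leqP n i.
  by rewrite nth_default ?mul0rn // (leq_trans sp).
by rewrite -mulr_natl natz abszM absz_nat leq_mul.
Qed.

Lemma absz_sum_leq (I : Type) (r : seq I) (F : I -> int) (M : nat) :
  (forall i, (`|F i| <= M)%N) -> (`|(\sum_(i <- r) F i)%R| <= size r * M)%N.
Proof.
move=> H; elim: r => [|x r IH]; first by rewrite big_nil.
by rewrite big_cons (leq_trans (leq_abszD _ _)) //= mulSn leq_add.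
Qed.

Lemma bndM (p q : {poly int}) m M M' : (size p <= m)%N -> bnd p M -> bnd q M' -> bnd (p * q) (m * (M * M')).
Proof.
move=> sp hp hq i; have -> : p = \poly_(j < m) p`_j.
  apply/polyP => j; rewrite coef_poly; case: ltnP => // mj.
  by rewrite nth_default // (leq_trans sp).
rewrite poly_def mulr_suml coef_sum.
have := @absz_sum_leq _ (index_enum 'I_m) (fun j => (p`_j *: 'X^j * q)`_i) (M * M').
rewrite -[X in size X]enumT size_enum_ord; apply=> j.
rewrite -scalerAl coefZ abszM leq_mul // coefXnM; by case: ifP.
Qed.

Fixpoint polys (m T : nat) : seq {poly int} :=
  if m is m'.+1 then [seq p * 'X + c%:P | p <- polys m' T, c <- rng T] else [:: 0].

Lemma size_polys m T : size (polys m T) = (T.*2.+1 ^ m)%N.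
Proof. elim: m => // m IH; rewrite [polys _ _]/(allpairs _ _ _) size_allpairs IH size_rng.
by rewrite expnS mulnC. Qed.

Lemma mem_polys m T p : (p \in polys m T) <-> ((size p <= m)%N /\ bnd p T).
Proof.
elim: m p => [|m IH] p.
  rewrite inE; split=> [/eqP->|[]]; first by rewrite size_poly0; split=> // i; rewrite coef0.
  by rewrite size_poly_leq0.
rewrite [polys _ _]/(allpairs _ _ _).
split=> [/allpairsP[[q c] /= [/IH[sq bq] cT ->]]|[sp bp]].
  split; first by rewrite size_MXaddC; case: ifP.
  move=> i; rewrite coefD coefMX coefC; case: i => [|i] /=; first by rewrite add0r -mem_rng.
  by rewrite addr0.
apply/allpairsP; exists (drop_poly 1 p, p`_0); split=> /=.
- apply/IH; split; first by rewrite size_drop_poly; move: (size p) sp; clear; lia.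
  by move=> i; rewrite coef_drop_poly.
- by rewrite mem_rng.
apply/polyP => i; rewrite coefD coefMX coefC; case: i => [|i] /=; first by rewrite add0r.
by rewrite coef_drop_poly addn1 addr0.
Qed.

(** Inserts a zero coefficient at [X^k], the place reserved for [t]; the fixed coefficients of the
    quotient are enumerated in this way. *)
Definition hole (k : nat) (p : {poly int}) : {poly int} := take_poly k p + drop_poly k p * 'X^(k.+1).

Lemma coef_hole k (p : {poly int}) i : (hole k p)`_i = if (i < k)%N then p`_i else if i == k then 0 else p`_(i.-1).
Proof.
rewrite coefD coef_take_poly coefMXn coef_drop_poly ltnS; case: ltngtP => h.
- by rewrite addr0.
- by rewrite add0r; congr (_`_ _); lia.
- by rewrite addr0.
Qed.

Lemma size_hole k m (p : {poly int}) : (size p <= m)%N -> (k <= m)%N -> (size (hole k p) <= m.+1)%N.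
Proof.
move=> sp km; apply/leq_sizeP => j mj; rewrite coef_hole.
case: ltnP => [h|_]; first by lia.
by case: eqP => // _; rewrite nth_default // (leq_trans sp); lia.
Qed.

Lemma bnd_hole k (p : {poly int}) T : bnd p T -> bnd (hole k p) T.
Proof. by move=> bp i; rewrite coef_hole; case: ifP => // _; case: ifP. Qed.

Lemma hole_surj k m T (r : {poly int}) : (k <= m)%N -> (size r <= m.+1)%N -> r`_k = 0 -> bnd r T ->
  exists2 p, p \in polys m T & r = hole k p.
Proof.
move=> km sr rk br; exists (\poly_(i < m) if (i < k)%N then r`_i else r`_(i.+1)).
  apply/mem_polys; split=> [|i]; first exact: size_poly.
  by rewrite coef_poly; case: ifP => // _; case: ifP.
apply/polyP => i; rewrite coef_hole !coef_poly.
have r0 j : (m.+1 <= j)%N -> r`_j = 0 by move=> h; rewrite nth_default // (leq_trans sr).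
case: ltnP => ik.
  by rewrite (leq_trans ik km).
case: eqP => [->//|ne]; have i0 : (0 < i)%N by lia.
have -> : (i.-1 < k)%N = false by lia.
by rewrite prednK //; case: ltnP => // h; rewrite r0 //; lia.
Qed.

Lemma count_dvd_pos (d T : nat) : (0 < d)%N -> (\sum_(1 <= k < T.+1) (d %| k)%N = T %/ d)%N.
Proof.
move=> d0; elim: T => [|T IH]; first by rewrite big_geq // div0n.
by rewrite big_nat_recr //= IH divnS // addnC.
Qed.

(* [mo] says whether the leading coefficient is required to be [1]. *)
Definition clist (mo : bool) (T : nat) : seq int := if mo then [:: 1] else [seq c <- rng T | c != 0].

Lemma mem_clist mo T c : (0 < T)%N -> c \in clist mo T -> (c != 0) && (`|c| <= T)%N.
Proof.
by rewrite /clist; case: mo => T0; [rewrite inE => /eqP->|rewrite mem_filter mem_rng].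
Qed.

Lemma sum_gcd_nz (g T : nat) : (0 < g)%N ->
  (\sum_(c <- [seq c <- rng T | c != 0%R]) gcdn g `|c| <= 2 * T * size (divisors g))%N.
Proof.
move=> g0.
apply: (@leq_trans (\sum_(c <- [seq c <- rng T | c != 0%R]) \sum_(d <- divisors g) (if (d %| `|c|)%N then d else 0))%N).
  by apply: leq_sum => c _; apply: gcdn_leq_sum.
rewrite exchange_big mulnC -sum_const_seq big_seq [X in (_ <= X)%N]big_seq.
apply: leq_sum => d; rewrite -dvdn_divisors // => dg.
have d0 : (0 < d)%N by apply: dvdn_gt0 dg.
rewrite big_filter big_mkcond.
apply: (@leq_trans (\sum_(c <- rng T) (if c == 0 then 0 else d * (d %| `|c|)%N))%N).
  by apply: leq_sum => c _; case: eqP => //= _; case: ifP; rewrite ?muln1.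
apply: leq_trans (sum_rng_abs (fun k => (d * (d %| k)%N)%N) T) _.
by rewrite -big_distrr /= count_dvd_pos // leq_mul2l mulnC leq_trunc_div.
Qed.

End PolyBounds.

Section GenericDegree.
Local Open Scope ring_scope.

Lemma absz_epsn m : `|epsn m|%N = 1%N.
Proof. by have /eqP := epsn_sqr m; rewrite sqrf_eq1 => /orP[] /eqP->. Qed.

Variables (n : nat) (b : int).
Hypothesis n4 : (4 <= n)%N.
Hypothesis b0 : b != 0.

(* For even [n] the free coefficient of the quotient is the constant one, for odd [n] the linear
   one; this makes the degree [n + k + 1] of the associated polynomial in [t] odd. *)
Let k : nat := odd n.
Let e := k.+2.
Let d := (n + k).+1.

Definition dir : {poly int} := ('X^2 - (4 * b)%:P) * 'X^k.
(** [s.2] is the leading coefficient of [g], kept apart from the other fixed coefficients [s.1]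
    because the primes dividing it are lost in the congruence argument. *)
Definition gfam (A B : int) (s : {poly int} * int) (t : int) : {poly int} :=
  gpoly b A B (s.1 + s.2 *: 'X^(n.-2) + t *: 'X^k).

Let en : (e < n)%N.
Proof. by rewrite /e /k; case o: (odd n); move: n4 o; clear; lia. Qed.

Lemma gfamE A B s t : gfam A B s t = gfam A B s 0 + t *: dir.
Proof. by rewrite /gfam /gpoly /dir scale0r addr0 mulrDr -scalerAr; ring. Qed.

Lemma size_dir : size dir = e.+1.
Proof.
have X0 : ('X^2 - (4 * b)%:P : {poly int}) != 0 by rewrite -size_poly_eq0 size_XnsubC.
by rewrite /dir size_mulXn // size_XnsubC // addn3.
Qed.

Lemma dir_top : dir`_e = 1.
Proof.
rewrite /dir coefMXn (_ : (e < k)%N = false); last by rewrite /e; clear; lia.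
by rewrite (_ : (e - k = 2)%N) ?coefB ?coefXn ?coefC // /e; clear; lia.
Qed.

(** An explicit relation over the integers, so that outside the primes dividing [c] the direction
    stays separable. *)
Lemma dir_bezout : exists (u v : {poly int}) (c : int), u * dir + v * dir^`() = c%:P /\ c != 0.
Proof.
rewrite /dir; case: (k) (leq_b1 (odd n) : (k <= 1)%N) => [|[|//]] _.
  exists (- 2%:P), 'X, (8 * b); split; last by rewrite mulf_neq0.
  rewrite expr0 mulr1 derivB derivXn derivC subr0 /= !polyCM; ring.
exists (9%:P * 'X), ((8 * b)%:P - 3%:P * 'X^2), (- (32 * b ^+ 2)).
split; last by rewrite oppr_eq0 mulf_neq0 ?expf_neq0.
rewrite expr1 derivM derivB derivXn derivC derivX subr0 /= !(polyCN, polyCM, polyC_exp); ring.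
Qed.

Let S0 (T : nat) (s : {poly int} * int) := [/\ (size s.1 <= n.-2)%N, bnd s.1 T, s.2 != 0 & (`|s.2| <= T)%N].

Lemma size_gfam T A B s t : S0 T s -> size (gfam A B s t) = n.+1.
Proof.
move=> [s1 _ s2 _]; rewrite /gfam; set q := s.1 + _ + _.
have n2 : n.-2.+2 = n by move: n4; clear; lia.
have szq : size q = n.-1.
  have -> : n.-1 = size (s.2 *: 'X^(n.-2) : {poly int}) by rewrite size_scale // size_polyXn -n2.
  rewrite /q -addrA addrCA size_polyDl // size_scale // size_polyXn.
  rewrite (leq_ltn_trans (size_polyD _ _)) // gtn_max ltnS s1 /= ltnS.
  rewrite (leq_trans (size_scale_leq _ _)) // size_polyXn.
  by move: en; rewrite /e; clear; lia.
have q0 : q != 0 by rewrite -size_poly_eq0 szq; move: n4; clear; case: (n) => [|[]].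
have X0 : ('X^2 - (4 * b)%:P : {poly int}) != 0 by rewrite -size_poly_eq0 size_XnsubC.
have szm : size (('X^2 - (4 * b)%:P) * q) = n.+1.
  by rewrite size_mul // szq size_XnsubC //; move: n4; clear; lia.
rewrite /gpoly -addrA size_polyDl ?szm // (leq_ltn_trans (size_polyD _ _)) // gtn_max.
rewrite (leq_ltn_trans (size_scale_leq _ _)) ?size_polyX //; last by move: n4; clear; lia.
by rewrite (leq_ltn_trans (size_polyC_leq1 _)) //; move: n4; clear; lia.
Qed.

Lemma lead_gfam T A B s t : S0 T s -> (gfam A B s t)`_n = s.2.
Proof.
move=> Ss; have [s1 _ s2 _] := Ss.
rewrite /gfam /gpoly !coefD coefZ coefX coefC mulrBl coefB coefXnM mul_polyC coefZ !coefD !coefZ !coefXn.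
have n0 : (0 < n)%N by move: n4; clear; lia.
rewrite (_ : (n < 2)%N = false); last by move: n4; clear; lia.
rewrite (_ : (n - 2 = n.-2)%N); last by move: n4; clear; lia.
rewrite (_ : (n == 1%N) = false); last by move: n4; clear; lia.
rewrite (_ : (n == 0%N) = false); last by move: n4; clear; lia.
rewrite eqxx (_ : (n == n.-2) = false); last by move: n4; clear; lia.
rewrite (_ : (n.-2 == k) = false); last by move: en; rewrite /e; clear; lia.
rewrite (_ : (n == k) = false); last by move: en; rewrite /e; clear; lia.
rewrite [s.1`_n.-2]nth_default // [s.1`_n]nth_default ?(leq_trans s1) //; last by move: n4; clear; lia.
by rewrite !(mulr0n, mulr1n); ring.
Qed.

Let Kb := (5 * (1 + 4 * `|b|))%N.

Lemma bnd_gfam T A B s t : S0 T s -> (`|A| <= T)%N -> (`|B| <= T)%N -> (`|t| <= T)%N ->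
  bnd (gfam A B s t) (Kb * T).
Proof.
move=> [_ b1 _ b2] AT BT tT; rewrite /gfam /gpoly mulrBl.
have bq : bnd (s.1 + s.2 *: 'X^(n.-2) + t *: 'X^k) (3 * T).
  apply: bndW (bndD (bndD b1 (bndZX _ _)) (bndZX _ _)) _.
  by move: b2 tT; move: (`|_|%N) (`|_|%N); clear; lia.
set q := s.1 + _ + _ in bq *.
have b1' : bnd ('X^2 * q) (3 * T) by move=> i; rewrite coefXnM; case: ifP.
have b2' : bnd (- ((4 * b)%:P * q)) (4 * `|b| * (3 * T)).
  by apply: bndN => i; rewrite mul_polyC coefZ !abszM leq_mul.
have b3 : bnd (B *: 'X) T by apply: bndW BT; have := bndZX B 1.
have b4 : bnd A%:P T by apply: bndW AT; apply: bndC.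
apply: bndW (bndD (bndD (bndD b1' b2') b3) b4) _.
by rewrite /Kb; move: (`|b|)%N => x; clear; nia.
Qed.

Lemma bnd_dir : bnd dir (1 + 4 * `|b|).
Proof.
move=> i; rewrite /dir coefMXn; case: ifP => // _; rewrite coefB coefXn coefC.
by case: (_ == 2)%N; case: (_ == 0)%N => /=; move: (b) => x; clear; lia.
Qed.

Let KW := (n.+1 * (n * Kb * (1 + 4 * `|b|)) + n.+1 * (n * (1 + 4 * `|b|) * Kb))%N.

Lemma bnd_Wr T A B s t : S0 T s -> (`|A| <= T)%N -> (`|B| <= T)%N -> (`|t| <= T)%N ->
  bnd (Wr (gfam A B s t) dir) (KW * T).
Proof.
move=> Ss AT BT tT; have bg := bnd_gfam Ss AT BT tT; have sg := size_gfam A B t Ss.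
have sh := size_dir; have dn (p : {poly int}) : (size p <= n.+1)%N -> (size p^`() <= n.+1)%N.
  by apply: leq_trans; apply: leq_trans (size_poly _ _) (leq_pred _).
have szd : (size dir <= n.+1)%N by rewrite sh ltnS ltnW.
have szg : (size (gfam A B s t) <= n.+1)%N by rewrite sg.
have m1 := bndM (dn _ szg) (bnd_deriv szg bg) bnd_dir.
have m2 := bndM (dn _ szd) (bnd_deriv szd bnd_dir) bg.
apply: bndW (bndD m1 (bndN m2)) _.
by rewrite /KW; apply/eq_leq; ring.
Qed.

Let c0 A B s := (gfam A B s 0)`_0.

Lemma c0E A B s : c0 A B s = A - 4 * b * (s.1)`_0.
Proof.
rewrite /c0 /gfam /gpoly !coefD coefZ coefX coefC mulrBl coefB coefXnM mul_polyC coefZ !coefD coefZ coefXn.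
rewrite (_ : (0 == n.-2) = false); last by move: n4; clear; lia.
by rewrite scale0r coef0 /= mulr0 !mulr0n; ring.
Qed.

Lemma c0_shift A B s t : odd n -> (gfam A B s t)`_0 = c0 A B s.
Proof.
by move=> on; rewrite gfamE coefD coefZ /dir coefMXn /k on mulr0 addr0.
Qed.

Let fac A B s := epsn n * (if odd n then (-1) ^+ n * c0 A B s else 1) * s.2.

Lemma fam_square T A B s t : S0 T s -> core_cond n b (gfam A B s t) ->
  exists y : nat, fac A B s * \det (Syl n d (Wr (gfam A B s t) dir) (gfam A B s t)) = y%:Z ^+ 2.
Proof.
move=> Ss co; have sg := size_gfam A B t Ss; have n0 : (0 < n)%N by move: n4; clear; lia.
have c0s := @c0_shift A B s t.
rewrite /fac /d /dir /k; case on: (odd n).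
  have [y yE] := core_dir3_square n0 sg co; exists y; rewrite -yE.
  by rewrite (lead_gfam A B t Ss) -(c0s on) expr1 addn1; ring.
have [y yE] := core_dir2_square n0 sg co; exists y; rewrite -yE.
by rewrite (lead_gfam A B t Ss) expr0 !mulr1 addn0.
Qed.

(** Here [g] and [dir] share the root 0 and the multiplier [fac] vanishes, so no information is
    left; this occurs for at most one [A] given [B] and [s]. *)
Let exc A B s := odd n && (c0 A B s == 0).

Lemma fac_neq0 T A B s : S0 T s -> ~~ exc A B s -> fac A B s != 0.
Proof.
move=> [_ _ s2 _]; rewrite /exc /fac => ne.
have e0 : epsn n != 0 by apply: contra_eq_neq (epsn_sqr n) => ->.
apply: mulf_neq0 => //; apply: mulf_neq0 => //; case on: (odd n) => //.
by rewrite mulf_neq0 ?signr_eq0 //; rewrite on in ne.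
Qed.

(** The norm [N] is itself a polynomial combination of [u^2 - 4b] and [g], by the identity [bez].
    For odd [n] the factor [u] of [dir] is prime to [g] because the constant coefficient is
    nonzero. *)
Lemma coprime_dir_gfam A B s t : Nf b A B != 0 -> ~~ exc A B s ->
  coprimep (map_poly intr dir : {poly rat}) (map_poly intr (gfam A B s t)).
Proof.
move=> N0 ne; rewrite {1}/dir rmorphM /= map_polyXn coprimepMl; apply/andP; split.
  set q := s.1 + s.2 *: 'X^(n.-2) + t *: 'X^k.
  have bez : ((B ^+ 2)%:P - (A%:P - B%:P * 'X) * q) * ('X^2 - (4 * b)%:P) + (A%:P - B%:P * 'X) * gfam A B s t
       = (Nf b A B)%:P.
    rewrite /gfam -/q /gpoly /Nf -mul_polyC !(polyCB, polyCM, polyC_exp); ring.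
  apply: (@nonzero_const_coprime _ _ _ (map_poly intr ((B ^+ 2)%:P - (A%:P - B%:P * 'X) * q))
            (map_poly intr (A%:P - B%:P * 'X)) (Nf b A B)%:~R); first by rewrite intr_eq0.
  by rewrite -!rmorphM -rmorphD /= bez map_polyC.
move: ne; rewrite /exc /k; case on: (odd n) => /= c00; last by rewrite expr0 coprime1p.
rewrite expr1 coprimep_sym coprimepX /root horner_coef0 coef_map /= intr_eq0.
by rewrite c0_shift.
Qed.

Lemma size_map_intr (p : {poly int}) : size (map_poly intr p : {poly rat}) = size p.
Proof. by rewrite size_map_inj_poly ?rmorph0 //; apply: intr_inj. Qed.

Lemma size_Wr_fam T A B s t : S0 T s -> size (Wr (gfam A B s t) dir) = d.+1.
Proof.
move=> Ss; have sg := size_gfam A B t Ss; have n0 : (0 < n)%N by move: n4; clear; lia.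
have ne : (n + e = d.+1)%N by rewrite /d /e !addnS.
have sg' : (size (gfam A B s t) <= n.+1)%N by rewrite sg.
have sd' : (size dir <= e.+1)%N by rewrite size_dir.
have le := size_Wr n0 (isT : (0 < e)%N) sg' sd'.
apply/eqP; rewrite eqn_leq -ne le andTb leqNgt; apply/negP => h.
have top := Wr_top n0 (isT : (0 < e)%N) sg' sd' dir_top.
have : (Wr (gfam A B s t) dir)`_(n + e).-1 = 0.
  by rewrite nth_default //; move: h; rewrite ne; move: (size _) => x; clear; lia.
rewrite top (lead_gfam A B t Ss) -mulrnBr ?(ltnW en) // => /eqP; rewrite mulrn_eq0 subn_eq0 leqNgt en /=.
by case: Ss => _ _ /negPf->.
Qed.

(** The degree in [t] is exactly [d = n + k + 1], which is odd. By [size_Sylt] this reduces to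
    coprimality of [h] with the Wronskian, which modulo [h] is [- h' g]; and [h] is prime to [h']
    and to [g]. *)
Lemma Sylt_nonsquare T A B s : S0 T s -> Nf b A B != 0 -> ~~ exc A B s ->
  let P := fac A B s *: Sylt n d (Wr (gfam A B s 0) dir) (gfam A B s 0) dir in
  (size P <= d.+1)%N /\ forall Y : {poly rat}, map_poly intr P != Y ^+ 2.
Proof.
move=> Ss N0 ne P; have f0 := fac_neq0 Ss ne.
have szP : size P = d.+1.
  rewrite /P -size_map_intr map_polyZ size_scale ?intr_eq0 // map_Sylt size_Sylt //.
  apply: Syl_neq0_l; rewrite ?size_map_intr ?(size_Wr_fam _ _ _ Ss) ?size_dir //; last exact: ltnW.
  have [u [v [c [bez cn0]]]] := dir_bezout.
  rewrite map_Wr coprimep_sym /Wr -mulNr coprimep_addl_mul coprimepMr coprime_dir_gfam // andbT.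
  apply: (@nonzero_const_coprime _ _ _ (map_poly intr u) (- map_poly intr v) c%:~R); first by rewrite intr_eq0.
  by rewrite mulrNN deriv_map -!rmorphM -rmorphD /= bez map_polyC.
split; first by rewrite szP.
apply: odd_size_nonsquare; last by rewrite -size_poly_eq0 szP.
by rewrite szP /d /= negbK oddD oddb addbb.
Qed.

Let Km := (KW + Kb)%N.

Lemma det_fam_bound T A B s t : S0 T s -> (`|A| <= T)%N -> (`|B| <= T)%N -> (`|t| <= T)%N ->
  (`|\det (Syl n d (Wr (gfam A B s t) dir) (gfam A B s t))| <= (n + d)`! * (Km * T) ^ (n + d))%N.
Proof.
move=> Ss AT BT tT; apply: det_norm_bound => i j.
have bW := bnd_Wr Ss AT BT tT; have bg := bnd_gfam Ss AT BT tT.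
rewrite mxE; case: split => r; rewrite mxE coefXnM; case: ifP => // _.
  by apply: leq_trans (bW _) _; rewrite leq_mul2r leq_addr orbT.
by apply: leq_trans (bg _) _; rewrite leq_mul2r leq_addl orbT.
Qed.

Lemma fac_bound T A B s : (0 < T)%N -> S0 T s -> (`|A| <= T)%N -> (`|B| <= T)%N -> (`|fac A B s| <= Kb * T ^ 2)%N.
Proof.
move=> T0 Ss AT BT; have [_ _ _ s2] := Ss.
have bc : (`|c0 A B s| <= Kb * T)%N by apply: bnd_gfam.
have e1 := absz_epsn n.
rewrite /fac !abszM e1 mul1n -mulnn mulnA leq_mul //; case: (odd n).
  by rewrite abszM abszX exp1n mul1n.
by rewrite /= muln_gt0 T0 andbT.
Qed.

Definition Slist (mo : bool) (T : nat) : seq ({poly int} * int) :=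
  [seq (hole k p, c) | p <- polys (n - 3) T, c <- clist mo T].

Lemma Slist_S0 mo T s : (0 < T)%N -> s \in Slist mo T -> S0 T s.
Proof.
move=> T0 /allpairsP[[p c] /= [/mem_polys[sp bp] cT ->]]; split=> /=.
- have kn : (k <= n - 3)%N by move: en; rewrite /e; clear; lia.
  have -> : n.-2 = (n - 3).+1 by move: n4; clear; lia.
  exact: size_hole.
- exact: bnd_hole.
- by case/andP: (mem_clist T0 cT).
- by case/andP: (mem_clist T0 cT).
Qed.

Lemma Slist_gcd (mo : bool) T g : (0 < T)%N -> (0 < g)%N ->
  (\sum_(s <- Slist mo T) gcdn g `|s.2| <= (3 ^ (n - 3) * 2) * T ^ (n.-2 - mo) * size (divisors g))%N.
Proof.
move=> T0 g0; rewrite /Slist big_allpairs_dep.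
have r3 : (T.*2.+1 <= 3 * T)%N by move: T0; clear; lia.
apply: (@leq_trans (\sum_(p <- polys (n - 3) T) (2 * T ^ (~~ mo) * size (divisors g)))%N).
  apply: leq_sum => p _; case: mo.
    rewrite big_seq1 gcdn1 muln1 (@leq_trans (size (divisors g))) ?leq_pmull //.
    have : g \in divisors g by rewrite -dvdn_divisors.
    by case: (divisors g).
  by rewrite expn1; apply: sum_gcd_nz.
rewrite sum_const_seq size_polys; apply: leq_trans (leq_mul (leq_expr _ r3) (leqnn _)) _.
have -> : (n.-2 - mo = n - 3 + ~~ mo)%N by case: mo; move: n4; clear; lia.
by rewrite expnMn expnD; apply/eq_leq; ring.
Qed.

Theorem generic_count (mo : bool) : exists C E : nat, (0 < E)%N /\
  forall U T : nat, (0 < U)%N -> T = (U ^ E)%N ->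
  (\sum_(A <- rng T) \sum_(B <- rng T) \sum_(s <- Slist mo T)
     count (fun t => `[< core_cond n b (gfam A B s t) >]) (rng T) <= C * T ^ (n - mo))%N.
Proof.
have nm : (n - mo = (n.-2 - mo).+2)%N by case: (mo); move: n4; clear; lia.
have [u [v [c [bez cn0]]]] := dir_bezout.
(* Away from these primes [dir] is separable and the factor [n - e] in the top coefficient of the
   Wronskian is invertible, as [residues_bound] requires. *)
pose C0 := (`|c| * (n - e))%N.
have C00 : (0 < C0)%N by rewrite muln_gt0 absz_gt0 cn0 subn_gt0.
pose KS := (3 ^ (n - 3) * 2)%N; pose Ky := (Kb * ((n + d)`! * Km ^ (n + d)))%N.
pose K := (3 * KS + Ky)%N; pose kap := (n + d + 2)%N.
have [C [E [E0 H]]] := @sum_square_fibers b d d kap C0 (n.-2 - mo) K b0 (ltn0Sn _) C00.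
exists C, E; split=> // U T U0 TE.
have T0 : (0 < T)%N by rewrite TE expn_gt0 U0.
rewrite nm.
have KSK : (KS <= K)%N by rewrite /K; move: (KS) (Ky); clear; lia.
pose X A B s t := `[< core_cond n b (gfam A B s t) >] && (Nf b A B != 0).
apply: (@leq_trans (\sum_(A <- rng T) \sum_(B <- rng T) \sum_(s <- Slist mo T) count (X A B s) (rng T))%N).
  apply: leq_sum2_seq => A B _ _; rewrite big_seq [X in (_ <= X)%N]big_seq; apply: leq_sum => s sS.
  apply: sub_count => t co; rewrite /X co /=.
  exact: core_Nf_neq0 (size_gfam A B t (Slist_S0 T0 sS)) (asboolW co).
apply: (H U T _ (Slist mo T) (fun s => `|s.2|%N) X exc U0 TE).
- move=> g g0; apply: leq_trans (Slist_gcd mo T0 g0) _.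
  by rewrite -mulnA -[X in (_ <= X)%N]mulnA leq_mul2r KSK orbT.
- by move=> A B s t /andP[].
- move=> A B s p ts AT BT sS pp od pC0 pl Hts uts.
  have Ss := Slist_S0 T0 sS; have sg0 := size_gfam A B 0 Ss.
  have n0 : (0 < n)%N by move: n4; clear; lia.
  have := @residues_bound n e p dir (gfam A B s 0) u v c ts pp en size_dir dir_top bez.
  have -> : ((n + e).-1 = d)%N by rewrite /e /d !addnS.
  have pc : ~~ (p%:Z %| s.2)%Z by rewrite dvdz_eq.
  apply=> //; rewrite ?sg0 ?(lead_gfam A B 0 Ss) //.
  + by rewrite dvdz_eq; apply: contra pC0; apply: dvdn_mulr.
  + by apply: contra pC0; apply: dvdn_mull.
  move=> t /Hts[tT /andP[/asboolP co _]]; rewrite -gfamE.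
  have [y yE] := core_disc_square n0 (size_gfam A B t Ss) co.
  have := odd_logn_dvd pp od yE; rewrite (lead_gfam A B t Ss) !dvdz_eq !abszM !Euclid_dvdM //.
  have e1 := absz_epsn n.
  by rewrite e1 Euclid_dvd1 //= (negPf pl).
- move=> A B s AT BT sS ne [t0 t0T /andP[/asboolP co0 _]].
  have Ss := Slist_S0 T0 sS; have n0 : (0 < n)%N by move: n4; clear; lia.
  have N0 := core_Nf_neq0 (size_gfam A B t0 Ss) co0.
  have [szP nsq] := Sylt_nonsquare Ss N0 ne; set P := _ *: _ in szP nsq.
  have PE t : P.[t] = fac A B s * \det (Syl n d (Wr (gfam A B s t) dir) (gfam A B s t)).
    by rewrite /P hornerZ horner_Sylt -(Wr_shift _ _ t) -gfamE.
  have /choice[y yE] : forall t, exists y : nat, core_cond n b (gfam A B s t) -> P.[t] = y%:Z ^+ 2.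
    move=> t; have [co|nco] := pselect (core_cond n b (gfam A B s t)); last by exists 0%N.
    by have [y yE] := fam_square Ss co; exists y => _; rewrite PE.
  exists P, y; split=> // t tT /andP[/asboolP co _]; split; first exact: yE.
  have yy : (y t <= y t ^ 2)%N by rewrite -mulnn; case: (y t) => // m; rewrite leq_pmulr.
  apply: leq_trans yy _; have -> : (y t ^ 2 = `|P.[t]|)%N by rewrite (yE t co) abszX absz_nat.
  rewrite PE abszM; rewrite mem_rng in AT; rewrite mem_rng in BT; rewrite mem_rng in tT.
  apply: leq_trans (leq_mul (fac_bound T0 Ss AT BT) (det_fam_bound Ss AT BT tT)) _.
  apply: (@leq_trans (Ky * T ^ kap)%N); last by rewrite leq_mul2r leq_addl orbT.
  rewrite /Ky /kap expnMn (expnD T (n + d) 2); move: ((n + d)`!) (Km ^ (n + d))%N => a1 a2.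
  by move: (T ^ (n + d))%N (T ^ 2)%N (Kb) => a3 a4 a5; apply/eq_leq; ring.
(* An exceptional triple has [odd n] and [A = 4 b] times the constant coefficient of [s.1], so [B]
   and [s] determine [A]. *)
- apply: (@leq_trans (\sum_(B <- rng T) \sum_(s <- Slist mo T) 1)%N); last first.
    rewrite !sum_const_seq size_rng muln1 expnS.
    have szS : (size (Slist mo T) <= KS * T ^ (n.-2 - mo))%N.
      have := Slist_gcd mo T0 (isT : (0 < 1)%N); rewrite muln1.
      by under eq_bigr do rewrite gcd1n; rewrite sum_const_seq muln1.
    apply: (@leq_trans (3 * T * (KS * T ^ (n.-2 - mo)))%N); first by rewrite leq_mul //; move: T0; clear; lia.
    apply: (@leq_trans (3 * KS * (T * T ^ (n.-2 - mo)))%N); first by apply/eq_leq; ring.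
    by rewrite leq_mul2r leq_addr orbT.
  rewrite exchange_big; apply: leq_sum => B _.
  apply: (@leq_trans (\sum_(s <- Slist mo T) \sum_(A <- rng T) exc A B s)%N).
    by rewrite exchange_big; apply: leq_sum => A _; rewrite sum_bool_count.
  apply: leq_sum => s _; rewrite sum_bool_count.
  apply: (@leq_trans (count_mem (4 * b * (s.1)`_0) (rng T))).
    by apply: sub_count => A; rewrite /exc c0E subr_eq0 => /andP[].
  by rewrite count_uniq_mem ?rng_uniq // leq_b1.
Qed.

End GenericDegree.

(** * Degrees two and three *)

Section SmallDegree.
Local Open Scope ring_scope.
Variable b : int.
Hypothesis b0 : b != 0.

Lemma core_disc_small (n : nat) (A B : int) (q : {poly int}) (D : int) : (0 < n)%N ->
  core_cond n b (gpoly b A B q) ->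
  (forall (L : splittingFieldType rat) (beta : 'I_n -> L),
     map_poly intr (gpoly b A B q) = ((gpoly b A B q)`_n)%:~R *: \prod_i ('X - (beta i)%:P) ->
     D%:~R = (((gpoly b A B q)`_n)%:~R ^+ n.-1 * \det (Vandermonde n (\row_i beta i))) ^+ 2) ->
  exists y : nat, D * Nf b A B = y%:Z ^+ 2.
Proof.
move=> n0 [L [beta [k [gE bI nz kE]]]] HD; set c := _`_n in gE.
apply: (@core_rat_square L k (c ^+ n)); rewrite rmorphM rmorphXn /= (HD _ _ gE) (norm_Nf gE) exprMn kE -/c.
have -> : c%:~R ^+ n = c%:~R * c%:~R ^+ n.-1 :> L by rewrite -exprS prednK.
by ring.
Qed.

Lemma coef_gpoly A B q i : (gpoly b A B q)`_i =
  (if (i < 2)%N then 0 else q`_(i - 2)) - 4 * b * q`_i + B * (i == 1%N)%:R + (if i == 0%N then A else 0).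
Proof.
by rewrite /gpoly !coefD coefZ coefX coefC mulrBl coefB coefXnM mul_polyC coefZ.
Qed.

Lemma absz_sq_leq (y : nat) (z : int) (M : nat) : z = y%:Z ^+ 2 -> (`|z| <= M)%N -> (y <= M)%N.
Proof.
move=> -> h; apply: leq_trans h; rewrite abszX absz_nat -mulnn.
by case: y => // m; rewrite leq_pmulr.
Qed.

Lemma vieta2 (K : fieldType) (g : {poly K}) (c : K) (beta : 'I_2 -> K) :
  g = c *: \prod_i ('X - (beta i)%:P) -> exists x y : K,
  [/\ g`_2 = c, g`_1 = - (c * (x + y)), g`_0 = c * (x * y) &
      \det (Vandermonde 2 (\row_i beta i)) = y - x].
Proof.
move=> gE; exists (beta ord0), (beta (lift ord0 ord0)).
have -> := det_Vandermonde (\row_i beta i).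
have -> : \prod_(i < 2) \prod_(j < 2 | (i < j)%N) ((\row_i beta i) 0 j - (\row_i beta i) 0 i) =
  \prod_(i < 2) \prod_(j < 2) (if (i < j)%N then beta j - beta i else 1).
  by apply: eq_bigr => i _; rewrite big_mkcond; apply: eq_bigr => j _; rewrite !mxE.
rewrite gE !big_ord_recl !big_ord0 /= !mulr1 !mul1r.
move: (beta ord0) (beta (lift ord0 ord0)) => x y.
have -> : ('X - x%:P) * ('X - y%:P) = 'X^2 + (- (x + y)) *: 'X + (x * y)%:P :> {poly K}.
  by rewrite -mul_polyC !(polyCN, polyCD, polyCM); ring.
rewrite !coefZ !coefD !coefZ !coefXn !coefX !coefC /= !(mulr0n, mulr1n); split=> //; ring.
Qed.

Lemma vieta3 (K : fieldType) (g : {poly K}) (c : K) (beta : 'I_3 -> K) :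
  g = c *: \prod_i ('X - (beta i)%:P) -> exists x y z : K,
  [/\ g`_3 = c, g`_2 = - (c * (x + y + z)), g`_1 = c * (x * y + y * z + x * z) , g`_0 = - (c * (x * y * z)) &
      \det (Vandermonde 3 (\row_i beta i)) = (y - x) * (z - x) * (z - y)].
Proof.
move=> gE; exists (beta ord0), (beta (lift ord0 ord0)), (beta (lift ord0 (lift ord0 ord0))).
have -> := det_Vandermonde (\row_i beta i).
have -> : \prod_(i < 3) \prod_(j < 3 | (i < j)%N) ((\row_i beta i) 0 j - (\row_i beta i) 0 i) =
  \prod_(i < 3) \prod_(j < 3) (if (i < j)%N then beta j - beta i else 1).
  by apply: eq_bigr => i _; rewrite big_mkcond; apply: eq_bigr => j _; rewrite !mxE.
rewrite gE !big_ord_recl !big_ord0 /= !mulr1 !mul1r.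
move: (beta ord0) (beta (lift ord0 ord0)) (beta (lift ord0 (lift ord0 ord0))) => x y z.
have -> : ('X - x%:P) * (('X - y%:P) * ('X - z%:P)) =
   'X^3 + (- (x + y + z)) *: 'X^2 + (x * y + y * z + x * z) *: 'X + (- (x * y * z))%:P :> {poly K}.
  by rewrite -!mul_polyC !(polyCN, polyCD, polyCM); ring.
rewrite !coefZ !coefD !coefZ !coefXn !coefX !coefC /= !(mulr0n, mulr1n); split=> //; ring.
Qed.

Lemma size_gpoly A B (q : {poly int}) n : size q = n.+1 -> size (gpoly b A B q) = n.+3.
Proof.
move=> sq; have q0 : q != 0 by rewrite -size_poly_eq0 sq.
have X0 : ('X^2 - (4 * b)%:P : {poly int}) != 0 by rewrite -size_poly_eq0 size_XnsubC.
have szm : size (('X^2 - (4 * b)%:P) * q) = n.+3 by rewrite size_mul // sq size_XnsubC.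
rewrite /gpoly -addrA size_polyDl ?szm // (leq_ltn_trans (size_polyD _ _)) // gtn_max.
rewrite (leq_ltn_trans (size_scale_leq _ _)) ?size_polyX //.
by rewrite (leq_ltn_trans (size_polyC_leq1 _)).
Qed.

Lemma size_quad (R : nzRingType) (x y z : R) : (size (x *: 'X^2 + y *: 'X + z%:P)%R <= 3)%N.
Proof.
apply/leq_sizeP => j; rewrite !coefD !coefZ coefXn coefX coefC.
by case: j => [|[|[|j]]] //= _; rewrite !mulr0 !addr0.
Qed.

Section Deg2.

(** The discriminant of [t u^2 + B u + (A - 4 b t)], as a polynomial in [t]. *)
Definition disc2 (A B : int) : {poly int} := (16 * b) *: 'X^2 + (- (4 * A)) *: 'X + (B ^+ 2)%:P.

Lemma disc2E A B t : (disc2 A B).[t] = B ^+ 2 - 4 * t * (A - 4 * b * t).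
Proof. rewrite /disc2 !hornerD !hornerZ hornerXn hornerX hornerC; ring. Qed.

Lemma core_disc2 A B t : core_cond 2 b (gpoly b A B t%:P) ->
  exists y : nat, (disc2 A B).[t] * Nf b A B = y%:Z ^+ 2.
Proof.
move=> co; apply: (core_disc_small _ co) => // L beta gE.
have [x [y [_ e1 e0 ->]]] := vieta2 gE.
have g2 : (gpoly b A B t%:P)`_2 = t by rewrite coef_gpoly !coefC /= !(mulr0n, mulr1n); ring.
have g1 : (gpoly b A B t%:P)`_1 = B by rewrite coef_gpoly !coefC /= !(mulr0n, mulr1n); ring.
have g0 : (gpoly b A B t%:P)`_0 = A - 4 * b * t by rewrite coef_gpoly !coefC /= !(mulr0n, mulr1n); ring.
move: e1 e0; rewrite !coef_map /= g2 g1 g0 => e1 e0.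
rewrite disc2E expr1; set a0 := A - _ in e0 *.
by rewrite expr2 rmorphB !rmorphM /= e1 e0; ring.
Qed.

(** The discriminant of [disc2] with respect to [t] is [16 N], which is nonzero; the proof is the
    comparison of coefficients with the square of a linear polynomial. *)
Lemma disc2_nonsquare A B : Nf b A B != 0 ->
  forall Y : {poly rat}, map_poly intr (Nf b A B *: disc2 A B) != Y ^+ 2.
Proof.
move=> N0 Y; apply/eqP => h.
pose N : rat := (Nf b A B)%:~R; pose a : rat := A%:~R; pose c : rat := B%:~R; pose d : rat := b%:~R.
have Nn0 : N != 0 by rewrite intr_eq0.
have dn0 : d != 0 by rewrite intr_eq0.
have NE : N = a ^+ 2 - 4 * d * c ^+ 2 by rewrite /N /Nf !expr2 rmorphB !rmorphM.
have PE : map_poly intr (Nf b A B *: disc2 A B) = (16 * d * N) *: 'X^2 + (- (4 * a * N)) *: 'X + (c ^+ 2 * N)%:P.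
  have dE : map_poly intr (disc2 A B) = (16 * d) *: 'X^2 + (- (4 * a)) *: 'X + (c ^+ 2)%:P.
    rewrite /disc2 !rmorphD /= !map_polyZ map_polyXn map_polyX map_polyC /= expr2.
    by rewrite rmorphN !rmorphM.
  rewrite map_polyZ dE -/N !scalerDr !scalerA -[_ *: _%:P]mul_polyC -polyCM.
  by congr (_ *: _ + _ *: _ + _%:P); ring.
rewrite h in PE.
have szY : (size Y <= 2)%N.
  have sz2 : (size (Y ^+ 2) <= 3)%N by rewrite PE size_quad.
  have := size_exp Y 2; move: (size (Y ^+ 2)) sz2 => s; move: (size Y) => m; clear; lia.
have YE : Y = Y`_1 *: 'X + (Y`_0)%:P.
  apply/polyP => i; rewrite coefD coefZ coefX coefC; case: i => [|[|i]] /=.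
  - by rewrite mulr0 add0r.
  - by rewrite mulr1 addr0.
  - by rewrite mulr0 addr0 nth_default // (leq_trans szY).
move: PE; rewrite YE; move: (Y`_1) (Y`_0) => y1 y0.
have -> : (y1 *: 'X + y0%:P) ^+ 2 = (y1 ^+ 2) *: 'X^2 + (2 * y0 * y1) *: 'X + (y0 ^+ 2)%:P.
  by rewrite -!mul_polyC !(polyCM, polyC_exp); ring.
move=> e; have cf i := congr1 (fun p : {poly rat} => p`_i) e.
have := cf 0%N; have := cf 1%N; have := cf 2%N.
rewrite !coefD !coefZ !coefXn !coefX !coefC /= !(mulr0n, mulr1n, mulr0, mulr1, addr0, add0r).
move=> e2 e1 e0.
have : (16 * N ^+ 2) * (d * c ^+ 2 * 4 - a ^+ 2) = 4 * (y1 ^+ 2 * y0 ^+ 2) - (2 * y0 * y1) ^+ 2.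
  by rewrite e2 e1 e0; ring.
have -> : 4 * (y1 ^+ 2 * y0 ^+ 2) - (2 * y0 * y1) ^+ 2 = 0 by ring.
have -> : d * c ^+ 2 * 4 - a ^+ 2 = - N by rewrite NE; ring.
by move/eqP; apply/negP; rewrite mulf_neq0 ?oppr_eq0 // mulf_neq0 ?expf_neq0.
Qed.

(** The leading coefficient of [disc2] in [t] is the constant [16 b], so [lc] is 1 and only the
    primes dividing [16 b] are discarded. No other coefficient is left, hence the one-element index
    list. *)
Theorem deg2_count : exists C E : nat, (0 < E)%N /\
  forall U T : nat, (0 < U)%N -> T = (U ^ E)%N ->
  (\sum_(A <- rng T) \sum_(B <- rng T)
     count (fun t : int => `[< core_cond 2 b (gpoly b A B t%:P) >] && (t != 0)) (rng T) <= C * T ^ 2)%N.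
Proof.
pose C0 := (16 * `|b|)%N; have C00 : (0 < C0)%N by rewrite muln_gt0 absz_gt0.
pose Kd := ((16 * `|b| + 4 + 1) * (1 + 4 * `|b|))%N; pose K := (Kd + 1)%N.
have [C [E [E0 H]]] := @sum_square_fibers b 2 2 4 C0 0 K b0 isT C00.
exists C, E; split=> // U T U0 TE.
have T0 : (0 < T)%N by rewrite TE expn_gt0 U0.
pose X A B (s : unit) (t : int) := `[< core_cond 2 b (gpoly b A B t%:P) >] && (t != 0) && (Nf b A B != 0).
have szg A B t : t != 0 -> size (gpoly b A B t%:P) = 3 by move=> t0; rewrite (@size_gpoly _ _ _ 0) // size_polyC t0.
apply: (@leq_trans (\sum_(A <- rng T) \sum_(B <- rng T) \sum_(s <- [:: tt]) count (X A B s) (rng T))%N).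
  apply: leq_sum2_seq => A B _ _; rewrite big_seq1; apply: sub_count => t /andP[co t0].
  by rewrite /X co t0 (core_Nf_neq0 (szg A B t t0) (asboolW co)).
apply: (H U T _ [:: tt] (fun=> 1%N) X (fun _ _ _ => false) U0 TE).
- move=> g g0; rewrite big_seq1 gcdn1 expn0 muln1 muln_gt0 {1}/K addn_gt0 orbT andTb.
  have : g \in divisors g by rewrite -dvdn_divisors.
  by case: (divisors g).
- by move=> A B s t /andP[].
- move=> A B s p ts AT BT sS pp od pC0 pl Hts uts.
  have c2 : (disc2 A B)`_2 = 16 * b.
    by rewrite /disc2 !coefD !coefZ coefXn coefX coefC /= mulr0n mulr1n; ring.
  have := @poly_roots_modp (disc2 A B) p ts pp.
  have sz : (size (disc2 A B) <= 3)%N by apply: size_quad.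
  move=> h; apply: (@leq_trans (size (disc2 A B)).-1); last by move: (size _) sz; clear; lia.
  apply: h => //; first by exists 2; rewrite c2 dvdz_eq abszM.
  move=> t /Hts[_ /andP[/andP[/asboolP co _] _]].
  have [y yE] := core_disc2 co; exact: odd_logn_dvd pp od yE.
- move=> A B s AT BT sS _ [t0 _ /andP[_ N0]].
  have /choice[y yE] : forall t, exists y : nat, core_cond 2 b (gpoly b A B t%:P) ->
      (Nf b A B *: disc2 A B).[t] = y%:Z ^+ 2.
    move=> t; have [co|nco] := pselect (core_cond 2 b (gpoly b A B t%:P)); last by exists 0%N.
    by have [y yE] := core_disc2 co; exists y => _; rewrite hornerZ mulrC.
  exists (Nf b A B *: disc2 A B), y; split.
  + by rewrite (leq_trans (size_scale_leq _ _)) // size_quad.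
  + exact: disc2_nonsquare.
  move=> t tT /andP[/andP[/asboolP co _] _]; split; first exact: yE.
  apply: absz_sq_leq (yE t co) _; rewrite hornerZ abszM.
  apply: leq_trans (leq_mul (Nf_bound b AT BT) (leqnn _)) _.
  move: AT BT tT; rewrite !mem_rng => AT BT tT.
  have dB : (`|(disc2 A B).[t]| <= (16 * `|b| + 4 + 1) * T ^ 2)%N.
    rewrite /disc2 !hornerD !hornerZ hornerXn hornerX hornerC.
    rewrite (leq_trans (leq_abszD _ _)) // mulnDl leq_add ?mul1n ?abszX ?leq_expr //.
    rewrite (leq_trans (leq_abszD _ _)) // mulnDl leq_add //.
      by rewrite !(abszX, abszM) leq_mul // ?leq_expr.
    by rewrite abszM abszN abszM -mulnn -mulnA leq_mul // leq_mul.
  apply: leq_trans (leq_mul (leqnn _) dB) _.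
  apply: (@leq_trans (Kd * T ^ 4)%N); last by rewrite leq_mul2r leq_addr orbT.
  by rewrite /Kd (_ : 4 = 2 + 2)%N // expnD; apply/eq_leq; ring.
- rewrite big1 // => A _; rewrite big1 // => B _.
Qed.

End Deg2.

Section Deg3.

(** [d3a], [d3b] and [d3c] make up the lower coefficients, as polynomials in [t], of the
    discriminant of [c u^3 + t u^2 + (B - 4 b c) u + (A - 4 b t)]. *)
Definition d3a (B c : int) : int := (B - 4 * b * c) ^+ 2 - 72 * b * c * (B - 4 * b * c) - 432 * b ^+ 2 * c ^+ 2.
Definition d3b (B c : int) : int := 18 * c * (B - 4 * b * c + 12 * b * c).
Definition d3c (B c : int) : int := - (4 * c * (B - 4 * b * c) ^+ 3).

Definition disc3 (A B c : int) : {poly int} :=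
  (16 * b) *: 'X^4 + (- (4 * A)) *: 'X^3 + (d3a B c *: 'X^2 + (A * d3b B c) *: 'X
  + (d3c B c - 27 * c ^+ 2 * A ^+ 2)%:P).

Lemma disc3E A B c t (c1 := B - 4 * b * c) (c0 := A - 4 * b * t) : (disc3 A B c).[t] =
  18 * c * t * c1 * c0 - 4 * t ^+ 3 * c0 + t ^+ 2 * c1 ^+ 2 - 4 * c * c1 ^+ 3 - 27 * c ^+ 2 * c0 ^+ 2.
Proof.
rewrite /disc3 !hornerD !hornerZ !hornerXn hornerX hornerC /c1 /c0 /d3a /d3b /d3c; ring.
Qed.

Lemma core_disc3 A B c t : core_cond 3 b (gpoly b A B (c *: 'X + t%:P)) ->
  exists y : nat, (disc3 A B c).[t] * Nf b A B = y%:Z ^+ 2.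
Proof.
move=> co; apply: (core_disc_small _ co) => // L beta gE.
have [x [y [z [_ e2 e1 e0 ->]]]] := vieta3 gE.
have cq i : (c *: 'X + t%:P : {poly int})`_i = c * (i == 1%N)%:R + (if i == 0%N then t else 0).
  by rewrite coefD coefZ coefX coefC.
have g3 : (gpoly b A B (c *: 'X + t%:P))`_3 = c by rewrite coef_gpoly !cq /= !(mulr0n, mulr1n); ring.
have g2 : (gpoly b A B (c *: 'X + t%:P))`_2 = t by rewrite coef_gpoly !cq /= !(mulr0n, mulr1n); ring.
have g1 : (gpoly b A B (c *: 'X + t%:P))`_1 = B - 4 * b * c by rewrite coef_gpoly !cq /= !(mulr0n, mulr1n); ring.
have g0 : (gpoly b A B (c *: 'X + t%:P))`_0 = A - 4 * b * t by rewrite coef_gpoly !cq /= !(mulr0n, mulr1n); ring.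
move: e2 e1 e0; rewrite !coef_map /= g3 g2 g1 g0 => e2 e1 e0.
rewrite disc3E; set c1 := B - _ in e1 *; set c0 := A - _ in e0 *.
clearbody c1 c0.
have E3 (w : int) : w ^+ 3 = w * w * w by rewrite !exprS expr0; ring.
by rewrite !E3 !expr2 ?(rmorphB, rmorphD, rmorphM) /= e2 e1 e0; ring.
Qed.

(** If [N] times the discriminant is the square of [y2 t^2 + y1 t + y0] and [A] is nonzero, the
    coefficients of [t^4], [t^3], [t] give [y0 / y2 = - d3b / 4], and that of [t^2] becomes the
    second equation. At most three [A] are exceptional for given [B] and [c]. *)
Definition exc3 (A B c : int) : bool := (A == 0) || (A ^+ 2 == 4 * b * d3a B c + 32 * b ^+ 2 * d3b B c).

(** In degree three the direction [u^2 - 4b] leads to the even degree four in [t], and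
    [(u^2 - 4b) u] would change the leading coefficient; parity is therefore replaced by a
    comparison of coefficients. *)
Lemma disc3_nonsquare A B c : Nf b A B != 0 -> ~~ exc3 A B c ->
  forall Y : {poly rat}, map_poly intr (Nf b A B *: disc3 A B c) != Y ^+ 2.
Proof.
rewrite /exc3 negb_or => Nf0 /andP[A0 nA] Y; apply/eqP => h.
pose N : rat := (Nf b A B)%:~R; pose a : rat := A%:~R; pose d : rat := b%:~R.
pose al : rat := (d3a B c)%:~R; pose be : rat := (d3b B c)%:~R.
have Nn0 : N != 0 by rewrite intr_eq0.
have dn0 : d != 0 by rewrite intr_eq0.
have an0 : a != 0 by rewrite intr_eq0.
have cE i : (Y ^+ 2)`_i = N * ((disc3 A B c)`_i)%:~R by rewrite -h coef_map /= coefZ rmorphM.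
have cd i : (disc3 A B c)`_i = 16 * b * (i == 4)%:R + - (4 * A) * (i == 3)%:R + (d3a B c * (i == 2)%:R +
    A * d3b B c * (i == 1%N)%:R + (if i == 0%N then d3c B c - 27 * c ^+ 2 * A ^+ 2 else 0)).
  by rewrite /disc3 !coefD !coefZ !coefXn coefX coefC.
have szY : (size Y <= 3)%N.
  have sz2 : (size (Y ^+ 2) <= 5)%N.
    apply/leq_sizeP => j hj; rewrite cE cd.
    by case: j hj => [|[|[|[|[|j]]]]] // _; rewrite ?(mulr0n, mulr0, addr0).
  have := size_exp Y 2; move: (size (Y ^+ 2)) sz2 => s; move: (size Y) => m; clear; lia.
have YE : Y = Y`_2 *: 'X^2 + Y`_1 *: 'X + (Y`_0)%:P.
  apply/polyP => i; rewrite !coefD !coefZ coefXn coefX coefC; case: i => [|[|[|i]]] /=.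
  - by rewrite !mulr0 !add0r.
  - by rewrite mulr0 mulr1 addr0 add0r.
  - by rewrite mulr0 mulr1 !addr0.
  - by rewrite !mulr0 !addr0 nth_default // (leq_trans szY).
move: cE; rewrite YE; move: (Y`_2) (Y`_1) (Y`_0) => y2 y1 y0 cE.
have sqE : (y2 *: 'X^2 + y1 *: 'X + y0%:P) ^+ 2 =
   (y2 ^+ 2) *: 'X^4 + (2 * y2 * y1) *: 'X^3 + ((y1 ^+ 2 + 2 * y2 * y0) *: 'X^2 + (2 * y1 * y0) *: 'X + (y0 ^+ 2)%:P).
  by rewrite -!mul_polyC !(polyCM, polyCD, polyC_exp); ring.
have := cE 4%N; have := cE 3%N; have := cE 2%N; have := cE 1%N.
rewrite sqE !cd !coefD !coefZ !coefXn !coefX !coefC /= !(mulr0n, mulr1n, mulr0, mulr1, addr0, add0r).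
have E16 : (16 * b)%:~R = 16 * d :> rat by rewrite rmorphM.
have E4 : (- (4 * A))%:~R = - (4 * a) :> rat by rewrite rmorphN rmorphM.
have Eb : (A * d3b B c)%:~R = a * be :> rat by rewrite /be; move: (d3b B c) => w; rewrite rmorphM.
rewrite E16 E4 Eb -/al => e1 e2 e3 e4.
have y20 : y2 != 0.
  by apply: contra_eq_neq e4 => ->; rewrite expr0n /= eq_sym mulf_neq0 // mulf_neq0.
have e5 : 4 * y0 = - (be * y2).
  apply: (mulfI (mulf_neq0 an0 Nn0)).
  have -> : a * N * (4 * y0) = - (y0 * (N * - (4 * a))) by ring.
  rewrite -e3; have -> : - (y0 * (2 * y2 * y1)) = - (y2 * (2 * y1 * y0)) by ring.
  by rewrite e1; ring.
case/negP: nA; rewrite -(inj_eq (@intr_inj rat)); apply/eqP.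
have -> : (4 * b * d3a B c + 32 * b ^+ 2 * d3b B c)%:~R = 4 * d * al + 32 * d ^+ 2 * be :> rat.
  rewrite /al /be; move: (d3a B c) (d3b B c) => u w.
  by rewrite expr2 rmorphD !rmorphM.
rewrite expr2 rmorphM /= -/a.
apply: (mulfI (_ : 8 * N ^+ 2 != 0)); first by rewrite mulf_neq0 ?expf_neq0.
have e6 : 2 * (y2 * y1) ^+ 2 = 8 * N ^+ 2 * (a * a).
  have -> : 2 * (y2 * y1) ^+ 2 = 2^-1 * (2 * y2 * y1) ^+ 2 by field.
  by rewrite e3; field.
rewrite -e6.
have e7 : 2 * (y2 * y1) ^+ 2 = 2 * y2 ^+ 2 * (y1 ^+ 2 + 2 * y2 * y0) - y2 ^+ 2 * y2 * (4 * y0) by ring.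
rewrite e7 e5 e2; have -> : y2 ^+ 2 * y2 * - (be * y2) = - (be * (y2 ^+ 2) ^+ 2) by ring.
by rewrite e4; ring.
Qed.

Lemma count_sqr_eq (T : nat) (z : int) : (count (fun A : int => A ^+ 2 == z) (rng T) <= 2)%N.
Proof.
rewrite -size_filter; case e: (filter _ _) => [|x s] //; rewrite -e.
have xz : x ^+ 2 = z by have : x \in x :: s := mem_head _ _; rewrite -e mem_filter => /andP[/eqP].
apply: (@uniq_leq_size _ _ [:: x; - x]); first by rewrite filter_uniq ?rng_uniq.
by move=> y; rewrite mem_filter !inE -xz eqf_sqr => /andP[].
Qed.

Theorem deg3_count (mo : bool) : exists C E : nat, (0 < E)%N /\
  forall U T : nat, (0 < U)%N -> T = (U ^ E)%N ->
  (\sum_(A <- rng T) \sum_(B <- rng T) \sum_(c <- clist mo T)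
     count (fun t : int => `[< core_cond 3 b (gpoly b A B (c *: 'X + t%:P)) >]) (rng T) <= C * T ^ (3 - mo))%N.
Proof.
pose C0 := (16 * `|b|)%N; have C00 : (0 < C0)%N by rewrite muln_gt0 absz_gt0.
pose k1 := (1 + 4 * `|b|)%N.
pose Kd := (18 * k1 ^ 2 + 4 * k1 + k1 ^ 2 + 4 * k1 ^ 3 + 27 * k1 ^ 2)%N; pose K := (27 + Kd * k1)%N.
have nm : (3 - mo = (1 - mo).+2)%N by case: (mo).
have [C [E [E0 H]]] := @sum_square_fibers b 4 4 6 C0 (1 - mo) K b0 isT C00.
exists C, E; split=> // U T U0 TE.
have T0 : (0 < T)%N by rewrite TE expn_gt0 U0.
pose X A B (c : int) (t : int) := `[< core_cond 3 b (gpoly b A B (c *: 'X + t%:P)) >] && (Nf b A B != 0).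
have szg A B c t : c != 0 -> size (gpoly b A B (c *: 'X + t%:P)) = 4.
  move=> c0; apply: size_gpoly; rewrite size_polyDl size_scale ?size_polyX //.
  by rewrite (leq_ltn_trans (size_polyC_leq1 _)).
have szc : (size (clist mo T) <= 3 * T ^ (1 - mo))%N.
  rewrite /clist; case: (mo) => //; rewrite subn0 expn1 size_filter (leq_trans (count_size _ _)) // size_rng.
  by move: T0; clear; lia.
rewrite nm.
apply: (@leq_trans (\sum_(A <- rng T) \sum_(B <- rng T) \sum_(c <- clist mo T) count (X A B c) (rng T))%N).
  apply: leq_sum2_seq => A B _ _; rewrite big_seq [X in (_ <= X)%N]big_seq; apply: leq_sum => c cS.
  apply: sub_count => t co; have /andP[c0 _] := mem_clist T0 cS.
  by rewrite /X co (core_Nf_neq0 (szg A B c t c0) (asboolW co)).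
apply: (H U T _ (clist mo T) (fun=> 1%N) X exc3 U0 TE).
- move=> g g0; under eq_bigr do rewrite gcdn1; rewrite sum_const_seq muln1.
  apply: leq_trans szc _; rewrite -mulnA leq_mul //.
  rewrite leq_pmulr //; have : g \in divisors g by rewrite -dvdn_divisors.
  by case: (divisors g).
- by move=> A B s t /andP[].
- move=> A B c p ts AT BT sS pp od pC0 pl Hts uts.
  have cd i : (4 < i)%N -> (disc3 A B c)`_i = 0.
    rewrite /disc3 !coefD !coefZ !coefXn coefX coefC.
    by case: i => [|[|[|[|[|j]]]]] //= _; rewrite !mulr0 !addr0.
  have c4 : (disc3 A B c)`_4 = 16 * b.
    by rewrite /disc3 !coefD !coefZ !coefXn coefX coefC /= !(mulr0n, mulr1n); ring.
  have sz : (size (disc3 A B c) <= 5)%N by apply/leq_sizeP => j hj; apply: cd.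
  have h := @poly_roots_modp (disc3 A B c) p ts pp.
  apply: (@leq_trans (size (disc3 A B c)).-1); last by move: (size _) sz; clear; lia.
  apply: h => //; first by exists 4%N; rewrite c4 dvdz_eq abszM.
  move=> t /Hts[_ /andP[/asboolP co _]].
  have [y yE] := core_disc3 co; exact: odd_logn_dvd pp od yE.
- move=> A B c AT BT cS ne [t0 _ /andP[_ N0]].
  have /choice[y yE] : forall t, exists y : nat, core_cond 3 b (gpoly b A B (c *: 'X + t%:P)) ->
      (Nf b A B *: disc3 A B c).[t] = y%:Z ^+ 2.
    move=> t; have [co|nco] := pselect (core_cond 3 b (gpoly b A B (c *: 'X + t%:P))); last by exists 0%N.
    by have [y yE] := core_disc3 co; exists y => _; rewrite hornerZ mulrC.
  exists (Nf b A B *: disc3 A B c), y; split.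
  + rewrite (leq_trans (size_scale_leq _ _)) //; apply/leq_sizeP => j.
    rewrite /disc3 !coefD !coefZ !coefXn coefX coefC.
    by case: j => [|[|[|[|[|j]]]]] //= _; rewrite !mulr0 !addr0.
  + exact: disc3_nonsquare.
  move=> t tT /andP[/asboolP co _]; split; first exact: yE.
  apply: absz_sq_leq (yE t co) _; rewrite hornerZ abszM.
  apply: leq_trans (leq_mul (Nf_bound b AT BT) (leqnn _)) _.
  have /andP[_ cT] := mem_clist T0 cS.
  move: AT BT tT; rewrite !mem_rng => AT BT tT.
  have l1 : (`|(B - 4 * b * c)%R| <= k1 * T)%N.
    by rewrite (leq_trans (leq_abszB _ _)) // /k1 mulnDl mul1n leq_add // !abszM leq_mul.
  have l0 : (`|(A - 4 * b * t)%R| <= k1 * T)%N.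
    by rewrite (leq_trans (leq_abszB _ _)) // /k1 mulnDl mul1n leq_add // !abszM leq_mul.
  have dB : (`|(disc3 A B c).[t]| <= Kd * T ^ 4)%N.
    rewrite disc3E; set c1 := B - _ in l1 *; set c0 := A - _ in l0 *; rewrite /Kd !mulnDl.
    rewrite (leq_trans (leq_abszB _ _)) // leq_add //; last first.
      rewrite !(abszX, abszM); apply: (@leq_trans (27 * T ^ 2 * (k1 * T) ^ 2)%N).
        by rewrite leq_mul ?leq_mul ?leq_expr.
      by rewrite expnMn (_ : 4 = 2 + 2)%N // expnD; apply/eq_leq; ring.
    rewrite (leq_trans (leq_abszB _ _)) // leq_add //; last first.
      rewrite !(abszX, abszM); apply: (@leq_trans (4 * T * (k1 * T) ^ 3)%N).
        by rewrite leq_mul ?leq_mul ?leq_expr.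
      by rewrite expnMn (_ : 4 = 1 + 3)%N // expnD expn1; apply/eq_leq; ring.
    rewrite (leq_trans (leq_abszD _ _)) // leq_add //; last first.
      rewrite !(abszX, abszM); apply: (@leq_trans (T ^ 2 * (k1 * T) ^ 2)%N).
        by rewrite leq_mul ?leq_expr.
      by rewrite expnMn (_ : 4 = 2 + 2)%N // expnD; apply/eq_leq; ring.
    rewrite (leq_trans (leq_abszB _ _)) // leq_add //; last first.
      rewrite !(abszX, abszM); apply: (@leq_trans (4 * T ^ 3 * (k1 * T))%N).
        by rewrite leq_mul ?leq_mul ?leq_expr.
      by rewrite (_ : 4%N = 3 + 1)%N // expnD expn1; apply/eq_leq; ring.
    rewrite !abszM; apply: (@leq_trans (18 * T * T * (k1 * T) * (k1 * T))%N).
      by rewrite !leq_mul.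
    by rewrite !expnS expn0; apply/eq_leq; ring.
  apply: leq_trans (leq_mul (leqnn _) dB) _.
  apply: (@leq_trans (Kd * k1 * T ^ 6)%N); last by rewrite leq_mul2r leq_addl orbT.
  by rewrite -/k1 (_ : 6 = 2 + 4)%N // expnD; apply/eq_leq; ring.
- apply: (@leq_trans (\sum_(B <- rng T) \sum_(c <- clist mo T) 3)%N); last first.
    rewrite !sum_const_seq size_rng expnS.
    apply: (@leq_trans (3 * T * (3 * T ^ (1 - mo) * 3))%N).
      by rewrite !leq_mul //; move: T0; clear; lia.
    apply: (@leq_trans (27 * (T * T ^ (1 - mo)))%N); first by apply/eq_leq; ring.
    by rewrite leq_mul2r leq_addr orbT.
  rewrite exchange_big; apply: leq_sum => B _.
  apply: (@leq_trans (\sum_(c <- clist mo T) \sum_(A <- rng T) exc3 A B c)%N).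
    by rewrite exchange_big; apply: leq_sum => A _; rewrite sum_bool_count.
  apply: leq_sum => c _; rewrite sum_bool_count /exc3.
  pose z := 4 * b * d3a B c + 32 * b ^+ 2 * d3b B c.
  have h2 := count_predUI (pred1 (0 : int)) (fun A : int => A ^+ 2 == z) (rng T).
  apply: (leq_trans (leq_addr (count (predI (pred1 (0 : int)) (fun A : int => A ^+ 2 == z)) (rng T)) _)).
  rewrite [X in (X <= _)%N]h2.
  have h1 : (count_mem 0%R (rng T) <= 1)%N by rewrite count_uniq_mem ?rng_uniq // leq_b1.
  exact: leq_add h1 (count_sqr_eq T z).
Qed.

End Deg3.

End SmallDegree.

(** * Monic quadratics *)

Section SquarefreeCongruences.
Local Open Scope ring_scope.

Lemma sf_dvd_sqr (n x : nat) : (sf n %| x ^ 2)%N -> (sf n %| x)%N.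
Proof.
move=> h; apply: prod_primes_dvd; [exact: oddp_uniq|exact: oddp_prime|] => p po.
have pp := allP (oddp_prime n) _ po.
have : (p %| x ^ 2)%N by apply: dvdn_trans h; rewrite /sf (big_rem p) //= dvdn_mulr.
by rewrite Euclid_dvdX // andbT.
Qed.

Lemma smsf_dvd_sqr (n x : int) : n != 0 -> (smsf n %| x ^+ 2)%Z -> (smsf n %| x)%Z.
Proof.
move=> n0; rewrite !dvdzE abszX absz_smsf //; exact: sf_dvd_sqr.
Qed.

Lemma smsf_eq (x y : int) (z : nat) : x != 0 -> y != 0 -> x * y = z%:Z ^+ 2 -> smsf x = smsf y.
Proof.
move=> x0 y0 e; have z0 : (0 < z)%N.
  by case: z e => // /eqP; rewrite expr0n /= mulf_eq0 (negPf x0) (negPf y0).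
have xy : 0 < x * y by rewrite e exprn_gt0.
rewrite /smsf; congr (_ * _%:Z).
  case: (sgzP x) xy x0 => [->|hx|hx] xy x0 //; case: (sgzP y) xy y0 => [->|hy|hy] xy y0 //.
    by move: xy; rewrite pmulr_rgt0 // ltNge ltW.
  by move: xy; rewrite nmulr_rgt0 // ltNge ltW.
apply: perm_big; apply: uniq_perm; rewrite ?oddp_uniq // => p; rewrite !mem_oddp.
have := congr1 (fun w : int => odd (logn p `|w|)) e.
rewrite abszM lognM ?absz_gt0 // oddD abszX lognX oddM /= => /eqP.
by rewrite addbC; case: (odd _); case: (odd _).
Qed.

Lemma sf_nonsquare (n : nat) (x y : int) : (1 < sf n)%N -> x != 0 -> (sf n)%:Z * x ^+ 2 <> y ^+ 2.
Proof.
move=> n1 x0 e; case eo: (oddp n) => [|p ps]; first by move: n1; rewrite /sf eo big_nil.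
have po : p \in oddp n by rewrite eo mem_head.
have := congr1 (fun w : int => odd (logn p `|w|)) e.
rewrite abszM !abszX absz_nat lognM ?sf_gt0 ?expn_gt0 ?absz_gt0 ?x0 // !lognX oddD !oddM /= addbF.
by rewrite logn_prod_primes ?oddp_uniq ?oddp_prime // po.
Qed.

End SquarefreeCongruences.

(** * Dirichlet approximation and lines near the hyperbola *)

Section Dirichlet.
Local Open Scope ring_scope.

Lemma dirichlet (R : realType) (s : R) (X : nat) : (0 < X)%N ->
  exists (x : nat) (l : int), (0 < x <= X)%N /\ X%:R * `|s * x%:R - l%:~R| <= 1.
Proof.
move=> X0; pose fr (i : nat) : R := s * i%:R - (Num.floor (s * i%:R))%:~R.
have fr0 i : 0 <= fr i by rewrite subr_ge0 floor_le.
have fr1 i : fr i < 1 by have := floorD1_gt (s * i%:R); rewrite /fr intrD; lra.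
pose h i := Num.truncn (X%:R * fr i).
have XR : 0 < X%:R :> R by rewrite ltr0n.
have hX i : (h i < X)%N.
  by rewrite /h -(ltr_nat R) (@le_lt_trans _ _ (X%:R * fr i)) ?truncn_le ?mulr_ge0 ?(ltW XR) // -[X in _ < X]mulr1 ltr_pM2l.
have [/injectiveP inj|] := boolP (injectiveb (fun i : 'I_X.+1 => Ordinal (hX i))).
  by have := leq_card _ inj; rewrite !card_ord ltnn.
case/injectivePn => i [j ij /(congr1 val)/= hij].
wlog lt_ij : i j ij hij / (i < j)%N => [H|].
  have [lt|gt|e] := ltngtP i j; first exact: (H i j).
    by apply: (H j i) => //; rewrite eq_sym.
  by case/eqP: ij; apply: val_inj.
exists (j - i)%N, (Num.floor (s * j%:R) - Num.floor (s * i%:R)); split.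
  by rewrite subn_gt0 lt_ij (leq_trans (leq_subr _ _)) // -ltnS.
rewrite natrB ?(ltnW lt_ij) // rmorphB /=.
have -> : s * (j%:R - i%:R) - ((Num.floor (s * j%:R))%:~R - (Num.floor (s * i%:R))%:~R) = fr j - fr i.
  by rewrite /fr; ring.
rewrite -[X in X * _](ger0_norm (ltW XR)) -normrM mulrBr.
have b1 k : (h k)%:R <= X%:R * fr k by rewrite truncn_le mulr_ge0 // ltW.
have b2 k : X%:R * fr k < (h k).+1%:R by apply: truncnS_gt.
have := b1 i; have := b1 j; have := b2 i; have := b2 j; rewrite hij -natr1.
by move: (h j)%:R (X%:R * fr i) (X%:R * fr j) => u v w h1 h2 h3 h4; rewrite ler_norml; apply/andP; split; lra.
Qed.

End Dirichlet.

Section Lines.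
Local Open Scope ring_scope.
Variables (R : realType) (b : int).
Hypothesis b0 : b != 0.

(** Both points lie within [K] of the line [v1 = s v2], and their first coordinates differ by
    [s^2 x1 (y - y')]. Moving by [(y - y') l1] in the second coordinate nearly follows that line,
    with error controlled by [s x1 - l1]; so the offsets [v2 - y l1] take few values. *)
Lemma offset_close (s x1 l1 v1 v2 v1' v2' y y' L K : R) : 1 <= s ->
  `|v1 - s * v2| <= K -> `|v1' - s * v2'| <= K -> v1 - v1' = s ^+ 2 * x1 * (y - y') ->
  `|y - y'| <= L -> L * `|s * x1 - l1| <= 1 ->
  `|(v2 - y * l1) - (v2' - y' * l1)| <= 1 + 2 * K.
Proof.
move=> s1 h1 h2 e hy hd; have s0 : 0 < s by apply: lt_le_trans s1.
set X := _ - _; have sX : s * X = (y - y') * (s * (s * x1 - l1)) - (v1 - s * v2) + (v1' - s * v2').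
  have -> : (y - y') * (s * (s * x1 - l1)) = (v1 - v1') - (y - y') * s * l1 by rewrite e; ring.
  by rewrite /X; ring.
have K0 : 0 <= K by apply: le_trans h1.
rewrite -(ler_pM2l s0) -[X in X * _ <= _](gtr0_norm s0) -normrM sX.
have hm : `|(y - y') * (s * (s * x1 - l1))| <= s.
  rewrite normrM normrM (gtr0_norm s0) mulrCA -[X in _ <= X]mulr1 ler_pM2l //.
  by apply: le_trans hd; rewrite ler_wpM2r.
apply: le_trans (ler_normD _ _) _; apply: le_trans (lerD (ler_normB _ _) h2) _.
apply: le_trans (lerD (lerD hm h1) (lexx _)) _.
by rewrite mulrDr mulr1 -addrA lerD2l; nra.
Qed.

(** On the line [B = b0' + m x1 t], [l = l0 + l1 t], the relation [D2 = m l^2] makes the inner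
    expression [(4 A)^2 - 64 b B^2 = 16 N]; the outer [m] makes the value a square when
    [N = m k^2]. *)
Definition quartic (m b0' l0 l1 x1 : int) : {poly int} :=
  let Bp := (m * x1) *: 'X + b0'%:P in let lp := l1 *: 'X + l0%:P in
  m *: ((Bp ^+ 2 - m *: lp ^+ 2 + (16 * b)%:P) ^+ 2 - (64 * b) *: Bp ^+ 2).

Lemma horner_quartic m B0 l0 l1 x1 t (v1 := B0 + m * x1 * t) (v2 := l0 + l1 * t) :
  (quartic m B0 l0 l1 x1).[t] = m * ((v1 ^+ 2 - m * v2 ^+ 2 + 16 * b) ^+ 2 - 64 * b * v1 ^+ 2).
Proof.
rewrite /quartic hornerZ hornerD hornerN hornerZ !horner_exp !hornerD hornerN hornerZ !horner_exp.
rewrite !hornerD !hornerZ !hornerX !hornerC /v1 /v2; ring.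
Qed.

Lemma size_linear (x y : int) : (size (x *: 'X + y%:P)%R <= 2)%N.
Proof.
rewrite (leq_trans (size_polyD _ _)) // geq_max (leq_trans (size_scale_leq _ _)) ?size_polyX //=.
by rewrite (leq_trans (size_polyC_leq1 _)).
Qed.

Lemma size_sqr_leq (K : comNzRingType) (p : {poly K}) k : (size p <= k.+1)%N -> (size (p ^+ 2)%R <= (2 * k).+1)%N.
Proof.
by move=> h; rewrite expr2 (leq_trans (size_polyMleq _ _)) //; move: (size p) h; clear; lia.
Qed.

Lemma coef_sqr_top (K : comNzRingType) (p : {poly K}) k : (size p <= k.+1)%N -> (p ^+ 2)`_(2 * k) = p`_k ^+ 2.
Proof. by move=> h; rewrite expr2 mul2n -addnn (coefM_top h h) expr2. Qed.

(** The leading coefficient is [m] times the square of [m (m x1^2 - l1^2)]. As [m] is squarefree and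
    greater than 1, it is not a rational square, so that number is nonzero and the leading
    coefficient is not a square. *)
Lemma quartic_nonsquare (n : nat) (m B0 l0 l1 x1 : int) : m = (sf n)%:Z -> (1 < sf n)%N -> x1 != 0 ->
  (size (quartic m B0 l0 l1 x1) <= 5)%N /\ forall Y : {poly rat}, map_poly intr (quartic m B0 l0 l1 x1) != Y ^+ 2.
Proof.
move=> mE n1 x10; rewrite /quartic; set Bp := _ *: 'X + _; set lp := l1 *: 'X + _.
set Q := Bp ^+ 2 - _ + _.
have sB : (size (Bp ^+ 2) <= 3)%N by apply: (@size_sqr_leq _ _ 1); apply: size_linear.
have sl : (size (lp ^+ 2) <= 3)%N by apply: (@size_sqr_leq _ _ 1); apply: size_linear.
have sQ : (size Q <= 3)%N.
  rewrite (leq_trans (size_polyD _ _)) // geq_max (leq_trans (size_polyC_leq1 _)) // andbT.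
  rewrite (leq_trans (size_polyD _ _)) // geq_max sB size_polyN.
  by rewrite (leq_trans (size_scale_leq _ _)).
have Q2 : Q`_2 = m * (m * x1 ^+ 2 - l1 ^+ 2).
  rewrite !coefD coefN coefZ coefC /= addr0.
  rewrite (@coef_sqr_top _ Bp 1 (size_linear _ _)) (@coef_sqr_top _ lp 1 (size_linear _ _)).
  by rewrite !coefD !coefZ !coefX !coefC /= !(addr0, mulr1); ring.
have q0 : m * (m * x1 ^+ 2 - l1 ^+ 2) != 0.
  rewrite mulf_neq0 ?mE //; first by rewrite eqz_nat -lt0n ltnW.
  by rewrite subr_eq0; apply/eqP; apply: sf_nonsquare.
set P := m *: _; have sP : (size P <= 5)%N.
  rewrite (leq_trans (size_scale_leq _ _)) // (leq_trans (size_polyD _ _)) // geq_max size_polyN.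
  rewrite (@size_sqr_leq _ Q 2) //= (leq_trans (size_scale_leq _ _)) //.
  by apply: leq_trans sB _.
split=> // Y; apply/eqP => h.
have P4 : P`_4 = m * (m * (m * x1 ^+ 2 - l1 ^+ 2)) ^+ 2.
  rewrite coefZ coefB coefZ (@coef_sqr_top _ Q 2 sQ) Q2 [(Bp ^+ 2)`_4]nth_default ?mulr0 ?subr0 //.
  by apply: leq_trans sB _.
have sY : (size Y <= 3)%N.
  have sz2 : (size (Y ^+ 2) <= 5)%N by rewrite -h size_map_intr.
  have := size_exp Y 2; move: (size (Y ^+ 2)) sz2 => a; move: (size Y) => c; clear; lia.
have := congr1 (fun p : {poly rat} => p`_4) h.
rewrite coef_map /= (@coef_sqr_top _ Y 2 sY) P4 => /esym/rat_sqr_int[y].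
rewrite {1}mE; exact: sf_nonsquare.
Qed.

Let K1 := (4 + 16 * `|b|)%N.

(** With [s = sqrt m], [(v1 - s v2)(v1 + s v2) = 4 A - 16 b] is [O(T)], and the second factor is at
    least [v1 >= T / U]. *)
Lemma near_line (s : R) (m T U : nat) (v1 v2 : nat) (A : int) : s ^+ 2 = m%:R -> 0 <= s ->
  (0 < v1)%N -> (T <= v1 * U)%N -> (`|A| <= T)%N -> (0 < T)%N ->
  v1%:Z ^+ 2 - 4 * A + 16 * b = m%:Z * v2%:Z ^+ 2 -> `|v1%:R - s * v2%:R| <= (K1 * U)%:R :> R.
Proof.
move=> s2 s0 v10 TU AT T0 e.
have eR : (v1%:R - s * v2%:R) * (v1%:R + s * v2%:R) = (4 * A - 16 * b)%:~R :> R.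
  have -> : 4 * A - 16 * b = v1%:Z ^+ 2 - m%:Z * v2%:Z ^+ 2 by rewrite -e; ring.
  rewrite !expr2 !(rmorphB, rmorphM) /= -!pmulrn -s2; ring.
have v1R : 0 < v1%:R :> R by rewrite ltr0n.
have sv : 0 <= s * v2%:R by rewrite mulr_ge0.
have hA : (`|(4 * A - 16 * b)%R| <= K1 * T)%N.
  apply: leq_trans (leq_abszB _ _) _; rewrite !abszM /K1 mulnDl; apply: leq_add; first by rewrite leq_mul.
  by rewrite leq_pmulr.
rewrite -(ler_pM2r v1R).
apply: (@le_trans _ _ `|(v1%:R - s * v2%:R) * (v1%:R + s * v2%:R)|).
  by rewrite normrM ler_wpM2l // ger0_norm ?addr_ge0 // lerDl.
rewrite eR -intr_norm -abszE -pmulrn -natrM ler_nat (leq_trans hA) //.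
by rewrite -mulnA leq_mul // mulnC.
Qed.

(* With [x1] and [l1 / x1] a Dirichlet approximation of [sqrt m], the points [(B, l)] with
   [B^2 - m l^2] small and [B] in a fixed class modulo [m x1] lie on few lines of direction
   [(m x1, l1)]. *)
Lemma line_count (n m T U V CB EB K kap Ct : nat) (q : seq (nat * nat)) :
  (0 < V)%N -> (0 < EB)%N -> (0 < U)%N -> (0 < T)%N ->
  (forall (P : {poly int}) (a : int) (Q : pred int) (y : int -> nat),
     (size P <= 5)%N -> (forall Y : {poly rat}, map_poly intr P != Y ^+ 2) ->
     (forall t, t \in itv a (V ^ EB) -> Q t -> P.[t] = (y t)%:Z ^+ 2 /\ (y t <= K * (V ^ EB) ^ kap)%N) ->
     (count Q (itv a (V ^ EB)) <= CB * V ^ EB.-1)%N) ->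
  (16 * (1 + 4 * `|b|) * T ^ 3 <= K * (V ^ EB) ^ kap)%N ->
  m = sf n -> (1 < m)%N -> (m * (V ^ EB) ^ 2 <= T)%N -> (size (divisors m) <= Ct * U)%N -> uniq q ->
  (forall v, v \in q -> [/\ (0 < v.1 <= T)%N, (T <= v.1 * U ^ 5)%N, (m%:Z %| v.1%:Z ^+ 2 - 16 * b)%Z &
     exists A k : int, [/\ (`|A| <= T)%N, v.1%:Z ^+ 2 - 4 * A + 16 * b = m%:Z * v.2%:Z ^+ 2 &
                           Nf b A v.1%:Z = m%:Z * k ^+ 2]]) ->
  (size q * (m * V) <= CB * (3 + 4 * K1) * ((64 * `|b|).+1 * Ct) * 2 * U ^ 6 * T)%N.
Proof.
move=> V0 EB0 U0 T0 BP KT mE m1 mT tau uq Hq; set L := (V ^ EB)%N in BP KT mT.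
have L0 : (0 < L)%N by rewrite expn_gt0 V0.
have m0 : (0 < m)%N by apply: ltnW.
pose s : R := Num.sqrt m%:R.
have s2 : s ^+ 2 = m%:R by rewrite sqr_sqrtr.
have s1 : 1 <= s by rewrite -[X in X <= _]sqrtr1 ler_wsqrtr // ler1n.
have s0 : 0 <= s by apply: le_trans s1.
have [x1 [l1 [/andP[x10 x1L] dirX]]] := dirichlet s L0.
(* Write [v.1 = nu + m (i + x1 (y + L j))] with [i < x1] and [y < L]. The key [(nu, i, j)] fixes
   everything but [y = yv v], and [l0] tells on which line of direction [(m x1, l1)] the point lies.
   The residue [nu] is a square root of [16 b] modulo [m], so it takes few values. *)
pose nu (v : nat * nat) := (v.1%:Z %% m%:Z)%Z.
pose yv (v : nat * nat) := ((v.1 %/ m %/ x1) %% L)%N.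
pose key (v : nat * nat) := (nu v, ((v.1 %/ m %% x1)%N, (v.1 %/ (m * x1 * L))%N)).
pose l0 (v : nat * nat) : int := v.2%:Z - (yv v)%:Z * l1.
have v1E v : v.1%:Z = (nu v + m%:Z * ((v.1 %/ m %% x1)%N%:Z + x1%:Z * ((v.1 %/ (m * x1 * L))%N * L)%N%:Z)) + m%:Z * x1%:Z * (yv v)%:Z.
  rewrite /nu modz_nat /yv !divnMA.
  rewrite {1}(divn_eq v.1 m) {1}(divn_eq (v.1 %/ m) x1) {1}(divn_eq (v.1 %/ m %/ x1) L).
  by rewrite !(PoszD, PoszM); ring.
pose J := (T %/ (m * x1 * L))%N.
pose r1 := undup (map nu q).
pose r := [seq (a, rj) | a <- r1, rj <- [seq (i, j) | i <- iota 0 x1, j <- iota 0 J.+1]].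
pose Dl := (1 + 2 * (K1 * U ^ 5))%N.
have ncl1 : (size r1 <= (64 * `|b|).+1 * size (divisors m))%N.
  have -> : r1 = undup (map (modz^~ m%:Z) (map (fun v : nat * nat => v.1%:Z) q)) by rewrite -map_comp.
  apply: (@sqrt_mod_count m (64 * `|b|) (16 * b) _ m0).
    move=> g _; rewrite dvdz_eq !abszM => h; apply: (@leq_trans (g ^ 2)%N).
      by rewrite -mulnn; case: (g) => // g'; rewrite leq_pmulr.
    have h0 : (0 < `|4%R| * (`|16%R| * `|b|))%N by rewrite !muln_gt0 (absz_gt0 b) b0.
    by apply: leq_trans (dvdn_leq h0 h) _; rewrite mulnA.
  by move=> x /mapP[v vq ->]; have [_ _ h _] := Hq v vq.
have szq : (size q <= CB * V ^ EB.-1 * (2 * Dl + 1) * size r)%N.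
  apply: (size_fiber (f := key)) => [v vq|ky _].
    apply: allpairs_f; first by rewrite mem_undup map_f.
    have [/andP[_ vT] _ _ _] := Hq v vq.
    by apply: allpairs_f; rewrite mem_iota /= add0n ?ltn_pmod // ltnS leq_div2r.
  rewrite -size_filter; case eF: (filter _ _) => [|v0 F']; first by [].
  have v0F : v0 \in filter (fun x => key x == ky) q by rewrite eF mem_head.
  rewrite -eF; set F := filter _ q in v0F *.
  have FE v : v \in F -> key v = ky /\ v \in q by rewrite mem_filter => /andP[/eqP].
  rewrite -(size_itv (l0 v0 - Dl%:Z) (2 * Dl + 1)).
  apply: (size_fiber (f := l0)) => [v vF|lc _].
    have close : `|(l0 v)%:~R - (l0 v0)%:~R| <= Dl%:R :> R.
      have [kv vq] := FE v vF; have [kv0 v0q] := FE v0 v0F.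
      have [/andP[p1 _] TU _ [A [k [AT eA _]]]] := Hq v vq.
      have [/andP[p1' _] TU' _ [A' [k' [AT' eA' _]]]] := Hq v0 v0q.
      have n1 := near_line s2 s0 p1 TU AT T0 eA.
      have n2 := near_line s2 s0 p1' TU' AT' T0 eA'.
      have lE w : (l0 w)%:~R = w.2%:R - (yv w)%:R * l1%:~R :> R by rewrite /l0 rmorphB rmorphM /= -!pmulrn.
      rewrite !lE /Dl natrD natrM.
      apply: (@offset_close s x1%:R _ v.1%:R _ v0.1%:R _ _ _ L%:R) => //.
        have := v1E v; have := v1E v0; rewrite /key in kv kv0; move: kv0; rewrite -kv => -[-> -> ->].
        move: (nu v + _) => z e0 e1; rewrite s2 !pmulrn e0 e1 !rmorphD !rmorphM /=; ring.
      have y0 w : 0 <= (yv w)%:R :> R by rewrite ler0n.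
      have yL w : (yv w)%:R <= L%:R :> R by rewrite ler_nat ltnW // ltn_pmod.
      have := y0 v; have := y0 v0; have := yL v; have := yL v0.
      move: (yv v)%:R (yv v0)%:R L%:R => c d e h1 h2 h3 h4.
      by rewrite ler_norml; apply/andP; split; lra.
    move: close; rewrite -rmorphB -intr_norm -abszE -pmulrn ler_nat mem_itv.
    by move: (l0 v) (l0 v0) Dl; clear; lia.
  pose Qy (y : int) := has (fun v => (l0 v == lc) && (yv v == `|y|%N)) F.
  have [B0 B0E] : exists B0 : int, forall v, v \in F -> v.1%:Z = B0 + m%:Z * x1%:Z * (yv v)%:Z.
    exists (nu v0 + m%:Z * ((v0.1 %/ m %% x1)%N%:Z + x1%:Z * ((v0.1 %/ (m * x1 * L))%N * L)%N%:Z)).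
    move=> v vF; have [kv _] := FE v vF; have [kv0 _] := FE v0 v0F.
    by rewrite {1}(v1E v); move: kv0; rewrite -kv /key => -[-> -> ->].
  have l0E v : l0 v = lc -> v.2%:Z = lc + l1 * (yv v)%:Z by move=> <-; rewrite /l0; ring.
  have yvL v : (yv v < L)%N by rewrite ltn_pmod.
  apply: (@leq_trans (count Qy (itv 0 L))).
    rewrite -!size_filter -(size_map (fun v => (yv v)%:Z)); apply: uniq_leq_size.
      rewrite map_inj_in_uniq ?filter_uniq // => v w; rewrite [v \in _]mem_filter [w \in _]mem_filter.
      move=> /andP[/eqP lv vF] /andP[/eqP lw wF] [eyv].
      have := B0E v vF; rewrite eyv -(B0E w wF) => -[e1].
      have := l0E v lv; rewrite eyv -(l0E w lw) => -[e2].
      by case: (v) (w) e1 e2 => ? ? [? ?] /= -> ->.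
    move=> _ /mapP[v + ->]; rewrite mem_filter => /andP[/eqP lv vF].
    rewrite mem_filter mem_itv add0r ltz_nat yvL /=; apply/andP; split=> //.
    by apply/hasP; exists v => //; rewrite lv absz_nat !eqxx.
  have [szP nsq] := @quartic_nonsquare n m%:Z B0 lc l1 x1%:Z (congr1 Posz mE) ltac:(by rewrite -mE) ltac:(by rewrite eqz_nat -lt0n).
  have HP t : exists y : nat, t \in itv 0 L -> Qy t ->
      (quartic m%:Z B0 lc l1 x1%:Z).[t] = y%:Z ^+ 2 /\ (y <= K * L ^ kap)%N.
    have [/andP[tI /hasP[v vF /andP[/eqP lv /eqP yt]]]|nQ] := boolP ((t \in itv 0 L) && Qy t); last first.
      by exists 0%N => tI Qt; rewrite tI Qt in nQ.
    have [_ vq] := FE v vF; have [/andP[_ vT] _ _ [A [k [AT eA eN]]]] := Hq v vq.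
    have tE : t = (yv v)%:Z by move: tI; rewrite mem_itv yt => /andP[t0 _]; rewrite gez0_abs.
    exists `|(4 * m%:Z * k)%R|%N => _ _; rewrite horner_quartic tE -(B0E v vF) -(l0E v lv).
    have e4 : v.1%:Z ^+ 2 - m%:Z * v.2%:Z ^+ 2 + 16 * b = 4 * A by rewrite -eA; ring.
    have e5 : m%:Z * ((4 * A) ^+ 2 - 64 * b * v.1%:Z ^+ 2) = 16 * m%:Z * Nf b A v.1%:Z by rewrite /Nf; ring.
    rewrite e4 e5 eN abszE real_normK ?num_real //; split; first by ring.
    apply: leq_trans KT; have := @absz_sq_leq `|(4 * m%:Z * k)%R| (16 * m%:Z * Nf b A v.1%:Z).
    apply.
      by rewrite eN abszE real_normK ?num_real //; ring.
    rewrite !abszM absz_nat; have AT' : A \in rng T by rewrite mem_rng.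
    have vT' : v.1%:Z \in rng T by rewrite mem_rng absz_nat.
    apply: (@leq_trans (16 * T * ((1 + 4 * `|b|) * T ^ 2))%N).
      rewrite leq_mul ?(Nf_bound b AT' vT') // leq_mul // (leq_trans _ mT) // leq_pmulr //.
      by rewrite expn_gt0 L0.
    by rewrite !expnS expn0; apply/eq_leq; ring.
  have /choice[y yE] := HP.
  exact: (BP _ 0 Qy y szP nsq yE).
have szr : size r = (size r1 * (x1 * J.+1))%N by rewrite !size_allpairs !size_iota.
have VE : (V * V ^ EB.-1 = L)%N by rewrite -expnS prednK.
have xJ : (x1 * J.+1 * (m * L) <= 2 * T)%N.
  have -> : (x1 * J.+1 * (m * L) = J * (m * x1 * L) + m * (x1 * L))%N by ring.
  rewrite mul2n -addnn leq_add // ?leq_trunc_div // (leq_trans _ mT) // leq_mul // -mulnn leq_mul //.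
apply: leq_trans (leq_mul szq (leqnn _)) _; rewrite szr.
apply: (@leq_trans (CB * (2 * Dl + 1) * size r1 * (x1 * J.+1 * (m * L)))%N).
  by rewrite -VE; apply/eq_leq; ring.
apply: (@leq_trans (CB * ((3 + 4 * K1) * U ^ 5) * ((64 * `|b|).+1 * (Ct * U)) * (2 * T))%N).
  rewrite leq_mul // leq_mul //; last by apply: leq_trans ncl1 _; rewrite leq_mul2l tau orbT.
  rewrite leq_mul // /Dl; have : (0 < U ^ 5)%N by rewrite expn_gt0 U0.
  generalize (U ^ 5)%N K1 => u k u0; have -> : ((3 + 4 * k) * u = 3 * u + 4 * (k * u))%N by ring.
  by move: (k * u)%N u0; clear; lia.
by rewrite (_ : 6 = 5 + 1)%N // expnD expn1; apply/eq_leq; ring.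
Qed.

End Lines.

Section MonicQuadratic.
Local Open Scope ring_scope.
Variables (R : realType) (b : int).
Hypothesis b0 : b != 0.

(** The discriminant of the monic quadratic [u^2 + B u + (A - 4 b)]. *)
Definition D2 (A B : int) : int := B ^+ 2 - 4 * A + 16 * b.
(** Equality of signed squarefree parts says that [N * D2] is a square; the last clause says that
    [D2] is not a square. *)
Definition quad_cond (v : int * int) : bool :=
  [&& Nf b v.1 v.2 != 0, D2 v.1 v.2 != 0, smsf (Nf b v.1 v.2) == smsf (D2 v.1 v.2) & smsf (D2 v.1 v.2) != 1].

Lemma dvdz_smsf (x : int) : x != 0 -> (smsf x %| x)%Z.
Proof. by move=> x0; rewrite [X in (_ %| X)%Z](smsfE x0) dvdz_mulr.  Qed.

(** [(B^2 - 16 b)^2] is a combination of [N] and [D2], both divisible by the squarefree [m], so [m]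
    divides [B^2 - 16 b]; subtracting [D2] gives the second divisibility. *)
Lemma quad_cond_dvd A B : quad_cond (A, B) -> (smsf (D2 A B) %| B ^+ 2 - 16 * b)%Z /\ (smsf (D2 A B) %| 4 * (A - 8 * b))%Z.
Proof.
move=> /and4P[/= N0 D0 /eqP e _]; have dD := dvdz_smsf D0; have dN := dvdz_smsf N0; rewrite e in dN.
have h1 : (smsf (D2 A B) %| B ^+ 2 - 16 * b)%Z.
  apply: smsf_dvd_sqr => //.
  have -> : (B ^+ 2 - 16 * b) ^+ 2 = 16 * Nf b A B + D2 A B * (8 * A + D2 A B) by rewrite /Nf /D2; ring.
  by apply: dvdz_add; [apply: dvdz_mull|apply: dvdz_mulr].
split=> //; have -> : 4 * (A - 8 * b) = (B ^+ 2 - 16 * b) - D2 A B by rewrite /D2; ring.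
exact: dvdz_sub.
Qed.

Let Kc := (100 * (1 + `|b|))%N.

Lemma sqr_lower (T U : nat) (B : int) : (0 < U)%N -> (Kc * U ^ 10 <= T)%N -> (T <= `|B| * U ^ 5)%N ->
  (Kc * T <= `|B| ^ 2)%N /\ (T ^ 2 <= `|B| ^ 2 * U ^ 10)%N.
Proof.
move=> U0 KT TB; have h2 : (T ^ 2 <= `|B| ^ 2 * U ^ 10)%N.
  by rewrite (_ : 10 = 5 * 2)%N // expnM -expnMn leq_expr.
split=> //; have u0 : (0 < U ^ 10)%N by rewrite expn_gt0 U0.
rewrite -(leq_pmul2r u0); apply: leq_trans h2; rewrite -mulnn.
by rewrite mulnAC leq_mul2r KT orbT.
Qed.

(** For [|B| >= T / U^5] the term [B^2] dominates, so the discriminant and [m] are positive. As [A]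
    differs from [8 b], [m] divides a nonzero integer of size [O(T)], and the cofactor [w] of [m] in
    [B^2 - 16 b] is then at least of order [T / U^10]. *)
Lemma quad_cond_facts (T U : nat) (A B : int) (m := sf `|D2 A B|) (l := sqpart `|D2 A B|) :
  (0 < U)%N -> (0 < T)%N -> (Kc * U ^ 10 <= T)%N -> quad_cond (A, B) -> A != 8 * b ->
  (`|A| <= T)%N -> (`|B| <= T)%N -> (T <= `|B| * U ^ 5)%N ->
  [/\ (1 < m)%N, D2 A B = m%:Z * l%:Z ^+ 2, (exists k : int, Nf b A B = m%:Z * k ^+ 2),
      (exists2 w : nat, B ^+ 2 - 16 * b = m%:Z * w%:Z & (T <= Kc * w * U ^ 10)%N) &
      (exists2 a : int, 4 * (A - 8 * b) = m%:Z * a & (`|a| * m <= Kc * T)%N)].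
Proof.
move=> U0 T0 KT mo A8 AT BT TB; have [B2 TB2] := sqr_lower U0 KT TB.
have bT : (`|b| <= T)%N.
  by apply: leq_trans KT; rewrite /Kc -mulnA mulnCA (leq_trans _ (leq_pmulr _ _)) ?muln_gt0 ?expn_gt0 ?U0 // leq_addl.
have B2E : B ^+ 2 = (`|B| ^ 2)%N%:Z by rewrite -abszX gez0_abs // sqr_ge0.
have KTb : (Kc * T = 100 * T + 100 * (`|b| * T))%N by rewrite /Kc; ring.
have bbT : (`|b| <= `|b| * T)%N by rewrite leq_pmulr.
have Dp : 0 < D2 A B.
  by rewrite /D2 B2E; move: B2 bbT AT T0; rewrite KTb; move: (`|B| ^ 2)%N (`|b| * T)%N (b) => x y z; clear; lia.
have D0 : D2 A B != 0 by rewrite gt_eqF.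
have mE : smsf (D2 A B) = m%:Z by rewrite /smsf gtr0_sgz // mul1r.
have [d1 d2] := quad_cond_dvd mo; rewrite mE in d1 d2.
case/and4P: mo => /= N0 _ /eqP eN n1; rewrite mE in eN n1.
have m0 : (0 < m)%N by apply: sf_gt0.
have m1 : (1 < m)%N by move: m0 n1; case: (m) => [|[|]].
have A80 : A - 8 * b != 0 by rewrite subr_eq0.
have ah : (`|(4 * (A - 8 * b))%R| <= 36 * (1 + `|b|) * T)%N.
  rewrite abszM; apply: (@leq_trans (4 * (T + 8 * `|b|))%N).
    rewrite leq_mul // (leq_trans (leq_abszB _ _)) // leq_add // abszM //.
  have -> : (36 * (1 + `|b|) * T = 36 * T + 36 * (`|b| * T))%N by ring.
  by move: bbT; move: (`|b| * T)%N; clear; lia.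
have mle : (m <= 36 * (1 + `|b|) * T)%N.
  apply: leq_trans ah; apply: dvdn_leq; first by rewrite absz_gt0 mulf_neq0.
  by rewrite -dvdz_eq.
split=> //.
- by rewrite {1}(smsfE D0) mE.
- by exists (sqpart `|Nf b A B|)%:Z; rewrite {1}(smsfE N0) eN.
- have /dvdzP[w wE] := d1; rewrite [w * _]mulrC in wE.
  have Bb : (`|B| ^ 2)%N%:Z <= 2 * (B ^+ 2 - 16 * b).
    by rewrite B2E; move: B2 bbT T0; rewrite KTb; move: (`|B| ^ 2)%N (`|b| * T)%N (b) => x y z; clear; lia.
  have Bp : (0 < `|B| ^ 2)%N by apply: leq_trans B2; rewrite muln_gt0 T0 andbT.
  have w0 : 0 < w.
    have : 0 < m%:Z * w by rewrite -wE; move: Bb Bp; move: (`|B| ^ 2)%N (B ^+ 2 - 16 * b); clear; lia.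
    by rewrite pmulr_rgt0 // ltz_nat.
  exists `|w|%N; first by rewrite wE gez0_abs // ltW.
  have Bw : (`|B| ^ 2 <= 2 * (m * `|w|))%N.
    have mw : m%:Z * w = (m * `|w|)%N%:Z by rewrite PoszM gez0_abs // ltW.
    by move: Bb; rewrite wE mw; move: (`|B| ^ 2)%N (m * `|w|)%N; clear; lia.
  rewrite -(leq_pmul2l T0) [X in (X <= _)%N]mulnn.
  apply: leq_trans TB2 _; apply: leq_trans (leq_mul Bw (leqnn _)) _.
  apply: (@leq_trans (2 * (36 * (1 + `|b|) * T * `|w|) * U ^ 10)%N); first by rewrite !leq_mul.
  apply: (@leq_trans (72 * (T * ((1 + `|b|) * `|w| * U ^ 10)))%N); first by apply/eq_leq; ring.
  apply: (@leq_trans (100 * (T * ((1 + `|b|) * `|w| * U ^ 10)))%N); first by rewrite leq_mul.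
  by rewrite /Kc; apply/eq_leq; ring.
have /dvdzP[a aE] := d2; exists a; first by rewrite aE mulrC.
have -> : (`|a| * m = `|(4 * (A - 8 * b))%R|)%N by rewrite aE abszM absz_nat.
by apply: leq_trans ah _; rewrite leq_mul // /Kc leq_mul.
Qed.

Lemma count_pairs (T : nat) (P : pred (int * int)) :
  count P [seq (A, B) | A <- rng T, B <- rng T] = (\sum_(A <- rng T) \sum_(B <- rng T) P (A, B))%N.
Proof. by rewrite -sum_bool_count big_allpairs_dep. Qed.

Lemma pairs_uniq T : uniq [seq (A, B) | A <- rng T, B <- rng T].
Proof. by apply: allpairs_uniq; try exact: rng_uniq; move=> [? ?] [? ?] _ _ /= [-> ->]. Qed.

Lemma mem_pairs T v : (v \in [seq (A, B) | A <- rng T, B <- rng T]) = (`|v.1| <= T)%N && (`|v.2| <= T)%N.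
Proof.
apply/allpairsP/andP => [[[A B] /= [+ + ->]]|[h1 h2]]; first by rewrite !mem_rng.
by exists v; rewrite !mem_rng h1 h2; case: v h1 h2.
Qed.

Lemma count_degenerate T : (0 < T)%N ->
  (count (fun v : int * int => [|| v.2 == 0, v.2 ^+ 2 == 16 * b | v.1 == 8 * b]%R) [seq (A, B) | A <- rng T, B <- rng T]
   <= 12 * T)%N.
Proof.
move=> T0; rewrite count_pairs; have r3 : (size (rng T) <= 3 * T)%N by rewrite size_rng; move: T0; clear; lia.
apply: (@leq_trans (\sum_(A <- rng T) \sum_(B <- rng T) ((B == 0%R) + (B ^+ 2 == 16 * b)%R + (A == 8 * b)%R))%N).
  apply: leq_sum => A _; apply: leq_sum => B _ /=.
  by case: (B == 0); case: (_ == 16 * b); case: (A == _).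
apply: (@leq_trans (\sum_(A <- rng T) (3 + 3 * T * (A == 8 * b)%R))%N).
  apply: leq_sum => A _; rewrite !big_split /= sum_const_seq !sum_bool_count leq_add //.
    have h1 : (count_mem 0%R (rng T) <= 1)%N by rewrite count_uniq_mem ?rng_uniq // leq_b1.
    exact: leq_add h1 (count_sqr_eq T _).
  by rewrite leq_mul.
rewrite big_split /= sum_const_seq -big_distrr /= sum_bool_count.
have h1 : (count_mem (8 * b)%R (rng T) <= 1)%N by rewrite count_uniq_mem ?rng_uniq // leq_b1.
have -> : (12 * T = 3 * T * 3 + 3 * T * 1)%N by ring.
by rewrite leq_add // leq_mul.
Qed.

(** For each [B], [m] is a signed divisor of the nonzero integer [B^2 - 16 b], and each [m] admits
    [O(U^3)] values of [A] by the Pell count. The product [U^4] is covered by the shorter range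
    [T / U^5] of [B]. *)
Lemma count_small_B (E Ct Cp U T : nat) : (0 < U)%N -> T = (U ^ E)%N -> (U ^ 5 <= T)%N ->
  (forall n, (n <= Kc * T ^ 2)%N -> (size (divisors n) <= Ct * U)%N) ->
  (forall B m : int, B \in rng T -> B != 0 ->
     (count (fun A => (Nf b A B != 0) && (smsf (Nf b A B) == m)) (rng T) <= Cp * U ^ 3)%N) ->
  (count (fun v : int * int => [&& quad_cond v, v.2 != 0, v.2 ^+ 2 != 16 * b & (`|v.2| * U ^ 5 < T)%N]%R)
     [seq (A, B) | A <- rng T, B <- rng T] <= 6 * Ct * Cp * T)%N.
Proof.
move=> U0 TE UT Ht Hp; rewrite count_pairs exchange_big /=.
have T0 : (0 < T)%N by rewrite TE expn_gt0 U0.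
have U50 : (0 < U ^ 5)%N by rewrite expn_gt0 U0.
pose M := (2 * (Ct * U) * (Cp * U ^ 3))%N.
apply: (@leq_trans (\sum_(B <- rng T) (if (`|B| <= T %/ U ^ 5)%N then M else 0))%N).
  rewrite big_seq [X in (_ <= X)%N]big_seq; apply: leq_sum => B BT.
  case: ifP => [hB|nB]; last first.
    rewrite big1 // => A _; apply/eqP; rewrite eqb0; apply/negP => /and4P[_ _ _ h].
    by move: nB; rewrite leq_divRL // ltnW.
  rewrite sum_bool_count; case: (boolP ((B != 0) && (B ^+ 2 != 16 * b))) => [/andP[B0 B16]|nn]; last first.
    rewrite (eq_count (a2 := pred0)) ?count_pred0 // => A /=; apply/negP => /and4P[_ h1 h2 _].
    by rewrite h1 h2 in nn.
  pose z := `|(B ^+ 2 - 16 * b)%R|%N.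
  have z0 : (0 < z)%N by rewrite absz_gt0 subr_eq0.
  pose r : seq int := [seq d%:Z | d <- divisors z] ++ [seq - d%:Z | d <- divisors z].
  have szr : (size r <= 2 * (Ct * U))%N.
    rewrite size_cat !size_map addnn -mul2n leq_mul2l Ht //.
    rewrite /z; apply: leq_trans (leq_abszB _ _) _; rewrite abszX abszM.
    apply: (@leq_trans (T ^ 2 + 16 * `|b| * T ^ 2)%N).
      by rewrite leq_add // ?leq_expr -?mem_rng // -mulnA leq_mul // leq_pmulr // expn_gt0 T0.
    rewrite -{1}[(T ^ 2)%N]mul1n -mulnDl leq_mul // /Kc; move: (`|b|%N); clear; lia.
  have -> : M = (Cp * U ^ 3 * (2 * (Ct * U)))%N by rewrite /M mulnC.
  apply: leq_trans (leq_mul (leqnn _) szr).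
  apply: (@count_fiber _ _ (fun A => smsf (Nf b A B))) => [A AT /and4P[mo _ _ _]|m _].
    have [d1 _] := quad_cond_dvd mo; case/and4P: mo => /= _ _ /eqP-> _; move: (smsf _) d1 => m d1.
    have mz : `|m|%N \in divisors z by rewrite -dvdn_divisors // -dvdzE.
    rewrite mem_cat; have [m0|m0] := lerP 0 m.
      by apply/orP; left; apply/mapP; exists `|m|%N => //; rewrite gez0_abs.
    by apply/orP; right; apply/mapP; exists `|m|%N => //; rewrite ltz0_abs // opprK.
  apply: leq_trans (Hp B m BT B0); apply: sub_count => A /andP[/and4P[mo _ _ _] ->].
  by case/and4P: mo => /= ->.
rewrite -big_mkcond big_const_seq iter_addn_0 -size_filter.
have szF : (size [seq x <- rng T | (`|x| <= T %/ U ^ 5)%N] <= 3 * (T %/ U ^ 5))%N.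
  apply: (@leq_trans (size (rng (T %/ U ^ 5)))).
    apply: uniq_leq_size; first by rewrite filter_uniq ?rng_uniq.
    by move=> x; rewrite mem_filter [x \in rng (T %/ _)]mem_rng => /andP[].
  have : (0 < T %/ U ^ 5)%N by rewrite divn_gt0.
  by rewrite size_rng; move: (T %/ U ^ 5)%N; clear; lia.
apply: leq_trans (leq_mul (leqnn M) szF) _.
apply: (@leq_trans (6 * Ct * Cp * (T %/ U ^ 5 * (U ^ 4))))%N.
  by rewrite /M (_ : 4 = 3 + 1)%N // expnD expn1; apply/eq_leq; ring.
rewrite leq_mul2l; apply/orP; right; apply: leq_trans (leq_trunc_div T (U ^ 5)).
by rewrite leq_mul2l leq_pexp2l ?orbT.
Qed.

Lemma D2_split A B : D2 A B = (B ^+ 2 - 16 * b) - 4 * (A - 8 * b).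
Proof. by rewrite /D2; ring. Qed.

Lemma D2_bound (T : nat) (A B : int) : (0 < T)%N -> (`|A| <= T)%N -> (`|B| <= T)%N ->
  (`|D2 A B| <= Kc * T ^ 2)%N /\ (`|(B ^+ 2 - 16 * b)%R| <= Kc * T ^ 2)%N.
Proof.
move=> T0 AT BT; have BT2 : (`|B| ^ 2 <= T ^ 2)%N by rewrite leq_expr.
have T2 : (T <= T ^ 2)%N by rewrite -mulnn leq_pmulr.
have bT : (`|b| <= `|b| * T ^ 2)%N by rewrite leq_pmulr // expn_gt0 T0.
have h1 : (`|(B ^+ 2)%R| <= T ^ 2)%N by rewrite abszX.
have KE : (Kc * T ^ 2 = 100 * T ^ 2 + 100 * (`|b| * T ^ 2))%N by rewrite /Kc; ring.
rewrite KE /D2; move: (B ^+ 2) h1 bT T2 AT => B2 + + + +; move: (`|b| * T ^ 2)%N (T ^ 2)%N (b) => x y z.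
by clear; lia.
Qed.

(** Sort by [l] and [a], where [D2 = m l^2] and [4 (A - 8 b) = m a]. As [m >= T / La^2], [l] is
    [O(La^6)] and [a] is [O(La^2)], which makes [O(T / La^2)] pairs. Such a pair determines
    [w = l^2 + a], with [B^2 - 16 b = m w]; so [B] is a square root of [16 b] modulo [w], and [w] is
    large enough to leave [O(U^11)] values. Finally [B] determines [m] and [A]. *)
Lemma count_large_m (Ct U T La : nat) : (0 < U)%N -> (0 < La)%N -> T = (La ^ 10)%N ->
  (Kc * U ^ 10 <= T)%N -> (U ^ 11 <= La ^ 2)%N ->
  (forall n, (n <= Kc * T ^ 2)%N -> (size (divisors n) <= Ct * U)%N) ->
  (count (fun v : int * int => [&& quad_cond v, v.1 != 8 * b, (T <= `|v.2| * U ^ 5)%N & (T <= sf `|D2 v.1 v.2| * La ^ 2)%N]%R)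
     [seq (A, B) | A <- rng T, B <- rng T] <= 24 * Kc ^ 3 * (64 * `|b|).+1 * Ct * T)%N.
Proof.
move=> U0 L0 TE KT UL Ht; have T0 : (0 < T)%N by rewrite TE expn_gt0 L0.
have K0 : (0 < Kc)%N by [].
pose mm (v : int * int) := sf `|D2 v.1 v.2|.
pose f (v : int * int) := (sqpart `|D2 v.1 v.2|, (4 * (v.1 - 8 * b) %/ (mm v)%:Z)%Z).
pose r := [seq (l, a) | l <- iota 0 (Kc * La ^ 6).+1, a <- rng (Kc * La ^ 2)].
have szr : (size r <= 6 * Kc ^ 2 * La ^ 8)%N.
  rewrite size_allpairs size_iota size_rng.
  have h1 : (0 < Kc * La ^ 6)%N by rewrite muln_gt0 K0 expn_gt0 L0.
  have h2 : (0 < Kc * La ^ 2)%N by rewrite muln_gt0 K0 expn_gt0 L0.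
  apply: (@leq_trans (2 * (Kc * La ^ 6) * (3 * (Kc * La ^ 2)))%N).
    by apply: leq_mul; move: (Kc * La ^ 6)%N (Kc * La ^ 2)%N h1 h2; clear; lia.
  by rewrite (_ : 8 = 6 + 2)%N // expnD; apply/eq_leq; ring.
pose k := (4 * Kc * U ^ 10 * ((64 * `|b|).+1 * (Ct * U)))%N.
apply: (@leq_trans (k * size r)%N); last first.
  apply: leq_trans (leq_mul (leqnn _) szr) _; have -> : T = (La ^ 2 * La ^ 8)%N by rewrite TE -expnD.
  apply: (@leq_trans (24 * Kc ^ 3 * (64 * `|b|).+1 * Ct * (U ^ 11 * La ^ 8))%N).
    by rewrite /k (_ : 11 = 10 + 1)%N // expnD expn1; apply/eq_leq; ring.
  by rewrite leq_mul2l leq_mul2r UL !orbT.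
apply: (@count_fiber _ _ f) => [[A B]|[l a] _].
  rewrite mem_pairs => /andP[/= AT BT] /and4P[/= mo A8 TB Tm].
  have [m1 De _ _ [a aE aK]] := quad_cond_facts U0 T0 KT mo A8 AT BT TB.
  have [Db _] := D2_bound T0 AT BT; move: De aE aK m1 Tm; rewrite /f /mm /=.
  move: (sf _) (sqpart _) => m l De aE aK m1 Tm; apply: allpairs_f.
    rewrite mem_iota /= add0n ltnS -leq_sqr.
    have h : (m * l ^ 2 <= Kc * T ^ 2)%N by move: Db; rewrite De abszM abszX !absz_nat.
    rewrite -(leq_pmul2l T0); apply: (@leq_trans (Kc * T ^ 2 * La ^ 2)%N).
      apply: leq_trans (leq_mul Tm (leqnn _)) _.
      by rewrite mulnAC leq_mul2r h orbT.
    have -> : (Kc * T ^ 2 * La ^ 2 = T * (Kc * (T * La ^ 2)))%N by rewrite -mulnn; ring.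
    rewrite leq_mul2l; apply/orP; right; rewrite expnMn leq_mul //; first by rewrite -mulnn leq_pmulr.
    by rewrite TE -expnD -expnM.
  have m0 : m%:Z != 0 by rewrite eqz_nat -lt0n ltnW.
  rewrite aE mulKz // mem_rng -(leq_pmul2l T0).
  apply: leq_trans (leq_mul Tm (leqnn _)) _.
  have -> : (m * La ^ 2 * `|a| = `|a| * m * La ^ 2)%N by ring.
  by apply: leq_trans (leq_mul aK (leqnn _)) _; apply/eq_leq; ring.
rewrite -size_filter; set F := filter _ _; case eF: F => [|[A0 B0] F']; first by [].
rewrite -eF; have FE v : v \in F -> exists w : nat, [/\ v.2 ^+ 2 - 16 * b = (mm v)%:Z * w%:Z,
    4 * (v.1 - 8 * b) = (mm v)%:Z * a, (0 < mm v)%N, w%:Z = l%:Z ^+ 2 + a & [/\ (T <= Kc * w * U ^ 10)%N, (w <= Kc * T ^ 2)%N & v.2 \in rng T]].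
  case: v => A B; rewrite mem_filter mem_pairs => /andP[/andP[/and4P[/= mo A8 TB Tm] fv] /andP[/= AT BT]].
  have [m1 De _ [w wE wK] [a' aE aK]] := quad_cond_facts U0 T0 KT mo A8 AT BT TB.
  have [_ Db] := D2_bound T0 AT BT; exists w.
  move: De wE aE aK m1 fv; rewrite /f /mm /=; move: (sf _) (sqpart _) => m l' De wE aE aK m1 /eqP[l'E].
  have m0 : m%:Z != 0 by rewrite eqz_nat -lt0n ltnW.
  rewrite {1}aE mulKz // => aa; rewrite -aa -l'E; split=> //; first exact: ltnW.
    apply: (mulfI m0); rewrite mulrDr -De -aE D2_split wE; ring.
  split=> //; last by rewrite mem_rng.
  by apply: leq_trans Db; rewrite wE abszM !absz_nat leq_pmull // ltnW.
have [w [_ _ _ wE [wK wT _]]] := FE (A0, B0) ltac:(by rewrite eF mem_head).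
have w0 : (0 < w)%N by move: T0 wK; case: (w) => // /leq_trans h /h; rewrite muln0.
have FE' v : v \in F -> [/\ v.2 ^+ 2 - 16 * b = (mm v)%:Z * w%:Z, 4 * (v.1 - 8 * b) = (mm v)%:Z * a & v.2 \in rng T].
  by case/FE => w' [h1 h2 _ h3 [_ _ h4]]; split=> //; rewrite h1 wE -h3.
pose Q (x : int) := (w%:Z %| x ^+ 2 - 16 * b)%Z.
apply: (@leq_trans (count Q (rng T))).
  rewrite -size_filter -(size_map snd); apply: uniq_leq_size.
    rewrite map_inj_in_uniq ?filter_uniq ?pairs_uniq // => v v' /FE'[e1 e2 _] /FE'[e1' e2' _] ev.
    have wz : w%:Z != 0 by rewrite eqz_nat -lt0n.
    have em : (mm v)%:Z = (mm v')%:Z by apply: (mulIf wz); rewrite -e1 -e1' ev.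
    have eA : v.1 = v'.1.
      apply: (addIr (- (8 * b))); apply: (@mulfI _ 4) => //; by rewrite e2 e2' em.
    by case: (v) (v') eA ev => ? ? [? ?] /= -> ->.
  move=> _ /mapP[v /FE'[e1 _ vT] ->]; rewrite [_ \in _]mem_filter vT andbT /Q e1 dvdz_mull //.
have := @count_modcl (- T%:Z) (T.*2.+1) w Q w0; rewrite -[itv _ _]/(rng T).
move=> /leq_trans; apply; rewrite /k; apply: leq_mul.
  have h : (T.*2.+1 <= 3 * Kc * U ^ 10 * w)%N.
    apply: (@leq_trans (3 * T)); first by move: T0; clear; lia.
    by apply: leq_trans (leq_mul (leqnn 3) wK) _; apply/eq_leq; ring.
  have h2 : (T.*2.+1 %/ w <= 3 * Kc * U ^ 10)%N by rewrite -[X in (_ <= X)%N](mulnK _ w0) leq_div2r.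
  have h3 : (0 < Kc * U ^ 10)%N by rewrite muln_gt0 K0 expn_gt0 U0.
  by move: h2 h3; rewrite -!mulnA; move: (Kc * U ^ 10)%N; clear; lia.
apply: leq_trans (leq_mul (leqnn (64 * `|b|).+1) (Ht w wT)).
apply: (@sqrt_mod_count w (64 * `|b|) (16 * b) _ w0).
  move=> g _; rewrite dvdz_eq !abszM => h; apply: (@leq_trans (g ^ 2)%N).
    by rewrite -mulnn; case: (g) => // g'; rewrite leq_pmulr.
  have h0 : (0 < `|4%R| * (`|16%R| * `|b|))%N by rewrite !muln_gt0 (absz_gt0 b) b0.
  by apply: leq_trans (dvdn_leq h0 h) _; rewrite mulnA.
by move=> x; rewrite mem_filter => /andP[].
Qed.

(** For each [m], [line_count] bounds the pairs [(|B|, l)]; these determine [A], and [B] up to sign,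
    whence the factor 2. The harmonic sum over [m] costs a [U], and the gain [V >= U ^ 8] covers it
    together with the [U ^ 6] of [line_count]. *)
Lemma count_small_m (E Ct U T V CB EB : nat) : (0 < U)%N -> (0 < V)%N -> (0 < EB)%N -> T = ((V ^ EB) ^ 10)%N ->
  T = (U ^ E)%N -> (U ^ 8 <= V)%N -> (Kc * U ^ 10 <= T)%N ->
  (forall n, (n <= Kc * T ^ 2)%N -> (size (divisors n) <= Ct * U)%N) ->
  (forall (P : {poly int}) (a : int) (Q : pred int) (y : int -> nat),
     (size P <= 5)%N -> (forall Y : {poly rat}, map_poly intr P != Y ^+ 2) ->
     (forall t, t \in itv a (V ^ EB) -> Q t ->
        P.[t] = (y t)%:Z ^+ 2 /\ (y t <= 16 * (1 + 4 * `|b|) * (V ^ EB) ^ 30)%N) ->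
     (count Q (itv a (V ^ EB)) <= CB * V ^ EB.-1)%N) ->
  (count (fun v : int * int => [&& quad_cond v, v.1 != 8 * b, (T <= `|v.2| * U ^ 5)%N & (sf `|D2 v.1 v.2| * (V ^ EB) ^ 2 <= T)%N]%R)
     [seq (A, B) | A <- rng T, B <- rng T]
   <= 4 * E.+2 * (CB * (3 + 4 * (4 + 16 * `|b|)) * ((64 * `|b|).+1 * Ct)) * T)%N.
Proof.
move=> U0 V0 EB0 TE TU UV KT Ht BP; have T0 : (0 < T)%N by rewrite TU expn_gt0 U0.
have L0 : (0 < V ^ EB)%N by rewrite expn_gt0 V0.
have K0 : (0 < Kc)%N by [].
set C3 := (CB * _ * _)%N; set P := (fun v : int * int => _).
pose W := (C3 * 2 * U ^ 6 * T %/ V)%N.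
pose fm (v : int * int) := sf `|D2 v.1 v.2|.
apply: (@leq_trans (\sum_(m <- index_iota 1 T.+1) 2 * (W %/ m))%N); last first.
  rewrite -big_distrr /=; apply: leq_trans (leq_mul (leqnn 2) (sum_div_harmonic_leq W T)) _.
  have hl : ((trunc_log 2 T).+1 <= E.+2 * U)%N.
    by have := @trunc_log_leqU 1 E U T U0; rewrite mul1n add1n TU; apply.
  have WU : (W * U <= C3 * 2 * T)%N.
    have u6 : (0 < U ^ 6)%N by rewrite expn_gt0 U0.
    rewrite -(leq_pmul2r u6); apply: (@leq_trans (W * V)%N).
      rewrite -mulnA leq_mul2l -expnS (leq_trans _ UV) ?orbT // leq_pexp2l //.
    by apply: leq_trans (leq_trunc_div _ _) _; apply/eq_leq; ring.
  apply: leq_trans (leq_mul (leqnn 2) (leq_mul (leqnn W) hl)) _.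
  have -> : (2 * (W * (E.+2 * U)) = 2 * E.+2 * (W * U))%N by ring.
  by apply: leq_trans (leq_mul (leqnn _) WU) _; apply/eq_leq; ring.
apply: leq_trans (@count_sum_fiber _ _ fm P _ (index_iota 1 T.+1) _) _.
  move=> v _ /and4P[_ _ _ h]; rewrite mem_index_iota sf_gt0 ltnS.
  by apply: leq_trans h; rewrite leq_pmulr // expn_gt0 L0.
apply: leq_sum => m _; rewrite -size_filter; set F := filter _ _.
have FE v : v \in F -> [/\ P v, fm v = m, (`|v.1| <= T)%N & (`|v.2| <= T)%N].
  by rewrite mem_filter mem_pairs => /andP[/andP[Pv /eqP e] /andP[h1 h2]].
case eF: F => [|v0 F']; first by [].
rewrite -eF; have v0F : v0 \in F by rewrite eF mem_head.
pose phi (v : int * int) := (`|v.2|%N, sqpart `|D2 v.1 v.2|).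
pose q := undup (map phi F).
have facts v : v \in F -> [/\ (1 < m)%N, D2 v.1 v.2 = m%:Z * (phi v).2%:Z ^+ 2, (exists k : int, Nf b v.1 v.2 = m%:Z * k ^+ 2),
    (m%:Z %| v.2 ^+ 2 - 16 * b)%Z & [/\ (`|v.1| <= T)%N, (0 < `|v.2| <= T)%N, (T <= `|v.2| * U ^ 5)%N & (m * (V ^ EB) ^ 2 <= T)%N]].
  case: v => A B vF; have [/and4P[/= mo A8 TB mL] fme AT BT] := FE _ vF.
  have [m1 De kE [w wE _] _] := quad_cond_facts U0 T0 KT mo A8 AT BT TB; move: fme mL m1 De kE wE; rewrite /fm /= => <- mL m1 De kE wE.
  split=> //; first by rewrite wE dvdz_mulr.
  split=> //; rewrite BT andbT; move: T0 TB; case: (`|B|%N) => // /leq_trans h /h; by rewrite mul0n.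
have sF : (size F <= 2 * size q)%N.
  apply: (size_fiber (f := phi)) => [v vF|y _]; first by rewrite mem_undup map_f.
  rewrite -size_filter; case eG: (filter _ F) => [|[A1 B1] G']; first by [].
  have : (A1, B1) \in filter (fun v => phi v == y) F by rewrite eG mem_head.
  rewrite -eG mem_filter => /andP[/eqP py v1F].
  apply: (@uniq_leq_size _ _ [:: (A1, B1); (A1, - B1)]); first by rewrite !filter_uniq // pairs_uniq.
  move=> [A B]; rewrite mem_filter => /andP[/eqP py' vF]; move: py'; rewrite -py => -[/= eB el].
  have [_ De _ _ _] := facts _ vF; have [_ De1 _ _ _] := facts _ v1F; move: De De1; rewrite /phi /= el => <-.
  have B2 : B ^+ 2 = B1 ^+ 2 by rewrite -[LHS]real_normK ?num_real // -abszE eB abszE real_normK ?num_real.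
  rewrite /D2 B2 => eD; have -> : A = A1.
    apply: (@mulfI _ 4) => //; move: (B1 ^+ 2) eD; clear; lia.
  by rewrite !inE !xpair_eqE eqxx /= -eqf_sqr B2.
apply: leq_trans sF _; rewrite leq_mul2l /=.
have [m1 _ _ _ [_ _ _ mL]] := facts _ v0F.
rewrite /W -divnMA leq_divRL; last by rewrite muln_gt0 V0 ltnW.
rewrite [(V * m)%N]mulnC /C3.
apply: (@line_count R b b0 `|D2 v0.1 v0.2| m T U V CB EB (16 * (1 + 4 * `|b|)) 30 Ct q) => //.
- by rewrite leq_mul2l TE -expnM leqnn orbT.
- by have [_ <-] := FE _ v0F.
- apply: Ht; apply: (@leq_trans T).
    by apply: leq_trans mL; rewrite leq_pmulr // expn_gt0 L0.
  by rewrite -mulnn mulnA leq_pmull // muln_gt0 K0.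
- exact: undup_uniq.
move=> v; rewrite mem_undup => /mapP[[A B] uF ->].
have [_ De [k kE] mw [/= AT BT TB _]] := facts _ uF.
have B2 : `|B|%N%:Z ^+ 2 = B ^+ 2 by rewrite abszE real_normK ?num_real.
split=> //=; first by rewrite B2.
exists A, k; split=> //; first by rewrite B2; exact: De.
by rewrite -kE /Nf /= B2.
Qed.

Lemma leq_count_predU (X : Type) (P Q : pred X) (s : seq X) : (count (predU P Q) s <= count P s + count Q s)%N.
Proof. by rewrite -count_predUI leq_addr. Qed.

Theorem quad_monic_count : exists C E : nat, (0 < E)%N /\ forall U T : nat, (0 < U)%N -> T = (U ^ E)%N ->
  (\sum_(A <- rng T) \sum_(B <- rng T) quad_cond (A, B) <= C * T)%N.
Proof.
have [CB [EB [_ [EB1 BP]]]] := bombieri_pila 4 30 (16 * (1 + 4 * `|b|)).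
have EB0 : (0 < EB)%N by apply: ltnW.
(* The 8 gives [U ^ 8 <= V], and [Kc] gives [Kc <= U ^ Kc <= V] as soon as [U >= 2]. The 10 in [E]
   makes [T] the tenth power of [La = V ^ EB]. *)
pose v := (8 + Kc)%N; pose E := (10 * v * EB)%N.
have [Ct [_ Ht0]] := tau_leq Kc (2 * E).
have [Cp [_ Hp0]] := pell_fiber E b0.
pose Cs := (6 * Ct * Cp)%N; pose Cl := (24 * Kc ^ 3 * (64 * `|b|).+1 * Ct)%N.
pose Cm := (4 * E.+2 * (CB * (3 + 4 * (4 + 16 * `|b|)) * ((64 * `|b|).+1 * Ct)))%N.
exists (12 + (Cs + (Cl + Cm)))%N, E; split; first by rewrite muln_gt0 EB0.
move=> U T U0 TE; rewrite -count_pairs.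
have [U1|U1] := leqP U 1.
  have -> : T = 1%N by rewrite TE (_ : U = 1%N) ?exp1n //; move: U0 U1; clear; lia.
  rewrite muln1; apply: leq_trans (count_size _ _) _; rewrite size_allpairs !size_rng.
  by apply: leq_trans (leq_addr _ _).
have T0 : (0 < T)%N by rewrite TE expn_gt0 U0.
pose V := (U ^ v)%N; pose La := (V ^ EB)%N.
have TL : T = (La ^ 10)%N by rewrite TE /La /V -!expnM; congr (_ ^ _)%N; rewrite /E; ring.
have V0 : (0 < V)%N by rewrite expn_gt0 U0.
have La0 : (0 < La)%N by rewrite expn_gt0 V0.
have VLa : (V <= La)%N by rewrite -{1}[V]expn1 leq_pexp2l.
have UV : (U ^ 8 <= V)%N by rewrite leq_pexp2l // leq_addr.
have KV : (Kc <= V)%N.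
  apply: (@leq_trans (U ^ Kc)%N); first exact/ltnW/ltn_expl.
  by rewrite leq_pexp2l // leq_addl.
have UL : (U ^ 11 <= La ^ 2)%N.
  apply: (@leq_trans ((U ^ 8) ^ 2)%N); first by rewrite -expnM leq_pexp2l.
  by rewrite leq_expr // (leq_trans UV).
have LT : (La ^ 3 <= T)%N by rewrite TL leq_pexp2l.
have KT : (Kc * U ^ 10 <= T)%N.
  apply: leq_trans LT; rewrite (expnS La 2); apply: leq_mul; first exact: leq_trans VLa.
  by apply: leq_trans UL; rewrite leq_pexp2l.
have UT : (U ^ 5 <= T)%N.
  by apply: leq_trans KT; apply: (@leq_trans (U ^ 10)%N); rewrite ?leq_pexp2l // leq_pmull.
have Ht n : (n <= Kc * T ^ 2)%N -> (size (divisors n) <= Ct * U)%N.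
  by move=> h; apply: Ht0 => //; rewrite [(2 * E)%N]mulnC expnM -TE.
have Hp (B m : int) : B \in rng T -> B != 0 ->
     (count (fun A => (Nf b A B != 0) && (smsf (Nf b A B) == m)) (rng T) <= Cp * U ^ 3)%N.
  by rewrite TE; apply: Hp0.
have h1 := count_degenerate T0; have h2 := count_small_B U0 TE UT Ht Hp.
have h3 := count_large_m U0 La0 TL KT UL Ht.
have h4 := @count_small_m E Ct U T V CB EB U0 V0 EB0 TL TE UV KT Ht (fun P a Q y => BP V P a Q y V0).
rewrite (mulnDl 12) (mulnDl Cs) (mulnDl Cl); apply: leq_trans (leq_add h1 (leq_add h2 (leq_add h3 h4))).
apply: leq_trans (leq_add (leqnn _) (leq_add (leqnn _) (leq_count_predU _ _ _))).
apply: leq_trans (leq_add (leqnn _) (leq_count_predU _ _ _)).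
apply: leq_trans (leq_count_predU _ _ _); apply: sub_count => w mo /=; rewrite mo /=.
case: (w.2 =P 0) => //= _; case: (w.2 ^+ 2 =P 16 * b) => //= _; case: (w.1 =P 8 * b) => //= _.
rewrite ltnNge -/La; case: (T <= _)%N => //=; exact: leq_total.
Qed.

End MonicQuadratic.

(** * Counting the polynomials *)

Section Coefficients.
Local Open Scope ring_scope.

Lemma bnd_exists (p : {poly int}) : exists M, bnd p M.
Proof.
exists (\max_(i < size p) `|(p`_i)%R|)%N => i; have [lt|ge] := ltnP i (size p); last by rewrite nth_default.
exact: (@leq_bigmax _ (fun j : 'I_(size p) => `|(p`_j)%R|%N) (Ordinal lt)).
Qed.

Lemma size_cleared n b g : (size (cleared n b g) <= n.*2.+1)%N.
Proof.
apply: (leq_trans (size_sum _ _ _)); apply/bigmax_leqP => i _.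
rewrite (leq_trans (size_scale_leq _ _)) // (leq_trans (size_polyMleq _ _)) //.
by rewrite size_polyXn size_X2Db; have := ltn_ord i; lia.
Qed.

Lemma coef_cleared_top n b g : (cleared n b g)`_(n.*2) = g`_n.
Proof.
case: n => [|n]; first by rewrite /cleared big_ord1 mul1r expr0 coefZ coef1 mulr1.
rewrite clearedS coefD coefXM coefZ /= nth_default ?add0r ?size_cleared //.
by rewrite (coef_X2Db_top b n.+1) mulr1.
Qed.

(** The passage from the coefficients of [f] to those of [g] is triangular: read off the top one,
    subtract its contribution and divide by [X]. *)
Lemma cleared_bound n b : exists C : nat, forall g H,
  bnd (cleared n b g) H -> forall i, (i <= n)%N -> (`|(g`_i)%R| <= C * H)%N.
Proof.
elim: n => [|n [C IH]].
  exists 1%N => g H bg [|//] _; rewrite mul1n.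
  by have := bg 0%N; rewrite (coef_cleared_top 0).
have [M HM] := bnd_exists (('X^2 + b%:P) ^+ n.+1).
exists (1 + C * (1 + M))%N => g H bg.
have top : (`|(g`_n.+1)%R| <= H)%N by have := bg n.+1.*2; rewrite coef_cleared_top.
have bX : bnd (cleared n b g) ((1 + M) * H).
  move=> i; have -> : (cleared n b g)`_i = (cleared n.+1 b g)`_i.+1 - g`_n.+1 * (('X^2 + b%:P) ^+ n.+1)`_i.+1.
    by rewrite clearedS coefD coefXM coefZ /= addrK.
  apply: leq_trans (leq_abszB _ _) _; rewrite mulnDl mul1n leq_add // abszM mulnC leq_mul //.
move=> i; rewrite leq_eqVlt => /predU1P[->|lt].
  by apply: leq_trans top _; rewrite leq_pmull.
by apply: leq_trans (IH g _ bX i lt) _; rewrite mulnA leq_mul2r leq_addl orbT.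
Qed.

(** Division by [u^2 - 4b], one leading term at a time, with the growth of the coefficients
    tracked. *)
Lemma gpoly_repr n b : (0 < n)%N -> exists C : nat, forall (g : {poly int}) H, (size g <= n.+1)%N -> bnd g H ->
  exists A B (q : {poly int}), [/\ g = gpoly b A B q, (size q <= n.-1)%N, (`|A| <= C * H)%N, (`|B| <= C * H)%N & bnd q (C * H)].
Proof.
elim: n => // -[|n] IH _.
  exists 1%N => g H sg bg; exists g`_0, g`_1, 0; split; rewrite ?size_poly0 ?mul1n //.
    apply/polyP => i; rewrite coef_gpoly !coef0; case: i => [|[|i]] /=; rewrite ?(mulr0, mulr1, add0r, addr0, subr0) //.
    by rewrite nth_default ?(leq_trans sg).
  by move=> i; rewrite coef0.
have [//|C HC] := IH; exists (C * (1 + 4 * `|b|) + 1)%N => g H sg bg.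
pose c := g`_n.+2; pose g' := g - c *: 'X^(n.+2) + (4 * b * c) *: 'X^n.
have sg' : (size g' <= n.+2)%N.
  apply/leq_sizeP => j hj; rewrite coefD coefB !coefZ !coefXn.
  have -> : (j == n) = false by move: hj; clear; lia.
  rewrite mulr0 addr0; case: eqP => [->|ne]; first by rewrite mulr1 subrr.
  by rewrite mulr0 subr0 nth_default // (leq_trans sg) //; move: ne hj; clear; lia.
have bg' : bnd g' ((1 + 4 * `|b|) * H).
  move=> j; rewrite coefD coefB !coefZ !coefXn mulnDl mul1n; apply: leq_trans (leq_abszD _ _) _.
  apply: leq_add.
    by case: eqP => [->|_]; rewrite ?mulr1 ?subrr // mulr0 subr0.
  by case: eqP => _; rewrite ?mulr0 // mulr1 !abszM leq_mul //; exact: bg.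
have [A [B [q [gE sq AH BH qH]]]] := HC g' _ sg' bg'.
have le : (C * ((1 + 4 * `|b|) * H) <= (C * (1 + 4 * `|b|) + 1) * H)%N by rewrite mulnA leq_mul2r leq_addr orbT.
exists A, B, (q + c *: 'X^n); split; try exact: leq_trans le.
- have -> : g = g' + c *: 'X^(n.+2) - (4 * b * c) *: 'X^n by rewrite /g'; ring.
  rewrite gE /gpoly -!mul_polyC !polyCM (exprD _ 2 n); ring.
- rewrite (leq_trans (size_polyD _ _)) // geq_max (leq_trans sq) //=.
  by rewrite (leq_trans (size_scale_leq _ _)) // size_polyXn.
rewrite mulnDl mul1n -mulnA; apply: bndD => //; apply: bndW (bndZX _ _) _; exact: bg.
Qed.

End Coefficients.

Section Quadratics.
Local Open Scope ring_scope.
Variable b : int.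

Lemma D2_roots (L : splittingFieldType rat) (beta : 'I_2 -> L) A B (g := gpoly b A B 1) :
  map_poly intr g = (g`_2)%:~R *: \prod_i ('X - (beta i)%:P) ->
  (D2 b A B)%:~R = (beta ord0 - beta (lift ord0 ord0)) ^+ 2.
Proof.
have g2 : g`_2 = 1 by rewrite /g coef_gpoly !coef1 /= !(mulr0n, mulr1n); ring.
have g1 : g`_1 = B by rewrite /g coef_gpoly !coef1 /= !(mulr0n, mulr1n); ring.
have g0 : g`_0 = A - 4 * b by rewrite /g coef_gpoly !coef1 /= !(mulr0n, mulr1n); ring.
rewrite g2 scale1r !big_ord_recl big_ord0 mulr1.
set x := beta _; set y := beta _ => e; have xy : ('X - x%:P) * ('X - y%:P) = 'X^2 - (x + y) *: 'X + (x * y)%:P.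
  by rewrite -mul_polyC polyCD polyCM; ring.
rewrite xy in e.
have e1 : B%:~R = - (x + y).
  have := congr1 (fun p : {poly L} => p`_1) e; rewrite coef_map /= g1 => ->.
  by rewrite !(coefD, coefN, coefZ, coefXn, coefX, coefC) /=; ring.
have e0 : (A - 4 * b)%:~R = x * y.
  have := congr1 (fun p : {poly L} => p`_0) e; rewrite coef_map /= g0 => ->.
  by rewrite !(coefD, coefN, coefZ, coefXn, coefX, coefC) /=; ring.
have -> : D2 b A B = B * B - 4 * (A - 4 * b) by rewrite /D2; ring.
by rewrite rmorphB !rmorphM /= e0 e1; ring.
Qed.

(** If [D2 = z^2], the difference of the roots is an integer up to sign, hence fixed by every
    automorphism; the transposition negates it, so it is zero. *)
Lemma Sn_D2_nonsquare A B (z : int) : galois_group_is_Sn 2 (gpoly b A B 1) -> D2 b A B != 0 -> D2 b A B <> z ^+ 2.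
Proof.
move=> [L [beta [gE bS]]] D0 Dz; have sg : size (gpoly b A B 1) = 3 by rewrite (@size_gpoly b A B 1 0) ?size_poly1.
move: gE; rewrite /roots_of lead_coefE sg => gE.
have := D2_roots gE; set x := beta _; set y := beta _ => De.
have : tperm ord0 (lift ord0 ord0) \in galois_perms beta by rewrite bS inE.
rewrite inE => /existsP[tau /andP[_ /forallP tE]].
have tx : tau x = y by have /eqP := tE ord0; rewrite tpermL.
have ty : tau y = x by have /eqP := tE (lift ord0 ord0); rewrite tpermR.
have : (x - y - z%:~R) * (x - y + z%:~R) = 0.
  have -> : (x - y - z%:~R) * (x - y + z%:~R) = (x - y) ^+ 2 - z%:~R ^+ 2 by ring.
  by rewrite -De Dz rmorphXn subrr.
have key (w : int) : x - y = w%:~R -> False.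
  move=> h; have : tau (x - y) = x - y by rewrite h rmorph_int.
  rewrite rmorphB /= tx ty => h2; have h3 : (x - y) *+ 2 = 0 by rewrite mulr2n -{1}h2; ring.
  have xy0 : x - y = 0.
    have : (x - y) * (2 : int)%:~R = 0 by rewrite mulrzr.
    by move/eqP; rewrite mulf_eq0 intr_ext_eq0 orbF => /eqP.
  by move/eqP: De; rewrite xy0 expr0n intr_ext_eq0 (negPf D0).
move/eqP; rewrite mulf_eq0 subr_eq0 addr_eq0 => /orP[] /eqP h; first exact: (key z).
by apply: (key (- z)); rewrite h rmorphN.
Qed.

Lemma quad_cond_of_core A B : core_cond 2 b (gpoly b A B 1) -> galois_group_is_Sn 2 (gpoly b A B 1) -> quad_cond b (A, B).
Proof.
move=> co gS; have sg : size (gpoly b A B 1) = 3 by rewrite (@size_gpoly b A B 1 0) ?size_poly1.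
have N0 : Nf b A B != 0 by apply: core_Nf_neq0 co.
have D0 : D2 b A B != 0.
  have [L [beta [k [gE bI _ _]]]] := co; rewrite -(intr_ext_eq0 L) (D2_roots gE) expf_eq0 /= subr_eq0.
  by apply/eqP => /bI.
have [y yE] : exists y : nat, D2 b A B * Nf b A B = y%:Z ^+ 2.
  have [|y] := @core_disc2 b A B 1; first by rewrite polyC1.
  by rewrite disc2E => h; exists y; rewrite -h /D2; congr (_ * _); ring.
apply/and4P; split=> //=; first by rewrite (smsf_eq D0 N0 yE).
apply/eqP => h; apply: (@Sn_D2_nonsquare A B (sqpart `|D2 b A B|)%:Z gS D0).
by rewrite {1}(smsfE D0) h mul1r.
Qed.

End Quadratics.

(** * Assembling the cases of the degree *)

Section Cover.
Local Open Scope ring_scope.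
Variables (R : realType) (n : nat) (b : int) (mo : bool).
Hypotheses (n2 : (2 <= n)%N) (b0 : b != 0).

Lemma size_flatten_map (X Y : Type) (F : X -> seq Y) (s : seq X) :
  size (flatten (map F s)) = (\sum_(x <- s) size (F x))%N.
Proof. by elim: s => [|x s IH]; rewrite ?big_nil //= size_cat IH big_cons. Qed.

(** The list is written out in each case so that its length is literally the sum bounded earlier;
    membership then only requires splitting [q] into its free and its fixed coefficients. *)
Lemma admissible_cover : exists C E : nat, (0 < E)%N /\ forall U T : nat, (0 < U)%N -> T = (U ^ E)%N ->
  exists2 G : seq {poly int}, (size G <= C * T ^ (n - mo))%N &
  forall A B (q : {poly int}), (size q <= n.-1)%N -> (`|A| <= T)%N -> (`|B| <= T)%N -> bnd q T ->
    size (gpoly b A B q) = n.+1 -> (mo -> (gpoly b A B q)`_n = 1) ->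
    core_cond n b (gpoly b A B q) -> galois_group_is_Sn n (gpoly b A B q) -> gpoly b A B q \in G.
Proof.
have lead A B (q : {poly int}) : (size q <= n.-1)%N -> (gpoly b A B q)`_n = q`_(n.-2).
  move=> sq; rewrite coef_gpoly [q`_n]nth_default; last by apply: leq_trans sq _; apply: leq_pred.
  have -> : (n < 2)%N = false by rewrite ltnNge n2.
  have -> : (n == 1)%N = false by move: n2; clear; lia.
  have -> : (n == 0)%N = false by move: n2; clear; lia.
  by rewrite mulr0 subr0 mulr0n mulr0 !addr0 subn2.
have lead_clist A B (q : {poly int}) T : (size q <= n.-1)%N -> bnd q T -> size (gpoly b A B q) = n.+1 ->
    (mo -> (gpoly b A B q)`_n = 1) -> q`_(n.-2) \in clist mo T.
  move=> sq bq sg; rewrite lead // /clist; case: (mo) => [->//|_]; rewrite mem_filter mem_rng bq andbT -(lead A B) //.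
  by move: (lead_coef_eq0 (gpoly b A B q)); rewrite lead_coefE sg /= => ->; rewrite -size_poly_eq0 sg.
have [n4|n4] := leqP 4 n.
  have [C [E [E0 HC]]] := generic_count n4 b0 mo; exists C, E; split=> // U T U0 TE.
  exists (flatten [seq flatten [seq flatten [seq [seq gfam n b A B s t | t <- rng T & `[< core_cond n b (gfam n b A B s t) >]]
            | s <- Slist n mo T] | B <- rng T] | A <- rng T]).
    apply: leq_trans (HC U T U0 TE); rewrite size_flatten_map; apply: leq_sum => A _.
    rewrite size_flatten_map; apply: leq_sum => B _; rewrite size_flatten_map; apply: leq_sum => s _.
    by rewrite size_map size_filter.
  move=> A B q sq AT BT bq sg mg co gS.
  pose k : nat := odd n; pose c := q`_(n.-2); pose t := q`_k.
  pose r := q - c *: 'X^(n.-2) - t *: 'X^k.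
  have kn : (k < n.-2)%N by rewrite /k; case: (odd n) (odd_double_half n); move: n4; clear; lia.
  have rE i : r`_i = if (i == n.-2) || (i == k) then 0 else q`_i.
    rewrite !coefB !coefZ !coefXn; case: (i =P n.-2) => [->|_] /=.
      by rewrite (gtn_eqF kn) mulr1 mulr0 subr0 subrr.
    by case: eqP => [->|_]; rewrite ?mulr0 ?mulr1 ?subr0 ?subrr.
  have [||||p pT rp] := @hole_surj k (n - 3) T r.
  - by move: kn; clear; lia.
  - apply/leq_sizeP => j hj; rewrite rE; case: eqP => //= ne; case: eqP => // _.
    by rewrite nth_default // (leq_trans sq) //; move: hj ne n4; clear; lia.
  - by rewrite rE eqxx orbT.
  - by move=> i; rewrite rE; case: ifP.
  have gE : gpoly b A B q = gfam n b A B (r, c) t.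
    by rewrite /gfam; congr (gpoly b A B _); rewrite /r /k /=; ring.
  rewrite gE in co *; apply/flatten_mapP; exists A; first by rewrite mem_rng.
  apply/flatten_mapP; exists B; first by rewrite mem_rng.
  apply/flatten_mapP; exists (r, c).
    rewrite rp; apply: allpairs_f => //; exact: lead_clist sg mg.
  by apply: map_f; rewrite mem_filter mem_rng bq andbT; apply/asboolP.
have [n3|n3] := eqVneq n 3.
  have [C [E [E0 HC]]] := deg3_count b0 mo; exists C, E; split=> // U T U0 TE; rewrite {1}n3.
  exists (flatten [seq flatten [seq flatten [seq [seq gpoly b A B (c *: 'X + t%:P) | t <- rng T & `[< core_cond 3 b (gpoly b A B (c *: 'X + t%:P)) >]]
            | c <- clist mo T] | B <- rng T] | A <- rng T]).
    apply: leq_trans (HC U T U0 TE); rewrite size_flatten_map; apply: leq_sum => A _.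
    rewrite size_flatten_map; apply: leq_sum => B _; rewrite size_flatten_map; apply: leq_sum => s _.
    by rewrite size_map size_filter.
  move=> A B q sq AT BT bq sg mg co _; have cq := lead_clist A B q T sq bq sg mg.
  rewrite n3 /= in cq sq co; have qE : q = q`_1 *: 'X + (q`_0)%:P.
    apply/polyP => i; rewrite coefD coefZ coefX coefC; case: i => [|[|i]] /=; rewrite ?mulr0 ?mulr1 ?add0r ?addr0 //.
    by rewrite nth_default // (leq_trans sq).
  rewrite qE in co *; apply/flatten_mapP; exists A; first by rewrite mem_rng.
  apply/flatten_mapP; exists B; first by rewrite mem_rng.
  apply/flatten_mapP; exists q`_1 => //.
  by apply: map_f; rewrite mem_filter mem_rng bq andbT; apply/asboolP.
have {n3 n4} n2' : n = 2%N by move: n3 n4 n2; clear; lia.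
case emo: mo.
  have [C [E [E0 HC]]] := quad_monic_count R b0; exists C, E; split=> // U T U0 TE; rewrite {1}n2' subn1 expn1.
  exists (flatten [seq [seq gpoly b A B 1 | B <- rng T & quad_cond b (A, B)] | A <- rng T]).
    apply: leq_trans (HC U T U0 TE); rewrite size_flatten_map; apply: leq_sum => A _.
    by rewrite size_map size_filter sum_bool_count.
  move=> A B q sq AT BT bq sg mg co gS; have cq := lead_clist A B q T sq bq sg; rewrite emo in cq.
  have {}cq := cq mg; rewrite /clist n2' /= inE in cq.
  rewrite n2' /= in sq co gS; have q1 : q = 1 by rewrite (size1_polyC sq) (eqP cq).
  rewrite q1 in co gS *; apply/flatten_mapP; exists A; first by rewrite mem_rng.
  by apply: map_f; rewrite mem_filter mem_rng BT andbT; apply: quad_cond_of_core.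
have [C [E [E0 HC]]] := deg2_count b0; exists C, E; split=> // U T U0 TE; rewrite {1}n2' subn0.
exists (flatten [seq flatten [seq [seq gpoly b A B t%:P | t : int <- rng T & `[< core_cond 2 b (gpoly b A B t%:P) >] && (t != 0)]
          | B <- rng T] | A <- rng T]).
  apply: leq_trans (HC U T U0 TE); rewrite size_flatten_map; apply: leq_sum => A _.
  rewrite size_flatten_map; apply: leq_sum => B _.
  by rewrite size_map size_filter.
move=> A B q sq AT BT bq sg mg co gS; have cq := lead_clist A B q T sq bq sg; rewrite emo in cq.
have : q`_0 \in [seq c <- rng T | c != 0] by have := cq mg; rewrite n2'.
rewrite mem_filter => /andP[q0 qT].
rewrite n2' /= in sq co; have qE := size1_polyC sq.
rewrite qE in co *; apply/flatten_mapP; exists A; first by rewrite mem_rng.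
apply/flatten_mapP; exists B; first by rewrite mem_rng.
by apply: map_f; rewrite mem_filter qT q0 !andbT; apply/asboolP.
Qed.

(** The counts are stated for heights that are exact [E]-th powers; rounding up costs the constant
    factor [2 ^ E]. *)
Lemma pow_in_range (E M : nat) : (0 < E)%N -> (0 < M)%N -> exists U, (0 < U)%N /\ (M <= U ^ E <= 2 ^ E * M)%N.
Proof.
move=> E0 M0; have ex : exists U, (M <= U ^ E)%N by exists M; rewrite -{1}[M]expn1 leq_pexp2l.
case: (ex_minnP ex) => U MU Umin; exists U.
have U0 : (0 < U)%N by move: MU; case: (U) => //; rewrite exp0n // leqNgt M0.
rewrite U0 MU; split=> //=; have [U1|U1] := leqP U 1.
  have -> : U = 1%N by move: U0 U1; clear; lia.
  by rewrite exp1n muln_gt0 expn_gt0.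
have lt : (U.-1 ^ E < M)%N by rewrite ltnNge; apply/negP => /Umin; move: U0; clear; lia.
apply: (@leq_trans ((2 * U.-1) ^ E)%N); first by apply: leq_expr; move: U1; clear; lia.
by rewrite expnMn leq_mul2l (ltnW lt) orbT.
Qed.

(** Every [f] is [cleared n b g] for its trace polynomial [g], whose data [A], [B], [q] are [O(H)];
    so [f] lies in the image of the covering list at a height [T] comparable to [H]. *)
Lemma family_count : exists C : nat, forall (H : nat) (X : seq {poly int}), (0 < H)%N -> uniq X ->
  (forall f, f \in X -> [/\ breciprocal n b f, bnd f H, separable_poly (map_poly intr f : {poly rat}),
      exists2 g : {poly int}, trace_poly n b f g & galois_group_is_Sn n g &
      galois_group_within b f (G2_group n) /\ (mo -> f \is monic)]) ->
  (size X <= C * H ^ (n - mo))%N.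
Proof.
have n0 : (0 < n)%N by apply: leq_trans n2.
have [C1 H1] := cleared_bound n b; have [C2 H2] := gpoly_repr b n0.
have [C3 [E [E0 H3]]] := admissible_cover.
pose K := (C2 * C1).+1; exists (C3 * (2 ^ E * K) ^ (n - mo))%N => H X H0 uX HX.
have [U [U0 /andP[KU UK]]] : exists U, (0 < U)%N /\ (K * H <= U ^ E <= 2 ^ E * (K * H))%N.
  by apply: pow_in_range => //; rewrite muln_gt0.
have [G sG GE] := H3 U (U ^ E)%N U0 erefl.
apply: (@leq_trans (size (map (cleared n b) G))); last first.
  rewrite size_map; apply: leq_trans sG _; rewrite -mulnA leq_mul2l; apply/orP; right.
  by rewrite -expnMn leq_expr // -mulnA.
apply: uniq_leq_size => // f fX; have [fr fb fs [g tr gS] [fG fm]] := HX f fX.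
have fE := trace_polyE tr; have sg : size g = n.+1 by case: tr.
rewrite fE; apply: map_f.
have gb : bnd g (C1 * H).
  move=> i; have [le|lt] := leqP i n; first by apply: H1 le; rewrite -fE.
  by rewrite nth_default // sg.
have [|A [B [q [gE sq AH BH qH]]]] := H2 g (C1 * H)%N _ gb; first by rewrite sg.
have le : (C2 * (C1 * H) <= U ^ E)%N by apply: leq_trans KU; rewrite mulnA leq_mul2r leqnSn orbT.
rewrite gE; apply: GE => //; rewrite -?gE //; try exact: leq_trans le.
- exact: bndW le.
- move=> m; have := fm m; rewrite monicE lead_coefE; case: (fr) => -> _ /=.
  by rewrite fE coef_cleared_top => /eqP.
exact: (galois_core b0 fr fs tr fG).
Qed.

End Cover.

Section Main.
Local Open Scope ring_scope.
Variables (R : realType) (n : nat) (b : int).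
Hypotheses (n2 : (2 <= n)%N) (b0 : b != 0).

(** Passes from real [H] to its integer part; [mo] lets one proof serve both counts. *)
Lemma family_card (mo : bool) (F : R -> set {poly int}) :
  (forall H, (F H `<=` reciprocal_family b (G2_group n) H)%classic) ->
  (forall H f, F H f -> mo -> f \is monic) ->
  exists2 C : R, 0 < C & forall H : R, 2 <= H -> (#|` fset_set (F H)|%fset)%:R <= C * H ^+ (n - mo).
Proof.
move=> sub monF; have [C HC] := family_count R mo n2 b0.
exists C.+1%:R; first by rewrite ltr0Sn.
move=> H H2; have H0 : 0 <= H by apply: le_trans H2.
have fin : finite_set (F H) by apply: sub_finite_set (finite_reciprocal_family b (G2_group n) H).
pose h := Num.truncn H; have hH : h%:R <= H by rewrite truncn_le.
have h0 : (0 < h)%N.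
  rewrite -ltnS -(ltr_nat R); apply: (@le_lt_trans _ _ H); last exact: truncnS_gt.
  by apply: le_trans H2; rewrite ler_nat.
apply: (@le_trans _ _ (C * h ^ (n - mo))%N%:R).
  rewrite ler_nat; apply: HC => // [|f]; first exact: fset_uniq.
  rewrite [f \in _]in_fset_set // inE => Ff.
  have [fr fH fs fg fG] := sub H f Ff; split=> //; last by split=> //; apply: monF Ff.
  move=> i; rewrite -ltnS -(ltr_nat R); apply: (@le_lt_trans _ _ H); last exact: truncnS_gt.
  by rewrite pmulrn abszE intr_norm ler_norml.
rewrite natrM natrX; apply: ler_pM; rewrite ?ler0n ?exprn_ge0 ?ler_nat //.
by apply: lerXn2r => //; rewrite nnegrE ?ler0n.
Qed.

End Main.

Local Open Scope ring_scope.

Theorem theorem2p6 (R : realType) (n : nat) (b : int)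
    (hn : (2 <= n)%N) (hb : b != 0) :
  (exists2 C : R, 0 < C &
     forall H : R, 2 <= H -> (E_count b (G2_group n) H)%:R <= C * H ^+ n) /\
  (exists2 C : R, 0 < C &
     forall H : R, 2 <= H -> (E_monic_count b (G2_group n) H)%:R <= C * H ^+ (n - 1)).
Proof.
split.
  have [//|C C0 HC] := @family_card R n b hn hb false (fun H => reciprocal_family b (G2_group n) H) (fun=> @subset_refl _ _).
  by exists C => // H /HC; rewrite subn0.
apply: (@family_card R n b hn hb true (fun H => reciprocal_family b (G2_group n) H `&` [set f | f \is monic])%classic).
  by move=> H f [].
by move=> H f [].
Qed.
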